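(* Let $A\in\mathcal{A}_\mu(P,\{P_s,A_s\})$ be a conically singular connection on a principal $G$-bundle $P\to Z\setminus S$. Let $s\in S$, let $\Upsilon_1,\Upsilon_2:B_R(0)\to Z$ be two $\mathrm{SU}(3)$-coordinate systems both centred at $s$, and let $\tilde\Upsilon_j:\mathrm{pr}_{S^5}^*P_s\to\Upsilon_j^*P$ ($j=1,2$) be two bundle isomorphisms that both satisfy $$\big|\nabla^k_{\mathrm{pr}_{S^5}^*A_s}(\tilde\Upsilon_j^*A-\mathrm{pr}_{S^5}^*A_s)\big|=\mathcal{O}(r^{\mu_s-k})\quad\text{for every }k\in\mathbb{N}_0\text{ as }r\to0.$$ Then there exists a bundle isomorphism $\tilde U:P_s\to P_s$ covering $U:=D_0(\Upsilon_2^{-1}\circ\Upsilon_1)\in\mathrm{SU}(3)$ such that $\tilde U^*A_s=A_s$ and $$\big|\nabla^k_{\mathrm{pr}_{S^5}^*A_s}\big(\tilde\Upsilon_2^{-1}\circ\tilde\Upsilon_1-\mathrm{pr}_{S^5}^*\tilde U\big)\big|=\mathcal{O}(r^{\mu_s+1-k})\quad\text{for every }k\in\mathbb{N}_0\text{ as }r\to0.$$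
   Context: On $\mathbb{C}^3\cong\mathbb{R}^6$ let $\omega_0=\frac i2\sum_j dz_j\wedge d\bar z_j$, $\Omega_0=dz_1\wedge dz_2\wedge dz_3$. $Z$ is a compact 6-manifold with an $\mathrm{SU}(3)$-structure, i.e. a pair $(\omega,\Omega)\in\Omega^2(Z)\times\Omega^3(Z,\mathbb{C})$ such that for every $z\in Z$ there is a real-linear isomorphism $f:\mathbb{C}^3\to T_zZ$ with $f^*(\omega_z,\Omega_z)=(\omega_0,\Omega_0)$. An $\mathrm{SU}(3)$-coordinate system centred at $z\in Z$ is a diffeomorphism $\Upsilon:B_R(0)\subset\mathbb{C}^3\to U\subset Z$ onto an open set with $\Upsilon(0)=z$ and $(\Upsilon^*(\omega,\Omega))_0=(\omega_0,\Omega_0)$. $G$ is a compact Lie group whose Lie algebra carries an $\mathrm{Ad}$-invariant inner product. $S\subset Z$ is finite, $P\to Z\setminus S$ a principal $G$-bundle. $\mathrm{pr}_{S^5}:\mathbb{C}^3\setminus\{0\}\to S^5$ is the radial projection, $r$ the radius. Forms $\theta,\omega_1,\omega_2,\omega_3$ on $S^5$ are determined by $\omega_0=r\,dr\wedge\theta+r^2\omega_1$, $\Omega_0=r^2(dr+ir\theta)\wedge(\omega_2+i\omega_3)$ (pullbacks suppressed). For each $s\in S$ we fix a rate $\mu_s\in(-1,0)$, a principal $G$-bundle $P_s\to S^5$ and a connection $A_s$ on $P_s$ with $F_{A_s}\wedge\omega_j=0$ for $j=1,2,3$. $\mathcal{A}_\mu(P,\{P_s,A_s\})$ is the set of connections $A$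 on $P$ such that for every $s\in S$ there exist an $\mathrm{SU}(3)$-coordinate system $\Upsilon_s$ centred at $s$ and a bundle isomorphism $\tilde\Upsilon_s:\mathrm{pr}_{S^5}^*P_s\to P$ covering $\Upsilon_s$ (over the punctured ball) with $|\nabla^k_{\mathrm{pr}_{S^5}^*A_s}(\tilde\Upsilon_s^*A-\mathrm{pr}_{S^5}^*A_s)|=\mathcal{O}(r^{\mu_s-k})$ for all $k\in\mathbb{N}_0$. Convention for the difference: $G\subset\mathrm{GL}(W)$ for some vector space $W$, so $\tilde\Upsilon_2^{-1}\circ\tilde\Upsilon_1$ and $\mathrm{pr}_{S^5}^*\tilde U$ are regarded as homomorphisms of the associated vector bundle $\mathrm{pr}_{S^5}^*P_s\times_GW$; moreover $\tilde\Upsilon_2^{-1}\circ\tilde\Upsilon_1$ is composed with the parallel transport of $\mathrm{pr}_{S^5}^*A_s$ along the straight line connecting $(\Upsilon_2^{-1}\circ\Upsilon_1)(z)$ with $Uz$. Then both are sections (near $0$) of the vector bundle $\mathrm{Hom}(P_s\times_GW,U^*P_s\times_GW)$ (pulled back by $\mathrm{pr}_{S^5}$), so that the difference and its covariant derivatives are defined. Norms use the flat metric on $\mathbb{C}^3$. *)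

(* Defs.v *)
(* The MathComp / MathComp-Analysis libraries are used throughout. *)
From HB Require Import structures.
From mathcomp Require Import all_boot all_order all_algebra.
From mathcomp Require Import all_classical all_reals all_analysis.
From mathcomp Require Import complex.

Set Implicit Arguments.
Unset Strict Implicit.
Unset Printing Implicit Defensive.
Import Order.TTheory GRing.Theory Num.Theory.
Import numFieldNormedType.Exports.

Local Open Scope classical_set_scope.
Local Open Scope ring_scope.

(** * Smooth maps between open subsets of Euclidean spaces *)

(* The norm that MathComp-Analysis puts on 'rV_n is the sup norm. *)
Definition enorm (R : realType) n (x : 'rV[R]_n) : R :=
  Num.sqrt (\sum_(i < n) x 0 i ^+ 2).

Definition eball (R : realType) n (rho : R) : set 'rV[R]_n :=
  [set x | enorm x < rho].

Fixpoint Ck (R : realType) n (V : normedModType R) (k : nat)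
    (D : set 'rV[R]_n) (f : 'rV[R]_n -> V) : Prop :=
  match k with
  | 0 => forall x, D x -> {for x, continuous f}
  | k'.+1 => (forall x, D x -> differentiable f x) /\
             (forall v, Ck k' D (fun x => 'D_v f x))
  end.

(* Only meaningful for open D. *)
Definition smooth_on (R : realType) n (V : normedModType R)
    (D : set 'rV[R]_n) (f : 'rV[R]_n -> V) : Prop := forall k, Ck k D f.

(** * Manifolds *)

(* An atlas on a subset of T: charts [acoord j], defined on [adom j], with
   inverses [apt j], and a preferred chart [aat x] around each point x.
   The tangent space at x is 'rV_n, namely the coordinates of tangent vectors
   in the preferred chart at x. *)
Record atlas (R : realType) (T : Type) (n : nat) := Atlas {
  aidx : Type;
  adom : aidx -> set T;
  acoord : aidx -> T -> 'rV[R]_n;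
  apt : aidx -> 'rV[R]_n -> T;
  aat : T -> aidx }.

Arguments adom {R T n} a _.
Arguments acoord {R T n} a _ _.
Arguments apt {R T n} a _ _.
Arguments aat {R T n} a _.

(* The set D, as seen in the chart j. *)
Definition in_chart (R : realType) T n (M : atlas R T n) (j : aidx M)
    (D : set T) : set 'rV[R]_n := acoord M j @` (adom M j `&` D).

Arguments in_chart {R T n} M j D.

Record is_manifold (R : realType) (T : topologicalType) n (M : atlas R T n)
    : Prop := IsManifold {
  manifold_at : forall x, adom M (aat M x) x;
  manifold_dom_open : forall j, open (adom M j);
  manifold_cod_open : forall j, open (in_chart M j (adom M j));
  manifold_coordK : forall j x, adom M j x -> apt M j (acoord M j x) = x;
  manifold_coord_cont : forall j x, adom M j x ->
    {for x, continuous (acoord M j)};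
  manifold_pt_cont : forall j y, in_chart M j (adom M j) y ->
    {for y, continuous (apt M j)};
  manifold_smooth : forall j k,
    smooth_on (in_chart M j (adom M k)) (acoord M k \o apt M j) }.

(* Open sets of the topology determined by the atlas. *)
Definition mopen (R : realType) T n (M : atlas R T n) (D : set T) : Prop :=
  forall j, open (in_chart M j D).

Definition smooth_fun (R : realType) T n (M : atlas R T n)
    (V : normedModType R) (D : set T) (f : T -> V) : Prop :=
  forall j, smooth_on (in_chart M j D) (f \o apt M j).

Definition smooth_map (R : realType) T n (M : atlas R T n) T' n'
    (N : atlas R T' n') (D : set T) (f : T -> T') : Prop :=
  forall k, mopen M (D `&` f @^-1` adom N k) /\
            smooth_fun M (D `&` f @^-1` adom N k) (acoord N k \o f).

(* f is a diffeomorphism from D onto an open set, with inverse g. *)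
Definition diffeo (R : realType) T n (M : atlas R T n) T' n'
    (N : atlas R T' n') (D : set T) (f : T -> T') (g : T' -> T) : Prop :=
  [/\ smooth_map M N D f, mopen N (f @` D), smooth_map N M (f @` D) g
    & forall x, D x -> g (f x) = x].

(* The differential of f at x, for the above convention on tangent spaces. *)
Definition tmap (R : realType) T n (M : atlas R T n) T' n'
    (N : atlas R T' n') (f : T -> T') (x : T) (v : 'rV[R]_n) : 'rV[R]_n' :=
  'd (acoord N (aat N (f x)) \o f \o apt M (aat M x)) (acoord M (aat M x) x) v.

Definition fdiff (R : realType) T n (M : atlas R T n) (V : normedModType R)
    (f : T -> V) (x : T) (v : 'rV[R]_n) : V :=
  'd (f \o apt M (aat M x)) (acoord M (aat M x) x) v.

(* The tangent vector at [apt M j y] whose coordinates in the chart j are v. *)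
Definition tchart (R : realType) T n (M : atlas R T n) (j : aidx M)
    (y v : 'rV[R]_n) : 'rV[R]_n :=
  'd (acoord M (aat M (apt M j y)) \o apt M j) y v.

Arguments tchart {R T n} M j y v.

Definition euclid (R : realType) n : atlas R 'rV[R]_n n :=
  @Atlas R 'rV[R]_n n unit (fun=> setT) (fun=> id) (fun=> id) (fun=> tt).

(* The unit sphere in R^(n+1), with the 2(n+1) charts which forget the i-th
   coordinate on the open hemisphere where (-1)^b x_i > 0. *)
Definition sphere (R : realType) n : atlas R 'rV[R]_n.+1 n :=
  @Atlas R 'rV[R]_n.+1 n ('I_n.+1 * bool)%type
    (fun j => [set x | enorm x = 1 /\ 0 < (-1) ^+ j.2 * x 0 j.1])
    (fun j x => \row_k x 0 (lift j.1 k))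
    (fun j y => \row_l (if unlift j.1 l is Some k then y 0 k
                        else (-1) ^+ j.2 * Num.sqrt (1 - enorm y ^+ 2)))
    (fun x => let i := [arg max_(i > ord0) `|x 0 i|]%O in (i, x 0 i < 0)).

Definition usphere (R : realType) n : set 'rV[R]_n := [set x | enorm x = 1].

Arguments usphere R n : clear implicits.

(* Radial projection. *)
Definition pr (R : realType) n (x : 'rV[R]_n) : 'rV[R]_n := (enorm x)^-1 *: x.

(** * SU(3)-structures *)

(* C^3 = R^6 with z_j = x_(2j) + i x_(2j+1). *)
Definition zcoord (R : realType) (v : 'rV[R]_6) : 'rV[R[i]]_3 :=
  \row_(j < 3) (v 0 (inord j.*2) +i* v 0 (inord j.*2.+1))%C.

(* (i/2) dz /\ dzbar = dx /\ dy *)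
Definition omega0 (R : realType) (u v : 'rV[R]_6) : R :=
  \sum_(j < 3) (u 0 (inord j.*2) * v 0 (inord j.*2.+1)
              - v 0 (inord j.*2) * u 0 (inord j.*2.+1)).

Definition Omega0 (R : realType) (u v w : 'rV[R]_6) : R[i] :=
  \det (\matrix_(k < 3, j < 3) zcoord (nth 0 [:: u; v; w] k) 0 j).

Definition form2 (R : realType) (T : Type) (n : nat) :=
  T -> 'rV[R]_n -> 'rV[R]_n -> R.
Definition cform3 (R : realType) (T : Type) (n : nat) :=
  T -> 'rV[R]_n -> 'rV[R]_n -> 'rV[R]_n -> R[i].

(* That omega and Omega are multilinear and alternating follows from the last
   clause. *)
Definition SU3_structure (R : realType) T (M : atlas R T 6)
    (omega : form2 R T 6) (Omega : cform3 R T 6) : Prop :=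
  [/\ forall j u v, smooth_on (in_chart M j (adom M j)) (fun y =>
        omega (apt M j y) (tchart M j y u) (tchart M j y v)),
      forall j u v w, smooth_on (in_chart M j (adom M j)) (fun y =>
        complex.Re (Omega (apt M j y)
          (tchart M j y u) (tchart M j y v) (tchart M j y w))),
      forall j u v w, smooth_on (in_chart M j (adom M j)) (fun y =>
        complex.Im (Omega (apt M j y)
          (tchart M j y u) (tchart M j y v) (tchart M j y w)))
    & forall z, exists f : {linear 'rV[R]_6 -> 'rV[R]_6},
        [/\ bijective f,
            forall u v, omega z (f u) (f v) = omega0 u v
          & forall u v w, Omega z (f u) (f v) (f w) = Omega0 u v w]].

Definition SU3_coordinates (R : realType) T (M : atlas R T 6)
    (omega : form2 R T 6) (Omega : cform3 R T 6) (z : T) (rho : R)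
    (Y : 'rV[R]_6 -> T) (Yinv : T -> 'rV[R]_6) : Prop :=
  let dY := tmap (euclid R 6) M Y 0 in
  [/\ 0 < rho, diffeo (euclid R 6) M (eball rho) Y Yinv, Y 0 = z,
      forall u v, omega z (dY u) (dY v) = omega0 u v
    & forall u v w, Omega z (dY u) (dY v) (dY w) = Omega0 u v w].

Definition SU3 (R : realType) (U : 'rV[R]_6 -> 'rV[R]_6) : Prop :=
  exists2 B : 'M[R[i]]_3,
    B *m (map_mx (@conjc R) B)^T = 1%:M /\ \det B = 1
    & forall x, zcoord (U x) = zcoord x *m B.

(* omega_0 = r dr /\ theta + r^2 omega_1,
   Omega_0 = r^2 (dr + i r theta) /\ (omega_2 + i omega_3) on C^3 \ 0. *)
Definition cone_forms (R : realType)
    (theta : 'rV[R]_6 -> 'rV[R]_5 -> R)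
    (omega1 omega2 omega3 : form2 R 'rV[R]_6 5) : Prop :=
  forall x : 'rV[R]_6, x != 0 -> forall u v w : 'rV[R]_6,
  let r := enorm x in
  let dr : 'rV[R]_6 -> R := 'd (@enorm R 6) x in
  let p := tmap (euclid R 6) (sphere R 5) (@pr R 6) x in
  let th u := theta (pr x) (p u) in
  let o1 u v := omega1 (pr x) (p u) (p v) in
  let a u : R[i] := (dr u +i* (r * th u))%C in
  let o23 u v : R[i] :=
    (omega2 (pr x) (p u) (p v) +i* omega3 (pr x) (p u) (p v))%C in
  omega0 u v = r * (dr u * th v - dr v * th u) + r ^+ 2 * o1 u v /\
  Omega0 u v w =
    ((r ^+ 2)%:C)%C * (a u * o23 v w - a v * o23 u w + a w * o23 u v).

(** * Compact Lie groups *)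

Definition compact_group (R : realType) m (G : set 'M[R]_m) : Prop :=
  [/\ compact G, G 1%:M, forall g h, G g -> G h -> G (g *m h)
    & forall g, G g -> g \in unitmx /\ G (invmx g)].

(* The tangent space to G at 1. *)
Definition lie_algebra (R : realType) m (G : set 'M[R]_m) : set 'M[R]_m :=
  [set X | exists gamma : R -> 'M[R]_m,
    [/\ gamma 0 = 1%:M, forall t, G (gamma t) & is_derive (0 : R) (1 : R) gamma X]].

Definition Ad_invariant_inner_product (R : realType) m (G : set 'M[R]_m)
    (ip : 'M[R]_m -> 'M[R]_m -> R) : Prop :=
  let g := lie_algebra G in
  [/\ forall a X Y W, g X -> g Y -> g W ->
        ip (a *: X + Y) W = a * ip X W + ip Y W,
      forall X Y, g X -> g Y -> ip X Y = ip Y X,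
      forall X, g X -> X != 0 -> 0 < ip X X
    & forall h X Y, G h -> g X -> g Y ->
        ip (h *m X *m invmx h) (h *m Y *m invmx h) = ip X Y].

(* Q is the Gram matrix of a G-invariant inner product on W = R^m. *)
Definition invariant_gram (R : realType) m (G : set 'M[R]_m) (Q : 'M[R]_m)
    : Prop :=
  [/\ Q^T = Q, forall w : 'cV[R]_m, w != 0 -> 0 < (w^T *m Q *m w) 0 0
    & forall h, G h -> h^T *m Q *m h = Q].

(* The squared Hilbert-Schmidt norm of an endomorphism of (W, Q). *)
Definition HSnorm2 (R : realType) m (Q h : 'M[R]_m) : R :=
  \tr (invmx Q *m h^T *m Q *m h).

(** * Principal bundles and connections *)

(* A principal bundle over the subset [pbase] of T, with total space [ptot] in
   E, and an atlas of local trivializations i over [pdom i], each given by its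
   section [psec i] and its fibre coordinate [pfib i], and a preferred
   trivialization [pat x] around each point x.  The smooth structure on the
   total space is the one given by the local trivializations. *)
Record pbundle (R : realType) (m : nat) (T E : Type) := PBundle {
  pbase : set T;
  ptot : set E;
  pproj : E -> T;
  pact : E -> 'M[R]_m -> E;
  pidx : Type;
  pdom : pidx -> set T;
  psec : pidx -> T -> E;
  pfib : pidx -> E -> 'M[R]_m;
  pat : T -> pidx }.

Arguments pdom {R m T E} p _ _.
Arguments psec {R m T E} p _ _.
Arguments pfib {R m T E} p _ _.
Arguments pat {R m T E} p _.

Record is_pbundle (R : realType) m (G : set 'M[R]_m) T n (M : atlas R T n) E
    (P : pbundle R m T E) : Prop := IsPBundle {
  pbundle_proj : forall p, ptot P p -> pbase P (pproj P p);
  pbundle_act : forall p g, ptot P p -> G g ->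
    ptot P (pact P p g) /\ pproj P (pact P p g) = pproj P p;
  pbundle_act1 : forall p, ptot P p -> pact P p 1%:M = p;
  pbundle_actM : forall p g h, ptot P p -> G g -> G h ->
    pact P (pact P p g) h = pact P p (g *m h);
  pbundle_at : forall x, pbase P x -> pdom P (pat P x) x;
  pbundle_dom : forall i, pdom P i `<=` pbase P;
  pbundle_dom_open : forall i, mopen M (pdom P i);
  pbundle_sec : forall i x, pdom P i x ->
    [/\ ptot P (psec P i x), pproj P (psec P i x) = x
      & pfib P i (psec P i x) = 1%:M];
  pbundle_fib : forall i p, ptot P p -> pdom P i (pproj P p) ->
    [/\ G (pfib P i p),
        forall g, G g -> pfib P i (pact P p g) = pfib P i p *m g
      & pact P (psec P i (pproj P p)) (pfib P i p) = p];
  pbundle_smooth : forall i j,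
    smooth_fun M (pdom P i `&` pdom P j) (fun x => pfib P i (psec P j x)) }.

(* The pullback f^*P, restricted to B. *)
Definition pullback_bundle (R : realType) m T' T E (P : pbundle R m T E)
    (f : T' -> T) (B : set T') : pbundle R m T' (T' * E) :=
  @PBundle R m T' (T' * E)%type
    B [set e | [/\ B e.1, ptot P e.2 & pproj P e.2 = f e.1]]
    fst (fun e g => (e.1, pact P e.2 g))
    (pidx P) (fun i => B `&` f @^-1` pdom P i)
    (fun i x => (x, psec P i (f x))) (fun i e => pfib P i e.2)
    (fun x => pat P (f x)).

(* F, with inverse Finv, is an isomorphism of principal bundles from the
   restriction of P to B onto the restriction of P' to f(B), covering f, which
   is meant to be a diffeomorphism from B onto f(B). *)
Record bundle_iso (R : realType) m (G : set 'M[R]_m) T n (M : atlas R T n) E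
    (P : pbundle R m T E) T' E' (P' : pbundle R m T' E') (B : set T)
    (f : T -> T') (F : E -> E') (Finv : E' -> E) : Prop := BundleIso {
  iso_cover : forall p, ptot P p -> B (pproj P p) ->
    ptot P' (F p) /\ pproj P' (F p) = f (pproj P p);
  iso_act : forall p g, ptot P p -> B (pproj P p) -> G g ->
    F (pact P p g) = pact P' (F p) g;
  iso_FK : forall p, ptot P p -> B (pproj P p) -> Finv (F p) = p;
  iso_FVK : forall p, ptot P' p -> (f @` B) (pproj P' p) ->
    [/\ ptot P (Finv p), B (pproj P (Finv p)) & F (Finv p) = p];
  iso_smooth : forall i k,
    smooth_fun M (B `&` pdom P i `&` f @^-1` pdom P' k)
      (fun x => pfib P' k (F (psec P i x))) }.

(* A connection is given by its local potentials: [A i x] is the value at x of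
   the pullback, by the local section [psec P i], of the connection form. *)
Definition potentials (R : realType) m T n E (P : pbundle R m T E) :=
  pidx P -> T -> 'rV[R]_n -> 'M[R]_m.

Record is_connection (R : realType) m (G : set 'M[R]_m) T n (M : atlas R T n)
    E (P : pbundle R m T E) (A : potentials n P) : Prop := IsConnection {
  conn_lie : forall i x v, pdom P i x -> lie_algebra G (A i x v);
  conn_linear : forall i x a u v, pdom P i x ->
    A i x (a *: u + v) = a *: A i x u + A i x v;
  conn_smooth : forall i j v, smooth_on (in_chart M j (pdom P i))
    (fun y => A i (apt M j y) (tchart M j y v));
  conn_gauge : forall i j x v, pdom P i x -> pdom P j x ->
    let g y := pfib P i (psec P j y) in
    A j x v = invmx (g x) *m A i x v *m g x + invmx (g x) *m fdiff M g x v }.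

(* dA + A /\ A, computed in the preferred chart at x. *)
Definition curvature (R : realType) m T n (M : atlas R T n) E
    (P : pbundle R m T E) (A : potentials n P) (i : pidx P) (x : T)
    (u v : 'rV[R]_n) : 'M[R]_m :=
  let j := aat M x in
  let L w y := A i (apt M j y) (tchart M j y w) in
  'D_u (L v) (acoord M j x) - 'D_v (L u) (acoord M j x)
  + (A i x u *m A i x v - A i x v *m A i x u).

Definition wedge22 (R : realType) m n (F : 'rV[R]_n -> 'rV[R]_n -> 'M[R]_m)
    (w : 'rV[R]_n -> 'rV[R]_n -> R) (a b c d : 'rV[R]_n) : 'M[R]_m :=
  w c d *: F a b - w b d *: F a c + w b c *: F a d
  + w a d *: F b c - w a c *: F b d + w a b *: F c d.

(* The pullback f^*A on f^*P. *)
Definition pullback_connection (R : realType) m T' n' (M' : atlas R T' n') T n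
    (M : atlas R T n) E (P : pbundle R m T E) (f : T' -> T) (B : set T')
    (A : potentials n P) : potentials n' (pullback_bundle P f B) :=
  fun i x v => A i (f x) (tmap M' M f x v).

Arguments pullback_connection {R m T' n'} M' {T n} M {E P} f B A _ _ _.

(* The pullback F^*A of a connection A on P' by an isomorphism F from P to P'
   which covers f.  The value does not depend on the trivialization k. *)
Definition iso_connection (R : realType) m T n (M : atlas R T n) E
    (P : pbundle R m T E) T' n' (M' : atlas R T' n') E'
    (P' : pbundle R m T' E') (f : T -> T') (F : E -> E')
    (A : potentials n' P') : potentials n P :=
  fun i x v =>
    let k := pat P' (f x) in
    let h y := pfib P' k (F (psec P i y)) in
    invmx (h x) *m A k (f x) (tmap M M' f x v) *m h x
    + invmx (h x) *m fdiff M h x v.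

Arguments iso_connection {R m T n} M {E} P {T' n'} M' {E' P'} f F A _ _ _.

(* e' is the parallel transport of e along the straight line from y to z, in a
   bundle over an open subset of R^n. *)
Definition parallel_transport (R : realType) m n E
    (P : pbundle R m 'rV[R]_n E) (A : potentials n P) (y z : 'rV[R]_n)
    (e e' : E) : Prop :=
  let c (t : R) := y + t *: (z - y) in
  exists2 d : R, 0 < d & exists q : R -> E, [/\ q 0 = e, q 1 = e'
    & forall t, - d < t < 1 + d ->
      [/\ ptot P (q t), pproj P (q t) = c t
        & forall i, pdom P i (c t) ->
          is_derive t (1 : R) (fun s => pfib P i (q s))
            (- (A i (c t) (z - y) *m pfib P i (q t)))]].

(** * Covariant derivatives on R^n *)

(* The covariant derivative in the direction v of a section s of a bundle of
   homomorphisms, A and B being the local potentials on the source and on the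
   target bundle.  The case A = B is that of the adjoint bundle. *)
Definition cov (R : realType) m n (B A : 'rV[R]_n -> 'rV[R]_n -> 'M[R]_m)
    (v : 'rV[R]_n) (s : 'rV[R]_n -> 'M[R]_m) : 'rV[R]_n -> 'M[R]_m :=
  fun x => 'D_v s x + B x v *m s x - s x *m A x v.

(* The component (nabla^k s)(e_{i_1}, ..., e_{i_k}); constant vector fields are
   parallel for the flat metric. *)
Definition ncov (R : realType) m n (B A : 'rV[R]_n -> 'rV[R]_n -> 'M[R]_m)
    (I : seq 'I_n) (s : 'rV[R]_n -> 'M[R]_m) : 'rV[R]_n -> 'M[R]_m :=
  foldr (fun i => cov B A (delta_mx 0 i)) s I.

(* |nabla^k_A a| at x in a trivialization i, for an ad-valued 1-form a. *)
Definition nabla_form_norm (R : realType) m n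
    (ip : 'M[R]_m -> 'M[R]_m -> R) (A a : 'rV[R]_n -> 'rV[R]_n -> 'M[R]_m)
    (k : nat) (x : 'rV[R]_n) : R :=
  Num.sqrt (\sum_(I : k.-tuple 'I_n) \sum_(b < n)
    let X := ncov A A I (fun y => a y (delta_mx 0 b)) x in ip X X).

(* |nabla^k s| at x for a section s of a bundle of homomorphisms. *)
Definition nabla_hom_norm (R : realType) m n (Q : 'M[R]_m)
    (B A : 'rV[R]_n -> 'rV[R]_n -> 'M[R]_m) (s : 'rV[R]_n -> 'M[R]_m)
    (k : nat) (x : 'rV[R]_n) : R :=
  Num.sqrt (\sum_(I : k.-tuple 'I_n) HSnorm2 Q (ncov B A I s x)).

(** * Conically singular connections *)

Definition cone_bundle (R : realType) m E (P : pbundle R m 'rV[R]_6 E) :=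
  pullback_bundle P (@pr R 6) (~` [set 0]).

Definition cone_connection (R : realType) m E (P : pbundle R m 'rV[R]_6 E)
    (A : potentials 5 P) : potentials 6 (cone_bundle P) :=
  pullback_connection (euclid R 6) (sphere R 5) (@pr R 6) (~` [set 0]) A.

Definition punctured_ball (R : realType) (rho : R) : set 'rV[R]_6 :=
  eball rho `\ 0.

(* |nabla^k (Yt^*A - pr^*As)| = O(r^(mu - k)) for all k as r -> 0, where Yt
   covers Y. *)
Definition asymptotic (R : realType) m (ip : 'M[R]_m -> 'M[R]_m -> R) T
    (M : atlas R T 6) E (P : pbundle R m T E) (A : potentials 6 P) Es
    (Ps : pbundle R m 'rV[R]_6 Es) (As : potentials 5 Ps) (mu : R)
    (Y : 'rV[R]_6 -> T) (Yt : 'rV[R]_6 * Es -> E) : Prop :=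
  let C := cone_bundle Ps in
  let A0 := cone_connection As in
  let A1 := iso_connection (euclid R 6) C M Y Yt A in
  forall k : nat, exists K eps : R, 0 < eps /\
    forall (i : pidx C) x, 0 < enorm x < eps -> pdom C i x ->
      nabla_form_norm ip (A0 i) (fun y v => A1 i y v - A0 i y v) k x
        <= K * enorm x `^ (mu - k%:R).

(* A belongs to A_mu(P, {P_s, A_s}). *)
Definition conically_singular (R : realType) m (G : set 'M[R]_m)
    (ip : 'M[R]_m -> 'M[R]_m -> R) T (M : atlas R T 6) (omega : form2 R T 6)
    (Omega : cform3 R T 6) (S : set T) E (P : pbundle R m T E) (mu : T -> R)
    (Es : T -> Type) (Ps : forall s, pbundle R m 'rV[R]_6 (Es s))
    (As : forall s, potentials 5 (Ps s)) (A : potentials 6 P) : Prop :=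
  is_connection G M A /\
  forall s, S s -> exists (rho : R) (Y : 'rV[R]_6 -> T) (Yinv : T -> 'rV[R]_6)
    (Yt : 'rV[R]_6 * Es s -> E) (Ytinv : E -> 'rV[R]_6 * Es s),
    [/\ SU3_coordinates M omega Omega s rho Y Yinv,
        bundle_iso G (euclid R 6) (cone_bundle (Ps s)) P (punctured_ball rho)
          Y Yt Ytinv
      & asymptotic ip M A (As s) (mu s) Y Yt].

(* Main.v *)
Require Import Defs.
From HB Require Import structures.
From mathcomp Require Import all_boot all_order all_algebra.
From mathcomp Require Import all_classical all_reals all_analysis.
From mathcomp Require Import complex.
From mathcomp Require Import ring lra.

Set Implicit Arguments.
Unset Strict Implicit.
Unset Printing Implicit Defensive.
Import Order.TTheory GRing.Theory Num.Theory.
Import numFieldNormedType.Exports.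

Local Open Scope classical_set_scope.
Local Open Scope ring_scope.

(* Put Phi = Y2^-1 o Y1, so that U = D_0 Phi and U x - Phi x = O(r^2).  In radially constant
   frames the matrix h of Yt2^-1 o Yt1 satisfies D_v h = h A1(v) - A2(D_v Phi) h, where A1 and A2
   differ from the cone connection by O(r^mu) with all derivatives.  Parallel transport along the
   segment from Phi x to U x solves a linear ODE with small coefficients, hence is 1 + O(r); so
   the composite F of h with this transport has covariant derivative O(r^mu), and likewise for
   the higher derivatives.

   As mu > -1, the values F(2^-n x) converge geometrically to a G-valued limit F_0 with
   F - F_0 = O(r^(mu+1)).  The derivatives converge as well, and give that F_0 is parallel and
   constant along rays; so nabla^(k+1) (F - F_0) = nabla^k (nabla F), which is O(r^(mu-k)).
   Being determined by this rate of convergence, the limits F_0 in the various frames agree and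
   form a bundle isomorphism of P_s over U; it preserves A_s because F_0 is parallel. *)

(** Three uniformity problems shape the development. The segment of the parallel transport depends
    on the base point, so the transport is the value at time 1 of a linear ODE on a fixed time
    interval with x as a parameter; its coefficient is O(r), being the cone potential, O(r^-1),
    applied to U x - Phi x = O(r^2), so on a small radius Picard iteration contracts on the whole
    interval at once. All functions are measured in one calculus of symbols, functions with D^j f =
    O(r^(lam - j)), closed under products, composition with Phi and solving such ODEs; there
    covariant and ordinary derivatives are interchangeable, since the cone potentials are
    homogeneous of degree -1. Constants come from compactness: the work is done on truncated cones
    over small balls of S^5, where homogeneity reduces a bound to a compact set of directions.
    Finally the trivializations may form an infinite family, so the constants cannot be a maximum
    over frames: the estimate is proved in one preferred pair of frames near each direction and
    carried to the others by gauge covariance of nabla^k, compactness of G bounding the transition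
    functions. *)

Section Differentiability.
Variable R : realType.
Implicit Types V W : normedModType R.

(** Limits and solutions of ODEs are only ever controlled by inequalities on a remainder; this turns
    such an inequality into differentiability together with the value of the differential. *)
Lemma differentiable_epsP V W (f : V -> W) (x : V) (L : {linear V -> W}) :
  continuous L ->
  (forall e : R, 0 < e -> \forall v \near (0 : V), `|f (x + v) - f x - L v| <= e * `|v|) ->
  differentiable f x /\ 'd f x = L :> (V -> W).
Proof.
move=> Lc fL.
have fE : f \o shift x = cst (f x) + L +o_ (0 : V) id.
  apply/eqaddoP => e e0; have := fL _ e0.
  apply: filterS => v.
  by rewrite -[(_ - _) v]/(f (v + x) - (f x + L v)) [v + x]addrC opprD addrA.
have dL : 'd f x = L :> (V -> W) by apply: diff_unique.
split=> //; apply/diff_locallyP; rewrite dL; split=> //.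
Qed.

Lemma diff_eps V W (f : V -> W) (x : V) (e : R) : differentiable f x -> 0 < e ->
  \forall v \near (0 : V), `|f (x + v) - f x - 'd f x v| <= e * `|v|.
Proof.
move=> /diff_locally/eqaddoP/(_ e) df e0; have := df e0.
apply: filterS => v.
by rewrite -[(_ - _) v]/(f (v + x) - (f x + 'd f x v)) [v + x]addrC opprD addrA.
Qed.

Lemma near_eq_diff V W (f g : V -> W) (x : V) :
  (\near x, f x = g x) -> differentiable f x ->
  differentiable g x /\ 'd g x = 'd f x :> (V -> W).
Proof.
move=> fg df; apply: differentiable_epsP.
  exact: diff_continuous.
move=> e e0; have gx := nbhs_singleton fg.
have := diff_eps df e0.
have fg0 : \forall v \near (0 : V), f (x + v) = g (x + v).
  by have /nbhs0P := fg.
by apply: filterS2 fg0 => v <-; rewrite -gx.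
Qed.

Lemma mx_entry_le p q (A : 'M[R]_(p, q)) i j : `|A i j| <= `|A|.
Proof.
rewrite [leRHS]/Num.Def.normr/= mx_normrE.
exact: (le_bigmax _ (fun k : 'I_p * 'I_q => `|A k.1 k.2|) (i, j)).
Qed.

Lemma mx_norm_le p q (A : 'M[R]_(p, q)) (e : R) : 0 <= e ->
  (forall i j, `|A i j| <= e) -> `|A| <= e.
Proof.
move=> e0 Ae; rewrite [leLHS]/Num.Def.normr/= mx_normrE.
by apply: bigmax_le => // k _; exact: Ae.
Qed.

Lemma linear_rV_continuous n W (L : {linear 'rV[R]_n -> W}) : continuous L.
Proof.
have -> : (L : 'rV[R]_n -> W) =
    \sum_(b < n) (fun v : 'rV[R]_n => v 0 b *: L (delta_mx 0 b)).
  apply/funext => v; rewrite {1}(row_sum_delta v) linear_sum fct_sumE.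
  by apply: eq_bigr => b _; rewrite linearZ.
by move=> v; apply/differentiable_continuous/differentiable_sum => b;
  apply: differentiableZl; exact: differentiable_coord.
Qed.

Lemma differentiable_mx V p q (f : V -> 'M[R]_(p, q)) (x : V) :
  (forall i j, differentiable (fun y => f y i j) x) -> differentiable f x.
Proof.
move=> df.
have -> : f = \sum_(i < p) \sum_(j < q) (fun y => f y i j *: delta_mx i j).
  apply/funext => y; rewrite {1}(matrix_sum_delta (f y)) fct_sumE.
  by apply: eq_bigr => i _; rewrite fct_sumE.
apply: differentiable_sum => i; apply: differentiable_sum => j.
exact: differentiableZl.
Qed.

Lemma differentiable_entry V p q (f : V -> 'M[R]_(p, q)) (x : V) i j :
  differentiable f x -> differentiable (fun y => f y i j) x.
Proof.
move=> df.
apply: (@differentiable_comp _ _ _ _ f (fun N : 'M[R]_(p, q) => N i j)) => //.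
exact: differentiable_coord.
Qed.

Lemma derive_entry V p q (f : V -> 'M[R]_(p, q)) (x v : V) i j :
  differentiable f x -> ('D_v f x) i j = 'D_v (fun y => f y i j) x.
Proof. by move=> df; rewrite derive_mx ?mxE //; exact: diff_derivable. Qed.

Lemma derive_lin V W (f : V -> W) (x u v : V) (a : R) : differentiable f x ->
  'D_(a *: u + v) f x = a *: 'D_u f x + 'D_v f x.
Proof. by move=> df; rewrite !deriveE // linearP. Qed.

Lemma derive_scale V W (f : V -> W) (x u : V) (a : R) : differentiable f x ->
  'D_(a *: u) f x = a *: 'D_u f x.
Proof. by move=> df; rewrite !deriveE // linearZ. Qed.

Lemma derive_basis n W (f : 'rV[R]_n -> W) (x v : 'rV[R]_n) : differentiable f x ->
  'D_v f x = \sum_(b < n) v 0 b *: 'D_(delta_mx 0 b) f x.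
Proof.
move=> df; rewrite deriveE // {1}(row_sum_delta v) linear_sum.
by apply: eq_bigr => b _; rewrite linearZ deriveE.
Qed.

Lemma derive_comp V V' W (f : V -> V') (g : V' -> W) (x v : V) :
  differentiable f x -> differentiable g (f x) ->
  'D_v (g \o f) x = 'D_('D_v f x) g (f x).
Proof.
move=> df dg; have dc : differentiable (g \o f) x by exact: differentiable_comp.
by rewrite (deriveE _ dc) (diff_comp df dg) (deriveE _ df) (deriveE _ dg).
Qed.

Lemma is_derive_diff V (f : R -> V) (t : R) : derivable f t 1 -> differentiable f t.
Proof. by move/derivable1_diffP. Qed.

Lemma is_derive_line V W (f : V -> W) (x v : V) (s : R) :
  differentiable f (x + s *: v) ->
  is_derive s (1 : R) (fun r => f (x + r *: v)) ('D_v f (x + s *: v)).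
Proof.
move=> df.
have dl : is_diff s (fun r : R => x + r *: v) (fun r => r *: v).
  apply: is_diff_eq.
  by apply/funext => r /=; rewrite add0r.
have dc : differentiable (f \o (fun r : R => x + r *: v)) s.
  by apply: differentiable_comp => //.
apply: DeriveDef; first exact/derivable1_diffP.
have dl' : differentiable (fun r : R => x + r *: v) s by [].
rewrite (deriveE _ dc) (diff_comp dl' df) (deriveE _ df) /=.
by rewrite diff_val scale1r.
Qed.

Lemma differentiable_cont V W (f : V -> W) (x : V) :
  differentiable f x -> {for x, continuous f}.
Proof. exact: differentiable_continuous. Qed.

Lemma mvt_le (f df : R -> R) (a b C : R) : a <= b ->
  (forall t, a <= t <= b -> {for t, continuous f}) ->
  (forall t, a < t < b -> is_derive t 1 f (df t)) ->
  (forall t, a < t < b -> `|df t| <= C) ->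
  `|f b - f a| <= C * (b - a).
Proof.
move=> ab fc fd fC.
have [->|anb] := eqVneq a b; first by rewrite !subrr normr0 mulr0.
have {}ab : a < b by rewrite lt_neqAle anb.
have fd' t : t \in `]a, b[%R -> is_derive t 1 f (df t).
  by rewrite in_itv /=; exact: fd.
have fc' : {within `[a, b], continuous f}.
  apply: continuous_in_subspaceT => t; rewrite inE /= in_itv /=; exact: fc.
have [c cab ->] := MVT ab fd' fc'.
have ba : 0 < b - a by rewrite subr_gt0.
rewrite normrM (gtr0_norm ba) ler_pM2r //.
by apply: fC; rewrite in_itv in cab.
Qed.

Lemma mvt_segment V (f : V -> R) (x v : V) (C : R) :
  (forall s, 0 <= s <= 1 -> differentiable f (x + s *: v)) ->
  (forall s, 0 <= s <= 1 -> `|'D_v f (x + s *: v)| <= C) ->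
  `|f (x + v) - f x| <= C.
Proof.
move=> df fC.
have := @mvt_le (fun s => f (x + s *: v)) (fun s => 'D_v f (x + s *: v)) 0 1 C ler01.
rewrite scale1r scale0r addr0 subr0 mulr1; apply.
- move=> t t01; apply/differentiable_cont/is_derive_diff.
  by have [] := is_derive_line (df t t01).
- by move=> t /andP[t0 t1]; apply: is_derive_line; apply: df; rewrite !ltW.
- by move=> t /andP[t0 t1]; apply: fC; rewrite !ltW.
Qed.

End Differentiability.

Lemma near_continuous (T U : topologicalType) (f g : T -> U) (x : T) :
  (\near x, f x = g x) -> {for x, continuous f} -> {for x, continuous g}.
Proof.
move=> fg fc; have gx := nbhs_singleton fg.
have : g y @[y --> x] --> f x by apply: cvg_trans fc; exact: near_eq_cvg.
by rewrite gx.
Qed.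

(** * The Euclidean norm, compared with the sup norm *)

Section EuclideanNorm.
Variables (R : realType) (n : nat).
Implicit Types x y : 'rV[R]_n.

Lemma enorm_ge0 x : 0 <= enorm x. Proof. exact: sqrtr_ge0. Qed.

Lemma enorm2 x : enorm x ^+ 2 = \sum_(i < n) x 0 i ^+ 2.
Proof. by rewrite sqr_sqrtr // sumr_ge0 // => i _; exact: sqr_ge0. Qed.

Lemma enormZ a x : enorm (a *: x) = `|a| * enorm x.
Proof.
rewrite /enorm -sqrtr_sqr -sqrtrM ?sqr_ge0 // mulr_sumr.
by congr Num.sqrt; apply: eq_bigr => i _; rewrite mxE exprMn.
Qed.

Lemma norm_le_enorm x : `|x| <= enorm x.
Proof.
apply: mx_norm_le => [|i j]; first exact: enorm_ge0.
rewrite ord1 -sqrtr_sqr ler_wsqrtr // (bigD1 j) //= lerDl.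
by apply: sumr_ge0 => l _; exact: sqr_ge0.
Qed.

Lemma enorm_eq0 x : (enorm x == 0) = (x == 0).
Proof.
apply/eqP/eqP => [x0|->]; last by rewrite -(scale0r 0) enormZ normr0 mul0r.
by apply/eqP; rewrite -normr_le0 -x0 norm_le_enorm.
Qed.

Lemma enorm_gt0 x : (0 < enorm x) = (x != 0).
Proof. by rewrite lt_neqAle enorm_ge0 andbT eq_sym enorm_eq0. Qed.

Lemma enorm_continuous : continuous (@enorm R n).
Proof.
move=> x; apply: (@continuous_comp _ _ _ (fun x => \sum_(i < n) x 0 i ^+ 2)).
  have -> : (fun x => \sum_(i < n) x 0 i ^+ 2) =
      \sum_(i < n) ((fun x : 'rV[R]_n => x 0 i) ^+ 2).
    by apply/funext => y; rewrite fct_sumE; apply: eq_bigr => i _; rewrite !expr2.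
  by apply/differentiable_continuous/differentiable_sum => i;
    apply: differentiableX; exact: differentiable_coord.
exact: sqrt_continuous.
Qed.

Lemma open_eball rho : open (@eball R n rho).
Proof.
have -> : @eball R n rho = @enorm R n @^-1` [set t | t < rho] by [].
by apply: open_comp; [move=> x _; exact: enorm_continuous|exact: open_lt].
Qed.

Lemma open_punctured : open (~` [set (0 : 'rV[R]_n)]).
Proof. have -> : ~` [set 0] = @enorm R n @^-1` [set t | 0 < t].
  by apply/seteqP; split=> x /=; rewrite enorm_gt0 => /eqP.
by apply: open_comp; [move=> x _; exact: enorm_continuous|exact: open_gt]. Qed.

End EuclideanNorm.

(** * Symbol estimates *)

Section Symbols.
Variable R : realType.

(* The class of t-dependent functions with f = O(r^lam) and D^j f = O(r^(lam - j)) for j <= k,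
   uniformly in t.  The mode [md] selects the conditions: 0 is continuity only, 1 adds the
   bounds, 2 adds a Lipschitz condition in x that is uniform in t. *)
Definition symbol0 n (md : nat) (lam : R) (D : set 'rV[R]_n)
    (f : R -> 'rV[R]_n -> R) : Prop :=
  [/\ forall t x, D x -> {for x, continuous (f t)},
      forall t x, D x -> {for t, continuous (fun s => f s x)},
      (0 < md)%N -> exists2 K : R, 0 <= K & forall t x, D x -> `|f t x| <= K * enorm x `^ lam
    & (1 < md)%N -> forall x, D x -> exists2 K : R, 0 <= K & \forall v \near (0 : 'rV[R]_n),
        forall t, `|f t (x + v) - f t x| <= K * `|v|].

Fixpoint symbol n (md k : nat) (lam : R) (D : set 'rV[R]_n)
    (f : R -> 'rV[R]_n -> R) : Prop :=
  symbol0 md lam D f /\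
  match k with
  | 0 => True
  | k'.+1 => (forall t x, D x -> differentiable (f t) x) /\
      forall v, symbol md k' (lam - 1) D (fun t x => 'D_v (f t) x)
  end.

(** Real powers add up only at a positive base, so the origin is excluded as soon as bounds are
    required; mode 0 still allows domains that contain it. *)
Definition away0 n (md : nat) (D : set 'rV[R]_n) :=
  (0 < md)%N -> forall x, D x -> 0 < enorm x.

Variable n : nat.
Implicit Types (D : set 'rV[R]_n) (f g : R -> 'rV[R]_n -> R).

Lemma symbol_symbol0 md k lam D f : symbol md k lam D f -> symbol0 md lam D f.
Proof. by case: k => [|k] []. Qed.

Lemma symbol_diff md k lam D f : symbol md k.+1 lam D f ->
  forall t x, D x -> differentiable (f t) x.
Proof. by case=> _ []. Qed.

Lemma symbol_derive md k lam D f v : symbol md k.+1 lam D f ->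
  symbol md k (lam - 1) D (fun t x => 'D_v (f t) x).
Proof. by case=> _ [_]; exact. Qed.

Lemma symbol_pred md k lam D f : symbol md k.+1 lam D f -> symbol md k lam D f.
Proof.
elim: k lam f => [|k IH] lam f; first by case.
by move=> [f0 [df fv]]; split=> //; split=> // v; exact/IH/fv.
Qed.

Lemma symbol_leq md k k' lam D f : (k' <= k)%N ->
  symbol md k lam D f -> symbol md k' lam D f.
Proof.
elim: k => [|k IH]; first by rewrite leqn0 => /eqP ->.
by rewrite leq_eqVlt => /predU1P[->//|/IH] h /symbol_pred.
Qed.

Lemma symbol_mode md md' k lam D f : (md' <= md)%N ->
  symbol md k lam D f -> symbol md' k lam D f.
Proof.
move=> mm; elim: k lam f => [|k IH] lam f; rewrite /symbol -/symbol.
  move=> [[? ? h1 h2] _]; do 2!split=> //; move=> h; [apply: h1|apply: h2];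
  exact: leq_trans mm.
move=> [[? ? h1 h2] [df dv]]; split; last by split=> // v; exact/IH/dv.
by split=> // h; [apply: h1|apply: h2]; exact: leq_trans mm.
Qed.

Lemma symbol0_sub md lam D D' f : D' `<=` D -> symbol0 md lam D f -> symbol0 md lam D' f.
Proof.
move=> DD [h1 h2 h3 h4]; split=> [t x /DD|t x /DD|md0|md1 x /DD].
- exact: h1.
- exact: h2.
- by have [K K0 h] := h3 md0; exists K => // t x /DD; exact: h.
- exact: h4.
Qed.

Lemma symbol_sub md k lam D D' f : D' `<=` D -> symbol md k lam D f -> symbol md k lam D' f.
Proof.
move=> DD; elim: k lam f => [|k IH] lam f; rewrite /symbol -/symbol.
  by move=> [/(symbol0_sub DD)].
by move=> [/(symbol0_sub DD) ? [df fv]]; do 2!split=> //;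
  [move=> t x /DD; exact: df|move=> v; exact/IH/fv].
Qed.

Lemma open_near D x (P : set 'rV[R]_n) : open D -> D x -> (forall y, D y -> P y) -> \near x, P x.
Proof. by move=> oD Dx DP; apply: filterS (open_nbhs_nbhs (conj oD Dx)). Qed.

Lemma open_near0 D x (P : set 'rV[R]_n) : open D -> D x -> (forall y, D y -> P y) ->
  \forall v \near (0 : 'rV[R]_n), P (x + v).
Proof. by move=> oD Dx DP; have /nbhs0P := open_near oD Dx DP. Qed.

Lemma symbol0_eq md lam D f g : open D -> (forall t x, D x -> f t x = g t x) ->
  symbol0 md lam D f -> symbol0 md lam D g.
Proof.
move=> oD fg [h1 h2 h3 h4]; split=> [t x Dx|t x Dx|md0|md1 x Dx].
- apply: (@near_continuous _ _ (f t)); last exact: h1.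
  by apply: open_near Dx _ => // y Dy; exact: fg.
- have -> : (fun s => g s x) = (fun s => f s x) by apply/funext => s; rewrite fg.
  exact: h2.
- by have [K K0 h] := h3 md0; exists K => // t x Dx; rewrite -fg //; exact: h.
- have [K K0 h] := h4 md1 x Dx; exists K => //.
  have := @open_near0 D x D oD Dx (fun _ h => h).
  by apply: filterS2 h => v hv Dv t; rewrite -!fg.
Qed.

Lemma symbol_eq md k lam D f g : open D -> (forall t x, D x -> f t x = g t x) ->
  symbol md k lam D f -> symbol md k lam D g.
Proof.
move=> oD; elim: k lam f g => [|k IH] lam f g fg; rewrite /symbol -/symbol.
  by move=> [/(symbol0_eq oD fg)].
move=> [/(symbol0_eq oD fg) ? [df fv]]; split=> //; split=> [t x Dx|v].
  have nfg : \near x, f t x = g t x by apply: open_near Dx _ => // y; exact: fg.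
  by have [] := near_eq_diff nfg (df t x Dx).
apply: IH (fv v) => t x Dx; apply: near_eq_derive.
by apply: open_near Dx _ => // y; exact: fg.
Qed.

(** All directional derivatives are combinations of the n coordinate ones. Closure under sums and
    scalings enters as a hypothesis because it is proved further on; [symbolS] discharges it. *)
Lemma symbol_step md k lam D f : open D -> symbol0 md lam D f ->
  (forall t x, D x -> differentiable (f t) x) ->
  (forall b, symbol md k (lam - 1) D (fun t x => 'D_(delta_mx 0 b) (f t) x)) ->
  (forall h : 'I_n -> R -> 'rV[R]_n -> R,
     (forall b, symbol md k (lam - 1) D (h b)) ->
     symbol md k (lam - 1) D (fun t x => \sum_b h b t x)) ->
  (forall (c : R) h, symbol md k (lam - 1) D h ->
     symbol md k (lam - 1) D (fun t x => c * h t x)) ->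
  symbol md k.+1 lam D f.
Proof.
move=> oD f0 df db hs hc; split=> //; split=> // v.
apply: (@symbol_eq _ _ _ _
  (fun t x => \sum_b v 0 b * 'D_(delta_mx 0 b) (f t) x)) => //.
  by move=> t x Dx; rewrite (derive_basis v (df t x Dx)).
by apply: hs => b; exact: hc.
Qed.

Lemma symbol_zero md k lam D : symbol md k lam D (fun _ _ => 0).
Proof.
elim: k lam => [|k IH] lam; rewrite /symbol -/symbol.
  split=> //; split=> [t x _|t x _|_|_ x _]; [exact: cst_continuous|exact: cst_continuous| |].
  - by exists 0 => // t x _; rewrite normr0 mul0r.
  - by exists 0 => //; apply: (@filterE _ (nbhs (0 : 'rV[R]_n))) => v t; rewrite subrr normr0 mul0r.
split; first exact: symbol_symbol0 (IH lam).
split=> [t x _|v]; first exact: differentiable_cst.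
suff -> : (fun _ : R => 'D_v (fun _ : 'rV[R]_n => 0 : R)) = (fun _ _ => 0) by exact: IH.
by apply/funext => t; apply/funext => x; exact: derive_cst.
Qed.

Lemma symbol_cst md k D (c : R) : away0 md D -> symbol md k 0 D (fun _ _ => c).
Proof.
move=> D0; have c0 : symbol0 md 0 D (fun _ _ => c).
  split=> [t x _|t x _|md0|_ x _]; [exact: cst_continuous|exact: cst_continuous| |].
  - by exists `|c| => // t x /D0 x0; rewrite powRr0 mulr1.
  - by exists 0 => //; apply: (@filterE _ (nbhs (0 : 'rV[R]_n))) => v t; rewrite subrr normr0 mul0r.
case: k => [|k]; first by split.
split=> //; split=> [t x _|v]; first exact: differentiable_cst.
suff -> : (fun _ : R => 'D_v (fun _ : 'rV[R]_n => c)) = (fun _ _ => 0) by exact: symbol_zero.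
by apply/funext => t; apply/funext => x; exact: derive_cst.
Qed.

Lemma symbol0_add md lam D f g : symbol0 md lam D f -> symbol0 md lam D g ->
  symbol0 md lam D (fun t x => f t x + g t x).
Proof.
move=> [f1 f2 f3 f4] [g1 g2 g3 g4]; split=> [t x Dx|t x Dx|md0|md1 x Dx].
- by apply: continuousD; [exact: f1|exact: g1].
- by apply: continuousD; [exact: f2|exact: g2].
- have [K K0 hf] := f3 md0; have [L L0 hg] := g3 md0; exists (K + L); first exact: addr_ge0.
  move=> t x Dx; rewrite mulrDl (le_trans (ler_normD _ _)) // lerD //; [exact: hf|exact: hg].
- have [K K0 hf] := f4 md1 x Dx; have [L L0 hg] := g4 md1 x Dx.
  exists (K + L); first exact: addr_ge0.
  apply: filterS2 hf hg => v hf hg t; rewrite opprD addrACA mulrDl.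
  by rewrite (le_trans (ler_normD _ _)) // lerD.
Qed.

Lemma symbol_add md k lam D f g : open D ->
  symbol md k lam D f -> symbol md k lam D g ->
  symbol md k lam D (fun t x => f t x + g t x).
Proof.
move=> oD; elim: k lam f g => [|k IH] lam f g; rewrite /symbol -/symbol.
  by move=> [f0 _] [g0 _]; split=> //; exact: symbol0_add.
move=> [f0 [df fv]] [g0 [dg gv]]; split; first exact: symbol0_add.
split=> [t x Dx|v]; first by apply: differentiableD; [exact: df|exact: dg].
apply: symbol_eq (IH _ _ _ (fv v) (gv v)) => // t x Dx.
by rewrite deriveD //; apply: diff_derivable; [exact: df|exact: dg].
Qed.

Lemma symbol0_mul md lam mu D f g : away0 md D ->
  symbol0 md lam D f -> symbol0 md mu D g ->
  symbol0 md (lam + mu) D (fun t x => f t x * g t x).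
Proof.
move=> D0 [f1 f2 f3 f4] [g1 g2 g3 g4]; split=> [t x Dx|t x Dx|md0|md1 x Dx].
- by apply: continuousM; [exact: f1|exact: g1].
- by apply: continuousM; [exact: f2|exact: g2].
- have [K K0 hf] := f3 md0; have [L L0 hg] := g3 md0; exists (K * L); first exact: mulr_ge0.
  move=> t x Dx; rewrite powRD; last by rewrite (gt_eqF (D0 md0 x Dx)) implybT.
  by rewrite mulrACA normrM ler_pM //; [exact: hf|exact: hg].
- have [K K0 hf] := f4 md1 x Dx; have [L L0 hg] := g4 md1 x Dx.
  have [K' K0' bf] := f3 (ltnW md1); have [L' L0' bg] := g3 (ltnW md1).
  (* With |v| <= 1, [B] bounds g t (x + v) and [B'] bounds f t x, both uniformly in t. *)
  pose B := L' * enorm x `^ mu + L; pose B' := K' * enorm x `^ lam.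
  have B0 : 0 <= B by rewrite addr_ge0 ?mulr_ge0 ?powR_ge0.
  have B0' : 0 <= B' by rewrite mulr_ge0 ?powR_ge0.
  exists (K * B + B' * L); first by apply: addr_ge0; apply: mulr_ge0.
  have v1 : \forall v \near (0 : 'rV[R]_n), `|v| <= 1 by apply: nbhs0_le; exact: ltr01.
  apply: filterS3 v1 hf hg => v v1 hfv' hgv' t.
  have hfv := hfv' t; have hgv := hgv' t.
  have -> : f t (x + v) * g t (x + v) - f t x * g t x =
    (f t (x + v) - f t x) * g t (x + v) + f t x * (g t (x + v) - g t x) by ring.
  rewrite (le_trans (ler_normD _ _)) // [leRHS]mulrDl; apply: lerD; rewrite normrM.
    rewrite mulrAC; apply: ler_pM => //.
    have -> : g t (x + v) = g t x + (g t (x + v) - g t x) by ring.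
    rewrite (le_trans (ler_normD _ _)) //; apply: lerD; first exact: bg.
    by rewrite (le_trans hgv) // ler_piMr.
  by rewrite -mulrA; apply: ler_pM => //; exact: bf.
Qed.

Lemma symbol_mul md k lam mu D f g : open D -> away0 md D ->
  symbol md k lam D f -> symbol md k mu D g ->
  symbol md k (lam + mu) D (fun t x => f t x * g t x).
Proof.
move=> oD D0; elim: k lam mu f g => [|k IH] lam mu f g.
  by move=> [f0 _] [g0 _]; split=> //; exact: symbol0_mul.
move=> fk gk; have [f0 [df fv]] := fk; have [g0 [dg gv]] := gk.
split; first exact: symbol0_mul.
split=> [t x Dx|v]; first by apply: differentiableM; [exact: df|exact: dg].
apply: (@symbol_eq _ _ _ _
  (fun t x => f t x * 'D_v (g t) x + g t x * 'D_v (f t) x)) => //.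
  by move=> t x Dx; rewrite deriveM //; apply: diff_derivable; [exact: df|exact: dg].
apply: symbol_add => //.
  by rewrite -addrA; apply: IH; [exact: symbol_pred|exact: gv].
by rewrite [lam + mu]addrC -addrA; apply: IH; [exact: symbol_pred|exact: fv].
Qed.

Lemma symbol_scale md k lam D (c : R) f : open D -> away0 md D ->
  symbol md k lam D f -> symbol md k lam D (fun t x => c * f t x).
Proof.
by move=> oD D0 fk; rewrite -(add0r lam); apply: symbol_mul => //; exact: symbol_cst.
Qed.

Lemma symbol_opp md k lam D f : open D -> away0 md D ->
  symbol md k lam D f -> symbol md k lam D (fun t x => - f t x).
Proof.
move=> oD D0 /(symbol_scale (-1) oD D0).
by apply: symbol_eq => // t x _; rewrite mulN1r.
Qed.

Lemma symbol_sub2 md k lam D f g : open D -> away0 md D ->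
  symbol md k lam D f -> symbol md k lam D g ->
  symbol md k lam D (fun t x => f t x - g t x).
Proof. by move=> oD D0 fk gk; apply: symbol_add => //; exact: symbol_opp. Qed.

Lemma symbol_sum md k lam D (I : Type) (r : seq I) (h : I -> R -> 'rV[R]_n -> R) :
  open D -> (forall i, symbol md k lam D (h i)) ->
  symbol md k lam D (fun t x => \sum_(i <- r) h i t x).
Proof.
move=> oD hk; elim: r => [|i r IH].
  by apply: symbol_eq (symbol_zero _ _ _ _) => // t x _; rewrite big_nil.
by apply: symbol_eq (symbol_add oD (hk i) IH) => // t x _; rewrite big_cons.
Qed.

Lemma symbolS md k lam D f : open D -> away0 md D -> symbol0 md lam D f ->
  (forall t x, D x -> differentiable (f t) x) ->
  (forall b, symbol md k (lam - 1) D (fun t x => 'D_(delta_mx 0 b) (f t) x)) ->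
  symbol md k.+1 lam D f.
Proof.
move=> oD D0 f0 df db; apply: symbol_step => //.
  by move=> h hk; exact: symbol_sum.
by move=> c h hk; exact: symbol_scale.
Qed.

Lemma symbol_le md k lam lam' D f : away0 md D ->
  ((0 < md)%N -> forall x, D x -> enorm x <= 1) -> lam' <= lam ->
  symbol md k lam D f -> symbol md k lam' D f.
Proof.
move=> D0 D1 ll; elim: k lam lam' ll f => [|k IH] lam lam' ll f.
  move=> [[h1 h2 h3 h4] _]; split=> //; split=> // md0.
  have [K K0 h] := h3 md0; exists K => // t x Dx; rewrite (le_trans (h t x Dx)) //.
  by rewrite ler_wpM2l // ger_powR // D0 // D1.
move=> [[h1 h2 h3 h4] [df fv]]; split; last first.
  by split=> // v; apply: IH (fv v); rewrite lerD2r.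
split=> // md0.
have [K K0 h] := h3 md0; exists K => // t x Dx; rewrite (le_trans (h t x Dx)) //.
by rewrite ler_wpM2l // ger_powR // D0 // D1.
Qed.

End Symbols.

(** * Compositions of symbols, matrix-valued symbols *)

Section MoreSymbols.
Variable R : realType.

(** The sign of lam is arbitrary: the maximum of y^lam over [a, b] sits at one of the two ends, and
    the sum bounds both cases. *)
Lemma powR_le_add (a b y lam : R) : 0 < a -> a <= y -> y <= b ->
  y `^ lam <= a `^ lam + b `^ lam.
Proof.
move=> a0 ay yb; have y0 : 0 < y by exact: lt_le_trans ay.
have [l0|l0] := leP 0 lam.
  by rewrite ler_wpDl ?powR_ge0 // ge0_ler_powR ?nnegrE // ltW // (lt_le_trans y0).
have e z : z `^ lam = (z `^ (- lam))^-1 by rewrite -powRN opprK.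
rewrite ler_wpDr ?powR_ge0 // !e lef_pV2 ?posrE ?powR_gt0 //.
by rewrite ge0_ler_powR ?nnegrE ?oppr_ge0 // ltW.
Qed.

Lemma enorm_powR_bounded n (x : 'rV[R]_n) lam : 0 < enorm x ->
  exists2 C, 0 <= C & \forall y \near x, enorm y `^ lam <= C.
Proof.
move=> x0; exists ((enorm x / 2) `^ lam + (enorm x + 1) `^ lam).
  by rewrite addr_ge0 ?powR_ge0.
have := @enorm_continuous R n x.
move/cvgrPdist_lt => /(_ (Num.min (enorm x / 2) 1)).
rewrite lt_min ltr01 divr_gt0 // => /(_ isT); apply: filterS => y.
rewrite lt_min => /andP[h1 h2]; apply: powR_le_add; first by rewrite divr_gt0.
  by move: h1; rewrite ltr_norml => /andP[_]; lra.
by move: h2; rewrite ltr_norml => /andP[]; lra.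
Qed.

Lemma near_segment n (x : 'rV[R]_n) (P : set 'rV[R]_n) : (\near x, P x) ->
  \forall v \near (0 : 'rV[R]_n), forall s : R, 0 <= s <= 1 -> P (x + s *: v).
Proof.
move=> /nbhs_ballP[d /= d0 dP]; apply/nbhs_ballP; exists d => // v.
rewrite -ball_normE /= sub0r normrN => vd s /andP[s0 s1]; apply: dP.
rewrite -ball_normE /= opprD addNKr normrN normrZ ger0_norm //.
by apply: le_lt_trans vd; rewrite ler_piMl.
Qed.

Lemma derive_bound n (f : 'rV[R]_n -> R) (x v : 'rV[R]_n) (C : R) :
  differentiable f x -> (forall b, `|'D_(delta_mx 0 b) f x| <= C) ->
  `|'D_v f x| <= n%:R * C * `|v|.
Proof.
move=> df fC; rewrite (derive_basis v df) (le_trans (ler_norm_sum _ _ _)) //.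
apply: (@le_trans _ _ (\sum_(b < n) (C * `|v|))).
  apply: ler_sum => b _; rewrite normrM mulrC; apply: ler_pM => //.
  exact: mx_entry_le.
by rewrite sumr_const card_ord -[leLHS]mulr_natl mulrA.
Qed.

(** Spending one derivative, the mean value inequality gives a Lipschitz constant that is locally
    uniform in x and uniform in t, as the ODEs with parameters require. *)
Lemma symbol_calm n k lam (D : set 'rV[R]_n) f : open D -> away0 1 D ->
  symbol 1 k.+1 lam D f -> symbol 2 k lam D f.
Proof.
move=> oD D0; elim: k lam f => [|k IH] lam f fk; last first.
  have [[h1 h2 h3 _] [df dv]] := fk.
  have [f0 _] : symbol 2 0 lam D f.
    have {}IH := IH lam f (symbol_pred fk).
    by split=> //; exact: symbol_symbol0 IH.
  by split=> //; split=> // v; exact/IH/dv.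
have [[h1 h2 h3 _] [df dv]] := fk.
split=> //; split=> // _ x Dx.
have /choice[K hK] : forall b, exists K : R, 0 <= K /\ forall t y, D y ->
    `|'D_(delta_mx 0 b) (f t) y| <= K * enorm y `^ (lam - 1).
  move=> b; have [[_ _ /(_ isT)[K K0 hK] _] _] := dv (delta_mx 0 b).
  by exists K.
have [C C0 hC] := enorm_powR_bounded (lam - 1) (D0 isT x Dx).
have S0 : 0 <= \sum_b K b by apply: sumr_ge0 => b _; have [] := hK b.
exists (n%:R * ((\sum_b K b) * C)); first by rewrite !mulr_ge0.
have nD : \near x, D x by apply: open_near Dx _.
apply: filterS (near_segment (filterI nD hC)) => v hv t; apply: mvt_segment => s s01.
  by apply: df; have [] := hv s s01.
have [Dy Cy] := hv s s01.
apply: derive_bound; first exact: df.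
move=> b; have [Kb0 /(_ t _ Dy) hb] := hK b; apply: (le_trans hb).
apply: ler_pM; rewrite ?powR_ge0 //.
by rewrite (bigD1 b) //= lerDl sumr_ge0 // => c _; have [] := hK c.
Qed.

Lemma continuous_mx (T : topologicalType) p q (F : T -> 'M[R]_(p, q)) (x : T) :
  (forall i j, {for x, continuous (fun y => F y i j)}) -> {for x, continuous F}.
Proof.
move=> Fc; apply/cvgrPdist_le => e e0.
have : \forall y \near x, forall i j, `|F x i j - F y i j| <= e.
  by apply: filter_forall => i; apply: filter_forall => j; move/cvgrPdist_le: (Fc i j); exact.
apply: filterS => y hy; apply: mx_norm_le; first exact: ltW.
by move=> i j; rewrite !mxE.
Qed.

Lemma continuous_entry (T : topologicalType) p q (F : T -> 'M[R]_(p, q)) (x : T) i j :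
  {for x, continuous F} -> {for x, continuous (fun y => F y i j)}.
Proof.
move=> Fc; apply: (@continuous_comp _ _ _ F (fun A : 'M[R]_(p, q) => A i j)) => //.
exact: coord_continuous.
Qed.

Lemma symbol_coord n md k (D : set 'rV[R]_n) b : away0 md D ->
  symbol md k 1 D (fun _ x => x 0 b).
Proof.
move=> D0; have c0 : symbol0 md 1 D (fun _ x => x 0 b).
  split=> [t x _|t x _|md0|_ x _]; [exact: coord_continuous|exact: cst_continuous| |].
  - exists 1 => // t x _; rewrite mul1r powRr1 ?enorm_ge0 //.
    by rewrite (le_trans (mx_entry_le _ _ _)) ?norm_le_enorm.
  - exists 1 => //; apply: (@filterE _ (nbhs (0 : 'rV[R]_n))) => v t.
    by rewrite mxE addrAC subrr add0r mul1r mx_entry_le.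
case: k => [|k]; first by split.
split=> //; split=> [t x _|v]; first exact: differentiable_coord.
suff -> : (fun _ : R => 'D_v (fun x : 'rV[R]_n => x 0 b)) = (fun _ _ => v 0 b).
  by rewrite subrr; exact: symbol_cst.
apply/funext => t; apply/funext => x.
rewrite -[LHS](@derive_entry _ _ _ _ id x v 0 b) ?derive_id //.
Qed.

(** Since the radii of x and Phi t x are comparable, a power of one is a bound by the same power of
    the other, whatever the sign of lam. Higher orders follow from the chain rule. The Lipschitz
    mode is left out; [symbol_calm] recovers it. *)
Lemma symbol_comp n p md k lam (D : set 'rV[R]_n) (D' : set 'rV[R]_p)
    (f : 'rV[R]_p -> R) (Phi : R -> 'rV[R]_n -> 'rV[R]_p) :
  (md <= 1)%N -> open D -> away0 md D ->
  (forall t x, D x -> D' (Phi t x)) ->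
  ((0 < md)%N -> exists a c : R, [/\ 0 < a, 0 < c & forall t x, D x ->
     a * enorm x <= enorm (Phi t x) <= c * enorm x]) ->
  (forall b, symbol md k 1 D (fun t x => Phi t x 0 b)) ->
  symbol md k lam D' (fun=> f) -> symbol md k lam D (fun t x => f (Phi t x)).
Proof.
move=> md1 oD D0 DD' hac; elim: k lam f => [|k IH] lam f hPhi hf.
all: have [f1 f2 f3 _] := symbol_symbol0 hf.
all: have f0 : symbol0 md lam D (fun t x => f (Phi t x)).
1,3: split=> [t x Dx|t x Dx|md0|]; last by rewrite ltnNge md1.
1,4: apply: (@continuous_comp _ _ _ (Phi t) f); last exact: (f1 t _ (DD' t x Dx)).
1,2: by apply: continuous_mx => i j; rewrite ord1; have [h1 _ _ _] := symbol_symbol0 (hPhi j); exact: h1.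
1,3: apply: (@continuous_comp _ _ _ (fun s => Phi s x) f); last exact: (f1 t _ (DD' t x Dx)).
1,2: by apply: continuous_mx => i j; rewrite ord1; have [_ h2 _ _] := symbol_symbol0 (hPhi j); exact: h2.
1,2: have [K K0 hK] := f3 md0; have [a [c [a0 c0 ac]]] := hac md0.
1,2: exists (K * (a `^ lam + c `^ lam)); first by rewrite mulr_ge0 ?addr_ge0 ?powR_ge0.
1,2: move=> t x Dx; apply: (le_trans (hK t _ (DD' t x Dx))).
1,2: rewrite -mulrA ler_wpM2l //; have x0 := D0 md0 x Dx; have /andP[h1 h2] := ac t x Dx.
1,2: rewrite mulrDl -(powRM _ (ltW a0) (ltW x0)) -(powRM _ (ltW c0) (ltW x0)).
1,2: by apply: powR_le_add => //; exact: mulr_gt0.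
- by split.
- have dPhi t x : D x -> differentiable (Phi t) x.
    move=> Dx; apply: differentiable_mx => i j; rewrite ord1.
    exact: (symbol_diff (hPhi j)).
  have df t x : D x -> differentiable f (Phi t x).
    by move=> Dx; exact: (symbol_diff hf t (DD' t x Dx)).
  split=> //; split=> [t x Dx|v].
    by apply: (@differentiable_comp _ _ _ _ (Phi t) f); [exact: dPhi|exact: df].
  apply: (@symbol_eq _ _ _ _ _ _ (fun t x => \sum_b 'D_v (fun y => Phi t y 0 b) x *
      'D_(delta_mx 0 b) f (Phi t x))) => //.
    move=> t x Dx; rewrite -[RHS]/('D_v (f \o Phi t) x) derive_comp; [|exact: dPhi|exact: df].
    rewrite derive_basis; last exact: df.
    by apply: eq_bigr => b _; rewrite derive_entry //; exact: dPhi.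
  (* The rate is split as (1 - 1) + (lam - 1): a derivative of Phi times a derivative of f taken at
     Phi. *)
  apply: symbol_sum => // b; rewrite -[lam - 1]add0r -[X in X + _](subrr 1).
  apply: symbol_mul => //; first exact: symbol_derive.
  apply: (IH (lam - 1) (fun y => 'D_(delta_mx 0 b) f y)); last exact: (symbol_derive _ hf).
  by move=> c; exact: symbol_pred.
Qed.

Definition msymbol n p q md k lam (D : set 'rV[R]_n) (F : R -> 'rV[R]_n -> 'M[R]_(p, q)) :=
  forall i j, symbol md k lam D (fun t x => F t x i j).

Lemma msymbol_eq n p q md k lam (D : set 'rV[R]_n) (F G : R -> 'rV[R]_n -> 'M[R]_(p, q)) :
  open D -> (forall t x, D x -> F t x = G t x) ->
  msymbol md k lam D F -> msymbol md k lam D G.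
Proof. by move=> oD FG h i j; apply: symbol_eq (h i j) => // t x Dx; rewrite FG. Qed.

Lemma msymbol_add n p q md k lam (D : set 'rV[R]_n) (F G : R -> 'rV[R]_n -> 'M[R]_(p, q)) :
  open D -> msymbol md k lam D F -> msymbol md k lam D G ->
  msymbol md k lam D (fun t x => F t x + G t x).
Proof.
move=> oD hF hG i j; apply: symbol_eq (symbol_add oD (hF i j) (hG i j)) => // t x _.
by rewrite mxE.
Qed.

Lemma msymbol_opp n p q md k lam (D : set 'rV[R]_n) (F : R -> 'rV[R]_n -> 'M[R]_(p, q)) :
  open D -> away0 md D -> msymbol md k lam D F ->
  msymbol md k lam D (fun t x => - F t x).
Proof.
move=> oD D0 hF i j; apply: symbol_eq (symbol_opp oD D0 (hF i j)) => // t x _.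
by rewrite mxE.
Qed.

Lemma msymbol_sub n p q md k lam (D : set 'rV[R]_n) (F G : R -> 'rV[R]_n -> 'M[R]_(p, q)) :
  open D -> away0 md D -> msymbol md k lam D F -> msymbol md k lam D G ->
  msymbol md k lam D (fun t x => F t x - G t x).
Proof. by move=> oD D0 hF hG; apply: msymbol_add => //; exact: msymbol_opp. Qed.

Lemma msymbol_mul n p q r md k lam mu (D : set 'rV[R]_n)
    (F : R -> 'rV[R]_n -> 'M[R]_(p, q)) (G : R -> 'rV[R]_n -> 'M[R]_(q, r)) :
  open D -> away0 md D -> msymbol md k lam D F -> msymbol md k mu D G ->
  msymbol md k (lam + mu) D (fun t x => F t x *m G t x).
Proof.
move=> oD D0 hF hG i j.
apply: (@symbol_eq _ _ _ _ _ _ (fun t x => \sum_l F t x i l * G t x l j)) => //.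
  by move=> t x _; rewrite mxE.
by apply: symbol_sum => // l; exact: symbol_mul.
Qed.

Lemma msymbol_scale n p q md k lam mu (D : set 'rV[R]_n)
    (f : R -> 'rV[R]_n -> R) (G : R -> 'rV[R]_n -> 'M[R]_(p, q)) :
  open D -> away0 md D -> symbol md k lam D f -> msymbol md k mu D G ->
  msymbol md k (lam + mu) D (fun t x => f t x *: G t x).
Proof.
move=> oD D0 hf hG i j.
apply: (@symbol_eq _ _ _ _ _ _ (fun t x => f t x * G t x i j)) => //.
  by move=> t x _; rewrite mxE.
exact: symbol_mul.
Qed.

Lemma msymbol_cst n p q md k (D : set 'rV[R]_n) (A : 'M[R]_(p, q)) : away0 md D ->
  msymbol md k 0 D (fun _ _ => A).
Proof. by move=> D0 i j; exact: symbol_cst. Qed.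

Lemma msymbol_sum n p q md k lam (D : set 'rV[R]_n) (I : Type) (r : seq I)
    (h : I -> R -> 'rV[R]_n -> 'M[R]_(p, q)) :
  open D -> (forall i, msymbol md k lam D (h i)) ->
  msymbol md k lam D (fun t x => \sum_(i <- r) h i t x).
Proof.
move=> oD hk i j.
apply: symbol_eq (symbol_sum r oD (fun l => hk l i j)) => // t x _.
by rewrite summxE.
Qed.

Lemma msymbol_diff n p q md k lam (D : set 'rV[R]_n) (F : R -> 'rV[R]_n -> 'M[R]_(p, q)) :
  msymbol md k.+1 lam D F -> forall t x, D x -> differentiable (F t) x.
Proof. by move=> h t x Dx; apply: differentiable_mx => i j; exact: (symbol_diff (h i j)). Qed.

Lemma msymbol_derive n p q md k lam (D : set 'rV[R]_n) (F : R -> 'rV[R]_n -> 'M[R]_(p, q)) v :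
  open D -> msymbol md k.+1 lam D F -> msymbol md k (lam - 1) D (fun t x => 'D_v (F t) x).
Proof.
move=> oD h i j; apply: symbol_eq (symbol_derive v (h i j)) => // t x Dx.
by rewrite derive_entry //; exact: (msymbol_diff h).
Qed.

Lemma msymbolS n p q md k lam (D : set 'rV[R]_n) (F : R -> 'rV[R]_n -> 'M[R]_(p, q)) :
  open D -> away0 md D -> msymbol md 0 lam D F ->
  (forall t x, D x -> differentiable (F t) x) ->
  (forall b, msymbol md k (lam - 1) D (fun t x => 'D_(delta_mx 0 b) (F t) x)) ->
  msymbol md k.+1 lam D F.
Proof.
move=> oD D0 F0 dF dv i j; apply: symbolS => //.
- exact: symbol_symbol0 (F0 i j).
- by move=> t x Dx; apply: differentiable_entry; exact: dF.
- move=> b; apply: symbol_eq (dv b i j) => // t x Dx.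
  by rewrite derive_entry //; exact: dF.
Qed.

Lemma msymbol_le n p q md k lam lam' (D : set 'rV[R]_n) (F : R -> 'rV[R]_n -> 'M[R]_(p, q)) :
  away0 md D -> ((0 < md)%N -> forall x, D x -> enorm x <= 1) -> lam' <= lam ->
  msymbol md k lam D F -> msymbol md k lam' D F.
Proof. by move=> D0 D1 ll h i j; exact: symbol_le (h i j). Qed.

Lemma msymbol_leq n p q md k k' lam (D : set 'rV[R]_n) (F : R -> 'rV[R]_n -> 'M[R]_(p, q)) :
  (k' <= k)%N -> msymbol md k lam D F -> msymbol md k' lam D F.
Proof. by move=> kk h i j; exact: symbol_leq (h i j). Qed.

Lemma msymbol_bound n p q md k lam (D : set 'rV[R]_n) (F : R -> 'rV[R]_n -> 'M[R]_(p, q)) :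
  (0 < md)%N -> msymbol md k lam D F ->
  exists2 K, 0 <= K & forall t x, D x -> `|F t x| <= K * enorm x `^ lam.
Proof.
move=> md0 h.
have /choice[K hK] : forall ij : 'I_p * 'I_q, exists K : R, 0 <= K /\ forall t y, D y ->
    `|F t y ij.1 ij.2| <= K * enorm y `^ lam.
  move=> [i j]; have [_ _ /(_ md0)[K K0 hK] _] := symbol_symbol0 (h i j).
  by exists K.
have S0 : 0 <= \sum_b K b by apply: sumr_ge0 => b _; have [] := hK b.
exists (\sum_b K b) => // t x Dx; apply: mx_norm_le; first by rewrite mulr_ge0 ?powR_ge0.
move=> i j; have [_ /(_ t x Dx) hb] := hK (i, j); apply: (le_trans hb).
apply: ler_wpM2r; first exact: powR_ge0.
by rewrite (bigD1 (i, j)) //= lerDl sumr_ge0 // => c _; have [] := hK c.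
Qed.

Lemma msymbol0P n p q lam (D : set 'rV[R]_n) (F : 'rV[R]_n -> 'M[R]_(p, q)) (K : R) :
  (forall x, D x -> {for x, continuous F}) -> 0 <= K ->
  (forall x, D x -> `|F x| <= K * enorm x `^ lam) -> msymbol 1 0 lam D (fun=> F).
Proof.
move=> Fc K0 FK i j; split=> //; split=> // [t x Dx|t x Dx|_].
- by apply: continuous_entry; exact: Fc.
- exact: cst_continuous.
- by exists K => // _ x Dx; rewrite (le_trans (mx_entry_le _ _ _)) // FK.
Qed.

(** Mode 0 only records continuity of the derivatives, so it is C^k and the rate is a free
    parameter. *)
Lemma Ck_msymbol n p q k lam (D : set 'rV[R]_n) (F : 'rV[R]_n -> 'M[R]_(p, q)) :
  open D -> Ck k D F <-> msymbol 0 k lam D (fun=> F).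
Proof.
move=> oD; elim: k lam F => [|k IH] lam F.
  split=> [h i j|h x Dx].
    split=> //; split=> // t x Dx; last exact: cst_continuous.
    by apply: continuous_entry; exact: h.
  by apply: continuous_mx => i j; have [h1 _ _ _] := symbol_symbol0 (h i j); exact: (h1 0).
split=> [[dF dv]|h].
  apply: msymbolS => //.
  - move=> i j; split=> //; split=> // t x Dx; last exact: cst_continuous.
    by apply/continuous_entry/differentiable_cont/dF.
  - by move=> b; apply/IH/dv.
split=> [x Dx|v]; first exact: (msymbol_diff h 0).
by apply/(IH (lam - 1)); exact: msymbol_derive.
Qed.

End MoreSymbols.

(** * Sources of symbols: smooth, vanishing and homogeneous functions *)

Section SymbolSources.
Variables (R : realType) (n : nat).
Implicit Types (D W Om K : set 'rV[R]_n) (f : 'rV[R]_n -> R).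

Lemma symbol_any k lam lam' D (f : R -> 'rV[R]_n -> R) :
  symbol 0 k lam D f -> symbol 0 k lam' D f.
Proof.
elim: k lam lam' f => [|k IH] lam lam' f; first by move=> [[? ? _ _] _].
by move=> [[? ? _ _] [df dv]]; split=> //; split=> // v; exact: IH (dv v).
Qed.

Lemma compact_bound K f : compact K -> (forall x, K x -> {for x, continuous f}) ->
  exists2 C, 0 <= C & forall x, K x -> `|f x| <= C.
Proof.
move=> Kc fc; have [K0|/set0P K0] := eqVneq K set0.
  by exists 0 => // x; rewrite K0.
have nfc : {within K, continuous (fun x => `|f x|)}.
  apply: continuous_in_subspaceT => x; rewrite inE => Kx.
  apply: (@continuous_comp _ _ _ f (fun y : R => `|y|)); [exact: fc|exact: norm_continuous].
have [c _ hc] := EVT_max_rV K0 Kc nfc.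
by exists `|f c| => // x Kx; apply: hc; rewrite inE.
Qed.

(** Where r <= 1, a bounded function is O(r^lam) for every lam <= 0, and all derivatives of f are
    bounded on the compact set. *)
Lemma smooth_symbol k lam K W D f : open D -> compact K -> K `<=` W ->
  (forall x, D x -> [/\ K x, 0 < enorm x & enorm x <= 1]) -> lam <= 0 ->
  symbol 0 k 0 W (fun=> f) -> symbol 1 k lam D (fun=> f).
Proof.
move=> oD cK KW DK; elim: k lam f => [|k IH] lam f l0 fk.
all: have [f1 f2 _ _] := symbol_symbol0 fk.
all: have f0 : symbol0 1 lam D (fun=> f).
1,3: split=> // [t x /DK[Kx _ _]|t x _|_]; [exact/(f1 t)/KW|exact: cst_continuous|].
1,2: have fK x : K x -> {for x, continuous f} by move=> /KW; exact: (f1 0).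
1,2: have [C C0 hC] := compact_bound cK fK; exists C => // _ x /DK[Kx x0 x1].
1,2: apply: (le_trans (hC x Kx)); rewrite ler_peMr //.
1,2: by rewrite -(powRr0 (enorm x)) ger_powR // x0.
  by split.
split=> //; split=> [t x /DK[/KW Wx _ _]|v]; first exact: (symbol_diff fk t Wx).
apply: (IH _ (fun x => 'D_v f x)); first by lra.
exact: (symbol_any _ (symbol_derive v fk)).
Qed.

Definition supball (r : R) : set 'rV[R]_n := [set x | `|x| <= r].

Lemma compact_supball r : compact (supball r).
Proof.
apply: bounded_closed_compact.
  by exists r; split; [exact: num_real|move=> M rM x /le_trans; apply; exact: ltW].
have -> : supball r = (fun x : 'rV[R]_n => `|x|) @^-1` [set t | t <= r] by [].
by apply: closed_comp; [move=> x _; exact: norm_continuous|exact: closed_le].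
Qed.

Lemma vanish_bound (r : R) (p : nat) f :
  (forall x, `|x| <= r -> differentiable f x) -> f 0 = 0 ->
  (exists2 C, 0 <= C & forall x b, `|x| <= r -> `|'D_(delta_mx 0 b) f x| <= C * `|x| ^+ p) ->
  exists2 C, 0 <= C & forall x, `|x| <= r -> `|f x| <= C * `|x| ^+ p.+1.
Proof.
move=> df f0 [C C0 hC]; exists (n%:R * C); first exact: mulr_ge0.
move=> x xr; rewrite -[f x]subr0 -f0 -[in f x](add0r x).
have sr s : 0 <= s <= 1 -> `|0 + s *: x| <= `|x|.
  by move=> /andP[s0 s1]; rewrite add0r normrZ ger0_norm // ler_piMl.
apply: mvt_segment => s s01; first by apply/df/(le_trans (sr s s01)).
rewrite exprSr mulrA -(mulrA n%:R); apply: derive_bound.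
  by apply/df/(le_trans (sr s s01)).
move=> b; apply: (le_trans (hC _ _ _)); first exact: le_trans (sr s s01) xr.
by rewrite ler_wpM2l // lerXn2r ?nnegrE ?normr_ge0 // sr.
Qed.

(** Order of vanishing at 0 becomes a rate: f is estimated by the mean value inequality on the
    segment from 0 to x. That segment ends outside [D], so the bound on the first derivatives is
    asked on the whole ball, separately from their symbol estimates on [D]. *)
Lemma symbol_vanish (r lam : R) (p k : nat) W D f : open D -> supball r `<=` W ->
  (forall x, D x -> [/\ `|x| <= r, 0 < enorm x & enorm x <= 1]) ->
  symbol 0 k 0 W (fun=> f) -> (0 < k)%N ->
  f 0 = 0 ->
  (exists2 C, 0 <= C & forall x b, `|x| <= r -> `|'D_(delta_mx 0 b) f x| <= C * `|x| ^+ p) ->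
  (forall b, symbol 1 k.-1 p%:R D (fun=> 'D_(delta_mx 0 b) f)) ->
  symbol 1 k p.+1%:R D (fun=> f).
Proof.
move=> oD rW Dr fk k0 f0 hC hb; case: k k0 fk hb => // k _ fk hb.
have df x : `|x| <= r -> differentiable f x.
  by move=> xr; apply: (symbol_diff fk 0); exact: rW.
apply: symbolS => //.
- by move=> _ x /Dr[].
- have [f1 _ _ _] := symbol_symbol0 fk.
  split=> // [t x /Dr[xr _ _]|t x _|_]; [exact/differentiable_cont/df|exact: cst_continuous|].
  have [C C0 {}hC] := vanish_bound df f0 hC; exists C => // _ x /Dr[xr x0 _].
  apply: (le_trans (hC x xr)); rewrite ler_wpM2l // powR_mulrn ?enorm_ge0 //.
  by rewrite lerXn2r ?nnegrE ?normr_ge0 ?enorm_ge0 // norm_le_enorm.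
- by move=> t x /Dr[xr _ _]; exact: df.
- move=> b; have -> : p.+1%:R - 1 = p%:R :> R by rewrite -addn1 natrD addrK.
  exact: hb.
Qed.

Lemma symbol_vanish1 (r : R) (k : nat) W D f : open D -> supball r `<=` W ->
  (forall x, D x -> [/\ `|x| <= r, 0 < enorm x & enorm x <= 1]) ->
  (forall k, symbol 0 k 0 W (fun=> f)) -> f 0 = 0 ->
  symbol 1 k 1 D (fun=> f).
Proof.
move=> oD rW Dr fk f0; apply: (@symbol_leq _ _ _ k.+1) => //.
have cr := compact_supball (r := r).
have hfb b : symbol 0 k 0 W (fun=> 'D_(delta_mx 0 b) f).
  exact: (symbol_any _ (symbol_derive _ (fk k.+1))).
apply: (@symbol_vanish r 0 0 k.+1 W D) => //.
  have /choice[C hC] : forall b, exists C, 0 <= C /\ forall x, `|x| <= r -> `|'D_(delta_mx 0 b) f x| <= C.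
    move=> b; have [|C C0 hC] := @compact_bound _ ('D_(delta_mx 0 b) f) cr.
      by move=> x xr; have [h _ _ _] := symbol_symbol0 (hfb b); apply: (h 0); exact: rW.
    by exists C.
  exists (\sum_b C b); first by apply: sumr_ge0 => b _; have [] := hC b.
  move=> x b xr; rewrite expr0 mulr1; have [_ h] := hC b; apply: (le_trans (h x xr)).
  by rewrite (bigD1 b) //= lerDl sumr_ge0 // => c _; have [] := hC c.
move=> b; apply: (@smooth_symbol _ _ (supball r) W) => //.
Qed.

(** The mean value inequality is used twice: the first derivatives vanish at 0, hence are O(|x|),
    hence f = O(|x|^2). This gives the rate 2 of U - Phi. *)
Lemma symbol_vanish2 (r : R) (k : nat) W D f : open D -> supball r `<=` W ->
  (forall x, D x -> [/\ `|x| <= r, 0 < enorm x & enorm x <= 1]) ->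
  (forall k, symbol 0 k 0 W (fun=> f)) -> f 0 = 0 ->
  (forall b, 'D_(delta_mx 0 b) f 0 = 0) ->
  symbol 1 k 2 D (fun=> f).
Proof.
move=> oD rW Dr fk f0 df0; apply: (@symbol_leq _ _ _ k.+1) => //.
have hfb b k' : symbol 0 k' 0 W (fun=> 'D_(delta_mx 0 b) f).
  exact: (symbol_any _ (symbol_derive _ (fk k'.+1))).
apply: (@symbol_vanish r 0 1 k.+1 W D) => //; last first.
  by move=> b; apply: (@symbol_vanish1 r _ W) => //; exact: hfb.
have /choice[C hC] : forall b, exists C, 0 <= C /\ forall x, `|x| <= r -> `|'D_(delta_mx 0 b) f x| <= C * `|x| ^+ 1.
  move=> b.
  have [|||C C0 hC] := @vanish_bound r 0 ('D_(delta_mx 0 b) f).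
  - by move=> x xr; apply: (symbol_diff (hfb b 1%N) 0); exact: rW.
  - exact: df0.
  - have /choice[C hC] : forall c, exists C, 0 <= C /\ forall x, `|x| <= r ->
        `|'D_(delta_mx 0 c) ('D_(delta_mx 0 b) f) x| <= C.
      move=> c; have [|C C0 hC] := @compact_bound _ ('D_(delta_mx 0 c) ('D_(delta_mx 0 b) f)) (compact_supball (r := r)).
        move=> x xr; have [h _ _ _] := symbol_symbol0 (symbol_derive (delta_mx 0 c) (hfb b 1%N)).
        by apply: (h 0); exact: rW.
      by exists C.
    exists (\sum_b C b); first by apply: sumr_ge0 => c _; have [] := hC c.
    move=> x c xr; rewrite expr0 mulr1; have [_ h] := hC c; apply: (le_trans (h x xr)).
    by rewrite (bigD1 c) //= lerDl sumr_ge0 // => d _; have [] := hC d.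
  by exists C.
exists (\sum_b C b); first by apply: sumr_ge0 => b _; have [] := hC b.
move=> x b xr; have [_ h] := hC b; apply: (le_trans (h x xr)).
apply: ler_wpM2r; first exact: exprn_ge0.
by rewrite (bigD1 b) //= lerDl sumr_ge0 // => c _; have [] := hC c.
Qed.

Definition conic Om := forall (s : R) x, 0 < s -> Om x -> Om (s *: x).

Definition homogeneous lam Om f := forall s x, 0 < s -> Om x -> f (s *: x) = s `^ lam * f x.

Lemma homogeneous_derive lam Om f v : open Om -> conic Om ->
  (forall x, Om x -> differentiable f x) -> homogeneous lam Om f ->
  homogeneous (lam - 1) Om ('D_v f).
Proof.
move=> oO cO df hf s x s0 Ox.
have dfs : differentiable f (s *: x) by apply/df/cO.
have ds : differentiable (fun y : 'rV[R]_n => s *: y) x by [].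
have e1 : 'D_v (f \o (fun y => s *: y)) x = s * 'D_v f (s *: x).
  rewrite derive_comp // -[X in _ = X]/(s *: _) -derive_scale //; congr ('D_ _ _ _).
  by rewrite deriveZ ?derive_id //; exact: derivable_id.
have e2 : 'D_v (f \o (fun y => s *: y)) x = s `^ lam * 'D_v f x.
  rewrite -[RHS]/(s `^ lam *: 'D_v f x) -deriveZ; last exact/diff_derivable/df.
  by apply: near_eq_derive; apply: open_near Ox _ => // y Oy /=; exact: hf.
have sn0 : s != 0 by rewrite gt_eqF.
apply: (mulfI sn0); rewrite -e1 e2 mulrA; congr (_ * _).
by rewrite powRB ?sn0 ?implybT // powRr1 ?ltW // mulrCA divff // mulr1.
Qed.

(** With x = r pr x, the value f x is r^lam f (pr x), and the constant is the maximum of |f| over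
    the compact set of directions; derivatives are again homogeneous, of degree one less. *)
Lemma homogeneous_symbol k lam K Om D f : open Om -> conic Om -> open D ->
  compact K -> K `<=` Om ->
  (forall x, D x -> 0 < enorm x /\ K (pr x)) ->
  symbol 0 k 0 Om (fun=> f) -> homogeneous lam Om f ->
  symbol 1 k lam D (fun=> f).
Proof.
move=> oO cO oD cK KO DK.
have DO x : D x -> Om x.
  move=> /DK[x0 /KO/(cO _ _ x0)].
  by rewrite scalerA divff ?scale1r // gt_eqF.
elim: k lam f => [|k IH] lam f fk hf.
all: have [f1 f2 _ _] := symbol_symbol0 fk.
all: have f0 : symbol0 1 lam D (fun=> f).
1,3: split=> // [t x /DO Ox|t x _|_]; [exact: (f1 t)|exact: cst_continuous|].
1,2: have fK x : K x -> {for x, continuous f} by move=> /KO; exact: (f1 0).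
1,2: have [C C0 hC] := compact_bound cK fK; exists C => // _ x /DK[x0 Kx].
1,2: have {1}-> : x = enorm x *: pr x by rewrite scalerA divff ?scale1r // gt_eqF.
1,2: rewrite hf //; last exact: KO.
1,2: by rewrite normrM ger0_norm ?powR_ge0 // mulrC; apply: ler_wpM2r; rewrite ?powR_ge0 // hC.
  by split.
split=> //; split=> [t x /DO|v]; first exact: (symbol_diff fk).
apply: (IH _ (fun x => 'D_v f x)).
  exact: (symbol_any _ (symbol_derive v fk)).
by apply: homogeneous_derive => // x Ox; exact: (symbol_diff fk 0).
Qed.

End SymbolSources.

(** * Geometrically convergent sequences of numbers and of functions *)

Section GeometricLimits.
Variable R : realType.

Lemma geometric_small (C q e : R) : 0 <= q < 1 -> 0 < e ->
  \forall n \near \oo, C * q ^+ n <= e.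
Proof.
move=> /andP[q0 q1] e0.
have h : geometric C q n @[n --> \oo] --> (0 : R).
  by apply: cvg_geometric; rewrite ger0_norm.
move/cvgrPdist_le : h => /(_ e e0); apply: filterS => n /=.
by rewrite sub0r normrN; apply: le_trans; exact: ler_norm.
Qed.

Lemma geometric_limit (u : nat -> R) (C q : R) : 0 <= q < 1 ->
  (forall n, `|u n.+1 - u n| <= C * q ^+ n) ->
  exists l, forall n, `|u n - l| <= C / (1 - q) * q ^+ n.
Proof.
move=> q01 hu; have /andP[q0 q1] := q01; have q1' : 0 < 1 - q by rewrite subr_gt0.
have cs : cvgn (series (telescope u)).
  apply: normed_cvg; apply: (@series_le_cvg _ _ (geometric C q)) => //.
  - by move=> n /=.
  - by move=> n; apply: le_trans (hu n).
  - by apply: is_cvg_geometric_series; rewrite ger0_norm.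
rewrite telescopeK in cs.
have [l ul] : exists l : R, u n @[n --> \oo] --> l.
  exists (limn [sequence u n - u 0%N]_n + u 0%N).
  have h : ([sequence u n - u 0%N]_n + (fun=> u 0%N)) n @[n --> \oo] -->
      limn [sequence u n - u 0%N]_n + u 0%N by apply: (cvgD cs); exact: cvg_cst.
  rewrite (_ : _ + (fun=> _) = u) in h; first exact: h.
  by apply/funext => n; rewrite -[LHS]/(u n - u 0%N + u 0%N) subrK.
exists l => n.
(* The factor 1 - q^k of the partial geometric sum makes the induction step an equality. *)
have uk k : `|u (n + k)%N - u n| <= C / (1 - q) * q ^+ n * (1 - q ^+ k).
  elim: k => [|k IH]; first by rewrite addn0 expr0 !subrr normr0 mulr0.
  rewrite addnS -(subrKA (u (n + k)%N)) (le_trans (ler_normD _ _)) //.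
  rewrite addrC (le_trans (lerD IH (hu _))) // exprD exprS.
  rewrite le_eqVlt; apply/orP; left; apply/eqP; field.
  by rewrite gt_eqF.
have C0 : 0 <= C by have := hu 0%N; rewrite expr0 mulr1; exact: le_trans.
rewrite distrC; apply: (@cvgr_to_le _ \oo _ _ (fun m => `|u m - u n|)).
  by apply: cvg_norm; apply: cvgB => //; exact: cvg_cst.
near=> m; have nm : (n <= m)%N by near: m; exact: nbhs_infty_ge.
rewrite -(subnKC nm) (le_trans (uk _)) // ler_piMr ?gerBl ?exprn_ge0 //.
by rewrite !mulr_ge0 ?exprn_ge0 ?invr_ge0 // ltW.
Unshelve. all: by end_near. Qed.

Lemma geometric_limit_mx p q' (u : nat -> 'M[R]_(p, q')) (C q : R) : 0 <= q < 1 ->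
  (forall n, `|u n.+1 - u n| <= C * q ^+ n) ->
  exists l, forall n, `|u n - l| <= C / (1 - q) * q ^+ n.
Proof.
move=> q01 hu; have /andP[q0 q1] := q01; have q1' : 0 < 1 - q by rewrite subr_gt0.
have C0 : 0 <= C by have := hu 0%N; rewrite expr0 mulr1; exact: le_trans.
have /choice[l hl] : forall ij : 'I_p * 'I_q', exists l, forall n,
    `|u n ij.1 ij.2 - l| <= C / (1 - q) * q ^+ n.
  move=> [i j]; apply: geometric_limit => // n.
  have -> : u n.+1 i j - u n i j = (u n.+1 - u n) i j by rewrite !mxE.
  exact: le_trans (mx_entry_le _ _ _) (hu n).
exists (\matrix_(i, j) l (i, j)) => n; apply: mx_norm_le => [|i j].
  by rewrite !mulr_ge0 ?exprn_ge0 ?invr_ge0 // ltW.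
by rewrite !mxE; exact: (hl (i, j)).
Qed.

(** The mean value inequality bounds the increments of f_m - f_n; letting m grow bounds those of g -
    f_n by q^n |v|, and n is fixed before v tends to 0. No continuity of [G] enters, and linearity
    of [G y] is asked at y = x alone. *)
Lemma c1_limit (V : normedModType R) (x : V) (d A q : R) (f : nat -> V -> R) (g : V -> R)
    (G : V -> V -> R) (L : {linear V -> R}) :
  0 < d -> 0 <= q < 1 -> continuous L -> G x = L ->
  (forall n y, `|y - x| < d -> differentiable (f n) y) ->
  (forall n y v, `|y - x| < d -> `|'D_v (f n) y - G y v| <= A * q ^+ n * `|v|) ->
  (forall n y, `|y - x| < d -> `|f n y - g y| <= A * q ^+ n) ->
  differentiable g x /\ 'd g x = L :> (V -> R).
Proof.
move=> d0 q01 Lc GL df dG fg; apply: differentiable_epsP => // e e0.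
have dv_small : \forall v \near (0 : V), `|v| < d by exact: nbhs0_lt.
have [n hn] : exists n, A * q ^+ n <= e / 4.
  have e4 : 0 < e / 4 by rewrite divr_gt0.
  by have /filter_ex := geometric_small A q01 e4.
have xx : `|x - x| < d by rewrite subrr normr0.
have e2 : 0 < e / 2 by rewrite divr_gt0.
have := diff_eps (df n x xx) e2.
apply: filterS2 dv_small => v vd hv.
have xv : `|x + v - x| < d by rewrite addrAC subrr add0r.
have key : `|(g (x + v) - f n (x + v)) - (g x - f n x)| <= A * q ^+ n * `|v|.
  apply/ler_addgt0Pr => e' e'0.
  have e'' : 0 < e' / (2 + `|v|) by rewrite divr_gt0 // ltr_wpDr.
  have [m hm] : exists m, A * q ^+ m <= e' / (2 + `|v|).
    by have /filter_ex := geometric_small A q01 e''.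
  have fm : `|(f m (x + v) - f n (x + v)) - (f m x - f n x)| <=
      A * q ^+ n * `|v| + A * q ^+ m * `|v|.
    rewrite -[X in X - _]/((f m \- f n) (x + v)) -[X in _ - X]/((f m \- f n) x).
    have xs s : 0 <= s <= 1 -> `|x + s *: v - x| < d.
      move=> /andP[s0 s1]; rewrite addrAC subrr add0r normrZ ger0_norm //.
      by apply: le_lt_trans vd; rewrite ler_piMl.
    apply: mvt_segment => s s01.
      by apply: differentiableB; apply: df; exact: xs.
    rewrite deriveB; [|exact/diff_derivable/df/xs|exact/diff_derivable/df/xs].
    have h1 := dG n _ v (xs s s01); have h2 := dG m _ v (xs s s01).
    rewrite -(subrKA (G (x + s *: v) v)) (le_trans (ler_normD _ _)) // addrC lerD //.
    by rewrite distrC.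
  have -> : g (x + v) - f n (x + v) - (g x - f n x) =
    (f m (x + v) - f n (x + v) - (f m x - f n x)) - (f m (x + v) - g (x + v)) + (f m x - g x).
    by ring.
  apply: (le_trans (ler_normD _ _)).
  apply: (le_trans (lerD (ler_normB _ _) (fg m x xx))).
  apply: (le_trans (lerD (lerD fm (fg m _ xv)) (lexx _))).
  rewrite -!addrA lerD2l.
  have -> : A * q ^+ m * `|v| + (A * q ^+ m + A * q ^+ m) = A * q ^+ m * (2 + `|v|) by ring.
  by rewrite -ler_pdivlMr // ltr_wpDr.
have hG : `|'d (f n) x v - L v| <= A * q ^+ n * `|v|.
  by rewrite -GL -deriveE; [exact: dG|exact: df].
have -> : g (x + v) - g x - L v =
   (g (x + v) - f n (x + v) - (g x - f n x)) + (f n (x + v) - f n x - 'd (f n) x v)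
   + ('d (f n) x v - L v) by ring.
apply: (le_trans (ler_normD _ _)).
apply: (le_trans (lerD (ler_normD _ _) hG)).
apply: (le_trans (lerD (lerD key hv) (lexx _))).
rewrite -!mulrDl ler_wpM2r //; lra.
Qed.

End GeometricLimits.

(** * Linear differential equations with parameters *)

Section LinearODE.
Variable R : realType.

(* The retraction of R onto [-1, 2], an interval around the time interval [0, 1]. *)
Definition clamp (t : R) := (`|t + 1| - `|t - 2| + 1) / 2.

Lemma clamp_id t : -1 <= t <= 2 -> clamp t = t.
Proof.
move=> /andP[h1 h2]; rewrite /clamp ger0_norm; last by lra.
by rewrite ler0_norm; [field|lra].
Qed.

Lemma clamp_itv t : -1 <= clamp t <= 2.
Proof.
rewrite /clamp; have [h1|h1] := leP 0 (t + 1); have [h2|h2] := leP 0 (t - 2);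
  rewrite ?(ger0_norm h1) ?(ltr0_norm h1) ?(ger0_norm h2) ?(ltr0_norm h2);
  by apply/andP; split; lra.
Qed.

Lemma clampK t : clamp (clamp t) = clamp t.
Proof. by rewrite clamp_id // clamp_itv. Qed.

Lemma clamp_continuous : continuous clamp.
Proof.
move=> t; apply: cvgMr_tmp; apply: cvgD; last exact: cvg_cst.
by apply: cvgB; apply: cvg_norm; apply: cvgD; (try exact: cvg_id); exact: cvg_cst.
Qed.

(** The primitive is composed with [clamp]: it is then continuous and bounded on all of R, while its
    derivative is asserted only inside (-1, 2). *)
Lemma antiderivative (f : R -> R) : continuous f ->
  exists F : R -> R, [/\ F 0 = 0, continuous F, forall t, F t = F (clamp t)
    & forall t : R, -1 < t < 2 -> is_derive t 1 F (f t)].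
Proof.
move=> fc.
(* Integration over [-2, 3] leaves room around [-1, 2], so that the fundamental theorem applies also
   at the two endpoints. *)
have intf : (@lebesgue_measure R).-integrable `[-2, 3] (EFin \o f).
  apply: continuous_compact_integrable; first exact: segment_compact.
  exact: continuous_subspaceT.
pose F0 (x : R) : R := (\int[lebesgue_measure]_(t in `[-2, x]) f t)%R.
have dF (t : R) : -1 <= t <= 2 -> is_derive t 1 F0 (f t).
  move=> /andP[h1 h2].
  have t3 : t < 3 by lra.
  have t2 : -2 < t by lra.
  have [h3 h4] := continuous_FTC1_closed t3 intf t2 (fc t).
  by apply: DeriveDef; [exact: h3|rewrite -derive1E; exact: h4].
have F0c t : {for t, continuous (F0 \o clamp)}.
  apply: continuous_comp; first exact: clamp_continuous.
  apply/differentiable_cont/derivable1_diffP.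
  by have [] := dF _ (clamp_itv t).
exists (fun t => F0 (clamp t) - F0 (clamp 0)); split.
- by rewrite subrr.
- move=> t; apply: (@continuousB _ _ _ (F0 \o clamp) (fun=> F0 (clamp 0))).
    exact: F0c.
  exact: cst_continuous.
- by move=> t; rewrite clampK.
move=> t t12; apply: (@near_eq_is_derive _ _ _ (fun s => F0 s - F0 (clamp 0))).
  have : \forall s \near t, s \in `]-1, 2[%R.
    by apply: near_in_itvoo; rewrite in_itv.
  apply: filterS => s; rewrite in_itv /= => /andP[h1 h2].
  by rewrite (@clamp_id s) // !ltW.
have := dF t; have /andP[h1 h2] := t12; rewrite !ltW // => /(_ isT) h.
rewrite -[f t]subr0; exact: (is_deriveB h (is_derive_cst _ _ _)).
Qed.

Lemma antiderivative_mx p q (f : R -> 'M[R]_(p, q)) : continuous f ->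
  exists F : R -> 'M[R]_(p, q), [/\ F 0 = 0, continuous F, forall t, F t = F (clamp t)
    & forall t : R, -1 < t < 2 -> is_derive t 1 F (f t)].
Proof.
move=> fc.
have /choice[F hF] : forall ij : 'I_p * 'I_q, exists F : R -> R,
   [/\ F 0 = 0, continuous F, forall t, F t = F (clamp t)
    & forall t : R, -1 < t < 2 -> is_derive t 1 F (f t ij.1 ij.2)].
  by move=> [i j]; apply: antiderivative => t; apply: continuous_entry; exact: fc.
exists (fun t => \matrix_(i, j) F (i, j) t); split.
- by apply/matrixP => i j; rewrite !mxE; have [] := hF (i, j).
- move=> t; apply: continuous_mx => i j; have [_ h _ _] := hF (i, j).
  rewrite (_ : (fun _ => _) = F (i, j)); first exact: h.
  by apply/funext => s; rewrite mxE.
- by move=> t; apply/matrixP => i j; rewrite !mxE; have [_ _ ->] := hF (i, j).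
move=> t t12.
have e i j : (fun s => (\matrix_(i, j) F (i, j) s) i j) = F (i, j).
  by apply/funext => s; rewrite mxE.
have dF : derivable (fun t => \matrix_(i, j) F (i, j) t) t (1 : R).
  by apply/derivable_mxP => i j; rewrite e; have [_ _ _ /(_ t t12)[]] := hF (i, j).
split=> //; rewrite derive_mx //; apply/matrixP => i j; rewrite mxE e.
by have [_ _ _ /(_ t t12)[]] := hF (i, j).
Qed.

Lemma is_derive_entry p q (y : R -> 'M[R]_(p, q)) t (g : 'M[R]_(p, q)) i j :
  is_derive t (1 : R) y g -> is_derive t (1 : R) (fun s => y s i j) (g i j).
Proof.
move=> [dy <-]; split; first by move/derivable_mxP : dy.
by rewrite derive_mx // mxE.
Qed.

Lemma is_derive_mx p q (y : R -> 'M[R]_(p, q)) t (g : 'M[R]_(p, q)) :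
  (forall i j, is_derive t (1 : R) (fun s => y s i j) (g i j)) -> is_derive t (1 : R) y g.
Proof.
move=> h; have dy : derivable y t (1 : R).
  by apply/derivable_mxP => i j; have [] := h i j.
by split=> //; rewrite derive_mx //; apply/matrixP => i j; rewrite mxE; have [] := h i j.
Qed.

(** The constant 2 is the largest distance from time 0 within [-1, 2]. *)
Lemma clamped_bound p q (y g : R -> 'M[R]_(p, q)) C : y 0 = 0 -> continuous y ->
  (forall t, y t = y (clamp t)) -> (forall t : R, -1 < t < 2 -> is_derive t 1 y (g t)) ->
  0 <= C -> (forall t : R, -1 < t < 2 -> `|g t| <= C) -> forall t, `|y t| <= 2 * C.
Proof.
move=> y0 yc ycl dy C0 gC t; rewrite ycl; have := clamp_itv t; move: (clamp t) => {}t t12.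
apply: mx_norm_le => [|i j]; first by rewrite mulr_ge0.
have yc' s : {for s, continuous (fun s => y s i j)} by apply: continuous_entry; exact: yc.
have e0 : y 0 i j = 0 by rewrite y0 mxE.
have gC' s : -1 < s < 2 -> `|g s i j| <= C.
  by move=> s12; exact: le_trans (mx_entry_le _ _ _) (gC s s12).
have dy' (s : R) : -1 < s < 2 -> is_derive s 1 (fun s => y s i j) (g s i j).
  by move=> s12; apply: is_derive_entry; exact: dy.
have /andP[t1 t2] := t12.
have [t0|t0] := leP 0 t.
  have := @mvt_le _ (fun s => y s i j) (fun s => g s i j) _ _ C t0.
  rewrite /= e0 !subr0 => h; apply: le_trans (h _ _ _) _ => //.
  - by move=> s /andP[s0 st]; apply: dy'; apply/andP; split; lra.
  - by move=> s /andP[s0 st]; apply: gC'; apply/andP; split; lra.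
  by rewrite mulrC ler_wpM2r.
have := @mvt_le _ (fun s => y s i j) (fun s => g s i j) _ _ C (ltW t0).
rewrite /= e0 !sub0r normrN => h; apply: le_trans (h _ _ _) _ => //.
- by move=> s /andP[s0 st]; apply: dy'; apply/andP; split; lra.
- by move=> s /andP[s0 st]; apply: gC'; apply/andP; split; lra.
by rewrite mulrC ler_wpM2r //; lra.
Qed.

Lemma mulmx_norm_le p q r (A : 'M[R]_(p, q)) (B : 'M[R]_(q, r)) :
  `|A *m B| <= q%:R * `|A| * `|B|.
Proof.
apply: mx_norm_le => [|i j]; first by rewrite !mulr_ge0.
rewrite mxE (le_trans (ler_norm_sum _ _ _)) //.
apply: (@le_trans _ _ (\sum_(l < q) (`|A| * `|B|))).
  by apply: ler_sum => l _; rewrite normrM; apply: ler_pM => //; exact: mx_entry_le.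
by rewrite sumr_const card_ord -[leLHS]mulr_natl mulrA.
Qed.

(** The zero initial value and the free term [e] make differences and parameter derivatives of
    solutions solutions of the same kind. For e = B, the function 1 + y is the fundamental solution
    of p' = B p with p 0 = 1. The interval [-1, 2] has both times 0 and 1 in its interior. *)
Definition ode_solution m q (B : R -> 'M[R]_m) (e y : R -> 'M[R]_(m, q)) : Prop :=
  [/\ y 0 = 0, continuous y, forall t, y t = y (clamp t)
    & forall t : R, -1 < t < 2 -> is_derive t 1 y (B t *m y t + e t)].

(** At a maximum of |y| the integrated equation gives S <= 2 (m b S + E); as m b <= 1/4, half of S
    is absorbed on the left. Smallness of the coefficient thus replaces an exponential estimate. *)
Lemma ode_bound m q (B : R -> 'M[R]_m) (e y : R -> 'M[R]_(m, q)) (b E : R) :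
  ode_solution B e y -> (forall t, `|B t| <= b) -> m%:R * b * 4 <= 1 ->
  0 <= E -> (forall t, `|e t| <= E) -> forall t, `|y t| <= 4 * E.
Proof.
move=> [y0 yc ycl dy] Bb mb E0 eE.
have nyc : {within `[-1, 2], continuous (fun t => `|y t|)}.
  apply: continuous_subspaceT => t.
  apply: (@continuous_comp _ _ _ y (fun y : 'M[R]_(m, q) => `|y|)); [exact: yc|exact: norm_continuous].
have le12 : -1 <= 2 :> R by lra.
have [c c12 hc] := EVT_max le12 nyc.
have b0 : 0 <= b by exact: le_trans (Bb 0).
have yS t : `|y t| <= `|y c|.
  by rewrite ycl; apply: hc; rewrite in_itv /= clamp_itv.
have h := @clamped_bound _ _ y (fun t => B t *m y t + e t) (m%:R * b * `|y c| + E) y0 yc ycl dy.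
have {}h : forall t, `|y t| <= 2 * (m%:R * b * `|y c| + E).
  apply: h; first by rewrite addr_ge0 // !mulr_ge0.
  move=> t _; rewrite (le_trans (ler_normD _ _)) // lerD // (le_trans (mulmx_norm_le _ _)) //.
  by apply: ler_pM; rewrite ?mulr_ge0 // ler_wpM2l.
have hcc := h c; have S0 : 0 <= `|y c| by [].
have : m%:R * b * `|y c| <= 4^-1 * `|y c| by apply: ler_wpM2r => //; lra.
move=> h4 t; apply: (le_trans (yS t)); lra.
Qed.

(** Picard iteration: integration costs a factor 2 and multiplication by B a factor m b <= 1/4, so
    consecutive iterates approach each other with ratio 1/2 on the whole interval. *)
Lemma ode_exists m q (B : R -> 'M[R]_m) (e : R -> 'M[R]_(m, q)) (b E : R) :
  continuous B -> continuous e ->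
  (forall t, `|B t| <= b) -> m%:R * b * 4 <= 1 -> 0 <= E -> (forall t, `|e t| <= E) ->
  exists y, ode_solution B e y.
Proof.
move=> Bc ec Bb mb E0 eE.
have /choice[I hI] : forall f : R -> 'M[R]_(m, q), exists F : R -> 'M[R]_(m, q),
    continuous f -> [/\ F 0 = 0, continuous F, forall t, F t = F (clamp t)
    & forall t : R, -1 < t < 2 -> is_derive t 1 F (f t)].
  move=> f; have [fc|fc] := pselect (continuous f); last by exists f.
  by have [F hF] := antiderivative_mx fc; exists F.
have mulc (y : R -> 'M[R]_(m, q)) : continuous y -> continuous (fun t => B t *m y t + e t).
  move=> yc t; apply: continuous_mx => i j.
  rewrite (_ : (fun _ => _) = (fun t => \sum_l B t i l * y t l j) \+ (fun t => e t i j)); last first.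
    by apply/funext => s; rewrite !mxE.
  apply: continuousD; last by apply: continuous_entry; exact: ec.
  apply: (@cvg_big _ _ +%R 0) => [|l _]; first exact: add_continuous.
  by apply: continuousM; apply: continuous_entry; [exact: Bc|exact: yc].
pose Y n := iter n (fun y => I (fun t => B t *m y t + e t)) (fun=> 0).
have Yc n : continuous (Y n).
  elim: n => [|n IH]; first exact: cst_continuous.
  by have [_ + _ _] := hI _ (mulc _ IH).
have YS n : ode_solution 0 (fun t => B t *m Y n t + e t) (Y n.+1).
  have [h1 h2 h3 h4] := hI _ (mulc _ (Yc n)); split=> // t t12.
  by rewrite mul0mx add0r; exact: h4.
have b0 : 0 <= b by exact: le_trans (Bb 0).
have q2 : 0 <= (2^-1 : R) < 1 by apply/andP; split; lra.
have dY n t : `|Y n.+1 t - Y n t| <= 2 * E * 2^-1 ^+ n.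
  elim: n t => [|n IH] t.
    rewrite expr0 mulr1 subr0; have [h1 h2 h3 h4] := YS 0%N.
    apply: (clamped_bound h1 h2 h3 h4) => // s _.
    by rewrite mulmx0 mul0mx !add0r.
  have [h1 h2 h3 h4] := YS n; have [h1' h2' h3' h4'] := YS n.+1.
  have -> : 2 * E * 2^-1 ^+ n.+1 = 2 * (4^-1 * (2 * E * 2^-1 ^+ n)).
    by rewrite exprS; field.
  apply: (@clamped_bound _ _ (fun s => Y n.+2 s - Y n.+1 s)
    (fun s => B s *m (Y n.+1 s - Y n s))).
  - by rewrite h1 h1' subrr.
  - by move=> s; apply: continuousB; [exact: h2'|exact: h2].
  - by move=> s; rewrite h3 h3'.
  - move=> s s12; apply: is_derive_eq; first by apply: is_deriveB; [exact: h4'|exact: h4].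
    by rewrite !mul0mx !add0r opprD addrACA subrr addr0 mulmxBr.
  - by rewrite !mulr_ge0 ?exprn_ge0 //; lra.
  - move=> s _; rewrite (le_trans (mulmx_norm_le _ _)) //.
    apply: ler_pM => //.
    by have := ler_wpM2l (ler0n _ m) (Bb s); lra.
have /choice[y hy] : forall t, exists l, forall n, `|Y n t - l| <= 2 * E / (1 - 2^-1) * 2^-1 ^+ n.
  by move=> t; apply: geometric_limit_mx => // n; exact: dY.
set A := 2 * E / (1 - 2^-1) in hy.
have A0 : 0 <= A by rewrite mulr_ge0 ?invr_ge0 //; lra.
have small ep : 0 < ep -> exists n, A * 2^-1 ^+ n <= ep.
  by move=> ep0; have /filter_ex := geometric_small A q2 ep0.
exists y; split.
- apply/eqP; rewrite -normr_le0; apply/ler_addgt0Pr => ep ep0; rewrite add0r.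
  have [n hn] := small _ ep0; have := hy 0 n.+1; have [-> _ _ _] := YS n.
  rewrite sub0r normrN => h; apply: (le_trans h); apply: le_trans hn.
  by rewrite ler_wpM2l // exprS ler_piMl ?exprn_ge0 //; lra.
- move=> t; apply/cvgrPdist_le => ep ep0.
  have ep3 : 0 < ep / 3 by rewrite divr_gt0.
  have [n hn] := small _ ep3.
  have := Yc n t; move/cvgrPdist_le => /(_ _ ep3); apply: filterS => s hs.
  have -> : y t - y s = (Y n t - Y n s) + (Y n s - y s) - (Y n t - y t).
    by apply/matrixP => i j; rewrite !mxE; ring.
  have h1 := hy s n; have h2 := hy t n.
  apply: (le_trans (ler_normB _ _)).
  apply: (le_trans (lerD (ler_normD _ _) (lexx _))); lra.
- move=> t; apply/eqP; rewrite -subr_eq0 -normr_le0; apply/ler_addgt0Pr => ep ep0; rewrite add0r.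
  have ep2 : 0 < ep / 2 by rewrite divr_gt0.
  have [n hn] := small _ ep2.
  have hn' : A * 2^-1 ^+ n.+1 <= ep / 2.
    by apply: le_trans hn; rewrite ler_wpM2l // exprS ler_piMl ?exprn_ge0 //; lra.
  have -> : y t - y (clamp t) = (Y n.+1 (clamp t) - y (clamp t)) - (Y n.+1 t - y t).
    have [_ _ h3 _] := YS n; rewrite (h3 t).
    by apply/matrixP => i j; rewrite !mxE; ring.
  apply: (le_trans (ler_normB _ _)).
  have h1 := hy (clamp t) n.+1; have h2 := hy t n.+1; lra.
(* The limit is differentiated by [c1_limit], since the derivatives B Y_n + e of the iterates
   converge geometrically as well; no integral equation has to be passed to the limit. *)
move=> t t12; apply: is_derive_mx => i j.
have [d d0 hd] : exists2 d : R, 0 < d & forall s, `|s - t| < d -> -1 < s < 2.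
  exists (Num.min (t + 1) (2 - t)); first by rewrite lt_min; apply/andP; split; lra.
  move=> s; rewrite lt_min => /andP[h1 h2].
  by move: h1 h2; rewrite !ltr_norml => /andP[h1 _] /andP[_ h2]; apply/andP; split; lra.
pose c := (B t *m y t + e t) i j.
have dl : is_diff t (fun s : R => s * c) (fun s => s * c).
  exact: (@is_diff_scalel _ R t c).
have key := @c1_limit R R t d A 2^-1 (fun n s => Y n.+1 s i j)
  (fun s => y s i j) (fun s v => v * (B s *m y s + e s) i j) ('d (fun s : R => s * c) t) d0 q2.
have [] := key.
- by apply: diff_continuous.
- by rewrite diff_val.
- move=> n s /hd s12; have [_ _ _ /(_ s s12) h] := YS n.
  have [h' _] := is_derive_entry i j h; exact/derivable1_diffP.
- move=> n s v /hd s12; have [_ _ _ /(_ s s12) h] := YS n.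
  have [h' h2] := is_derive_entry i j h.
  have := derive_scale (1 : R) v ((derivable1_diffP _ _).1 h').
  rewrite {1}/GRing.scale /= mulr1 => ->.
  rewrite h2 mul0mx add0r -[v *: _]/(v * _) -mulrBr normrM mulrC ler_wpM2r //.
  have -> : (B s *m Y n s + e s) i j - (B s *m y s + e s) i j = (B s *m (Y n s - y s)) i j.
    by rewrite mulmxBr !mxE; ring.
  apply: (le_trans (mx_entry_le _ _ _)); apply: (le_trans (mulmx_norm_le _ _)).
  have h3 := hy s n; apply: le_trans h3; rewrite ler_piMl //.
  by have := ler_wpM2l (ler0n _ m) (Bb s); lra.
- move=> n s _.
  have -> : Y n.+1 s i j - y s i j = (Y n.+1 s - y s) i j by rewrite !mxE.
  apply: (le_trans (mx_entry_le _ _ _)); apply: (le_trans (hy s n.+1)).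
  by rewrite ler_wpM2l // exprS ler_piMl ?exprn_ge0 //; lra.
move=> dfy dL; split; first exact/derivable1_diffP.
by rewrite deriveE // dL diff_val mul1r.
Qed.

End LinearODE.

(** * Dependence of the solutions on a parameter, with symbol estimates *)

Section ParametricODE.
Variable R : realType.

Lemma row_linear n (W : normedModType R) (w : 'I_n -> W) :
  exists L : {linear 'rV[R]_n -> W}, forall v, L v = \sum_b v 0 b *: w b.
Proof.
pose f (v : 'rV[R]_n) := \sum_b v 0 b *: w b.
have fl : linear f.
  move=> a u v; rewrite /f scaler_sumr -big_split /=; apply: eq_bigr => b _.
  by rewrite !mxE scalerDl scalerA.
pose fM := GRing.isLinear.Build _ _ _ _ _ fl.
by exists (HB.pack f fM : {linear _ -> _}).
Qed.

Lemma calm_continuous n (f : 'rV[R]_n -> R) (x : 'rV[R]_n) (K : R) :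
  (\forall v \near (0 : 'rV[R]_n), `|f (x + v) - f x| <= K * `|v|) -> {for x, continuous f}.
Proof.
move=> hf; apply/(@cvgrPdist_le _ _ _ (nbhs (x : 'rV[R]_n))) => e e0.
have : \forall v \near (0 : 'rV[R]_n), `|f x - f (x + v)| <= e.
  have K0 : 0 < `|K| + 1 by rewrite ltr_wpDl.
  have hv : \forall v \near (0 : 'rV[R]_n), `|v| <= e / (`|K| + 1).
    by apply: nbhs0_le; rewrite divr_gt0.
  apply: filterS2 hf hv => v hf hv; rewrite distrC (le_trans hf) //.
  apply: (@le_trans _ _ ((`|K| + 1) * `|v|)).
    by apply: ler_wpM2r => //; rewrite (le_trans (ler_norm _)) // lerDl.
  by rewrite mulrC -ler_pdivlMr.
by move=> h; exact: ((nbhs0P [set t | `|f x - f t| <= e] x).2 h).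
Qed.

Lemma msymbol_calm n p q k lam (D : set 'rV[R]_n) (F : R -> 'rV[R]_n -> 'M[R]_(p, q)) x :
  msymbol 2 k lam D F -> D x -> exists2 K, 0 <= K &
    \forall v \near (0 : 'rV[R]_n), forall t, `|F t (x + v) - F t x| <= K * `|v|.
Proof.
move=> hF Dx.
have /choice[K hK] : forall ij : 'I_p * 'I_q, exists K : R, 0 <= K /\
    \forall v \near (0 : 'rV[R]_n), forall t, `|F t (x + v) ij.1 ij.2 - F t x ij.1 ij.2| <= K * `|v|.
  move=> [i j]; have [_ _ _ /(_ isT x Dx)[K K0 h]] := symbol_symbol0 (hF i j).
  by exists K.
exists (\sum_b K b); first by apply: sumr_ge0 => b _; have [] := hK b.
have : \forall v \near (0 : 'rV[R]_n), forall ij t, `|F t (x + v) ij.1 ij.2 - F t x ij.1 ij.2| <= K ij * `|v|.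
  by apply: (@filter_forall _ _ _ (nbhs (0 : 'rV[R]_n))) => ij; have [] := hK ij.
apply: filterS => v hv t; apply: mx_norm_le.
  by rewrite mulr_ge0 // sumr_ge0 // => b _; have [] := hK b.
move=> i j; rewrite !mxE; apply: (le_trans (hv (i, j) t)); apply: ler_wpM2r => //.
by rewrite (bigD1 (i, j)) //= lerDl sumr_ge0 // => c _; have [] := hK c.
Qed.

(** The first derivatives are Lipschitz at x uniformly in t, so F minus its linear part has
    increments that are quadratic in v, uniformly in t. *)
Lemma msymbol_taylor n p q lam (D : set 'rV[R]_n) (F : R -> 'rV[R]_n -> 'M[R]_(p, q)) x :
  open D -> msymbol 2 1 lam D F -> D x -> exists2 K, 0 <= K &
    \forall v \near (0 : 'rV[R]_n), forall t,
      `|F t (x + v) - F t x - 'D_v (F t) x| <= K * `|v| ^+ 2.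
Proof.
move=> oD hF Dx.
have /choice[K hK] : forall b, exists K : R, 0 <= K /\
    \forall v \near (0 : 'rV[R]_n), forall t,
      `|'D_(delta_mx 0 b) (F t) (x + v) - 'D_(delta_mx 0 b) (F t) x| <= K * `|v|.
  move=> b; have [K K0 h] := msymbol_calm (msymbol_derive (delta_mx 0 b) oD hF) Dx.
  by exists K.
have S0 : 0 <= \sum_b K b by apply: sumr_ge0 => b _; have [] := hK b.
exists (n%:R * \sum_b K b); first by rewrite mulr_ge0.
have h1 : \forall v \near (0 : 'rV[R]_n), forall b t,
      `|'D_(delta_mx 0 b) (F t) (x + v) - 'D_(delta_mx 0 b) (F t) x| <= K b * `|v|.
  by apply: (@filter_forall _ _ _ (nbhs (0 : 'rV[R]_n))) => b; have [] := hK b.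
have h2 : \forall v \near (0 : 'rV[R]_n), D (x + v) by exact: (open_near0 oD Dx).
apply: filterS (near_segment (filterI h1 h2)) => v hv t.
apply: mx_norm_le => [|i j]; first by rewrite !mulr_ge0.
have dF s : 0 <= s <= 1 -> differentiable (F t) (x + s *: v).
  by move=> /hv; rewrite add0r => -[_ Ds]; exact: (msymbol_diff hF).
have dFx : differentiable (F t) x by exact: (msymbol_diff hF).
pose L := 'd (fun y => F t y i j) x.
have dFij := differentiable_entry i j dFx.
have dL y : differentiable L y by apply: linear_differentiable; exact: diff_continuous.
pose g := (fun y => F t y i j) \- L.
have -> : (F t (x + v) - F t x - 'D_v (F t) x) i j = g (x + v) - g x.
  by rewrite !mxE derive_entry // /g /= deriveE // linearD /L; ring.
have -> : n%:R * (\sum_b K b) * `|v| ^+ 2 = n%:R * ((\sum_b K b) * `|v|) * `|v|.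
  by rewrite expr2; ring.
apply: mvt_segment => s s01.
  by apply: differentiableB => //; apply: differentiable_entry; exact: dF.
have [hs _] := hv s s01; rewrite add0r in hs.
apply: derive_bound.
  by apply: differentiableB => //; apply: differentiable_entry; exact: dF.
move=> b.
have dFs := differentiable_entry i j (dF s s01).
rewrite deriveB; [|exact: diff_derivable|exact: diff_derivable].
have -> : 'D_(delta_mx 0 b) L (x + s *: v) = 'D_(delta_mx 0 b) (fun y => F t y i j) x.
  by rewrite deriveE // diff_lin ?deriveE //; exact: diff_continuous.
rewrite -!derive_entry //; last exact: dF.
have -> (A B : 'M[R]_(p, q)) : A i j - B i j = (A - B) i j by rewrite !mxE.
apply: (le_trans (mx_entry_le _ _ _)); apply: (le_trans (hs b t)).
have /andP[s0 s1] := s01.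
apply: ler_pM => //; first by have [] := hK b.
  by rewrite (bigD1 b) //= lerDl sumr_ge0 // => c _; have [] := hK c.
by rewrite normrZ ger0_norm // ler_piMl.
Qed.

(** The change of the coefficient is moved into the free term, so that perturbations of the data are
    again estimated by [ode_bound]. *)
Lemma ode_sub m q (B B' : R -> 'M[R]_m) (e e' y y' : R -> 'M[R]_(m, q)) :
  ode_solution B e y -> ode_solution B' e' y' ->
  ode_solution B' (fun t => (B' t - B t) *m y t + (e' t - e t)) (fun t => y' t - y t).
Proof.
move=> [h1 h2 h3 h4] [h1' h2' h3' h4']; split.
- by rewrite h1 h1' subrr.
- by move=> t; apply: continuousB; [exact: h2'|exact: h2].
- by move=> t; rewrite {1}h3 {1}h3'.
move=> t t12; have := is_deriveB (h4' t t12) (h4 t t12); congr is_derive.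
rewrite mulmxBr mulmxBl opprD addrACA !addrA; congr (_ + _ + _).
by rewrite subrK.
Qed.

Lemma ode_lin m q n (c : 'I_n -> R) (B : R -> 'M[R]_m) (e z : 'I_n -> R -> 'M[R]_(m, q)) :
  (forall b, ode_solution B (e b) (z b)) ->
  ode_solution B (fun t => \sum_b c b *: e b t) (fun t => \sum_b c b *: z b t).
Proof.
move=> h; split.
- by rewrite big1 // => b _; have [-> _ _ _] := h b; rewrite scaler0.
- move=> t; apply: continuous_mx => i j.
  rewrite (_ : (fun _ => _) = (fun t => \sum_b c b * z b t i j)); last first.
    by apply/funext => s; rewrite summxE; apply: eq_bigr => b _; rewrite mxE.
  apply: (@cvg_big _ _ +%R 0) => [|b _]; first exact: add_continuous.
  apply: continuousM; first exact: cst_continuous.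
  by have [_ h2 _ _] := h b; apply: continuous_entry; exact: h2.
- by move=> t; apply: eq_bigr => b _; have [_ _ -> _] := h b.
move=> t t12.
have -> : (fun s => \sum_b c b *: z b s) = \sum_b (fun s => c b *: z b s).
  by apply/funext => s; rewrite fct_sumE.
have := @is_derive_sum _ _ _ n (fun b s => c b *: z b s) t 1 (fun b => c b *: (B t *m z b t + e b t)).
move=> hs; apply: (is_derive_eq (hs _)).
  by move=> b; apply: is_deriveZ; have [_ _ _ h4] := h b; exact: h4.
rewrite mulmx_sumr -big_split /=; apply: eq_bigr => b _.
by rewrite scalerDr scalemxAr.
Qed.

Variables (n m : nat) (D : set 'rV[R]_n) (B : R -> 'rV[R]_n -> 'M[R]_m) (b : R).
Hypotheses (oD : open D) (D0 : away0 2 D) (D1 : forall x, D x -> enorm x <= 1).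
Hypothesis hB : forall k, msymbol 2 k 1 D B.
Hypotheses (Bb : forall t x, D x -> `|B t x| <= b) (mb : m%:R * b * 4 <= 1).

(** [ode_bound] at a fixed x gives the rate; applied to the difference of the solutions at x + v and
    at x it gives the Lipschitz condition. Both are uniform in time. *)
Lemma param_base q lam (e y : R -> 'rV[R]_n -> 'M[R]_(m, q)) :
  msymbol 2 0 lam D e ->
  (forall x, D x -> ode_solution (B^~ x) (e^~ x) (y^~ x)) -> msymbol 2 0 lam D y.
Proof.
move=> he hy.
have [E E0 eE] := msymbol_bound (isT : (0 < 2)%N) he.
have yE t x : D x -> `|y t x| <= 4 * (E * enorm x `^ lam).
  move=> Dx; apply: (@ode_bound _ _ _ _ _ _ b _ (hy x Dx)) => //.
  - by move=> s; exact: Bb.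
  - by rewrite mulr_ge0 ?powR_ge0.
  - by move=> s; exact: eE.
have ycalm x : D x -> exists2 K, 0 <= K & \forall v \near (0 : 'rV[R]_n),
    forall t, `|y t (x + v) - y t x| <= K * `|v|.
  move=> Dx; have [K1 K10 h1] := msymbol_calm (hB 0) Dx.
  have [K2 K20 h2] := msymbol_calm he Dx.
  have C0 : 0 <= 4 * (E * enorm x `^ lam) by rewrite !mulr_ge0 ?powR_ge0.
  exists (4 * (m%:R * K1 * (4 * (E * enorm x `^ lam)) + K2)).
    by rewrite mulr_ge0 // addr_ge0 // mulr_ge0 // mulr_ge0.
  apply: filterS3 (open_near0 oD Dx (fun y Dy => Dy)) h1 h2 => v Dv h1 h2 t.
  rewrite -mulrA.
  apply: (@ode_bound _ _ _ _ _ (fun t => y t (x + v) - y t x) b _ (ode_sub (hy x Dx) (hy _ Dv))) => //.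
  - by move=> s; exact: Bb.
  - by rewrite mulr_ge0 // addr_ge0 // mulr_ge0 // mulr_ge0.
  - move=> s; rewrite mulrDl (le_trans (ler_normD _ _)) // lerD //.
    rewrite (le_trans (mulmx_norm_le _ _)) // [leRHS]mulrAC; apply: ler_pM; rewrite ?mulr_ge0 //; last exact: yE.
    by rewrite -mulrA ler_wpM2l.
move=> i j; split=> //; split=> [t x Dx|t x Dx|_|_ x Dx].
- have [K K0 h] := ycalm x Dx; apply: (@calm_continuous _ _ _ K).
  apply: filterS h => v /(_ t); apply: le_trans.
  by have := mx_entry_le (y t (x + v) - y t x) i j; rewrite !mxE.
- by have [_ h _ _] := hy x Dx; apply: continuous_entry; exact: h.
- exists (4 * E); first by rewrite mulr_ge0.
  by move=> t x Dx; rewrite (le_trans (mx_entry_le _ _ _)) // -mulrA yE.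
- have [K K0 h] := ycalm x Dx; exists K => //; apply: filterS h => v h t.
  apply: le_trans (h t).
  by have := mx_entry_le (y t (x + v) - y t x) i j; rewrite !mxE.
Qed.

(** The candidates [z c] for the partial derivatives solve the equation differentiated in x. The
    Taylor remainder y (x + v) - y x - L v then solves an equation of the same kind, with zero
    initial value and a free term of size |v|^2, so [ode_bound] makes it O(|v|^2). *)
Lemma param_diff q lam lam' (e y : R -> 'rV[R]_n -> 'M[R]_(m, q))
    (z : 'I_n -> R -> 'rV[R]_n -> 'M[R]_(m, q)) :
  msymbol 2 1 lam D e ->
  (forall x, D x -> ode_solution (B^~ x) (e^~ x) (y^~ x)) ->
  (forall c, msymbol 2 0 lam' D (z c)) ->
  (forall c x, D x -> ode_solution (B^~ x)
     (fun t => 'D_(delta_mx 0 c) (B t) x *m y t x + 'D_(delta_mx 0 c) (e t) x) ((z c)^~ x)) ->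
  forall t x, D x -> differentiable (y t) x /\
    forall c, 'D_(delta_mx 0 c) (y t) x = z c t x.
Proof.
move=> he hy hz zsol t x Dx.
have [L hL] := row_linear (fun c => z c t x).
have LB : continuous L by exact: linear_rV_continuous.
have [|dy dyL] := @differentiable_epsP _ _ _ (y t) x L LB; last first.
  split=> // c; rewrite deriveE // dyL hL (bigD1 c) //= !mxE !eqxx scale1r.
  by rewrite big1 ?addr0 // => d dc; rewrite mxE (negbTE dc) andbF scale0r.
have [K1 K10 h1] := msymbol_calm (hB 0) Dx.
have [K2 K20 h2] := msymbol_taylor oD (hB 1) Dx.
have [K3 K30 h3] := msymbol_taylor oD he Dx.
have hy0 := param_base (fun i j => symbol_pred (he i j)) hy.
have [Cy Cy0 yC] := msymbol_bound (isT : (0 < 2)%N) hy0.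
have /choice[Cz zC] : forall c, exists C, 0 <= C /\ forall s, `|z c s x| <= C.
  move=> c; have [C C0 h] := msymbol_bound (isT : (0 < 2)%N) (hz c).
  by exists (C * enorm x `^ lam'); split=> [|s]; [rewrite mulr_ge0 ?powR_ge0|exact: h].
have [Y Y0 hY] : exists2 Y : R, 0 <= Y & forall s, `|y s x| <= Y.
  by exists (Cy * enorm x `^ lam) => [|s]; [rewrite mulr_ge0 ?powR_ge0|exact: yC].
set Z := \sum_c Cz c; have Z0 : 0 <= Z by apply: sumr_ge0 => c _; have [] := zC c.
(* The terms in the parentheses bound, up to |v|^2: the increment of B times the linear part, the
   Taylor remainder of B times y, and the Taylor remainder of e. The factor 4 is that of
   [ode_bound]. *)
set K := 4 * (m%:R * K1 * Z + (m%:R * K2 * Y + K3)).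
have E0 : 0 <= m%:R * K1 * Z + (m%:R * K2 * Y + K3).
  by apply: addr_ge0; [|apply: addr_ge0]; rewrite ?mulr_ge0.
have K0 : 0 <= K by rewrite mulr_ge0.
have key : \forall v \near (0 : 'rV[R]_n), `|y t (x + v) - y t x - L v| <= K * `|v| ^+ 2.
  apply: filterS2 (filterI (open_near0 oD Dx (fun y Dy => Dy)) h1) (filterI h2 h3).
  move=> v [Dv {}h1] [{}h2 {}h3].
  have su := ode_sub (hy x Dx) (hy _ Dv).
  have sz := ode_lin (fun c => v 0 c) (fun c => zsol c x Dx).
  have sw := ode_sub sz su.
  rewrite hL /K -mulrA; move: t {L hL LB}; apply: (@ode_bound _ _ _ _ _ _ b _ sw) => //.
  - by move=> s; exact: Bb.
  - by rewrite mulr_ge0 ?exprn_ge0.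
  move=> s; set ZZ := \sum_c v 0 c *: z c s x.
  have ZZle : `|ZZ| <= Z * `|v|.
    rewrite (le_trans (ler_norm_sum _ _ _)) // mulr_suml; apply: ler_sum => c _.
    by rewrite normrZ mulrC; apply: ler_pM => //; [have [] := zC c|exact: mx_entry_le].
  have -> : \sum_c v 0 c *: ('D_(delta_mx 0 c) (B s) x *m y s x + 'D_(delta_mx 0 c) (e s) x) =
      'D_v (B s) x *m y s x + 'D_v (e s) x.
    rewrite (derive_basis v (msymbol_diff (hB 1) s Dx)) (derive_basis v (msymbol_diff he s Dx)).
    rewrite mulmx_suml -big_split /=; apply: eq_bigr => c _.
    by rewrite scalerDr scalemxAl.
  have -> : (B s (x + v) - B s x) *m y s x + (e s (x + v) - e s x) -
      ('D_v (B s) x *m y s x + 'D_v (e s) x) =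
      (B s (x + v) - B s x - 'D_v (B s) x) *m y s x + (e s (x + v) - e s x - 'D_v (e s) x).
    by rewrite [in RHS]mulmxBl opprD addrACA.
  rewrite (le_trans (ler_normD _ _)) // [leRHS]mulrDl; apply: lerD.
    rewrite (le_trans (mulmx_norm_le _ _)) // expr2.
    rewrite (_ : m%:R * K1 * Z * (`|v| * `|v|) = m%:R * (K1 * `|v|) * (Z * `|v|)); last by ring.
    by apply: ler_pM; rewrite ?mulr_ge0 // ler_wpM2l.
  rewrite (le_trans (ler_normD _ _)) // mulrDl; apply: lerD => //.
  rewrite (le_trans (mulmx_norm_le _ _)) // [leRHS]mulrAC; apply: ler_pM; rewrite ?mulr_ge0 //.
  by rewrite -mulrA ler_wpM2l.
move=> ep ep0.
have hv : \forall v \near (0 : 'rV[R]_n), `|v| <= ep / (K + 1).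
  by apply: nbhs0_le; rewrite divr_gt0 // ltr_wpDl.
apply: filterS2 key hv => v key hv; apply: (le_trans key).
rewrite expr2 mulrA ler_wpM2r //.
apply: (@le_trans _ _ ((K + 1) * `|v|)); first by rewrite ler_wpM2r // lerDl.
by rewrite mulrC -ler_pdivlMr // ltr_wpDl.
Qed.

(** The derivative in direction c solves the equation with the same B and free term D_c B y + D_c e.
    Since B has rate 1, D_c B y keeps the rate lam, which is more than the lam - 1 needed where r <=
    1; the induction hypothesis then applies to the derivatives. *)
Lemma param_symbol q k lam (e y : R -> 'rV[R]_n -> 'M[R]_(m, q)) :
  msymbol 2 k lam D e ->
  (forall x, D x -> ode_solution (B^~ x) (e^~ x) (y^~ x)) -> msymbol 2 k lam D y.
Proof.
elim: k lam e y => [|k IH] lam e y he hy; first exact: param_base he hy.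
have yk : msymbol 2 k lam D y by apply: IH hy; exact: msymbol_leq he.
pose e' c t x := 'D_(delta_mx 0 c) (B t) x *m y t x + 'D_(delta_mx 0 c) (e t) x.
have he' c : msymbol 2 k (lam - 1) D (e' c).
  apply: msymbol_add => //; last exact: msymbol_derive.
  have : msymbol 2 k (0 + lam) D (fun t x => 'D_(delta_mx 0 c) (B t) x *m y t x).
    apply: msymbol_mul => //.
    by have := msymbol_derive (delta_mx 0 c) oD (hB k.+1); rewrite subrr.
  by apply: msymbol_le => //; rewrite add0r gerBl.
have /choice[z zsol] : forall c, exists z : R -> 'rV[R]_n -> 'M[R]_(m, q),
    forall x, D x -> ode_solution (B^~ x) ((e' c)^~ x) (z^~ x).
  move=> c.
  have /choice[z hz] : forall x, exists z, D x -> ode_solution (B^~ x) ((e' c)^~ x) z.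
    move=> x; have [Dx|nDx] := pselect (D x); last by exists (fun=> 0).
    have [E E0 eE] := msymbol_bound (isT : (0 < 2)%N) (he' c).
    have [z hz] : exists z, ode_solution (B^~ x) ((e' c)^~ x) z.
      apply: (@ode_exists _ _ _ _ _ b (E * enorm x `^ (lam - 1))) => //.
      - move=> t; apply: continuous_mx => i j.
        by have [_ h _ _] := symbol_symbol0 (hB 0 i j); exact: h.
      - move=> t; apply: continuous_mx => i j.
        by have [_ h _ _] := symbol_symbol0 (he' c i j); exact: h.
      - by move=> t; exact: Bb.
      - by rewrite mulr_ge0 ?powR_ge0.
      - by move=> t; exact: eE.
    by exists z.
  by exists (fun t x => z x t) => x; exact: hz.
have zk c : msymbol 2 k (lam - 1) D (z c) by apply: IH (he' c) (zsol c).
have he1 : msymbol 2 1 lam D e by exact: msymbol_leq he.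
have hd := param_diff he1 hy (fun c => msymbol_leq (leq0n k) (zk c)) zsol.
apply: msymbolS => //.
- exact: msymbol_leq yk.
- by move=> t x Dx; have [] := hd t x Dx.
- by move=> c; apply: msymbol_eq (zk c) => // t x Dx; have [_ ->] := hd t x Dx.
Qed.

End ParametricODE.

(** * Calculus of matrix-valued functions *)

Section MatrixCalculus.
Variable R : realType.

Lemma is_derive_mulmx (V : normedModType R) p q r (A : V -> 'M[R]_(p, q)) (B : V -> 'M[R]_(q, r))
    (x v : V) dA dB : is_derive x v A dA -> is_derive x v B dB ->
  is_derive x v (fun y => A y *m B y) (dA *m B x + A x *m dB).
Proof.
move=> [hA eA] [hB eB].
have hA' i j : is_derive x v (fun y => A y i j) (dA i j).
  split; first by move/derivable_mxP : hA.
  by rewrite -eA derive_mx // mxE.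
have hB' i j : is_derive x v (fun y => B y i j) (dB i j).
  split; first by move/derivable_mxP : hB.
  by rewrite -eB derive_mx // mxE.
have e i j : (fun y => (A y *m B y) i j) = \sum_l (fun y => A y i l * B y l j).
  by apply/funext => y; rewrite mxE fct_sumE.
have hAB i j : is_derive x v (fun y => (A y *m B y) i j) ((dA *m B x + A x *m dB) i j).
  rewrite e; apply: is_derive_eq.
  rewrite !mxE -big_split /=; apply: eq_bigr => l _.
  by rewrite addrC; congr (_ + _); rewrite -[LHS]/(B x l j * dA i l) mulrC.
have dAB : derivable (fun y => A y *m B y) x v.
  by apply/derivable_mxP => i j; have [] := hAB i j.
split=> //; rewrite derive_mx //; apply/matrixP => i j; rewrite mxE.
by have [_ ->] := hAB i j.
Qed.

Lemma differentiable_mulmx (V : normedModType R) p q r (A : V -> 'M[R]_(p, q))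
    (B : V -> 'M[R]_(q, r)) (x : V) : differentiable A x -> differentiable B x ->
  differentiable (fun y => A y *m B y) x.
Proof.
move=> dA dB; apply: differentiable_mx => i j.
have -> : (fun y => (A y *m B y) i j) = \sum_l (fun y => A y i l * B y l j).
  by apply/funext => y; rewrite mxE fct_sumE.
by apply: differentiable_sum => l; apply: differentiableM; exact: differentiable_entry.
Qed.

Lemma derive_mulmx (V : normedModType R) p q r (A : V -> 'M[R]_(p, q))
    (B : V -> 'M[R]_(q, r)) (x v : V) : differentiable A x -> differentiable B x ->
  'D_v (fun y => A y *m B y) x = 'D_v A x *m B x + A x *m 'D_v B x.
Proof.
move=> dA dB; apply: derive_val; apply: is_derive_mulmx; exact/derivableP/diff_derivable.
Qed.

Lemma derive_linear_mx (V W W' : normedModType R) (f : V -> W) (L : {linear W -> W'}) (x v : V) :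
  continuous L -> differentiable f x ->
  differentiable (L \o f) x /\ 'D_v (L \o f) x = L ('D_v f x).
Proof.
move=> Lc df; have dL : differentiable L (f x) by exact: linear_differentiable.
split; first exact: differentiable_comp.
by rewrite derive_comp // deriveE // diff_lin.
Qed.

Lemma mx_linear_continuous p q (W : normedModType R) (L : {linear 'M[R]_(p, q) -> W}) : continuous L.
Proof.
have -> : (L : 'M[R]_(p, q) -> W) =
    \sum_(i < p) \sum_(j < q) (fun A : 'M[R]_(p, q) => A i j *: L (delta_mx i j)).
  apply/funext => A; rewrite {1}(matrix_sum_delta A) linear_sum fct_sumE.
  apply: eq_bigr => i _; rewrite linear_sum fct_sumE.
  by apply: eq_bigr => j _; rewrite linearZ.
by move=> A; apply/differentiable_continuous; apply: differentiable_sum => i;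
  apply: differentiable_sum => j; apply: differentiableZl; exact: differentiable_coord.
Qed.

Lemma is_derive1_scale (V : normedModType R) (f : R -> V) (df : V) (a : R) :
  is_derive (0 : R) (1 : R) f df -> is_derive (0 : R) (1 : R) (fun t => f (a * t)) (a *: df).
Proof.
move=> [hf <-].
have d2 : differentiable f (a * 0) by rewrite mulr0; exact/derivable1_diffP.
have d1 : is_diff (0 : R) (fun t : R => a * t) (fun t => a * t).
  exact: (@is_diff_scaler _ R a 0).
have d1' : differentiable (fun t : R => a * t) (0 : R) by [].
split; first exact/derivable1_diffP/differentiable_comp.
rewrite -[LHS]/('D_1 (f \o (fun t => a * t)) 0) deriveE; last exact: differentiable_comp.
rewrite diff_comp // /= diff_val mulr1 mulr0 -[a in LHS]mulr1.
rewrite -[a * 1]/(a *: (1 : R)) linearZ /= deriveE //.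
exact/derivable1_diffP.
Qed.

(** Among the matrices with rows in S one of maximal rank spans S: a vector of S outside its row
    space would raise the rank. *)
Lemma subspace_rowspace N (S : set 'rV[R]_N) : S 0 ->
  (forall a u v, S u -> S v -> S (a *: u + v)) ->
  exists A : 'M[R]_N, forall u, S u <-> (u <= A)%MS.
Proof.
move=> S0 SD.
have Sspan k (A : 'M[R]_(k, N)) u : (forall i, S (row i A)) -> (u <= A)%MS -> S u.
  move=> SA /submxP[c ->]; rewrite mulmx_sum_row.
  elim/big_ind: _ => // [v w Sv Sw|i _]; first by rewrite -(scale1r v); exact: SD.
  by rewrite -[_ *: _]addr0; exact: SD.
pose P l := `[< exists A : 'M[R]_N, (forall i, S (row i A)) /\ \rank A = l >].
have P0 : exists l, P l.
  by exists 0%N; apply/asboolP; exists 0; split=> [i|]; rewrite ?row0 ?mxrank0.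
have Pub l : P l -> (l <= N)%N by move=> /asboolP[A [_ <-]]; exact: rank_leq_col.
case: (ex_maxnP P0 Pub) => l /asboolP[A [SA rA]] lmax; exists A => u.
split; last exact: Sspan.
move=> Su; apply: contrapT => nu.
have SAu i : S (row i <<col_mx A u>>%MS).
  apply: (@Sspan _ (col_mx A u)).
    move=> k; rewrite -(splitK k); case: (fintype.split k) => j /=.
      by rewrite rowKu.
    by rewrite rowKd; have -> : row j u = u by apply/rowP => c; rewrite mxE ord1.
  by rewrite -(genmxE (col_mx A u)) row_sub.
have : P (\rank (col_mx A u)).
  by apply/asboolP; exists <<col_mx A u>>%MS; rewrite genmxE.
move=> /lmax; rewrite leqNgt -rA => /negP; apply.
apply: rank_ltmx; rewrite ltmxE; apply/andP; split; first by rewrite -addsmxE addsmxSl.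
by rewrite -addsmxE addsmx_sub submx_refl; exact/negP.
Qed.

End MatrixCalculus.

(** * Compact matrix groups *)

Section CompactGroup.
Variables (R : realType) (m : nat) (G : set 'M[R]_m).
Hypothesis hG : compact_group G.

Let g := lie_algebra G.

Lemma cgroup1 : G 1%:M. Proof. by case: hG. Qed.

Lemma cgroupM h k : G h -> G k -> G (h *m k).
Proof. by case: hG => _ _ hM _; exact: hM. Qed.

Lemma cgroupU h : G h -> h \in unitmx.
Proof. by case: hG => _ _ _ hV /hV[]. Qed.

Lemma cgroupV h : G h -> G (invmx h).
Proof. by case: hG => _ _ _ hV /hV[]. Qed.

Lemma cgroup_closed : closed G.
Proof. by apply: compact_closed; [exact: norm_hausdorff|case: hG]. Qed.

Lemma cgroup_bounded : exists2 C, 0 <= C & forall h, G h -> `|h| <= C.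
Proof.
have [cG _ _ _] := hG; have [M [Mr hM]] := compact_bounded cG.
have M1 : M < `|M| + 1 by rewrite (le_lt_trans (ler_norm _)) // ltrDl.
by exists (`|M| + 1) => [|h Gh]; [rewrite addr_ge0|exact: (hM _ M1)].
Qed.

Lemma lie0 : g 0.
Proof.
exists (fun=> 1%:M); split=> // [_|]; first exact: cgroup1.
exact: is_derive_cst.
Qed.

Lemma lieZ a X : g X -> g (a *: X).
Proof.
move=> [c [c0 cG dc]]; exists (fun t => c (a * t)); split=> [|t|].
- by rewrite mulr0.
- exact: cG.
- exact: is_derive1_scale.
Qed.

(** The product of two curves through 1 has the sum of their velocities as its velocity. *)
Lemma lieD X Y : g X -> g Y -> g (X + Y).
Proof.
move=> [c [c0 cG dc]] [d [d0 dG dd]]; exists (fun t => c t *m d t); split=> [|t|].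
- by rewrite c0 d0 mulmx1.
- exact: cgroupM.
- by have := is_derive_mulmx dc dd; rewrite c0 d0 mul1mx mulmx1.
Qed.

Lemma lieN X : g X -> g (- X).
Proof. by move=> gX; rewrite -scaleN1r; exact: lieZ. Qed.

Lemma lieB X Y : g X -> g Y -> g (X - Y).
Proof. by move=> gX gY; apply: lieD => //; exact: lieN. Qed.

Lemma lie_sum (I : Type) (r : seq I) (F : I -> 'M[R]_m) :
  (forall i, g (F i)) -> g (\sum_(i <- r) F i).
Proof. by move=> gF; elim/big_ind: _ => // [|X Y]; [exact: lie0|exact: lieD]. Qed.

Lemma lieAd h X : G h -> g X -> g (invmx h *m X *m h).
Proof.
move=> Gh [c [c0 cG dc]]; exists (fun t => invmx h *m c t *m h); split=> [|t|].
- by rewrite c0 mulmx1 mulVmx // cgroupU.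
- by apply: cgroupM => //; apply: cgroupM => //; exact: cgroupV.
have h1 := is_derive_mulmx (is_derive_cst (invmx h) (0 : R) (1 : R)) dc.
have := is_derive_mulmx h1 (is_derive_cst h (0 : R) (1 : R)).
by rewrite mulmx0 addr0 mul0mx add0r.
Qed.

(** As the kernel of a linear map, the Lie algebra is closed under differentiation of functions with
    values in it; [lie_derive] draws that conclusion. *)
Lemma lie_linear_eq : exists L : {linear 'M[R]_m -> 'rV[R]_(m * m)},
  forall X, g X <-> L X = 0.
Proof.
have [||A hA] := @subspace_rowspace R (m * m) [set u | g (vec_mx u)].
- by rewrite /= linear0; exact: lie0.
- by move=> a u v /= gu gv; rewrite linearP; apply: lieD => //; exact: lieZ.
exists (mulmxr (cokermx A) \o mxvec) => X.
have := hA (mxvec X); rewrite /= mxvecK => ->.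
by rewrite submxE; split=> /eqP.
Qed.

Lemma lie_derive (V : normedModType R) (f : V -> 'M[R]_m) (x v : V) :
  differentiable f x -> (\near x, g (f x)) -> g ('D_v f x).
Proof.
move=> df gf; have [L hL] := lie_linear_eq; apply/hL.
have [_ <-] := derive_linear_mx v (@mx_linear_continuous _ _ _ _ L) df.
rewrite (@near_eq_derive _ _ _ _ (fun=> 0)) ?derive_cst //.
by apply: filterS gf => y /hL.
Qed.

Lemma lie_log_derive (V : normedModType R) (f : V -> 'M[R]_m) (x v : V) :
  differentiable f x -> (\near x, G (f x)) -> g (invmx (f x) *m 'D_v f x).
Proof.
move=> df Gf; have Gx := nbhs_singleton Gf.
(* An element of [lie_algebra] needs a curve that lies in G at all times, whereas f is known to do
   so only near x; elsewhere the curve is set to 1. *)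
pose c (t : R) := if `[< G (f (x + t *: v)) >] then invmx (f x) *m f (x + t *: v) else 1%:M.
exists c; split.
- by rewrite /c scale0r addr0 mulVmx ?cgroupU //; case: ifP.
- move=> t; rewrite /c; case: ifPn => [/asboolP Gt|_]; last exact: cgroup1.
  by apply: cgroupM => //; exact: cgroupV.
apply: (@near_eq_is_derive R R 'M[R]_m (fun t : R => invmx (f x) *m f (x + t *: v))).
  have : (fun t : R => x + t *: v) @ (0 : R) --> x + (0 : R) *: v.
    by apply: cvgD; [exact: cvg_cst|exact: scalel_continuous].
  rewrite scale0r addr0 => /(_ _ Gf) hc.
  have {}hc : \forall t \near (0 : R), G (f (x + t *: v)) by exact: hc.
  by apply: filterS hc => t Gt; rewrite /c; case: asboolP.
have df0 : differentiable f (x + (0 : R) *: v) by rewrite scale0r addr0.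
have := is_derive_mulmx (is_derive_cst (invmx (f x)) (0 : R) (1 : R)) (is_derive_line df0).
by rewrite mul0mx add0r scale0r addr0.
Qed.

Variable Q : 'M[R]_m.
Hypothesis hQ : invariant_gram G Q.

Lemma gram_unit : Q \in unitmx.
Proof.
have [QT Qpos _] := hQ; rewrite -unitmx_tr -row_free_unit; apply/inj_row_free => v vQ.
apply/eqP; apply: contrapT => /negP v0.
have /Qpos : v^T != 0 by rewrite -trmx0 (inj_eq trmx_inj).
by rewrite trmxK -{1}QT vQ mul0mx mxE ltxx.
Qed.

(* Invariance of Q makes inversion on G the restriction of a linear map. *)
Lemma cgroup_inv h : G h -> invmx h = invmx Q *m h^T *m Q.
Proof.
move=> Gh; have [_ _ /(_ h Gh) e] := hQ; have hu := cgroupU Gh.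
have : invmx Q *m h^T *m Q *m h = 1%:M by rewrite -!mulmxA (mulmxA h^T) e mulVmx ?gram_unit.
by move=> /(congr1 (mulmxr (invmx h))) /=; rewrite mulmxK // mul1mx => ->.
Qed.

Lemma is_derive_inv (V : normedModType R) (f : V -> 'M[R]_m) (x v : V) :
  differentiable f x -> (\near x, G (f x)) ->
  differentiable (fun y => invmx (f y)) x /\
  'D_v (fun y => invmx (f y)) x = - (invmx (f x) *m 'D_v f x *m invmx (f x)).
Proof.
move=> df Gf; have Gx := nbhs_singleton Gf.
pose L := (mulmxr Q \o mulmx (invmx Q) \o trmx : 'M[R]_m -> 'M[R]_m).
have nL : \near x, L (f x) = invmx (f x) by apply: filterS Gf => y Gy; rewrite cgroup_inv.
have [dL _] := derive_linear_mx v (@mx_linear_continuous _ _ _ _ (mulmxr Q \o mulmx (invmx Q) \o trmx)) df.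
have [di _] := near_eq_diff nL dL.
split=> //.
have : 'D_v (fun y => invmx (f y) *m f y) x = 0.
  rewrite (@near_eq_derive _ _ _ _ (fun=> 1%:M)) ?derive_cst //.
  by apply: filterS Gf => y Gy; rewrite mulVmx // cgroupU.
rewrite derive_mulmx // => /eqP; rewrite addr_eq0 => /eqP.
move=> /(congr1 (mulmxr (invmx (f x)))) /=; rewrite mulmxK ?cgroupU // => ->.
by rewrite mulNmx.
Qed.

(** If the curve c in G has velocity Y at 1, then c^-1 X c stays in the Lie algebra and its
    derivative at time 0 is X Y - Y X. *)
Lemma lie_bracket X Y : g X -> g Y -> g (X *m Y - Y *m X).
Proof.
move=> gX [c [c0 cG dc]].
have dcd : differentiable c (0 : R) by apply/derivable1_diffP; case: dc.
have Gc : \forall t \near (0 : R), G (c t) by apply: filterE; exact: cG.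
have [di dI] := @is_derive_inv _ c (0 : R) (1 : R) dcd Gc.
have dcX : differentiable (fun t => invmx (c t) *m X) (0 : R).
  by apply: differentiable_mulmx => //; exact: differentiable_cst.
have := @lie_derive _ (fun t => invmx (c t) *m X *m c t) (0 : R) 1 (differentiable_mulmx dcX dcd).
have dX : differentiable (fun _ : R => X) (0 : R) by exact: differentiable_cst.
rewrite (derive_mulmx _ dcX dcd) (derive_mulmx _ di dX).
rewrite dI derive_cst mulmx0 addr0; have [_ ->] := dc.
rewrite c0 invmx1 !mul1mx !mulmx1 mulNmx addrC; apply.
by apply: filterE => t; exact: lieAd.
Qed.

End CompactGroup.

(** * The inner product controls the matrix norm on the Lie algebra *)

Section AdInvariantNorm.
Variables (R : realType) (m : nat) (G : set 'M[R]_m).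
Hypothesis hG : compact_group G.
Variable ip : 'M[R]_m -> 'M[R]_m -> R.
Hypothesis hip : Ad_invariant_inner_product G ip.

Let g := lie_algebra G.

Lemma ipP a X Y W : g X -> g Y -> g W -> ip (a *: X + Y) W = a * ip X W + ip Y W.
Proof. by case: hip => h _ _ _; exact: h. Qed.

Lemma ipC X Y : g X -> g Y -> ip X Y = ip Y X.
Proof. by case: hip => _ h _ _; exact: h. Qed.

Lemma ip0l W : g W -> ip 0 W = 0.
Proof.
move=> gW; have := ipP 1 (lie0 hG) (lie0 hG) gW.
by rewrite scaler0 addr0 mul1r => h; apply: (addrI (ip 0 W)); rewrite addr0 -h.
Qed.

Lemma ipZl a X W : g X -> g W -> ip (a *: X) W = a * ip X W.
Proof. by move=> gX gW; rewrite -[a *: X]addr0 ipP // ?ip0l ?addr0 //; exact: lie0. Qed.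

Lemma ip_ge0 X : g X -> 0 <= ip X X.
Proof.
case: hip => _ _ h _ gX; have [->|X0] := eqVneq X 0; first by rewrite ip0l //; exact: lie0.
exact/ltW/h.
Qed.

Lemma ip_suml (I : Type) (r : seq I) (a : I -> R) (F : I -> 'M[R]_m) W :
  (forall i, g (F i)) -> g W ->
  ip (\sum_(i <- r) a i *: F i) W = \sum_(i <- r) a i * ip (F i) W.
Proof.
move=> gF gW; elim: r => [|i r IH]; first by rewrite !big_nil ip0l.
by rewrite !big_cons ipP // ?IH //; apply: lie_sum => // j; exact: lieZ (gF j).
Qed.

(* A maximal orthonormal family in the Lie algebra is a basis of it.  Note that [ip] is only
   assumed to be an inner product on the Lie algebra. *)
Lemma ip_norm_bound : exists2 C, 0 <= C &
  forall X, g X -> `|X| <= C * Num.sqrt (ip X X).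
Proof.
pose P l := `[< exists f : 'I_l -> 'M[R]_m,
   (forall i, g (f i)) /\ forall i j, ip (f i) (f j) = (i == j)%:R >].
have P0 : exists l, P l.
  exists 0%N; apply/asboolP; exists (fun=> 0); split; by case.
have Pub l : P l -> (l <= m * m)%N.
  move=> /asboolP[f [gf of_]]; pose A := \matrix_(i < l) mxvec (f i).
  suff : row_free A by rewrite -row_leq_rank => /leq_trans; apply; exact: rank_leq_col.
  apply/inj_row_free => v vA.
  have {}vA : \sum_i v 0 i *: f i = 0.
    apply: (can_inj mxvecK); rewrite linear0 -vA linear_sum mulmx_sum_row.
    by apply: eq_bigr => i _; rewrite linearZ rowK.
  apply/rowP => i; rewrite mxE.
  have := ip_suml (index_enum _) (v 0) gf (gf i); rewrite vA ip0l // => ->.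
  rewrite (bigD1 i) //= of_ eqxx mulr1 big1 ?addr0 // => j ji.
  by rewrite of_ (negbTE ji) mulr0.
case: (ex_maxnP P0 Pub) => l /asboolP[f [gf of_]] lmax.
exists (\sum_i `|f i|); first exact: sumr_ge0.
move=> X gX; pose a i := ip X (f i).
pose Y := X - \sum_i a i *: f i.
have gS : g (\sum_i a i *: f i) by apply: lie_sum => // i; exact: lieZ (gf i).
have gY : g Y by exact: lieB.
have Yf j : ip Y (f j) = 0.
  rewrite /Y -scaleN1r addrC ipP // ip_suml //.
  rewrite (bigD1 j) //= of_ eqxx mulr1 big1 ?addr0; last first.
    by move=> i ij; rewrite of_ (negbTE ij) mulr0.
  by rewrite mulN1r addNr.
have Y0 : Y = 0.
  apply: contrapT => /eqP Y0.
  have Ypos : 0 < ip Y Y by case: hip => _ _ h _; exact: h.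
  pose c := (Num.sqrt (ip Y Y))^-1.
  have gcY : g (c *: Y) by exact: lieZ.
  have : P l.+1.
    apply/asboolP; exists (fun i => if unlift ord_max i is Some j then f j else c *: Y); split.
      by move=> i; case: unliftP => [j|] _.
    move=> i j; case: unliftP => [i'|] ->; case: unliftP => [j'|] ->.
    - by rewrite of_ (inj_eq lift_inj).
    - by rewrite ipC // ipZl // Yf mulr0 eq_sym (negbTE (neq_lift _ _)).
    - by rewrite ipZl // Yf mulr0 (negbTE (neq_lift _ _)).
    - rewrite ipZl // ipC // ipZl // eqxx mulrA -invfM -expr2 sqr_sqrtr ?ltW //.
      by rewrite mulVf // gt_eqF.
  by move=> /lmax; rewrite ltnn.
have XE : X = \sum_i a i *: f i by apply/eqP; rewrite -subr_eq0; apply/eqP.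
have ipX : ip X X = \sum_i a i ^+ 2.
  by rewrite {1}XE ip_suml //; apply: eq_bigr => i _; rewrite ipC // expr2.
have hX : `|X| <= \sum_i `|a i *: f i| by rewrite {1}XE ler_norm_sum.
apply: (le_trans hX); rewrite mulr_suml; apply: ler_sum => i _.
rewrite normrZ mulrC ler_wpM2l // ipX -sqrtr_sqr ler_wsqrtr //.
by rewrite (bigD1 i) //= lerDl sumr_ge0 // => j _; exact: sqr_ge0.
Qed.

End AdInvariantNorm.

(** * Equations p' = B p with B in the Lie algebra preserve G *)

Section Invariance.
Variables (R : realType) (m : nat) (G : set 'M[R]_m).
Hypothesis hG : compact_group G.

Let g := lie_algebra G.

(** The distance to G, zero only on G because G is closed. Invariance is read off a differential
    inequality for it, so neither an exponential map nor a submanifold structure on G enters. *)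
Definition gdist (A : 'M[R]_m) : R := inf [set `|A - h| | h in G].

Lemma gdist_le A h : G h -> gdist A <= `|A - h|.
Proof.
move=> Gh; apply: ge_inf; last by exists h.
by exists 0 => _ [k _ <-].
Qed.

Lemma gdist_ge0 A : 0 <= gdist A.
Proof.
apply: lb_le_inf; last by move=> _ [k _ <-].
by exists `|A - 1%:M|; exists 1%:M => //; exact: cgroup1.
Qed.

Lemma gdist_near A e : 0 < e -> exists2 h, G h & `|A - h| < gdist A + e.
Proof.
move=> e0.
have hi : has_inf [set `|A - h| | h in G].
  split; first by exists `|A - 1%:M|; exists 1%:M => //; exact: cgroup1.
  by exists 0 => _ [k _ <-].
have [_ [h Gh <-] hlt] := inf_adherent e0 hi.
by exists h.
Qed.

Lemma gdist_lip A A' : gdist A <= gdist A' + `|A - A'|.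
Proof.
apply/ler_addgt0Pr => e e0; have [h Gh hlt] := gdist_near A' e0.
apply: (le_trans (gdist_le A Gh)); rewrite -(subrKA A').
apply: (le_trans (ler_normD _ _)); lra.
Qed.

Lemma gdist0 A : gdist A = 0 -> G A.
Proof.
move=> d0; have := cgroup_closed hG; rewrite /closed => cl; apply: cl => U.
move=> /nbhs_ballP[e /= e0 eU]; have [h Gh hlt] := gdist_near A e0.
exists h; split=> //; apply: eU; rewrite -ball_normE /=; by rewrite d0 add0r in hlt.
Qed.

Lemma gdist_continuous : continuous gdist.
Proof.
move=> A; apply/(@cvgrPdist_le _ _ _ (nbhs (A : 'M[R]_m))) => e e0.
have : \forall B \near A, `|A - B| <= e.
  by have /cvgrPdist_le := @cvg_id _ (nbhs (A : 'M[R]_m)); exact.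
apply: filterS => B hB; rewrite ler_norml.
by have := gdist_lip A B; have := gdist_lip B A; rewrite (distrC B A); lra.
Qed.

Lemma is_derive_eps (V : normedModType R) (f : R -> V) (t : R) (df : V) (e : R) :
  is_derive t (1 : R) f df -> 0 < e ->
  \forall h \near (0 : R), `|f (t + h) - f t - h *: df| <= e * `|h|.
Proof.
move=> [hf <-] e0; have dd : differentiable f t by exact/derivable1_diffP.
apply: filterS (diff_eps dd e0) => h; apply: le_trans.
by rewrite -deriveE // -derive_scale // -[h *: 1]/(h * 1) mulr1.
Qed.

(** B is the velocity of a curve c in G. For k in G nearly closest to p t, the point c h k of G
    follows p to first order; the error comes from B acting on p t - k and from two remainders, each
    at most eta h / 2. *)
Lemma gdist_step (p : R -> 'M[R]_m) (B : 'M[R]_m) (b t eta : R) :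
  is_derive t (1 : R) p (B *m p t) -> g B -> `|B| <= b -> 0 < eta ->
  exists2 d, 0 < d & forall h, 0 < h < d ->
    gdist (p (t + h)) <= gdist (p t) + h * (m%:R * b * gdist (p t) + eta).
Proof.
move=> dp [c [c0 cG dc]] Bb eta0.
have [C C0 hC] := cgroup_bounded hG.
have K0 : 0 < 2 * (m%:R * C + 1) by rewrite mulr_gt0 // ltr_wpDl // mulr_ge0.
have e1 : 0 < eta / 2 by rewrite divr_gt0.
have e2 : 0 < eta / (2 * (m%:R * C + 1)) by rewrite divr_gt0.
have h1 := is_derive_eps dp e1; have h2 := is_derive_eps dc e2.
have h12 : \forall h \near (0 : R), `|p (t + h) - p t - h *: (B *m p t)| <= eta / 2 * `|h| /\
    `|c (0 + h) - c 0 - h *: B| <= eta / (2 * (m%:R * C + 1)) * `|h|.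
  by apply: filterS2 h1 h2.
have /nbhs_ballP[d /= d0 hd] := h12; exists d => // h /andP[h0 hlt].
have [] := hd h; first by rewrite -ball_normE /= sub0r normrN gtr0_norm.
rewrite (gtr0_norm h0) add0r c0 => {}h1 {}h2.
have b0 : 0 <= b by exact: le_trans Bb.
have key k : G k -> gdist (p (t + h)) <= (1 + h * (m%:R * b)) * `|p t - k| + h * eta.
  move=> Gk; apply: (le_trans (gdist_le _ (cgroupM hG (cG h) Gk))).
  have -> : p (t + h) - c h *m k = (p t - k) + h *: (B *m (p t - k))
      + (p (t + h) - p t - h *: (B *m p t)) - (c h - 1%:M - h *: B) *m k.
    rewrite mulmxBr scalerBr !mulmxBl mul1mx -scalemxAl.
    by apply/matrixP => i j; rewrite !mxE; ring.
  apply: (le_trans (ler_normB _ _)).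
  have hk : `|(c h - 1%:M - h *: B) *m k| <= h * (eta / 2).
    apply: (le_trans (mulmx_norm_le _ _)).
    have := hC k Gk => hCk.
    apply: (@le_trans _ _ (m%:R * (eta / (2 * (m%:R * C + 1)) * h) * C)).
      by apply: ler_pM; rewrite ?mulr_ge0 // ler_wpM2l.
    have -> : m%:R * (eta / (2 * (m%:R * C + 1)) * h) * C =
        h * (eta / 2) * (m%:R * C / (m%:R * C + 1)).
      by field; rewrite gt_eqF // ltr_wpDl // mulr_ge0.
    rewrite ler_piMr ?mulr_ge0 ?divr_ge0 // ?ltW // ltr_pdivrMr ?mul1r ?ltrDl //.
    by rewrite ltr_wpDl // mulr_ge0.
  apply: (le_trans (lerD (ler_normD _ _) hk)).
  have hB : `|h *: (B *m (p t - k))| <= h * (m%:R * b) * `|p t - k|.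
    rewrite normrZ gtr0_norm // -mulrA; apply: ler_wpM2l; first exact: ltW.
    apply: (le_trans (mulmx_norm_le _ _)); apply: ler_wpM2r => //.
    by rewrite ler_wpM2l.
  have := ler_normD (p t - k) (h *: (B *m (p t - k))).
  lra.
have bh : 0 < 1 + h * (m%:R * b) by rewrite ltr_pwDl // !mulr_ge0 // ltW.
apply/ler_addgt0Pr => e e0.
have e' : 0 < e / (1 + h * (m%:R * b)) by rewrite divr_gt0.
have [k Gk hk] := gdist_near (p t) e'.
apply: (le_trans (key k Gk)).
have : (1 + h * (m%:R * b)) * `|p t - k| <= (1 + h * (m%:R * b)) * (gdist (p t) + e / (1 + h * (m%:R * b))).
  by rewrite ler_wpM2l // ltW.
rewrite mulrDr [_ * (e / _)]mulrC divfK ?gt_eqF //; lra.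
Qed.

(* If the distance to G were positive at t1, it would cross some line [e * t]
   upwards, against [gdist_step]. *)
Lemma group_forward (p B : R -> 'M[R]_m) (b T : R) :
  continuous p -> G (p 0) -> T <= 2 ->
  (forall t : R, 0 <= t < T -> is_derive t 1 p (B t *m p t)) ->
  (forall t : R, 0 <= t < T -> g (B t) /\ `|B t| <= b) -> m%:R * b * 4 <= 1 ->
  forall t : R, 0 <= t < T -> G (p t).
Proof.
move=> pc p0 T2 dp hB mb t1 /andP[t10 t1T].
apply: gdist0; apply/eqP; rewrite -[_ == _]negbK; apply/negP => d1.
have {}d1 : 0 < gdist (p t1) by rewrite lt_neqAle eq_sym d1 gdist_ge0.
have d00 : gdist (p 0) = 0.
  by apply/eqP; rewrite eq_le gdist_ge0 andbT (le_trans (gdist_le _ p0)) // subrr normr0.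
have t10' : 0 < t1.
  by rewrite lt_neqAle t10 andbT eq_sym; apply/eqP => e; rewrite e d00 ltxx in d1.
pose ep := gdist (p t1) / (2 * t1).
have ep0 : 0 < ep by rewrite divr_gt0 // mulr_gt0.
pose phi s := gdist (p s) - ep * s.
have phic : continuous phi.
  move=> s; apply: (@continuousB _ _ _ (gdist \o p) (fun s => ep * s)).
    by apply: (@continuous_comp _ _ _ p gdist); [exact: pc|exact: gdist_continuous].
  exact: (@scaler_continuous _ R ep).
(* The maximum t0 of [K] is the last time up to t1 with distance at most ep * t. It comes before t1,
   because ep * t1 is half the distance at t1. *)
pose K := [set s : R | 0 <= s <= t1 /\ phi s <= 0].
have cK : compact K.
  have -> : K = `[0, t1]%classic `&` (phi @^-1` [set x | x <= 0]).
    by apply/seteqP; split=> s /=; rewrite in_itv.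
  apply: compact_closedI; first exact: segment_compact.
  by apply: closed_comp; [move=> s _; exact: phic|exact: closed_le].
have K0 : K !=set0.
  by exists 0; split; [rewrite lexx ltW|rewrite /phi d00 mulr0 subr0].
have idc : {within K, continuous (@id R)} by apply: continuous_subspaceT => s; exact: cvg_id.
have [t0] := compact_EVT_max K0 cK idc; rewrite inE => -[/andP[t00 t01] f0] tmax.
have t0t1 : t0 < t1.
  rewrite lt_neqAle t01 andbT; apply/eqP => e; move: f0; rewrite e /phi /ep.
  have -> : gdist (p t1) / (2 * t1) * t1 = gdist (p t1) / 2 by field; rewrite gt_eqF.
  lra.
have t0T : 0 <= t0 < T by rewrite t00 (lt_trans t0t1).
have [gB Bb] := hB _ t0T.
have e20 : 0 < ep / 2 by rewrite divr_gt0.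
have [d dd hd] := gdist_step (dp _ t0T) gB Bb e20.
pose h := Num.min (d / 2) ((t1 - t0) / 2).
have h0 : 0 < h by rewrite lt_min !divr_gt0 // subr_gt0.
have hdl : h < d by rewrite /h gt_min; apply/orP; left; lra.
have htl : h <= t1 - t0 by rewrite /h ge_min; apply/orP; right; lra.
have {}hd := hd h; rewrite h0 hdl in hd; have {}hd := hd isT.
have b0 : 0 <= b by exact: le_trans Bb.
have : K (t0 + h).
  split; first by apply/andP; split; lra.
  rewrite /phi; rewrite /phi in f0.
  have g0 := gdist_ge0 (p t0).
  (* At t0 the distance is at most ep * t0 <= 2 ep, and m b <= 1/4, so it grows at rate at most ep /
     2; with eta = ep / 2 the total slope is at most ep, and t0 + h still belongs to [K]. *)
  have : m%:R * b * gdist (p t0) <= 4^-1 * (ep * 2).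
    apply: ler_pM; rewrite ?mulr_ge0 //; first by lra.
    have : ep * t0 <= ep * 2 by rewrite ler_wpM2l ?ltW //; lra.
    lra.
  move=> hb; have : h * (m%:R * b * gdist (p t0) + ep / 2) <= h * ep by apply: ler_wpM2l; [exact: ltW|lra].
  lra.
by move=> Kt; have := tmax (t0 + h); rewrite inE => /(_ Kt) /=; lra.
Qed.

Lemma group_ode (B y : R -> 'M[R]_m) (b : R) :
  ode_solution B B y -> (forall t, g (B t)) -> (forall t, `|B t| <= b) ->
  m%:R * b * 4 <= 1 -> forall t : R, -1 < t < 2 -> G (1%:M + y t).
Proof.
move=> [y0 yc _ dy] gB Bb mb.
have pc : continuous (fun t => 1%:M + y t).
  by move=> t; apply: (@continuousD _ _ _ (fun=> 1%:M) y); [exact: cst_continuous|exact: yc].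
have p0 : G (1%:M + y 0) by rewrite y0 addr0; exact: cgroup1.
have dp (t : R) : -1 < t < 2 -> is_derive t (1 : R) (fun t => 1%:M + y t) (B t *m (1%:M + y t)).
  move=> t12; have := is_deriveD (is_derive_cst 1%:M t (1 : R)) (dy t t12).
  by rewrite add0r mulmxDr mulmx1 [B t + _]addrC.
move=> t /andP[h1 h2]; have [t0|t0] := leP 0 t.
  apply: (@group_forward _ B b 2 pc p0) => //.
  - by move=> s /andP[s0 s2]; apply: dp; apply/andP; split; lra.
  - by rewrite t0.
(* Negative times are reached by reversing time, with horizon 1 in place of 2. *)
have fw := @group_forward (fun s => 1%:M + y (- s)) (fun s => - B (- s)) b 1.
rewrite -[t]opprK; apply: fw; [|by rewrite oppr0|lra| | |exact: mb|].
- by move=> s; apply: (@continuous_comp _ _ _ (@GRing.opp R) (fun t => 1%:M + y t));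
    [exact: oppr_continuous|exact: pc].
- move=> s /andP[s0 s1].
  have ds : is_derive (- s) (1 : R) (fun t => 1%:M + y t) (B (- s) *m (1%:M + y (- s))).
    by apply: dp; apply/andP; split; lra.
  have dn : is_diff s (-%R : R -> R) (-%R : R -> R).
    by apply: is_diff_eq.
  have d1 : differentiable (fun t => 1%:M + y t) (- s) by apply/derivable1_diffP; case: ds.
  have dns : differentiable (-%R : R -> R) s by [].
  split; first exact/derivable1_diffP/(@differentiable_comp _ _ _ _ (-%R : R -> R) (fun t => 1%:M + y t)).
  rewrite -[LHS]/('D_1 ((fun t => 1%:M + y t) \o (-%R : R -> R)) s) derive_comp //.
  have -> : 'D_1 (-%R : R -> R) s = -1 *: (1 : R) by rewrite (deriveE _ dns) diff_val scaleN1r.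
  by rewrite (derive_scale _ _ d1) scaleN1r mulNmx; have [_ ->] := ds.
- by move=> s _; split; [exact: (lieN (gB (- s)))|rewrite normrN; exact: Bb].
- by apply/andP; split; lra.
Qed.

End Invariance.

(** * Transport along short segments and radial limits *)

Section CovariantSymbols.
Variables (R : realType) (n : nat).
Implicit Types (D : set 'rV[R]_n).

Lemma symbol_time md k D (f : R -> R) C : away0 md D -> continuous f ->
  (forall t, `|f t| <= C) -> symbol md k 0 D (fun t _ => f t).
Proof.
move=> D0 fc fC; have C0 : 0 <= C by exact: le_trans (fC 0).
have c0 : symbol0 md 0 D (fun t _ => f t).
  split=> [t x _|t x _|md0|_ x _]; [exact: cst_continuous|exact: fc| |].
  - by exists C => // t x _; rewrite powRr0 mulr1.
  - by exists 0 => //; apply: (@filterE _ (nbhs (0 : 'rV[R]_n))) => v t; rewrite subrr normr0 mul0r.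
case: k => [|k]; first by split.
split=> //; split=> [t x _|v]; first exact: differentiable_cst.
suff -> : (fun t : R => 'D_v (fun _ : 'rV[R]_n => f t)) = (fun _ _ => 0) by exact: symbol_zero.
by apply/funext => t; apply/funext => x; exact: derive_cst.
Qed.

Lemma symbol_lower1 k lam lam' D f : away0 1 D -> (forall x, D x -> enorm x <= 1) ->
  lam' <= lam -> symbol 1 k lam D f -> symbol 1 k lam' D f.
Proof. by move=> D0 D1; apply: symbol_le. Qed.

(* [f \o U - f \o Phi] gains one order when U - Phi vanishes to second order. *)
Lemma symbol_comp_diff k lam (U : {linear 'rV[R]_n -> 'rV[R]_n}) (Phi : 'rV[R]_n -> 'rV[R]_n)
    D D' (f : 'rV[R]_n -> R) (a c : R) : open D -> away0 1 D ->
  0 < a -> 0 < c ->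
  (forall t x, 0 <= t <= 1 -> D x ->
     D' (Phi x + t *: (U x - Phi x)) /\
     a * enorm x <= enorm (Phi x + t *: (U x - Phi x)) <= c * enorm x) ->
  (forall b, symbol 1 k 1 D (fun _ x => Phi x 0 b)) ->
  (forall b, symbol 1 k 2 D (fun _ x => (U x - Phi x) 0 b)) ->
  symbol 1 k.+1 lam D' (fun=> f) ->
  symbol 1 k (lam + 1) D (fun _ x => f (U x) - f (Phi x)).
Proof.
move=> oD D0 a0 c0 seg.
have eU x : U x = Phi x + 1 *: (U x - Phi x) by rewrite scale1r addrC subrK.
have eP x : Phi x = Phi x + 0 *: (U x - Phi x) by rewrite scale0r addr0.
have DU x : D x -> D' (U x) /\ a * enorm x <= enorm (U x) <= c * enorm x.
  by move=> Dx; rewrite eU; apply: seg => //; rewrite lexx ler01.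
have DP x : D x -> D' (Phi x) /\ a * enorm x <= enorm (Phi x) <= c * enorm x.
  by move=> Dx; rewrite eP; apply: seg => //; rewrite lexx ler01.
have Uc b k' : symbol 1 k' 1 D (fun _ x => U x 0 b).
  have -> : (fun (_ : R) x => U x 0 b) =
      (fun (_ : R) (x : 'rV[R]_n) => \sum_(l < n) (U (delta_mx 0 l) 0 b) * x 0 l).
    apply/funext => _; apply/funext => x; rewrite {1}(row_sum_delta x) linear_sum summxE.
    by apply: eq_bigr => l _; rewrite linearZ mxE mulrC.
  by apply: symbol_sum => // l; apply: symbol_scale => //; exact: symbol_coord.
elim: k lam f => [|k IH] lam f hP hw hf.
all: have f0 : symbol0 1 (lam + 1) D (fun _ x => f (U x) - f (Phi x)).
1,3: have df y : D' y -> differentiable f y by move=> Dy; exact: (symbol_diff hf 0).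
1,2: have hU : symbol 1 0 lam D (fun _ x => f (U x)).
1,3: apply: (@symbol_comp _ _ _ _ _ _ D D' f (fun=> U)) => //;
  [by move=> t x /DU[] |by exists a, c; split=> // t x /DU[]|exact: symbol_leq hf].
1,2: have hP0 d : symbol 1 0 1 D (fun _ x => Phi x 0 d) by exact: symbol_leq (hP d).
1,2: have hPhi : symbol 1 0 lam D (fun _ x => f (Phi x)).
1,3: apply: (@symbol_comp _ _ _ _ _ _ D D' f (fun=> Phi)) => //;
  [by move=> t x /DP[] |by exists a, c; split=> // t x /DP[]|exact: symbol_leq hf].
1,2: have [s1 s2 _ _] := symbol_symbol0 (symbol_sub2 oD D0 hU hPhi).
1,2: split=> // _.
1,2: have /choice[K hK] : forall b, exists K : R, 0 <= K /\ forall y, D' y ->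
    `|'D_(delta_mx 0 b) f y| <= K * enorm y `^ (lam - 1)
  by move=> b; have [_ _ /(_ isT)[K K0 hK] _] := symbol_symbol0 (symbol_derive (delta_mx 0 b) hf);
    exists K; split=> // y; exact: (hK 0).
1,2: have [W W0 hW] := msymbol_bound (F := fun _ x => U x - Phi x) (isT : (0 < 1)%N)
  (fun i j => let e := ord1 i in eq_ind_r (fun i => symbol 1 0 2 D (fun _ x => (U x - Phi x) i j)) (symbol_leq (leq0n _) (hw j)) e).
1,2: have S0 : 0 <= \sum_b K b by apply: sumr_ge0 => b _; have [] := hK b.
1,2: set A := a `^ (lam - 1) + c `^ (lam - 1).
1,2: have A0 : 0 <= A by rewrite addr_ge0 ?powR_ge0.
1,2: exists (n%:R * ((\sum_b K b) * A) * W); first by rewrite !mulr_ge0.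
1,2: move=> _ x Dx; have x0 := D0 isT x Dx.
1,2: have {1}-> : U x = Phi x + (U x - Phi x) by rewrite addrC subrK.
1,2: have -> : lam + 1 = (lam - 1) + 2 by ring.
1,2: rewrite powRD ?(gt_eqF x0) ?implybT //.

1,2: apply: (@le_trans _ _ (n%:R * ((\sum_b K b) * A * enorm x `^ (lam - 1)) * (W * enorm x `^ 2)));
  last by rewrite le_eqVlt; apply/orP; left; apply/eqP; ring.
1,2: apply: (@le_trans _ _ (n%:R * ((\sum_b K b) * A * enorm x `^ (lam - 1)) * `|U x - Phi x|));
  last by apply: ler_wpM2l; [rewrite !mulr_ge0 ?powR_ge0|exact: (hW 0)].
1,2: apply: mvt_segment => s s01; have [Ds /andP[e1 e2]] := seg s x s01 Dx; first exact: df.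
1,2: apply: derive_bound; first exact: df.
1,2: move=> b; have [Kb0 hb] := hK b; apply: (le_trans (hb _ Ds)); rewrite -mulrA; apply: ler_pM => //;
  first exact: powR_ge0.
1,3: by rewrite (bigD1 b) //= lerDl sumr_ge0 // => d _; have [] := hK d.
1,2: rewrite mulrDl -(powRM _ (ltW a0) (ltW x0)) -(powRM _ (ltW c0) (ltW x0)).
1,2: by apply: powR_le_add => //; exact: mulr_gt0.
- by split.
have dP x : D x -> differentiable Phi x.
  by move=> Dx; apply: differentiable_mx => i j; rewrite ord1; exact: (symbol_diff (hP j) 0).
have dU x : differentiable U x by apply: linear_differentiable; exact: linear_rV_continuous.
have df y : D' y -> differentiable f y by move=> Dy; exact: (symbol_diff hf 0).
have dw x : D x -> differentiable (fun x => U x - Phi x) x.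
  by move=> Dx; apply: differentiableB; [exact: dU|exact: dP].
apply: symbolS => //.
  move=> _ x Dx; apply: (@differentiableB _ _ _ (f \o U) (f \o Phi)).
    by apply: differentiable_comp; [exact: dU|apply: df; have [] := DU x Dx].
  by apply: differentiable_comp; [exact: dP|apply: df; have [] := DP x Dx].
move=> b.
(* The constant matrix of U is split off: what remains is the same difference for D_l f, of rate
   (lam - 1) + 1 by induction, and D_l f along Phi times a derivative of U - Phi, of rate (lam - 1)
   + (2 - 1). *)
apply: (@symbol_eq _ _ _ _ _ _ (fun _ x => \sum_l
    ((U (delta_mx 0 b) 0 l) * ('D_(delta_mx 0 l) f (U x) - 'D_(delta_mx 0 l) f (Phi x)) +
     'D_(delta_mx 0 l) f (Phi x) * 'D_(delta_mx 0 b) (fun x => (U x - Phi x) 0 l) x))) => //.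
  move=> _ x Dx.
  have dfU : differentiable f (U x) by apply: df; have [] := DU x Dx.
  have dfP : differentiable f (Phi x) by apply: df; have [] := DP x Dx.
  have dPx := dP x Dx.
  have dcU : differentiable (f \o U) x by apply: differentiable_comp.
  have dcP : differentiable (f \o Phi) x by apply: differentiable_comp.
  rewrite -[RHS]/('D_(delta_mx 0 b) ((f \o U) \- (f \o Phi)) x).
  rewrite deriveB; [|exact: diff_derivable|exact: diff_derivable].
  rewrite (derive_comp _ (dU x) dfU) (derive_comp _ dPx dfP).
  rewrite (derive_basis _ dfU) (derive_basis _ dfP) -sumrB; apply: eq_bigr => l _.
  have -> : 'D_(delta_mx 0 b) U x = U (delta_mx 0 b).
    by rewrite deriveE // diff_lin //; exact: linear_rV_continuous.
  have -> : 'D_(delta_mx 0 b) (fun x => (U x - Phi x) 0 l) x = U (delta_mx 0 b) 0 l - 'D_(delta_mx 0 b) Phi x 0 l.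
    rewrite -derive_entry; last exact: dw.
    rewrite deriveB; [|exact: diff_derivable|exact: diff_derivable].
    rewrite !mxE; congr (_ - _).
    by rewrite deriveE // diff_lin //; exact: linear_rV_continuous.
  by rewrite /GRing.scale /=; ring.
rewrite addrK; apply: symbol_sum => // l; apply: symbol_add => //.
  apply: symbol_scale => //; rewrite -[lam](subrK 1).
  apply: (IH (lam - 1) (fun y => 'D_(delta_mx 0 l) f y)).
  - by move=> d; exact: symbol_pred.
  - by move=> d; exact: symbol_pred.
  - exact: (symbol_derive _ hf).
rewrite (_ : lam = (lam - 1) + (2 - 1)); last by ring.
apply: symbol_mul => //; last exact: symbol_derive.
apply: (@symbol_comp _ _ _ _ _ _ D D' (fun y => 'D_(delta_mx 0 l) f y) (fun=> Phi)) => //.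
- by move=> t x /DP[].
- by exists a, c; split=> // t x /DP[].
- by move=> d; exact: symbol_pred.
- exact: symbol_pred (symbol_derive (delta_mx 0 l) hf).
Qed.

Variable m : nat.
Implicit Types (A B : 'rV[R]_n -> 'rV[R]_n -> 'M[R]_m) (s : 'rV[R]_n -> 'M[R]_m).

Lemma cov_eq D A B v s s' : open D -> (forall x, D x -> s x = s' x) ->
  forall x, D x -> cov B A v s x = cov B A v s' x.
Proof.
move=> oD ss x Dx; rewrite /cov (ss x Dx).
suff -> : 'D_v s x = 'D_v s' x by [].
by apply: near_eq_derive; exact: (open_near oD Dx ss).
Qed.

Lemma ncov_eq D A B I s s' : open D -> (forall x, D x -> s x = s' x) ->
  forall x, D x -> ncov B A I s x = ncov B A I s' x.
Proof. by move=> oD ss; elim: I => [|b I IH] //=; exact: cov_eq. Qed.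

Lemma ncov_rcons A B I b s :
  ncov B A (rcons I b) s = ncov B A I (cov B A (delta_mx 0 b) s).
Proof. by rewrite /ncov foldr_rcons. Qed.

Lemma cov_symbol D A B lam k b s : open D -> away0 1 D ->
  (forall k, msymbol 1 k (-1) D (fun _ x => A x (delta_mx 0 b))) ->
  (forall k, msymbol 1 k (-1) D (fun _ x => B x (delta_mx 0 b))) ->
  msymbol 1 k.+1 lam D (fun=> s) ->
  msymbol 1 k (lam - 1) D (fun=> cov B A (delta_mx 0 b) s).
Proof.
move=> oD D0 hA hB hs; have hs' := msymbol_leq (leqnSn k) hs.
rewrite /cov; apply: msymbol_sub => //.
  apply: msymbol_add => //; first exact: msymbol_derive.
  by rewrite addrC; exact: (msymbol_mul oD D0 (hB k) hs').
exact: (msymbol_mul oD D0 hs' (hA k)).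
Qed.

Lemma ncov_symbol D A B lam k I s : open D -> away0 1 D ->
  (forall b k, msymbol 1 k (-1) D (fun _ x => A x (delta_mx 0 b))) ->
  (forall b k, msymbol 1 k (-1) D (fun _ x => B x (delta_mx 0 b))) ->
  (forall k, msymbol 1 k lam D (fun=> s)) ->
  msymbol 1 k (lam - (size I)%:R) D (fun=> ncov B A I s).
Proof.
move=> oD D0 hA hB hs; elim: I k => [|b I IH] k /=; first by rewrite subr0.
rewrite -(addn1 (size I)) natrD opprD addrA.
by apply: cov_symbol.
Qed.

(* Conversely, bounds on covariant derivatives are bounds on derivatives. *)
Lemma symbol_of_ncov D A lam k s : open D -> away0 1 D ->
  (forall b k, msymbol 1 k (-1) D (fun _ x => A x (delta_mx 0 b))) ->
  (forall k, msymbol 0 k 0 D (fun=> s)) ->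
  (forall I, (size I <= k)%N -> exists2 K, 0 <= K & forall x, D x ->
     `|ncov A A I s x| <= K * enorm x `^ (lam - (size I)%:R)) ->
  msymbol 1 k lam D (fun=> s).
Proof.
move=> oD D0 hA; elim: k lam s => [|k IH] lam s hs hI.
all: have s0 : msymbol 1 0 lam D (fun=> s).
1,3: have [K K0 hK] := hI [::] isT; apply: (@msymbol0P _ _ _ _ _ _ _ K) => //;
  last by move=> x Dx; have := hK x Dx; rewrite subr0.
1,2: by move=> x Dx; apply: continuous_mx => i j; have [h _ _ _] := symbol_symbol0 (hs 0 i j); exact: (h 0).
- by [].
have sk : msymbol 1 k lam D (fun=> s) by apply: IH => // I hk; apply: hI; exact: leqW.
have ds x : D x -> differentiable s x by move=> Dx; exact: (msymbol_diff (hs 1%N) 0).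
apply: msymbolS => // b.
(* The induction hypothesis is applied to the covariant derivative of s in direction b, whose
   iterated covariant derivatives are those of s with b as innermost index. *)
have hc : msymbol 1 k (lam - 1) D (fun=> cov A A (delta_mx 0 b) s).
  apply: IH => [k'|I hk].
    rewrite /cov; apply: msymbol_sub => //.
      apply: msymbol_add => //.
        by move=> i j; apply: (@symbol_any _ _ _ (0 - 1)); exact: (msymbol_derive _ oD (hs k'.+1)).
      move=> i j; apply: (@symbol_any _ _ _ (-1 + 0)).
      apply: (msymbol_mul oD _ _ (hs k') i j) => //.
      by move=> i' j'; exact: (symbol_mode _ (hA b k' i' j')).
    move=> i j; apply: (@symbol_any _ _ _ (0 + -1)).
    apply: (msymbol_mul oD _ (hs k') _ i j) => //.
    by move=> i' j'; exact: (symbol_mode _ (hA b k' i' j')).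
  have [|K K0 hK] := hI (rcons I b); first by rewrite size_rcons.
  exists K => // x Dx; have := hK x Dx; rewrite ncov_rcons size_rcons.
  by rewrite -(addn1 (size I)) natrD opprD addrCA addrC.
apply: (@msymbol_eq _ _ _ _ _ _ _ _ (fun _ x => cov A A (delta_mx 0 b) s x -
   (A x (delta_mx 0 b) *m s x - s x *m A x (delta_mx 0 b)))) => //.
  by move=> _ x Dx; rewrite /cov; apply/matrixP => i j; rewrite !mxE; ring.
apply: msymbol_sub => //; apply: msymbol_sub => //.
  by rewrite addrC; exact: (msymbol_mul oD D0 (hA b k) sk).
exact: (msymbol_mul oD D0 sk (hA b k)).
Qed.

End CovariantSymbols.

Lemma symbol_slice (R : realType) n k lam (D : set 'rV[R]_n) f (s : R) :
  symbol 1 k lam D f -> symbol 1 k lam D (fun _ => f s).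
Proof.
elim: k lam f => [|k IH] lam f fk.
all: have [h1 h2 h3 _] := symbol_symbol0 fk.
all: have f0 : symbol0 1 lam D (fun _ => f s).
1,3: split=> // [t x Dx|t x _|_]; [exact: h1|exact: cst_continuous|].
1,2: by have [K K0 hK] := h3 isT; exists K => // t x Dx; exact: hK.
- by [].
split=> //; split=> [t x Dx|v]; first exact: (symbol_diff fk).
exact: (IH _ _ (symbol_derive v fk)).
Qed.

(** * The framing change followed by parallel transport *)

Section Transport.
Variables (R : realType) (n m : nat).
Variables (D D' : set 'rV[R]_n) (U : {linear 'rV[R]_n -> 'rV[R]_n}) (Phi : 'rV[R]_n -> 'rV[R]_n).
Variable B : 'rV[R]_n -> 'rV[R]_n -> 'M[R]_m.
Variables (a c : R).
Hypotheses (oD : open D) (D0 : away0 1 D) (D1 : forall x, D x -> enorm x <= 1).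
Hypotheses (oD' : open D') (D0' : away0 1 D') (D1' : forall x, D' x -> enorm x <= 1).
Hypotheses (a0 : 0 < a) (c0 : 0 < c).
Hypothesis seg : forall t x, -1 <= t <= 2 -> D x ->
  D' (Phi x + t *: (U x - Phi x)) /\
  a * enorm x <= enorm (Phi x + t *: (U x - Phi x)) <= c * enorm x.
Hypothesis hP : forall b k, symbol 1 k 1 D (fun _ x => Phi x 0 b).
Hypothesis hw : forall b k, symbol 1 k 2 D (fun _ x => (U x - Phi x) 0 b).
Hypothesis hB : forall b k, msymbol 1 k (-1) D' (fun _ x => B x (delta_mx 0 b)).
Hypothesis linB : forall x v, D' x -> B x v = \sum_b v 0 b *: B x (delta_mx 0 b).

(* The potential along the segment from Phi x to U x; the clamp makes it global in t. *)
Definition segment_potential t x : 'M[R]_m :=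
  - B (Phi x + clamp t *: (U x - Phi x)) (U x - Phi x).

(** The rate is 2 + (-1): the direction U x - Phi x of the segment is O(r^2) and the potential along
    it is O(r^-1). *)
Lemma segment_potential_symbol k : msymbol 1 k 1 D segment_potential.
Proof.
have hcc b k' : symbol 1 k' 1 D (fun t x => (Phi x + clamp t *: (U x - Phi x)) 0 b).
  have h2 : symbol 1 k' 1 D (fun t x => clamp t * (U x - Phi x) 0 b).
    rewrite -(add0r 1); apply: symbol_mul => //.
      apply: (@symbol_time _ _ _ _ _ _ 2) => //; first exact: clamp_continuous.
      by move=> t; have /andP[h1 h2] := clamp_itv t; rewrite ler_norml; apply/andP; split; lra.
    by apply: (@symbol_lower1 _ _ _ 2) => //; lra.
  by apply: symbol_eq (symbol_add oD (hP b k') h2) => // t x _; rewrite !mxE.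
apply: (@msymbol_eq _ _ _ _ _ _ _ _ (fun t x =>
  - \sum_b (U x - Phi x) 0 b *: B (Phi x + clamp t *: (U x - Phi x)) (delta_mx 0 b))) => //.
  move=> t x Dx; rewrite /segment_potential linB //.
  by have [] := seg (clamp_itv t) Dx.
apply: msymbol_opp => //; apply: msymbol_sum => // b.
rewrite (_ : 1 = 2 + -1 :> R); last by ring.
apply: msymbol_scale => // i j.
apply: (@symbol_comp _ _ _ _ _ _ D D' (fun y => B y (delta_mx 0 b) i j)
  (fun t x => Phi x + clamp t *: (U x - Phi x))) => //.
- by move=> t x Dx; have [] := seg (clamp_itv t) Dx.
- by move=> _; exists a, c; split=> // t x Dx; have [] := seg (clamp_itv t) Dx.
- exact: hB.
Qed.

Lemma segment_potential_small e : 0 < e ->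
  exists2 d, 0 < d & forall t x, D x -> enorm x < d -> `|segment_potential t x| <= e.
Proof.
move=> e0; have [K K0 hK] := msymbol_bound (isT : (0 < 1)%N) (segment_potential_symbol 0).
exists (e / (K + 1)); first by rewrite divr_gt0 // ltr_wpDl.
move=> t x Dx xd; apply: (le_trans (hK t x Dx)); rewrite powRr1 ?enorm_ge0 //.
apply: (@le_trans _ _ ((K + 1) * enorm x)).
  by apply: ler_wpM2r; rewrite ?enorm_ge0 // lerDl.
by rewrite mulrC -ler_pdivlMr ?ltr_wpDl // ltW.
Qed.

Variable bb : R.
Hypotheses (Bb : forall t x, D x -> `|segment_potential t x| <= bb) (mb : m%:R * bb * 4 <= 1).

Lemma transport_exists : exists y : R -> 'rV[R]_n -> 'M[R]_m, forall x, D x ->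
  ode_solution (segment_potential^~ x) (segment_potential^~ x) (y^~ x).
Proof.
have /choice[z hz] : forall x, exists z, D x ->
    ode_solution (segment_potential^~ x) (segment_potential^~ x) z.
  move=> x; have [Dx|nDx] := pselect (D x); last by exists (fun=> 0).
  have cB : continuous (segment_potential^~ x).
    move=> t; apply: continuous_mx => i j.
    by have [_ h _ _] := symbol_symbol0 (segment_potential_symbol 0 i j); exact: h.
  have [] := @ode_exists _ _ _ (segment_potential^~ x) (segment_potential^~ x) bb bb cB cB.
  - by move=> t; exact: Bb.
  - exact: mb.
  - by apply: le_trans (Bb 0 Dx).
  - by move=> t; exact: Bb.
  by move=> z hz; exists z.
by exists (fun t x => z x t).
Qed.

Lemma transport_symbol (y : R -> 'rV[R]_n -> 'M[R]_m) k :
  (forall x, D x -> ode_solution (segment_potential^~ x) (segment_potential^~ x) (y^~ x)) ->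
  msymbol 1 k 1 D y.
Proof.
move=> hy i j; apply: (@symbol_mode _ _ 2) => //; move: i j.
have h2 k' : msymbol 2 k' 1 D segment_potential.
  by move=> i j; apply: symbol_calm => //; exact: segment_potential_symbol.
by apply: (param_symbol (B := segment_potential) oD _ D1 h2 Bb mb (h2 k) hy) => _; exact: D0.
Qed.

Variables (mu : R) (A : 'rV[R]_n -> 'rV[R]_n -> 'M[R]_m) (a1 a2 : 'I_n -> 'rV[R]_n -> 'M[R]_m).
Variable h : 'rV[R]_n -> 'M[R]_m.
Variable y : R -> 'rV[R]_n -> 'M[R]_m.
Hypotheses (mu1 : -1 < mu) (mu0 : mu < 0).
Hypothesis hA : forall b k, msymbol 1 k (-1) D (fun _ x => A x (delta_mx 0 b)).
Hypothesis ha1 : forall b k, msymbol 1 k mu D (fun=> a1 b).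
Hypothesis ha2 : forall b k, msymbol 1 k mu D' (fun=> a2 b).
Hypothesis dh : forall x, D x -> differentiable h x.
Variable Ch : R.
Hypothesis hbound : forall x, D x -> `|h x| <= Ch.
Hypothesis hderive : forall b x, D x ->
  'D_(delta_mx 0 b) h x = h x *m (A x (delta_mx 0 b) + a1 b x)
    - (\sum_l ('D_(delta_mx 0 b) Phi x) 0 l *: (B (Phi x) (delta_mx 0 l) + a2 l (Phi x))) *m h x.
Hypothesis hy : forall x, D x ->
  ode_solution (segment_potential^~ x) (segment_potential^~ x) (y^~ x).

Let seg0 x : D x -> D' (Phi x) /\ a * enorm x <= enorm (Phi x) <= c * enorm x.
Proof.
move=> Dx; have := @seg 0 x; rewrite scale0r addr0; apply=> //; apply/andP; split; lra.
Qed.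

Let seg1 x : D x -> D' (U x) /\ a * enorm x <= enorm (U x) <= c * enorm x.
Proof.
move=> Dx; have := @seg 1 x; rewrite scale1r addrC subrK; apply=> //; apply/andP; split; lra.
Qed.

Let comp_symbol k lam (f : 'rV[R]_n -> 'M[R]_m) : msymbol 1 k lam D' (fun=> f) ->
  msymbol 1 k lam D (fun _ x => f (Phi x)).
Proof.
move=> hf i j; apply: (@symbol_comp _ _ _ _ _ _ D D' (fun y => f y i j) (fun=> Phi)) => //.
- by move=> t x /seg0[].
- by move=> _; exists a, c; split=> // t x /seg0[].
Qed.

Let dPsym b l k : symbol 1 k 0 D (fun _ x => ('D_(delta_mx 0 b) Phi x) 0 l).
Proof.
rewrite -(subrr 1); apply: (@msymbol_derive _ _ _ _ _ _ _ _ (fun=> Phi)) => // i j.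
by rewrite ord1; exact: hP.
Qed.

Let lower k lam lam' p q (F : R -> 'rV[R]_n -> 'M[R]_(p, q)) : lam' <= lam ->
  msymbol 1 k lam D F -> msymbol 1 k lam' D F.
Proof. by move=> ll; apply: msymbol_le. Qed.

(** Bootstrapping: h is bounded, and its first derivatives are products of h with potentials of rate
    at least -1, so each order of estimates yields the next. *)
Lemma transition_symbol k : msymbol 1 k 0 D (fun=> h).
Proof.
elim: k => [|k IH].
  apply: (@msymbol0P _ _ _ _ _ _ _ (Num.max 0 Ch)).
  - by move=> x Dx; exact/differentiable_cont/dh.
  - by rewrite le_max lexx.
  - by move=> x Dx; rewrite powRr0 mulr1 le_max hbound // orbT.
apply: msymbolS => //; first exact: msymbol_leq IH.
move=> b; apply: (@msymbol_eq _ _ _ _ _ _ _ _ _ _ oD (fun t x Dx => esym (hderive b Dx))).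
have hAa : msymbol 1 k (-1) D (fun _ x => A x (delta_mx 0 b) + a1 b x).
  by apply: msymbol_add => //; apply: lower (ha1 b k); exact: ltW.
apply: msymbol_sub => //; first exact: msymbol_mul.
rewrite addrC; apply: msymbol_mul => //; apply: msymbol_sum => // l.
rewrite -(add0r (-1)); apply: msymbol_scale => //.
apply: msymbol_add => //; first exact: (comp_symbol (hB l k)).
by apply: lower (comp_symbol (ha2 l k)); exact: ltW.
Qed.

Definition transported x : 'M[R]_m := (1%:M + y 1 x) *m h x.

Let ysym k : msymbol 1 k 1 D y.
Proof. exact: transport_symbol. Qed.


Let y1sym k : msymbol 1 k 1 D (fun _ => y 1).
Proof. by move=> i j; exact: (symbol_slice 1 (ysym k i j)). Qed.

Let Psym k : msymbol 1 k 0 D (fun _ x => 1%:M + y 1 x).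
Proof.
apply: msymbol_add => //; first exact: msymbol_cst.
by apply: lower (y1sym k); exact: ler01.
Qed.

Lemma transported_symbol k : msymbol 1 k 0 D (fun _ => transported).
Proof. by rewrite -(addr0 0); apply: msymbol_mul => //; exact: transition_symbol. Qed.

(** The potential of U^* B for a linear U, that is, of the connection on the target of Hom(P_s, U^*
    P_s). *)
Definition rotated (x v : 'rV[R]_n) := B (U x) (U v).

Lemma rotated_symbol b k : msymbol 1 k (-1) D (fun _ x => rotated x (delta_mx 0 b)).
Proof.
apply: (@msymbol_eq _ _ _ _ _ _ _ _ (fun _ x => \sum_l (U (delta_mx 0 b)) 0 l *: B (U x) (delta_mx 0 l))) => //.
  by move=> _ x Dx; rewrite /rotated linB //; have [] := seg1 Dx.
apply: msymbol_sum => // l; rewrite -(add0r (-1)).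
apply: (@msymbol_scale _ _ _ _ _ _ _ _ _ (fun _ _ => (U (delta_mx 0 b)) 0 l)) => //.
  exact: symbol_cst.
move=> i j; apply: (@symbol_comp _ _ _ _ _ _ D D' (fun y => B y (delta_mx 0 l) i j) (fun=> U)) => //.
- by move=> t x /seg1[].
- by move=> _; exists a, c; split=> // t x /seg1[].
- move=> d; have le12 : 1 <= 2 :> R by lra.
  have := symbol_add oD (hP d k) (symbol_lower1 D0 D1 le12 (hw d k)).
  by apply: symbol_eq => // _ x _; rewrite !mxE; ring.
- exact: hB.
Qed.

Let dPhi x : D x -> differentiable Phi x.
Proof.
by move=> Dx; apply: differentiable_mx => i j; rewrite ord1; exact: (symbol_diff (hP j 1) 0).
Qed.

Let Pb b x := \sum_l ('D_(delta_mx 0 b) Phi x) 0 l *: B (Phi x) (delta_mx 0 l).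
Let P2 b x := \sum_l ('D_(delta_mx 0 b) Phi x) 0 l *: a2 l (Phi x).

Let Pbsym b k : msymbol 1 k (-1) D (fun _ => Pb b).
Proof.
rewrite -(add0r (-1)); apply: msymbol_sum => // l; apply: msymbol_scale => //.
apply: (comp_symbol (hB l k)).
Qed.

Let P2sym b k : msymbol 1 k mu D (fun _ => P2 b).
Proof.
rewrite -(add0r mu); apply: msymbol_sum => // l; apply: msymbol_scale => //.
exact: comp_symbol.
Qed.

(** The difference of U^* B and Phi^* B. Each has rate -1; the difference gains one order, both in
    the point where B is evaluated and in the vector to which it is applied, because U - Phi has
    rate 2. *)
Let Wsym b k : msymbol 1 k 0 D (fun _ x => rotated x (delta_mx 0 b) - Pb b x).
Proof.
apply: (@msymbol_eq _ _ _ _ _ _ _ _ (fun _ x => \sum_l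
   ((U (delta_mx 0 b)) 0 l *: (B (U x) (delta_mx 0 l) - B (Phi x) (delta_mx 0 l)) +
    'D_(delta_mx 0 b) (fun x => (U x - Phi x) 0 l) x *: B (Phi x) (delta_mx 0 l)))) => //.
  move=> _ x Dx; rewrite /rotated linB; last by have [] := seg1 Dx.
  rewrite /Pb -sumrB; apply: eq_bigr => l _.
  have -> : 'D_(delta_mx 0 b) (fun x => (U x - Phi x) 0 l) x =
      U (delta_mx 0 b) 0 l - 'D_(delta_mx 0 b) Phi x 0 l.
    have dU : differentiable U x by apply: linear_differentiable; exact: linear_rV_continuous.
    have dP := dPhi Dx.
    rewrite -derive_entry; last exact: differentiableB.
    rewrite deriveB; [|exact: diff_derivable|exact: diff_derivable].
    rewrite !mxE; congr (_ - _).
    by rewrite deriveE // diff_lin //; exact: linear_rV_continuous.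
  by rewrite scalerBr scalerBl addrA subrK.
apply: msymbol_sum => // l; apply: msymbol_add => //.
  rewrite -(add0r 0).
  apply: (@msymbol_scale _ _ _ _ _ _ _ _ _ (fun _ _ => (U (delta_mx 0 b)) 0 l)) => //.
    exact: symbol_cst.
  move=> i j.
  have h1 : symbol 1 k (-1 + 1) D (fun _ x => B (U x) (delta_mx 0 l) i j - B (Phi x) (delta_mx 0 l) i j).
    apply: (@symbol_comp_diff _ _ _ _ U Phi D D' (fun y => B y (delta_mx 0 l) i j) a c) => //.
      by move=> t x /andP[t0 t1] Dx; apply: seg => //; apply/andP; split; lra.
    exact: hB.
  by rewrite addrC subrr in h1; apply: symbol_eq h1 => // _ x _; rewrite !mxE.
rewrite -(subrr 1); apply: msymbol_scale => //; last exact: comp_symbol (hB l k).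
by have := symbol_derive (delta_mx 0 b) (hw l k.+1); rewrite (_ : 2 - 1 = 1); last by lra.
Qed.

(** The cone potential of the source cancels, and that of the target enters only through U^* B -
    Phi^* B and through products with y = O(r), all of rate 0. The rate mu comes from [a1] and
    [a2]. *)
Lemma transported_cov b k :
  msymbol 1 k mu D (fun _ => cov rotated A (delta_mx 0 b) transported).
Proof.
have mu0' := ltW mu0.
apply: (@msymbol_eq _ _ _ _ _ _ _ _ (fun _ x =>
   'D_(delta_mx 0 b) (y 1) x *m h x + transported x *m a1 b x
   - (1%:M + y 1 x) *m P2 b x *m h x
   + ((rotated x (delta_mx 0 b) - Pb b x) + (rotated x (delta_mx 0 b) *m y 1 x - y 1 x *m Pb b x)) *m h x)) => //.
  move=> _ x Dx; rewrite /cov /transported.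
  have dy : differentiable (y 1) x by exact: (msymbol_diff (y1sym 1) 0).
  have dp : differentiable (fun x => 1%:M + y 1 x) x.
    by apply: (@differentiableD _ _ _ (fun=> 1%:M) (y 1)) => //; exact: differentiable_cst.
  rewrite derive_mulmx //; last exact: dh.
  have -> : 'D_(delta_mx 0 b) (fun x => 1%:M + y 1 x) x = 'D_(delta_mx 0 b) (y 1) x.
    rewrite -[LHS]/('D_(delta_mx 0 b) ((fun _ : 'rV[R]_n => 1%:M) + y 1) x).
    by rewrite deriveD ?derive_cst ?add0r //; exact: diff_derivable.
  rewrite hderive //.
  have -> : \sum_l ('D_(delta_mx 0 b) Phi x) 0 l *: (B (Phi x) (delta_mx 0 l) + a2 l (Phi x)) = Pb b x + P2 b x.
    by rewrite -big_split /=; apply: eq_bigr => l _; rewrite scalerDr.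
  rewrite !(mulmxDl, mulmxDr, mulmxN, mulNmx, mul1mx, mulmxA).
  have aE (M N : 'M[R]_m) i j : (M + N) i j = M i j + N i j by rewrite mxE.
  have nE (M : 'M[R]_m) i j : (- M) i j = - M i j by rewrite mxE.
  by apply/matrixP => i j; rewrite !(aE, nE); ring.
apply: msymbol_add => //; first (apply: msymbol_sub => //; first apply: msymbol_add => //).
- apply: (lower mu0'); rewrite -(addr0 0); apply: msymbol_mul => //; last exact: transition_symbol.
  by rewrite -(subrr 1); apply: (@msymbol_derive _ _ _ _ _ _ _ _ (fun=> y 1)).
- by rewrite -(add0r mu); apply: msymbol_mul => //; exact: transported_symbol.
- rewrite -(addr0 mu); apply: msymbol_mul => //; last exact: transition_symbol.
  by rewrite -(add0r mu); apply: msymbol_mul.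
apply: (lower mu0'); rewrite -(addr0 0); apply: msymbol_mul => //; last exact: transition_symbol.
apply: msymbol_add => //; rewrite -(subrr 1).
apply: msymbol_sub => //; last exact: msymbol_mul.
by rewrite addrC; apply: msymbol_mul => //; exact: rotated_symbol.
Qed.

End Transport.

Lemma powR_antitone (R : realType) (a b lam : R) : 0 < a -> a <= b -> lam <= 0 -> b `^ lam <= a `^ lam.
Proof.
move=> a0 ab l0; have b0 := lt_le_trans a0 ab.
rewrite -[lam]opprK [b `^ _]powRN [a `^ _]powRN lef_pV2 ?posrE ?powR_gt0 //.
by apply: ge0_ler_powR; rewrite ?oppr_ge0 ?nnegrE ?(ltW a0) ?(ltW b0).
Qed.

(** * The limit along rays *)

Section RadialLimit.
Variables (R : realType) (n m : nat) (D : set 'rV[R]_n).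
Variables (A B : 'rV[R]_n -> 'rV[R]_n -> 'M[R]_m) (F : 'rV[R]_n -> 'M[R]_m) (mu : R).
Hypotheses (oD : open D) (D0 : away0 1 D) (D1 : forall x, D x -> enorm x <= 1).
Hypothesis starD : forall s x, 0 < s <= 1 -> D x -> D (s *: x).
Hypotheses (mu1 : -1 < mu) (mu0 : mu < 0).
Hypothesis hA : forall b k, msymbol 1 k (-1) D (fun _ x => A x (delta_mx 0 b)).
Hypothesis hB : forall b k, msymbol 1 k (-1) D (fun _ x => B x (delta_mx 0 b)).
Hypothesis linA : forall x v, D x -> A x v = \sum_b v 0 b *: A x (delta_mx 0 b).
Hypothesis linB : forall x v, D x -> B x v = \sum_b v 0 b *: B x (delta_mx 0 b).
Hypothesis homA : forall s x v, 0 < s <= 1 -> D x -> A (s *: x) v = s^-1 *: A x v.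
Hypothesis homB : forall s x v, 0 < s <= 1 -> D x -> B (s *: x) v = s^-1 *: B x v.
Hypothesis radA : forall x, D x -> A x x = 0.
Hypothesis radB : forall x, D x -> B x x = 0.
Hypothesis hF : forall k, msymbol 1 k 0 D (fun=> F).
Hypothesis hcov : forall b k, msymbol 1 k mu D (fun=> cov B A (delta_mx 0 b) F).

Lemma cov_lin (s : 'rV[R]_n -> 'M[R]_m) x v : D x -> differentiable s x ->
  cov B A v s x = \sum_b v 0 b *: cov B A (delta_mx 0 b) s x.
Proof.
move=> Dx ds; rewrite /cov (derive_basis v ds) linA // linB // mulmx_suml mulmx_sumr.
rewrite -big_split -sumrB; apply: eq_bigr => b _ /=.
by rewrite -scalemxAl -scalemxAr scalerBr scalerDr.
Qed.

(** In frames constant along rays the potentials vanish on the radial vector, so a bound on nabla F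
    is a bound on the variation of F itself along rays. *)
Lemma cov_radial (s : 'rV[R]_n -> 'M[R]_m) x : D x -> cov B A x s x = 'D_x s x.
Proof. by move=> Dx; rewrite /cov radA // radB // mulmx0 mul0mx addr0 subr0. Qed.

Let dF x : D x -> differentiable F x.
Proof. by move=> Dx; exact: (msymbol_diff (hF 1) 0). Qed.

Let mu2 : 0 < mu + 1.
Proof. by rewrite -ltrBlDr sub0r. Qed.

Let covF : exists2 K, 0 <= K & forall x v, D x -> `|cov B A v F x| <= K * `|v| * enorm x `^ mu.
Proof.
have /choice[K hK] : forall b, exists K, 0 <= K /\ forall x, D x ->
    `|cov B A (delta_mx 0 b) F x| <= K * enorm x `^ mu.
  by move=> b; have [K K0 h] := msymbol_bound (isT : (0 < 1)%N) (hcov b 0); exists K; split=> // x; exact: (h 0).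
exists (\sum_b K b) => [|x v Dx]; first by apply: sumr_ge0 => b _; have [] := hK b.
rewrite (cov_lin _ Dx (dF Dx)) (le_trans (ler_norm_sum _ _ _)) // !mulr_suml.
apply: ler_sum => b _; have [Kb h] := hK b.
rewrite normrZ mulrAC mulrC; apply: ler_pM => //; [exact: h|exact: mx_entry_le].
Qed.

(** The ratio 2^-(mu + 1) at which F (2^-n x) converges; it is below 1 because mu > -1. *)
Definition halving : R := 2^-1 `^ (mu + 1).

Lemma halving01 : 0 <= halving < 1.
Proof.
have h0 : (0 : R) <= 2^-1 by rewrite invr_ge0.
have h1 : (2^-1 : R) < 1 by rewrite invf_lt1 // ltr1n.
rewrite powR_ge0 /=; have := gt0_ltr_powR mu2 h0 (@ler01 R) h1.
by rewrite powR1.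
Qed.

Lemma enorm_half N (x : 'rV[R]_n) lam : enorm (2^-1 ^+ N *: x) `^ lam = (2^-1 `^ lam) ^+ N * enorm x `^ lam.
Proof.
have h0 : (0 : R) <= 2^-1 by rewrite invr_ge0.
rewrite enormZ ger0_norm ?exprn_ge0 // powRM ?exprn_ge0 ?enorm_ge0 //; congr (_ * _).
elim: N => [|N IH]; first by rewrite !expr0 powR1.
by rewrite !exprS powRM ?exprn_ge0 // IH.
Qed.

Let half01 N : 0 < (2^-1 : R) ^+ N <= 1.
Proof.
have h0 : (0 : R) < 2^-1 by rewrite invr_gt0.
by rewrite exprn_gt0 //= exprn_ile1 // ?ltW // invf_lt1 // ltr1n.
Qed.

(** Integrating nabla F = O(r^mu) radially from 2^-N x to half of it costs one more factor r, and
    r^(mu + 1) scales by [halving] at each step. *)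
Let Fcauchy : exists2 K, 0 <= K & forall x, D x -> forall N,
  `|F (2^-1 ^+ N.+1 *: x) - F (2^-1 ^+ N *: x)| <= K * enorm x `^ (mu + 1) * halving ^+ N.
Proof.
have [K K0 hK] := covF; exists K => // x Dx N.
set y := 2^-1 ^+ N *: x; have Dy : D y by apply: starD.
have -> : K * enorm x `^ (mu + 1) * halving ^+ N = K * enorm y `^ (mu + 1).
  by rewrite /y enorm_half -/halving; ring.
have -> : 2^-1 ^+ N.+1 *: x = y + (- 2^-1) *: y.
  by rewrite exprS -scalerA -/y -{2}[y]scale1r -scalerDl; congr (_ *: _); lra.
apply: mx_norm_le => [|i j]; first by rewrite !mulr_ge0 ?powR_ge0.
rewrite !mxE; apply: (mvt_segment (f := fun x => F x i j)) => s /andP[s0 s1].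
all: have -> : y + s *: (- 2^-1 *: y) = (1 - s / 2) *: y by
  rewrite scalerA -{1}[y]scale1r -scalerDl; congr (_ *: _); lra.
all: have s2 : 0 < 1 - s / 2 <= 1 by apply/andP; split; lra.
all: have Dz : D ((1 - s / 2) *: y) by exact: starD.
  exact/differentiable_entry/dF.
set z := (1 - s / 2) *: y.
have s3 : 1 - s / 2 != 0 by rewrite gt_eqF //; case/andP: s2.
have -> : - 2^-1 *: y = (- 2^-1 / (1 - s / 2)) *: z by rewrite /z [RHS]scalerA divfK.
rewrite -derive_entry; last exact: dF.
rewrite (derive_scale _ _ (dF Dz)) -(cov_radial F (x := z)) // mxE normrM.
have h1 : `|- 2^-1 / (1 - s / 2)| <= 1.
  rewrite normrM normrN normfV !ger0_norm ?invr_ge0 //; last by lra.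
  rewrite ler_pdivrMr; lra.
have h2 := hK z z Dz; have h3 := norm_le_enorm z; have zz : 0 < enorm z := D0 isT Dz.
have h4 : enorm z `^ (mu + 1) <= enorm y `^ (mu + 1).
  apply: ge0_ler_powR; rewrite ?(ltW mu2) ?nnegrE ?enorm_ge0 //.
  have /andP[s4 s5] := s2.
  by rewrite /z enormZ ger0_norm ?(ltW s4) // ler_piMl ?enorm_ge0.
apply: (@le_trans _ _ (1 * `|cov B A z F z|)).
  by apply: ler_pM => //; exact: mx_entry_le.
rewrite mul1r; apply: (le_trans h2); rewrite -mulrA.
apply: (ler_wpM2l K0); apply: le_trans h4.
rewrite powRD; last by rewrite (gt_eqF zz) implybT.
rewrite powRr1 ?enorm_ge0 // mulrC.
by apply: (ler_wpM2l (powR_ge0 _ _)).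
Qed.

(** The rate belongs to the definition: at N = 0 it is the estimate F - h = O(r^(mu + 1)), and it is
    what makes derivatives converge in [radial_limit_cov]. *)
Definition is_radial_limit (h : 'rV[R]_n -> 'M[R]_m) := exists2 K, 0 <= K &
  forall x, D x -> forall N, `|F (2^-1 ^+ N *: x) - h x| <= K * enorm x `^ (mu + 1) * halving ^+ N.

Lemma radial_limit_exists : exists h, is_radial_limit h.
Proof.
have [K K0 hK] := Fcauchy; have q01 := halving01; have /andP[q0 q1] := q01.
have /choice[h hh] : forall x, exists l, D x -> forall N,
    `|F (2^-1 ^+ N *: x) - l| <= K * enorm x `^ (mu + 1) / (1 - halving) * halving ^+ N.
  move=> x; have [Dx|nD] := pselect (D x); last by exists 0.
  by have [l hl] := geometric_limit_mx q01 (hK x Dx); exists l.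
exists h; exists (K / (1 - halving)).
  by rewrite divr_ge0 // subr_ge0 ltW.
by move=> x Dx N; apply: (le_trans (hh x Dx N)); rewrite le_eqVlt; apply/orP; left; apply/eqP; ring.
Qed.

Variable h : 'rV[R]_n -> 'M[R]_m.
Hypothesis hlim : is_radial_limit h.

(** The derivatives of the rescaled functions F (2^-N y) converge geometrically to h A - B h, so
    [c1_limit] gives D h = h A - B h, which is nabla h = 0. *)
Lemma radial_limit_cov x : D x -> differentiable h x /\ forall v, cov B A v h x = 0.
Proof.
move=> Dx; have [K K0 hK] := hlim; have [C C0 hC] := covF.
have x0 := D0 isT Dx.
have /choice[Ka ha] : forall b, exists K, 0 <= K /\ forall x, D x -> `|A x (delta_mx 0 b)| <= K * enorm x `^ (-1).
  by move=> b; have [k k0 h'] := msymbol_bound (isT : (0 < 1)%N) (hA b 0); exists k; split=> // y; exact: (h' 0).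
have /choice[Kb hb] : forall b, exists K, 0 <= K /\ forall x, D x -> `|B x (delta_mx 0 b)| <= K * enorm x `^ (-1).
  by move=> b; have [k k0 h'] := msymbol_bound (isT : (0 < 1)%N) (hB b 0); exists k; split=> // y; exact: (h' 0).
pose G (y v : 'rV[R]_n) : 'M[R]_m := \sum_b v 0 b *: (h y *m A y (delta_mx 0 b) - B y (delta_mx 0 b) *m h y).
have GE y v : D y -> G y v = h y *m A y v - B y v *m h y.
  move=> Dy; rewrite linA // linB // mulmx_suml mulmx_sumr -sumrB; apply: eq_bigr => b _.
  by rewrite -scalemxAl -scalemxAr scalerBr.
have [d d0 hd] : exists2 d, 0 < d & forall y, `|y - x| < d -> D y /\ enorm x / 2 <= enorm y.
  have nE : \forall y \near x, D y /\ enorm x / 2 <= enorm y.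
    suff h2 : \forall y \near x, enorm x / 2 <= enorm y.
      by apply: filterS2 (open_near oD Dx (fun y Dy => Dy)) h2 => y Dy hy; split.
    have /(@cvgrPdist_le _ _ _ (nbhs (x : 'rV[R]_n)))/(_ (enorm x / 2)) := @enorm_continuous R n x.
    move=> /(_ ltac:(by rewrite divr_gt0)); apply: filterS => y.
    by rewrite ler_norml => /andP[_]; lra.
  have /nbhs_ballP[d /= d0 hd] := nE; exists d => // y yd; apply: hd.
  by rewrite -ball_normE /= -normrN opprB.
have [S S0 hS] : exists2 S, 0 <= S & forall y v, D y -> `|A y v| + `|B y v| <= S * enorm y `^ (-1) * `|v|.
  exists (\sum_b (Ka b + Kb b)) => [|y v Dy].
    by apply: sumr_ge0 => b _; rewrite addr_ge0 //; [have [] := ha b|have [] := hb b].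
  rewrite linA // linB //; apply: (@le_trans _ _ (\sum_b (`|v 0 b *: A y (delta_mx 0 b)| + `|v 0 b *: B y (delta_mx 0 b)|))).
    by rewrite big_split; apply: lerD; exact: ler_norm_sum.
  rewrite !mulr_suml; apply: ler_sum => b _; rewrite !normrZ -mulrDr mulrC.
  apply: ler_pM; rewrite ?addr_ge0 //; last exact: mx_entry_le.
  by rewrite mulrDl; apply: lerD; [have [_] := ha b; exact|have [_] := hb b; exact].
have hN0 N : 0 <= halving ^+ N by rewrite exprn_ge0 // powR_ge0.
have halvingE : halving = 2^-1 * 2^-1 `^ mu.
  by rewrite /halving powRD ?powRr1 ?invr_ge0 // 1?mulrC // gt_eqF ?implybT // invr_gt0.
have powR_small y : D y -> enorm y `^ (mu + 1) <= 1.
  move=> Dy; have := @ge0_ler_powR R _ (ltW mu2) (enorm y) 1 (enorm_ge0 _) ler01 (D1 Dy).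
  by rewrite powR1.
have key : forall i j, differentiable (fun y => h y i j) x /\ 'd (fun y => h y i j) x = (fun v => G x v i j) :> (_ -> _).
  move=> i j.
  have [L hL] := row_linear (fun b => (h x *m A x (delta_mx 0 b) - B x (delta_mx 0 b) *m h x) i j).
  have GL : (fun y v => G y v i j) x = L.
    by apply/funext => v; rewrite hL /G summxE; apply: eq_bigr => b _; rewrite !mxE.
  set r := enorm x / 2 in hd; have r0 : 0 < r by rewrite divr_gt0.
  pose M := C * r `^ mu + m%:R * K * S * r `^ (-1) + K.
  have [||||dh dhE] := @c1_limit R _ x d M halving (fun N y => F (2^-1 ^+ N *: y) i j)
      (fun y => h y i j) (fun y v => G y v i j) L d0 halving01 _ GL.
  - exact: linear_rV_continuous.
  - move=> N y /hd[Dy _].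
    apply: (@differentiable_comp _ _ _ _ (fun y => 2^-1 ^+ N *: y) (fun y => F y i j)) => //.
    by apply/differentiable_entry/dF/starD.
  - move=> N y v /hd[Dy ry].
    have Dz : D (2^-1 ^+ N *: y) by exact: starD.
    set e := 2^-1 ^+ N in Dz *; have /andP[e0 e1] := half01 N; rewrite -/e in e0 e1.
    have -> : 'D_v (fun y => F (e *: y) i j) y = (e *: 'D_v F (e *: y)) i j.
      rewrite -[LHS]/('D_v ((fun y => F y i j) \o (fun y => e *: y)) y).
      rewrite derive_comp //; last exact/differentiable_entry/dF.
      have -> : 'D_v (fun y : 'rV[R]_n => e *: y) y = e *: v.
        by rewrite deriveZ ?derive_id //; exact: derivable_id.
      rewrite -derive_scale -?derive_entry //; first by apply: dF.
      exact: dF.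
    (* Homogeneity of degree -1: the factor 2^-N of the chain rule turns the potentials at 2^-N y
       into the potentials at y, leaving a rescaled nabla F and terms in F (2^-N y) - h y. *)
    have -> : (e *: 'D_v F (e *: y)) i j - G y v i j =
       (e *: cov B A v F (e *: y) + ((F (e *: y) - h y) *m A y v - B y v *m (F (e *: y) - h y))) i j.
      rewrite GE // /cov homA ?e0 // homB ?e0 // -scalemxAl -scalemxAr scalerBr scalerDr !scalerA divff ?gt_eqF // !scale1r.
      rewrite mulmxBl mulmxBr.
      have aE (X Y : 'M[R]_m) a b : (X + Y) a b = X a b + Y a b by rewrite mxE.
      have nE (X : 'M[R]_m) a b : (- X) a b = - X a b by rewrite mxE.
      by rewrite !(aE, nE); ring.
    apply: (le_trans (mx_entry_le _ _ _)).
    have rmu : enorm y `^ mu <= r `^ mu by apply: powR_antitone => //; exact: ltW.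
    have rm1 : enorm y `^ (-1) <= r `^ (-1) by apply: powR_antitone => //; rewrite oppr_le0.
    have y1 := powR_small y Dy.
    have hFh := hK y Dy N; rewrite -/e in hFh.
    have hFh' : `|F (e *: y) - h y| <= K * halving ^+ N.
      by apply: (le_trans hFh); apply: (ler_wpM2r (hN0 N)); rewrite ler_piMr.
    (* The factor 2^-N of the chain rule and 2^(-N mu) from the rate of nabla F combine to
       [halving]^N. *)
    have t1 : `|e *: cov B A v F (e *: y)| <= C * r `^ mu * halving ^+ N * `|v|.
      rewrite normrZ (ger0_norm (ltW e0)).
      apply: (@le_trans _ _ (e * (C * `|v| * enorm (e *: y) `^ mu))).
        by apply: (ler_wpM2l (ltW e0)); exact: hC.
      have -> : e * (C * `|v| * enorm (e *: y) `^ mu) = C * `|v| * halving ^+ N * enorm y `^ mu.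
        by rewrite /e enorm_half halvingE exprMn; ring.
      have -> : C * r `^ mu * halving ^+ N * `|v| = C * `|v| * halving ^+ N * r `^ mu by ring.
      by apply: ler_wpM2l rmu; rewrite !mulr_ge0.
    have t2 : `|(F (e *: y) - h y) *m A y v - B y v *m (F (e *: y) - h y)| <= m%:R * K * S * r `^ (-1) * halving ^+ N * `|v|.
      have hs := hS y v Dy.
      apply: (@le_trans _ _ (m%:R * `|F (e *: y) - h y| * (`|A y v| + `|B y v|))).
        rewrite mulrDr (le_trans (ler_normB _ _)) //; apply: lerD; first exact: mulmx_norm_le.
        by rewrite mulrAC; exact: mulmx_norm_le.
      apply: (@le_trans _ _ (m%:R * (K * halving ^+ N) * (S * r `^ (-1) * `|v|))).
        apply: ler_pM; rewrite ?mulr_ge0 ?addr_ge0 //; first by rewrite ler_wpM2l.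
        by apply: (le_trans hs); rewrite ler_wpM2r // ler_wpM2l.
      by rewrite le_eqVlt; apply/orP; left; apply/eqP; ring.
    apply: (le_trans (ler_normD _ _)); apply: (le_trans (lerD t1 t2)).
    rewrite -!mulrDl; apply: (ler_wpM2r (normr_ge0 _)); apply: (ler_wpM2r (hN0 N)).
    by rewrite /M lerDl.
  - move=> N y /hd[Dy _].
    have -> : F (2^-1 ^+ N *: y) i j - h y i j = (F (2^-1 ^+ N *: y) - h y) i j by rewrite !mxE.
    apply: (le_trans (mx_entry_le _ _ _)); apply: (le_trans (hK y Dy N)).
    apply: (ler_wpM2r (hN0 N)); apply: (@le_trans _ _ K).
      by rewrite ler_piMr // powR_small.
    by rewrite /M lerDr addr_ge0 // !mulr_ge0 ?powR_ge0.
  by split=> //; rewrite dhE -GL.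
have dh : differentiable h x by apply: differentiable_mx => i j; have [] := key i j.
split=> // v; rewrite /cov.
suff -> : 'D_v h x = G x v by rewrite GE // subrK subrr.
apply/matrixP => i j; rewrite derive_entry //; have [dij eij] := key i j.
by rewrite deriveE // eij.
Qed.

(** Parallel means constant along rays, because the covariant radial derivative is the ordinary
    one. *)
Lemma radial_limit_scale s x : 0 < s <= 1 -> D x -> h (s *: x) = h x.
Proof.
move=> /andP[s0 s1] Dx; apply/matrixP => i j; apply/eqP; rewrite -subr_eq0 -normr_le0.
have -> : s *: x = x + (s - 1) *: x by rewrite -{2}[x]scale1r -scalerDl addrC subrK.
have st t : 0 <= t <= 1 -> 0 < 1 + t * (s - 1) <= 1.
  by move=> /andP[t0 t1]; apply/andP; split; nra.
apply: (mvt_segment (f := fun x => h x i j)) => t /st t01.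
all: have -> : x + t *: ((s - 1) *: x) = (1 + t * (s - 1)) *: x by
  rewrite scalerA -{1}[x]scale1r -scalerDl.
all: have Dz : D ((1 + t * (s - 1)) *: x) by exact: starD.
all: have [dh ch] := radial_limit_cov Dz.
  exact: differentiable_entry.
set z := _ *: x in Dz dh ch *; have /andP[t0 t1] := t01.
have -> : (s - 1) *: x = ((s - 1) / (1 + t * (s - 1))) *: z.
  by rewrite /z [RHS]scalerA divfK // gt_eqF.
rewrite -derive_entry // (derive_scale _ _ dh) -(cov_radial h (x := z)) // ch.
by rewrite scaler0 mxE normr0.
Qed.

Lemma radial_limit_ncov k : exists2 K, 0 <= K & forall I, size I = k -> forall x, D x ->
  `|ncov B A I (fun y => F y - h y) x| <= K * enorm x `^ (mu + 1 - k%:R).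
Proof.
have dsub v x : D x -> cov B A v (fun y => F y - h y) x = cov B A v F x.
  move=> Dx; have [dh ch] := radial_limit_cov Dx; have dFx := dF Dx.
  rewrite -[RHS]subr0 -(ch v) /cov -[X in 'D_v X x]/(F \- h).
  rewrite deriveB; [|exact: diff_derivable|exact: diff_derivable].
  rewrite mulmxBl mulmxBr.
  have aE (X Y : 'M[R]_m) a b : (X + Y) a b = X a b + Y a b by rewrite mxE.
  have nE (X : 'M[R]_m) a b : (- X) a b = - X a b by rewrite mxE.
  by apply/matrixP => i j; rewrite !(aE, nE); ring.
case: k => [|k].
  have [K K0 hK] := hlim; exists K => // I /size0nil-> x Dx.
  by have := hK x Dx 0; rewrite !expr0 scale1r mulr1 subr0.
have /choice[K hK] : forall I : k.+1.-tuple 'I_n, exists K, 0 <= K /\ forall x, D x ->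
    `|ncov B A I (fun y => F y - h y) x| <= K * enorm x `^ (mu + 1 - k.+1%:R).
  move=> I; have := size_tuple I; case/lastP: (val I) => // I' b.
  rewrite size_rcons => -[sI].
  have [K K0 hK] := msymbol_bound (isT : (0 < 1)%N) (ncov_symbol 0 I' oD D0 hA hB (hcov b)).
  exists K; split=> // x Dx; rewrite ncov_rcons (ncov_eq A B I' oD (dsub (delta_mx 0 b)) Dx).
  have -> : mu + 1 - k.+1%:R = mu - (size I')%:R by rewrite sI mulrS; ring.
  exact: (hK 0).
exists (\sum_I K I) => [|I sI x Dx]; first by apply: sumr_ge0 => I _; have [] := hK I.
have [_ h'] := hK (tcast sI (in_tuple I)).
move: (h' x Dx); rewrite val_tcast /= => /le_trans; apply; apply: (ler_wpM2r (powR_ge0 _ _)).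
by rewrite (bigD1 (tcast sI (in_tuple I))) //= lerDl sumr_ge0 // => J _; have [] := hK J.
Qed.

End RadialLimit.

(** * Smooth maps and pullbacks *)

Section SmoothOn.
Variables (R : realType).

Lemma smooth_onP n p q lam (D : set 'rV[R]_n) (F : 'rV[R]_n -> 'M[R]_(p, q)) : open D ->
  smooth_on D F <-> forall k, msymbol 0 k lam D (fun=> F).
Proof. by move=> oD; split=> h k; apply/(Ck_msymbol k lam F oD); exact: h. Qed.

Lemma smooth_on_sub n (V : normedModType R) (D D' : set 'rV[R]_n) (F : 'rV[R]_n -> V) :
  D' `<=` D -> smooth_on D F -> smooth_on D' F.
Proof.
move=> DD h k; have := h k; elim: k (F) => [|k IH] f /=; first by move=> fc x /DD/fc.
by move=> [df dv]; split=> [x /DD/df|v] //; exact: IH.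
Qed.

Lemma smooth_on_local n (V : normedModType R) (D : set 'rV[R]_n) (F : 'rV[R]_n -> V) :
  (forall x, D x -> exists2 D', D' x & smooth_on D' F) -> smooth_on D F.
Proof.
move=> h k; have {}h : forall x, D x -> exists2 D', D' x & Ck k D' F.
  by move=> x /h[D' Dx hD]; exists D'.
elim: k F h => [|k IH] F h /=; first by move=> x /h[D' Dx]; exact.
split=> [x /h[D' Dx [df _]]|v]; first exact: df.
by apply: IH => x /h[D' Dx [_ dv]]; exists D'; last exact: dv.
Qed.

Lemma smooth_on_eq n p q (D : set 'rV[R]_n) (F F' : 'rV[R]_n -> 'M[R]_(p, q)) : open D ->
  (forall x, D x -> F x = F' x) -> smooth_on D F -> smooth_on D F'.
Proof.
move=> oD FF /(smooth_onP 0 _ oD) h; apply/(smooth_onP 0 _ oD) => k.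
by apply: msymbol_eq (h k) => // _ x; exact: FF.
Qed.

Lemma smooth_on_diff n (V : normedModType R) (D : set 'rV[R]_n) (F : 'rV[R]_n -> V) x :
  smooth_on D F -> D x -> differentiable F x.
Proof. by move=> /(_ 1%N)[h _]; exact: h. Qed.

Lemma smooth_on_derive n (V : normedModType R) (D : set 'rV[R]_n) (F : 'rV[R]_n -> V) v :
  smooth_on D F -> smooth_on D ('D_v F).
Proof. by move=> h k; have [_] := h k.+1; exact. Qed.

Lemma smooth_on_cst n p q (D : set 'rV[R]_n) (A : 'M[R]_(p, q)) : open D -> smooth_on D (fun=> A).
Proof. by move=> oD; apply/(smooth_onP 0 _ oD) => k; exact: msymbol_cst. Qed.

Lemma smooth_on_add n p q (D : set 'rV[R]_n) (F F' : 'rV[R]_n -> 'M[R]_(p, q)) : open D ->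
  smooth_on D F -> smooth_on D F' -> smooth_on D (fun x => F x + F' x).
Proof.
move=> oD /(smooth_onP 0 _ oD) h /(smooth_onP 0 _ oD) h'; apply/(smooth_onP 0 _ oD) => k.
exact: msymbol_add.
Qed.

Lemma smooth_on_opp n p q (D : set 'rV[R]_n) (F : 'rV[R]_n -> 'M[R]_(p, q)) : open D ->
  smooth_on D F -> smooth_on D (fun x => - F x).
Proof.
move=> oD /(smooth_onP 0 _ oD) h; apply/(smooth_onP 0 _ oD) => k.
exact: msymbol_opp.
Qed.

Lemma smooth_on_sum n p q (D : set 'rV[R]_n) (I : Type) (r : seq I)
    (F : I -> 'rV[R]_n -> 'M[R]_(p, q)) : open D ->
  (forall i, smooth_on D (F i)) -> smooth_on D (fun x => \sum_(i <- r) F i x).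
Proof.
move=> oD h; apply/(smooth_onP 0 _ oD) => k; apply: msymbol_sum => // i.
exact: (proj1 (smooth_onP 0 (F i) oD)).
Qed.

Lemma smooth_on_mul n p q r (D : set 'rV[R]_n) (F : 'rV[R]_n -> 'M[R]_(p, q))
    (F' : 'rV[R]_n -> 'M[R]_(q, r)) : open D ->
  smooth_on D F -> smooth_on D F' -> smooth_on D (fun x => F x *m F' x).
Proof.
move=> oD /(smooth_onP 0 _ oD) h /(smooth_onP 0 _ oD) h'; apply/(smooth_onP (0 + 0) _ oD) => k.
exact: msymbol_mul.
Qed.

Lemma smooth_on_entry n p q (D : set 'rV[R]_n) (F : 'rV[R]_n -> 'M[R]_(p, q)) k lam i j : open D ->
  smooth_on D F -> symbol 0 k lam D (fun _ x => F x i j).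
Proof. by move=> oD /(smooth_onP lam _ oD) h; exact: h. Qed.

Lemma smooth_on_scale n p q (D : set 'rV[R]_n) (f : 'rV[R]_n -> R)
    (F : 'rV[R]_n -> 'M[R]_(p, q)) : open D ->
  (forall k, symbol 0 k 0 D (fun=> f)) -> smooth_on D F -> smooth_on D (fun x => f x *: F x).
Proof.
move=> oD h /(smooth_onP 0 _ oD) h'; apply/(smooth_onP (0 + 0) _ oD) => k.
exact: msymbol_scale.
Qed.

Lemma smooth_on_comp n n' p q (D : set 'rV[R]_n) (D' : set 'rV[R]_n')
    (F : 'rV[R]_n' -> 'M[R]_(p, q)) (Y : 'rV[R]_n -> 'rV[R]_n') : open D -> open D' ->
  (forall x, D x -> D' (Y x)) -> smooth_on D Y -> smooth_on D' F -> smooth_on D (F \o Y).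
Proof.
move=> oD oD' DD /(smooth_onP 1 _ oD) h /(smooth_onP 0 _ oD') h'.
apply/(smooth_onP 0 _ oD) => k i j.
apply: (@symbol_comp _ _ _ _ _ _ D D' (fun y => F y i j) (fun=> Y)) => //.
- by move=> b; exact: (h k 0 b).
- exact: h'.
Qed.

End SmoothOn.

(** * Pulling back functions and connections to open subsets of R^p *)

Section Pullback.
Variables (R : realType) (T : Type) (n : nat) (N : atlas R T n) (X : set T).

(** The atlas axioms relative to a subset [X] and without a topology on T, so that the same lemmas
    serve the manifold Z and the unit sphere inside R^(n+1). *)
Definition atlas_on :=
  [/\ forall x, X x -> adom N (aat N x) x,
      forall j x, adom N j x -> apt N j (acoord N j x) = x
    & forall j k, smooth_on (in_chart N j (adom N k)) (acoord N k \o apt N j)].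

Hypothesis hN : atlas_on.

Lemma euclid_chart p (S : set 'rV[R]_p) : in_chart (euclid R p) tt S = S.
Proof.
apply/seteqP; split=> [x [y [_ Sy] <-]|x Sx] //.
by exists x.
Qed.

Lemma mopen_euclid p (S : set 'rV[R]_p) : mopen (euclid R p) S <-> open S.
Proof. by split=> [/(_ tt)|oS []]; rewrite euclid_chart. Qed.

Lemma smooth_fun_euclid p (V : normedModType R) (S : set 'rV[R]_p) (f : 'rV[R]_p -> V) :
  smooth_fun (euclid R p) S f <-> smooth_on S f.
Proof. by split=> [/(_ tt)|oS []]; rewrite euclid_chart. Qed.

Variables (p : nat) (D : set 'rV[R]_p) (Y : 'rV[R]_p -> T).
Hypothesis hY : smooth_map (euclid R p) N D Y.
Hypothesis YX : forall x, D x -> X (Y x).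

Let Dj j := D `&` Y @^-1` adom N j.

Lemma chart_dom_open j : open (Dj j).
Proof. by have [/mopen_euclid] := hY j. Qed.

Lemma chart_smooth j : smooth_on (Dj j) (acoord N j \o Y).
Proof. by have [_ /smooth_fun_euclid] := hY j. Qed.

Lemma in_chart_inj j S x : adom N j x -> in_chart N j S (acoord N j x) -> S x.
Proof.
have [_ cK _] := hN; move=> jx [z [jz Sz] e].
by rewrite -(cK j x jx) -e cK.
Qed.

Lemma chart_preimage_open j S : open (in_chart N j S) -> open (Dj j `&` Y @^-1` S).
Proof.
move=> oS; rewrite openE => x [Djx Sx].
have c : {for x, continuous (acoord N j \o Y)}.
  exact/differentiable_cont/(smooth_on_diff (chart_smooth j)).
have ix : in_chart N j S (acoord N j (Y x)) by exists (Y x) => //; case: Djx.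
have h1 := open_near (@chart_dom_open j) Djx (fun y Dy => Dy).
have h2 : \forall y \near x, in_chart N j S (acoord N j (Y y)).
  exact: (c _ (open_nbhs_nbhs (conj oS ix))).
apply: filterS2 h1 h2 => y Dy Sy; split=> //.
by apply: (in_chart_inj (proj2 Dy)).
Qed.

Lemma preimage_open S : mopen N S -> open (D `&` Y @^-1` S).
Proof.
move=> oS; rewrite openE => x [Dx Sx].
have [at_ _ _] := hN; have ax := at_ _ (YX Dx).
have := chart_preimage_open (oS (aat N (Y x))); rewrite openE => /(_ x).
case; first by split.
by move=> e e0 he; exists e => // y /he[[]].
Qed.

Lemma pull_near (W : Type) (g : T -> W) j x : Dj j x ->
  \forall y \near x, (g \o apt N j) (acoord N j (Y y)) = g (Y y).
Proof.
move=> Dx; apply: (open_near (@chart_dom_open j) Dx) => y [_ jy] /=.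
by have [_ cK _] := hN; rewrite cK.
Qed.

(** [tmap] refers to the preferred chart at Y x, which may jump as x moves; smoothness in x can only
    be stated after passing to one fixed chart j. *)
Lemma tmap_chart j x v : Dj j x ->
  tmap (euclid R p) N Y x v = tchart N j (acoord N j (Y x)) ('d (acoord N j \o Y) x v).
Proof.
move=> Djx; have [Dx jx] := Djx; have [at_ cK sm] := hN.
rewrite /tmap /tchart /= (cK j _ jx).
set j' := aat N (Y x); have jx' : adom N j' (Y x) by apply/at_/YX.
have d1 : differentiable (acoord N j \o Y) x by exact: (smooth_on_diff (chart_smooth j)).
have d2 : differentiable (acoord N j' \o apt N j) (acoord N j (Y x)).
  by apply: (smooth_on_diff (sm j j')); exists (Y x).
have e := pull_near (acoord N j') Djx.
have [_ e'] := @near_eq_diff _ _ _ ((acoord N j' \o apt N j) \o (acoord N j \o Y))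
  (acoord N j' \o Y) x e (differentiable_comp d1 d2).
have -> : (acoord N j' \o Y) \o id = acoord N j' \o Y by [].
apply: etrans (congr1 (fun f : _ -> _ => f v) e') _.
exact: (congr1 (fun f : _ -> _ => f v) (diff_comp d1 d2)).
Qed.

Lemma pull_diff (V : normedModType R) (S : set T) (g : T -> V) x v : smooth_fun N S g ->
  D x -> S (Y x) ->
  differentiable (g \o Y) x /\ 'd (g \o Y) x v = fdiff N g (Y x) (tmap (euclid R p) N Y x v).
Proof.
move=> sg Dx Sx; rewrite /fdiff /tmap /=.
set j := aat N (Y x); have [at_ cK _] := hN; have jx : adom N j (Y x) by apply/at_/YX.
have d1 : differentiable (acoord N j \o Y) x by exact: (smooth_on_diff (chart_smooth j)).
have d2 : differentiable (g \o apt N j) (acoord N j (Y x)).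
  by apply: (smooth_on_diff (sg j)); exists (Y x).
have [dg eg] := @near_eq_diff _ _ _ ((g \o apt N j) \o (acoord N j \o Y)) (g \o Y) x
  (pull_near g (conj Dx jx)) (differentiable_comp d1 d2).
by split=> //; rewrite eg (diff_comp d1 d2).
Qed.

Lemma pull_smooth r q (S : set T) (g : T -> 'M[R]_(r, q)) : mopen N S -> smooth_fun N S g ->
  smooth_on (D `&` Y @^-1` S) (g \o Y).
Proof.
move=> oS sg; apply: smooth_on_local => x [Dx Sx].
set j := aat N (Y x); have [at_ cK _] := hN; have jx : adom N j (Y x) by apply/at_/YX.
exists (Dj j `&` Y @^-1` S); first by split.
have oE := chart_preimage_open (oS j).
apply: (@smooth_on_eq _ _ _ _ _ ((g \o apt N j) \o (acoord N j \o Y))) => //.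
  by move=> y [[_ jy] _] /=; rewrite cK.
apply: smooth_on_comp (oS j) _ _ (sg j) => //.
  by move=> y [[_ jy] Sy]; exists (Y y).
by apply: smooth_on_sub (chart_smooth j) => y [].
Qed.

Lemma tmap_linear x a u v : tmap (euclid R p) N Y x (a *: u + v) =
  a *: tmap (euclid R p) N Y x u + tmap (euclid R p) N Y x v.
Proof. by rewrite /tmap linearP. Qed.

Variables (m : nat) (G : set 'M[R]_m) (E : Type) (P : pbundle R m T E).
Variable A : potentials n P.
Hypotheses (hP : is_pbundle G N P) (hA : is_connection G N A).

Definition pulled k x v : 'M[R]_m := A k (Y x) (tmap (euclid R p) N Y x v).

Lemma pulled_lie k x v : pdom P k (Y x) -> lie_algebra G (pulled k x v).
Proof. by move=> kx; apply: (conn_lie hA). Qed.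

Lemma pulled_linear k x a u v : pdom P k (Y x) ->
  pulled k x (a *: u + v) = a *: pulled k x u + pulled k x v.
Proof. by move=> kx; rewrite /pulled tmap_linear (conn_linear hA). Qed.

Lemma pulled_dom_open k : open (D `&` Y @^-1` pdom P k).
Proof. exact/preimage_open/(pbundle_dom_open hP). Qed.

Lemma pulled_smooth k v : smooth_on (D `&` Y @^-1` pdom P k) (pulled k ^~ v).
Proof.
apply: smooth_on_local => x [Dx kx].
set j := aat N (Y x); have [at_ cK _] := hN; have jx : adom N j (Y x) by apply/at_/YX.
have ok : open (in_chart N j (pdom P k)) by exact: (pbundle_dom_open hP).
have oE := chart_preimage_open ok.
exists (Dj j `&` Y @^-1` pdom P k); first by split.
pose L c y := A k (apt N j y) (tchart N j y (delta_mx 0 c)).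
apply: (@smooth_on_eq _ _ _ _ _ (fun y => \sum_c
   ('D_v (acoord N j \o Y) y) 0 c *: (L c \o (acoord N j \o Y)) y)) => //.
  move=> y [Djy ky]; have [Dy jy] := Djy.
  rewrite /pulled (tmap_chart v Djy) deriveE; last exact: (smooth_on_diff (chart_smooth j)).
  set w := 'd _ y v.
  have lin0 : A k (Y y) 0 = 0.
    have := conn_linear hA 1 0 0 ky; rewrite !scale1r addr0 => h.
    by apply: (@addrI _ (A k (Y y) 0)); rewrite addr0 -h.
  have -> : tchart N j (acoord N j (Y y)) w =
      \sum_c w 0 c *: tchart N j (acoord N j (Y y)) (delta_mx 0 c).
    rewrite {1}(row_sum_delta w) /tchart linear_sum.
    by apply: eq_bigr => c _; rewrite linearZ.
  elim: (index_enum _) => [|c r IH]; first by rewrite !big_nil lin0.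
  by rewrite !big_cons (conn_linear hA) // IH /L /= (cK j _ jy).
apply: smooth_on_sum => // c; apply: smooth_on_scale => //.
  move=> k'; apply: smooth_on_entry => //; apply: smooth_on_derive.
  by apply: smooth_on_sub (chart_smooth j) => y [].
apply: smooth_on_comp ok _ _ (conn_smooth hA k j _) => //.
  by move=> y [[_ jy] ky]; exists (Y y).
by apply: smooth_on_sub (chart_smooth j) => y [].
Qed.

Lemma pulled_gauge i j x v : D x -> pdom P i (Y x) -> pdom P j (Y x) ->
  let g y := pfib P i (psec P j (Y y)) in
  differentiable g x /\
  pulled j x v = invmx (g x) *m pulled i x v *m g x + invmx (g x) *m 'D_v g x.
Proof.
move=> Dx ix jx g.
have [dg eg] := pull_diff v (pbundle_smooth hP i j) Dx (conj ix jx).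
split=> //; rewrite /pulled (conn_gauge hA _ ix jx); congr (_ + _ *m _).
by rewrite deriveE // -eg.
Qed.

End Pullback.

(** * The sphere and the radial projection *)

Section Sphere.
Variable R : realType.

(** The exponents -1/2 and 1/2 of the squared norm expressions yield the smoothness of [pr] and of
    the inverse sphere charts. *)
Lemma symbol_powR n k (D : set 'rV[R]_n) (q : 'rV[R]_n -> R) (a : R) : open D ->
  (forall x, D x -> 0 < q x) -> (forall k, symbol 0 k 0 D (fun=> q)) ->
  symbol 0 k 0 D (fun _ x => q x `^ a).
Proof.
move=> oD q0 sq; have dq x : D x -> differentiable q x by move=> Dx; exact: (symbol_diff (sq 1%N) 0).
have dp x b : D x -> differentiable (fun s : R => s `^ b) (q x).
  by move=> Dx; apply/derivable1_diffP; have [] := is_derive1_powR b (q0 x Dx).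
have dqp x b : D x -> differentiable (fun x => q x `^ b) x.
  by move=> Dx; exact: (differentiable_comp (dq x Dx) (dp x b Dx)).
elim: k a => [|k IH] a.
all: have c0 : symbol0 0 0 D (fun (_ : R) x => q x `^ a) by
  split=> // t x Dx; [exact/differentiable_cont/dqp|exact: cst_continuous].
  by split.
apply: symbolS => // [_ x Dx|b]; first exact: dqp.
apply: (symbol_any (lam := 0)); apply: (@symbol_eq _ _ _ _ 0 _ (fun _ x => a * (q x `^ (a - 1) * 'D_(delta_mx 0 b) q x))) => //.
  move=> _ x Dx; rewrite -[RHS]/('D_(delta_mx 0 b) ((fun s => s `^ a) \o q) x).
  rewrite (derive_comp _ (dq x Dx) (dp x a Dx)).
  have -> : 'D_(delta_mx 0 b) q x = 'D_(delta_mx 0 b) q x *: (1 : R) by rewrite /GRing.scale /= mulr1.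
  rewrite (derive_scale _ _ (dp x a Dx)) /GRing.scale /= mulr1.
  by have [_ ->] := is_derive1_powR a (q0 x Dx); ring.
apply: symbol_scale => //; rewrite -(add0r 0); apply: symbol_mul => //.
exact: (symbol_any _ (symbol_derive _ (sq k.+1))).
Qed.

Lemma symbol_enorm2 n k (D : set 'rV[R]_n) : open D -> symbol 0 k 0 D (fun _ x => enorm x ^+ 2).
Proof.
move=> oD; apply: (@symbol_eq _ _ _ _ _ _ (fun _ x => \sum_i x 0 i * x 0 i)) => //.
  by move=> _ x _; rewrite enorm2; apply: eq_bigr => i _; rewrite expr2.
apply: symbol_sum => // i; rewrite -(add0r 0); apply: symbol_mul => //.
all: by apply: (symbol_any (lam := 1)); exact: symbol_coord.
Qed.

Lemma enorm_pr n (x : 'rV[R]_n) : x != 0 -> enorm (pr x) = 1.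
Proof.
move=> x0; rewrite /pr enormZ normfV ger0_norm ?enorm_ge0 // mulVf // enorm_eq0 //.
Qed.

Lemma pr_scale n (x : 'rV[R]_n) s : 0 < s -> pr (s *: x) = pr x.
Proof.
move=> s0; rewrite /pr enormZ gtr0_norm // scalerA invfM; congr (_ *: _).
by rewrite mulrAC mulVf ?mul1r // gt_eqF.
Qed.

Lemma pr_id n (x : 'rV[R]_n) : enorm x = 1 -> pr x = x.
Proof. by move=> x1; rewrite /pr x1 invr1 scale1r. Qed.

Lemma pr_polar n (x : 'rV[R]_n) : x != 0 -> x = enorm x *: pr x.
Proof. by move=> x0; rewrite /pr scalerA divff ?scale1r // enorm_eq0. Qed.

Lemma smooth_pr n : smooth_on (~` [set (0 : 'rV[R]_n)]) (@pr R n).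
Proof.
have oD := @open_punctured R n.
apply: (@smooth_on_eq _ _ _ _ _ (fun x => (enorm x ^+ 2) `^ (- 2^-1) *: x)) => //.
  move=> x /eqP x0; rewrite /pr powRN powR12_sqrt ?sqr_ge0 // sqrtr_sqr.
  by rewrite ger0_norm ?enorm_ge0.
apply: smooth_on_scale => //.
  move=> k; apply: symbol_powR => // [x /eqP x0|k']; last exact: symbol_enorm2.
  by rewrite exprn_gt0 // enorm_gt0.
apply/(smooth_onP 1 _ oD) => k i j; rewrite ord1; exact: symbol_coord.
Qed.

Variable n : nat.
Local Notation S := (sphere R n).

Lemma sphere_pt_smooth j : smooth_on (eball 1) (apt S j).
Proof.
have oD := @open_eball R n 1; apply/(smooth_onP 0 _ oD) => k r l; rewrite ord1.
apply: (@symbol_eq _ _ _ _ _ _ (fun _ y => if unlift j.1 l is Some k then y 0 k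
   else (-1) ^+ j.2 * (1 - enorm y ^+ 2) `^ (2^-1))) => //.
  move=> _ y yD; rewrite mxE; case: (unlift j.1 l) => //.
  rewrite powR12_sqrt // subr_ge0 expr_le1 ?enorm_ge0 //; exact: ltW.
case: (unlift j.1 l) => [c|].
  by apply: (symbol_any (lam := 1)); exact: symbol_coord.
apply: symbol_scale => //; apply: symbol_powR => //.
  move=> y; rewrite /eball /= => yD; rewrite subr_gt0 expr_lt1 ?enorm_ge0 //.
move=> k'; apply: symbol_sub2 => //; [exact: symbol_cst|exact: symbol_enorm2].
Qed.

Lemma sphere_coord2 j x : adom S j x -> enorm (acoord S j x) ^+ 2 = 1 - x 0 j.1 ^+ 2.
Proof.
move=> [x1 _]; have := enorm2 x; rewrite x1 expr1n (bigD1_ord j.1) //= => ->.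
rewrite addrAC subrr add0r enorm2; apply: eq_bigr => k _; by rewrite mxE.
Qed.

Lemma sphere_coord_ball j x : adom S j x -> eball 1 (acoord S j x).
Proof.
move=> jx; have [x1 xj] := jx; rewrite /eball /= -(expr_lt1 (n := 2)) ?enorm_ge0 //.
rewrite (sphere_coord2 jx) gtrBl exprn_even_gt0 //=.
by apply: contraTneq xj => ->; rewrite mulr0 ltxx.
Qed.

Lemma sphere_atlas : atlas_on S (usphere R n.+1).
Proof.
split.
(* The preferred hemisphere is that of a coordinate of largest modulus, which is nonzero on the
   sphere. *)
- move=> x x1; split=> //; rewrite /aat /=; case: arg_maxP => //= i _ hi.
  rewrite -normrEsign normr_gt0; apply: contra_eq_neq x1 => xi0.
  suff -> : x = 0.
    have /eqP -> : enorm (0 : 'rV[R]_n.+1) == 0 by rewrite enorm_eq0.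
    by rewrite eq_sym oner_eq0.
  apply/rowP => l; rewrite mxE; apply/eqP; rewrite -normr_le0.
  by have := hi l isT; rewrite xi0 normr0.
- move=> j x jx; have [x1 xj] := jx; apply/rowP => l; rewrite mxE.
  case: unliftP => [k ->|->]; first by rewrite mxE.
  rewrite (sphere_coord2 jx) subKr sqrtr_sqr.
  case: (j.2) xj => /=; rewrite ?expr1 ?expr0 ?mulN1r ?mul1r ?oppr_gt0 => xj.
    by rewrite ltr0_norm // opprK.
  by rewrite gtr0_norm.
- move=> j k; apply: (@smooth_on_sub _ _ _ (eball 1)).
    by move=> _ [x [jx kx] <-]; exact: sphere_coord_ball.
  have oD := @open_eball R n 1; apply/(smooth_onP 0 _ oD) => k' r l; rewrite ord1.
  apply: (@symbol_eq _ _ _ _ _ _ (fun _ y => apt S j y 0 (lift k.1 l))) => //.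
    by move=> _ y _; rewrite [RHS]mxE.
  by apply: smooth_on_entry => //; exact: sphere_pt_smooth.
Qed.

Lemma pr_smooth_map : smooth_map (euclid R n.+1) S (~` [set 0]) (@pr R n.+1).
Proof.
move=> k; have oD := @open_punctured R n.+1; set D := _ `&` _.
have DE : D = ~` [set 0] `&` [set x : 'rV[R]_n.+1 | 0 < (-1) ^+ k.2 * x 0 k.1].
  apply/seteqP; split=> x [/eqP x0].
    move=> [_]; rewrite /pr mxE mulrCA pmulr_rgt0 ?invr_gt0 ?enorm_gt0 // => xk.
    by split; [apply/eqP|exact: xk].
  move=> xk; split; first exact/eqP.
  split; first exact: enorm_pr.
  by rewrite /pr mxE mulrCA pmulr_rgt0 ?invr_gt0 ?enorm_gt0.
have oS : open D.
  rewrite DE; apply: openI => //.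
  apply: (@open_comp _ _ (fun x : 'rV[R]_n.+1 => (-1) ^+ k.2 * x 0 k.1) [set y | 0 < y]).
    move=> x _; apply: (@continuous_comp _ _ _ (fun x : 'rV[R]_n.+1 => x 0 k.1) (fun y : R => (-1) ^+ k.2 * y)).
      exact: coord_continuous.
    exact: mulrl_continuous.
  exact: open_gt.
split; first exact/mopen_euclid.
apply/smooth_fun_euclid; apply/(smooth_onP 0 _ oS) => k' r l; rewrite ord1.
apply: (@symbol_eq _ _ _ _ _ _ (fun _ y => pr y 0 (lift k.1 l))) => //.
  by move=> _ y _; rewrite [RHS]mxE.
apply: smooth_on_entry => //; apply: smooth_on_sub (@smooth_pr _) => x [].
by [].
Qed.

Lemma pr_sphere (x : 'rV[R]_n.+1) : (~` [set 0]) x -> usphere R n.+1 (pr x).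
Proof. by move=> /eqP x0; exact: enorm_pr. Qed.

Lemma homogeneous0_diff p (W : normedModType R) (f : 'rV[R]_p -> W) (s : R) (x v : 'rV[R]_p) :
  0 < s -> (forall y, f (s *: y) = f y) -> differentiable f (s *: x) ->
  'd f (s *: x) v = s^-1 *: 'd f x v.
Proof.
move=> s0 fs df; have ds : differentiable (fun y : 'rV[R]_p => s *: y) x by [].
have fE : f \o (fun y => s *: y) = f by apply/funext => y; exact: fs.
have dfx : differentiable f x by rewrite -fE; exact: differentiable_comp.
suff h : 'D_v f (s *: x) = s^-1 *: 'D_v f x.
  exact: (etrans (esym (deriveE v df)) (etrans h (congr1 (fun w => s^-1 *: w) (deriveE v dfx)))).
have e : 'D_v (f \o (fun y => s *: y)) x = s *: 'D_v f (s *: x).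
  rewrite (derive_comp _ ds df) -(derive_scale _ _ df); congr ('D_ _ _ _).
  by rewrite deriveZ ?derive_id //; exact: derivable_id.
by rewrite -[X in _ *: 'D_v X x]fE e scalerA mulVf ?scale1r // gt_eqF.
Qed.

Lemma homogeneous0_radial p (W : normedModType R) (f : 'rV[R]_p -> W) (x : 'rV[R]_p) :
  (forall s y, 0 < s -> f (s *: y) = f y) -> differentiable f x -> 'd f x x = 0.
Proof.
move=> fs df; rewrite -(deriveE x df).
have df0 : differentiable f (x + 0 *: x) by rewrite scale0r addr0.
have [_ h] := is_derive_line df0; rewrite scale0r addr0 in h; rewrite -h.
rewrite -(derive_cst (f x) (0 : R) (1 : R)); apply: near_eq_derive.
have : \forall r \near (0 : R), `|r| < 1 by exact: nbhs0_lt.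
apply: filterS => r; rewrite ltr_norml => /andP[r1 _].
by rewrite -{1}[x]scale1r -scalerDl fs // -ltrBlDl sub0r.
Qed.

(** As [pr] is constant along rays, its differential is homogeneous of degree -1. This is the origin
    of the rate -1 of the cone potentials. *)
Lemma tmap_pr_scale (s : R) (x v : 'rV[R]_n.+1) : 0 < s -> x != 0 ->
  tmap (euclid R n.+1) S (@pr R n.+1) (s *: x) v = s^-1 *: tmap (euclid R n.+1) S (@pr R n.+1) x v.
Proof.
move=> s0 x0; have [at_ _ _] := sphere_atlas.
set j := aat S (pr x).
have jx : adom S j (pr x) by apply: at_; apply: pr_sphere; exact/eqP.
have sx0 : s *: x != 0 by rewrite scaler_eq0 gt_eqF.
rewrite /tmap /= (pr_scale x s0) -/j.
have -> : (acoord S j \o @pr R n.+1) \o id = acoord S j \o @pr R n.+1 by [].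
apply: homogeneous0_diff => // [y|]; first by rewrite /comp pr_scale.
apply: (smooth_on_diff (chart_smooth pr_smooth_map j)).
by split; [apply/eqP|rewrite /preimage /= pr_scale].
Qed.

Lemma tmap_pr_radial (x : 'rV[R]_n.+1) : x != 0 -> tmap (euclid R n.+1) S (@pr R n.+1) x x = 0.
Proof.
move=> x0; have [at_ _ _] := sphere_atlas.
set j := aat S (pr x).
have jx : adom S j (pr x) by apply: at_; apply: pr_sphere; exact/eqP.
rewrite /tmap /= -/j.
have -> : (acoord S j \o @pr R n.+1) \o id = acoord S j \o @pr R n.+1 by [].
apply: homogeneous0_radial => [s y s0|]; first by rewrite /comp pr_scale.
by apply: (smooth_on_diff (chart_smooth pr_smooth_map j)); split; [apply/eqP|].
Qed.

End Sphere.

(** * Principal bundles over the cone *)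

Section Bundles.
Variables (R : realType) (m : nat) (G : set 'M[R]_m).
Hypothesis hG : compact_group G.

Lemma invmx_unique (A B : 'M[R]_m) : A *m B = 1%:M -> invmx A = B.
Proof.
by move=> AB; have [Au _] := mulmx1_unit AB; rewrite -[RHS]mul1mx -(mulVmx Au) -mulmxA AB mulmx1.
Qed.

Lemma cgroup_invM g h : G g -> G h -> invmx (g *m h) = invmx h *m invmx g.
Proof.
move=> Gg Gh; apply: invmx_unique.
by rewrite mulmxA -(mulmxA g) mulmxV ?(cgroupU hG) // mulmx1 mulmxV ?(cgroupU hG).
Qed.

(** Gauge transformations compose: transforming [a] by g h is transforming it by g and then by h. *)
Lemma frame_change (g h a dg dh : 'M[R]_m) : G g -> G h ->
  invmx (g *m h) *m a *m (g *m h) + invmx (g *m h) *m (dg *m h + g *m dh) =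
  invmx h *m (invmx g *m a *m g + invmx g *m dg) *m h + invmx h *m dh.
Proof.
move=> Gg Gh; rewrite cgroup_invM // !(mulmxDl, mulmxDr) !mulmxA -!addrA; congr (_ + (_ + _)).
by rewrite mulmxKV // (cgroupU hG Gg).
Qed.

Lemma smooth_on_tr n p q (D : set 'rV[R]_n) (F : 'rV[R]_n -> 'M[R]_(p, q)) : open D ->
  smooth_on D F -> smooth_on D (fun x => (F x)^T).
Proof.
move=> oD h; apply/(smooth_onP 0 _ oD) => k i j.
apply: (@symbol_eq _ _ _ _ _ _ (fun _ x => F x j i)) => // [_ x _|]; first by rewrite mxE.
exact: smooth_on_entry.
Qed.

Variable Q : 'M[R]_m.
Hypothesis hQ : invariant_gram G Q.

Lemma smooth_on_inv n (D : set 'rV[R]_n) (F : 'rV[R]_n -> 'M[R]_m) : open D ->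
  (forall x, D x -> G (F x)) -> smooth_on D F -> smooth_on D (fun x => invmx (F x)).
Proof.
move=> oD GF h; apply: (@smooth_on_eq _ _ _ _ _ (fun x => invmx Q *m (F x)^T *m Q)) => //.
  by move=> x Dx; rewrite [RHS](cgroup_inv hG hQ) //; apply: GF.
apply: smooth_on_mul => //; last exact: smooth_on_cst.
by apply: smooth_on_mul => //; [exact: smooth_on_cst|exact: smooth_on_tr].
Qed.

Section PrincipalBundle.
Variables (T : Type) (n : nat) (N : atlas R T n) (X : set T) (E : Type) (P : pbundle R m T E).
Hypotheses (hN : atlas_on N X) (hP : is_pbundle G N P).

Lemma fib_trans i j e : ptot P e -> pdom P i (pproj P e) -> pdom P j (pproj P e) ->
  pfib P i e = pfib P i (psec P j (pproj P e)) *m pfib P j e.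
Proof.
move=> te ie je; have [Gj _ ej] := pbundle_fib hP te je.
have [ts ps fs] := pbundle_sec hP je.
rewrite -{1}ej; have [|_ h _] := pbundle_fib hP (i := i) ts; first by rewrite ps.
by rewrite h.
Qed.

Lemma fib_inj i e e' : ptot P e -> ptot P e' -> pproj P e = pproj P e' -> pdom P i (pproj P e) ->
  pfib P i e = pfib P i e' -> e = e'.
Proof.
move=> te te' pe ie fe; have [_ _ <-] := pbundle_fib hP te ie.
by rewrite fe pe; have [|_ _ ->] := pbundle_fib hP (i := i) te'; rewrite -?pe.
Qed.

Lemma fibG i e : ptot P e -> pdom P i (pproj P e) -> G (pfib P i e).
Proof. by move=> te ie; have [] := pbundle_fib hP te ie. Qed.

Lemma fib_secG i j x : pdom P i x -> pdom P j x -> G (pfib P i (psec P j x)).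
Proof. by move=> ix jx; have [ts ps _] := pbundle_sec hP jx; apply: fibG; rewrite ?ps. Qed.

Section ConnectionLinear.
Variable A : potentials n P.
Hypothesis hA : is_connection G N A.

Lemma conn_zero i x : pdom P i x -> A i x 0 = 0.
Proof.
move=> ix; have := conn_linear hA 1 0 0 ix; rewrite !scale1r addr0 => h.
by apply: (@addrI _ (A i x 0)); rewrite addr0 -h.
Qed.

Lemma conn_scale i x a v : pdom P i x -> A i x (a *: v) = a *: A i x v.
Proof. by move=> ix; rewrite -[a *: v]addr0 (conn_linear hA _ _ _ ix) conn_zero // addr0. Qed.

End ConnectionLinear.

Lemma mopenI (A B : set T) : mopen N A -> mopen N B -> mopen N (A `&` B).
Proof.
move=> oA oB j; have [_ cK _] := hN.
rewrite (_ : in_chart N j (A `&` B) = in_chart N j A `&` in_chart N j B); first exact: openI.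
apply/seteqP; split=> [_ [x [jx [Ax Bx]] <-]|_ [[x [jx Ax] <-] h]].
  by split; exists x.
exists x => //; split=> //; split=> //; exact: (in_chart_inj hN jx h).
Qed.

End PrincipalBundle.

Section Cone.
Variables (Es : Type) (Ps : pbundle R m 'rV[R]_6 Es) (As : potentials 5 Ps).
Hypotheses (bPs : pbase Ps = usphere R 6) (hPs : is_pbundle G (sphere R 5) Ps)
  (hAs : is_connection G (sphere R 5) As).
Local Notation C := (cone_bundle Ps).
Local Notation A0 := (cone_connection As).

Lemma cone_pbundle : is_pbundle G (euclid R 6) C.
Proof.
have pS := @pr_sphere R 5; have sm := @pr_smooth_map R 5; have sA := @sphere_atlas R 5.
split.
- by move=> p [].
- move=> p g [p0 tp pp] Gg; have [t1 t2] := pbundle_act hPs tp Gg.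
  by split=> //; split=> //=; rewrite t2.
- by move=> [x e] [p0 tp pp] /=; rewrite (pbundle_act1 hPs).
- by move=> [x e] g h [p0 tp pp] Gg Gh /=; rewrite (pbundle_actM hPs).
- move=> x x0; split=> //; apply: (pbundle_at hPs); rewrite bPs; exact: pS.
- by move=> i x [].
- move=> i; apply/mopen_euclid; exact: (pulled_dom_open sA sm pS hPs).
- move=> i x [x0 ix]; have [h1 h2 h3] := pbundle_sec hPs ix; split=> //.
- move=> i [x e] [x0 te pe] [_ ie] /=; rewrite /= in pe ie te.
  have [|h1 h2 h3] := pbundle_fib hPs (i := i) te; first by rewrite pe.
  by split=> //; rewrite -pe h3.
- move=> i j; apply/smooth_fun_euclid.
  have oS := mopenI sA (pbundle_dom_open hPs (i := i)) (pbundle_dom_open hPs (i := j)).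
  apply: smooth_on_sub (pull_smooth sA sm pS oS (pbundle_smooth hPs i j)).
  by move=> x [[x0 ix] [_ jx]].
Qed.

Lemma cone_open i : open (pdom C i).
Proof. by have /mopen_euclid := pbundle_dom_open cone_pbundle (i := i). Qed.

Lemma cone_neq0 i x : pdom C i x -> x != 0.
Proof. by move=> [/eqP]. Qed.

Lemma cone_conic i : conic (pdom C i).
Proof.
move=> s x s0 [/eqP x0 ix]; split; last by rewrite /preimage /= pr_scale.
by apply/eqP; rewrite scaler_eq0 gt_eqF.
Qed.

Lemma cone_pr i x : x != 0 -> pdom C i (pr x) <-> pdom C i x.
Proof.
move=> x0; split=> [h|h].
  by rewrite (pr_polar x0); apply: cone_conic => //; rewrite enorm_gt0.
by apply: cone_conic => //; rewrite invr_gt0 enorm_gt0.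
Qed.

Lemma cone_lie i x v : pdom C i x -> lie_algebra G (A0 i x v).
Proof. by move=> [_ ix]; exact: (pulled_lie hAs v ix). Qed.

Lemma cone_linear i x a u v : pdom C i x -> A0 i x (a *: u + v) = a *: A0 i x u + A0 i x v.
Proof. by move=> [_ ix]; exact: (pulled_linear hAs a u v ix). Qed.

Lemma cone_smooth i v : smooth_on (pdom C i) (A0 i ^~ v).
Proof.
exact: (pulled_smooth (@sphere_atlas R 5) (@pr_smooth_map R 5) (@pr_sphere R 5) hPs hAs i v).
Qed.

Lemma cone_scale i s x v : 0 < s -> pdom C i x -> A0 i (s *: x) v = s^-1 *: A0 i x v.
Proof.
move=> s0 ix; have x0 := cone_neq0 ix; have [_ ix'] := ix.
rewrite /cone_connection /pullback_connection pr_scale // tmap_pr_scale //.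
by rewrite (conn_scale hAs).
Qed.

Lemma cone_radial i x : pdom C i x -> A0 i x x = 0.
Proof.
move=> ix; have x0 := cone_neq0 ix; have [_ ix'] := ix.
by rewrite /cone_connection /pullback_connection tmap_pr_radial // (conn_zero hAs).
Qed.

Lemma cone_gauge i j x v : pdom C i x -> pdom C j x ->
  let g y := pfib C i (psec C j y) in
  differentiable g x /\ A0 j x v = invmx (g x) *m A0 i x v *m g x + invmx (g x) *m 'D_v g x.
Proof.
move=> [x0 ix] [_ jx].
exact: (pulled_gauge (@sphere_atlas R 5) (@pr_smooth_map R 5) (@pr_sphere R 5) hPs hAs v x0 ix jx).
Qed.

End Cone.

(** * The connection of P seen through a framing *)

Section Frame.
Variables (T : topologicalType) (M : atlas R T 6).
Hypothesis hM : atlas_on M setT.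
Variables (E : Type) (P : pbundle R m T E) (A : potentials 6 P).
Hypotheses (hP : is_pbundle G M P) (hA : is_connection G M A).
Variables (E0 : Type) (C : pbundle R m 'rV[R]_6 E0).
Hypothesis hC : is_pbundle G (euclid R 6) C.
Variables (D : set 'rV[R]_6) (Y : 'rV[R]_6 -> T) (Yt : E0 -> E) (Ytinv : E -> E0).
Hypotheses (oD : open D) (hY : smooth_map (euclid R 6) M D Y).
Hypothesis hYt : bundle_iso G (euclid R 6) C P D Y Yt Ytinv.

Definition frame k i x := pfib P k (Yt (psec C i x)).

Definition frame_dom k i := D `&` pdom C i `&` Y @^-1` pdom P k.

Definition frame_potential k i x v : 'M[R]_m :=
  invmx (frame k i x) *m pulled M Y A k x v *m frame k i x
  + invmx (frame k i x) *m 'D_v (frame k i) x.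

Local Notation A1 := (iso_connection (euclid R 6) C M Y Yt A).

Let YT x : D x -> setT (Y x). Proof. by []. Qed.

Lemma bundle_open i : open (pdom C i).
Proof. by have /mopen_euclid := pbundle_dom_open hC (i := i). Qed.

Lemma frame_open k i : open (frame_dom k i).
Proof.
rewrite /frame_dom setIAC; apply: openI; last exact: bundle_open.
by apply: (preimage_open hM hY YT); exact: (pbundle_dom_open hP).
Qed.

Lemma frame_smooth k i : smooth_on (frame_dom k i) (frame k i).
Proof. by have /smooth_fun_euclid := iso_smooth hYt i k. Qed.

Lemma frame_tot i x : D x -> pdom C i x ->
  ptot P (Yt (psec C i x)) /\ pproj P (Yt (psec C i x)) = Y x.
Proof.
move=> Dx ix; have [ts ps _] := pbundle_sec hC ix.
by have := iso_cover hYt ts; rewrite ps => /(_ Dx).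
Qed.

Lemma frameG k i x : frame_dom k i x -> G (frame k i x).
Proof.
move=> [[Dx ix] kx]; have [t p] := frame_tot Dx ix.
by apply: (fibG hP t); rewrite p.
Qed.

Lemma frame_diff k i x : frame_dom k i x -> differentiable (frame k i) x.
Proof. exact: (smooth_on_diff (@frame_smooth k i)). Qed.

Lemma frame_at i x : D x -> pdom C i x -> frame_dom (pat P (Y x)) i x.
Proof.
move=> Dx ix; split=> //; apply: (pbundle_at hP).
by have [t <-] := frame_tot Dx ix; exact: (pbundle_proj hP).
Qed.

Lemma frame_potential_at i x v : D x -> pdom C i x ->
  A1 i x v = frame_potential (pat P (Y x)) i x v.
Proof.
move=> Dx ix; rewrite /iso_connection /frame_potential; congr (_ + _ *m _).
by rewrite deriveE //; exact/frame_diff/frame_at.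
Qed.

(** [iso_connection] uses the preferred trivialization of P at Y x, which may change with x.
    Independence of the trivialization lets k stay fixed near a point, so that smoothness can be
    proved. *)
Lemma frame_potential_indep k k' i x v : frame_dom k i x -> frame_dom k' i x ->
  frame_potential k i x v = frame_potential k' i x v.
Proof.
move=> kx k'x; have [[Dx ix] kYx] := kx; have [_ k'Yx] := k'x.
pose g y := pfib P k (psec P k' (Y y)).
have [dg eg] := pulled_gauge hM hY YT hP hA v Dx kYx k'Yx.
have Gg : G (g x) by exact: (fib_secG hP).
have fE y : frame_dom k i y -> frame_dom k' i y -> frame k i y = g y *m frame k' i y.
  move=> [[Dy iy] ky] [_ k'y]; have [t p] := frame_tot Dy iy.
  by rewrite /frame (fib_trans hP t (i := k) (j := k')) ?p.
have GF' := frameG k'x; have dF' := frame_diff k'x.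
have DE : 'D_v (frame k i) x = 'D_v g x *m frame k' i x + g x *m 'D_v (frame k' i) x.
  rewrite -derive_mulmx //; apply: near_eq_derive.
  have := open_near (openI (@frame_open k i) (@frame_open k' i)) (conj kx k'x) (fun y Dy => Dy).
  by apply: filterS => y [ky k'y]; exact: fE.
rewrite /frame_potential eg (fE _ kx k'x) DE; exact: frame_change.
Qed.

Lemma frame_potential_smooth i v : smooth_on (D `&` pdom C i) (A1 i ^~ v).
Proof.
apply: smooth_on_local => x [Dx ix]; set k := pat P (Y x).
have kx := frame_at Dx ix; have ok := @frame_open k i.
exists (frame_dom k i) => //.
apply: (@smooth_on_eq _ _ _ _ _ (frame_potential k i ^~ v)) => //.
  move=> y ky; have [[Dy iy] _] := ky.
  rewrite (frame_potential_at v Dy iy).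
  exact: (frame_potential_indep v ky (frame_at Dy iy)).
have sf := @frame_smooth k i.
have si := smooth_on_inv ok (@frameG k i) sf.
apply: smooth_on_add => //; apply: smooth_on_mul => //; last exact: smooth_on_derive.
apply: smooth_on_mul => //.
by apply: smooth_on_sub (pulled_smooth hM hY YT hP hA k v) => y [[]].
Qed.

Lemma frame_potential_linear i x a u v : D x -> pdom C i x ->
  A1 i x (a *: u + v) = a *: A1 i x u + A1 i x v.
Proof.
move=> Dx ix; rewrite !frame_potential_at // /frame_potential.
have kx := frame_at Dx ix; have [_ kY] := kx.
rewrite (pulled_linear hA _ _ _ kY) (derive_lin _ _ _ (frame_diff kx)).
by rewrite !(mulmxDl, mulmxDr) -!(scalemxAr, scalemxAl) scalerDr addrACA.
Qed.

Lemma frame_potential_lie i x v : D x -> pdom C i x -> lie_algebra G (A1 i x v).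
Proof.
move=> Dx ix; rewrite frame_potential_at //.
have kx := frame_at Dx ix; have [_ kY] := kx.
apply: (lieD hG).
  by apply: (lieAd hG); [exact: frameG|exact: (pulled_lie hA)].
apply: (lie_log_derive hG); first exact: frame_diff.
exact: (open_near (@frame_open _ _) kx (@frameG _ _)).
Qed.

End Frame.

End Bundles.

(** * The framing change and its differential equation *)

Section Transition.
Variables (R : realType) (m : nat) (G : set 'M[R]_m).
Hypothesis hG : compact_group G.
Variable Q : 'M[R]_m.
Hypothesis hQ : invariant_gram G Q.
Variables (T : topologicalType) (M : atlas R T 6).
Hypothesis hM : atlas_on M setT.

Lemma smooth_map_sub (D D' : set 'rV[R]_6) (Y : 'rV[R]_6 -> T) : open D' -> D' `<=` D ->
  smooth_map (euclid R 6) M D Y -> smooth_map (euclid R 6) M D' Y.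
Proof.
move=> oD' DD sY k; have [/mopen_euclid o1 /smooth_fun_euclid s1] := sY k.
have e : D' `&` Y @^-1` adom M k = D' `&` (D `&` Y @^-1` adom M k).
  by rewrite setIA (setIidl DD).
split; first by apply/mopen_euclid; rewrite e; exact: openI.
by apply/smooth_fun_euclid; apply: smooth_on_sub s1; rewrite e => x [].
Qed.

Lemma tmap_comp (D D2 : set 'rV[R]_6) (Y1 Y2 : 'rV[R]_6 -> T) (Phi : 'rV[R]_6 -> 'rV[R]_6) x v :
  open D -> smooth_map (euclid R 6) M D2 Y2 -> D x ->
  (forall y, D y -> D2 (Phi y) /\ Y2 (Phi y) = Y1 y) -> differentiable Phi x ->
  tmap (euclid R 6) M Y1 x v = tmap (euclid R 6) M Y2 (Phi x) ('D_v Phi x).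
Proof.
move=> oD s2 Dx hPhi dP; have [D2x e] := hPhi x Dx; rewrite /tmap /= e.
set j := aat M (Y1 x); have [at_ _ _] := hM; have jx : adom M j (Y1 x) by exact: at_.
have d2 : differentiable (acoord M j \o Y2) (Phi x).
  by apply: (smooth_on_diff (@chart_smooth _ _ _ _ _ _ _ s2 j)); split=> //; rewrite /preimage /= e.
have ne : \near x, ((acoord M j \o Y2) \o Phi) x = (acoord M j \o Y1) x.
  by apply: (open_near oD Dx) => y /hPhi[_] /= ->.
have [_ e'] := near_eq_diff ne (differentiable_comp dP d2).
have -> : (acoord M j \o Y1) \o id = acoord M j \o Y1 by [].
have -> : (acoord M j \o Y2) \o id = acoord M j \o Y2 by [].
apply: etrans (congr1 (fun f : _ -> _ => f v) e') _.
rewrite (deriveE v dP).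
exact: (congr1 (fun f : _ -> _ => f v) (diff_comp dP d2)).
Qed.

Variables (E : Type) (P : pbundle R m T E) (A : potentials 6 P).
Hypotheses (hP : is_pbundle G M P) (hA : is_connection G M A).
Variables (E0 : Type) (C : pbundle R m 'rV[R]_6 E0).
Hypothesis hC : is_pbundle G (euclid R 6) C.
Variables (D1 D2 D : set 'rV[R]_6) (Y1 Y2 : 'rV[R]_6 -> T).
Variables (Yt1 Yt2 : E0 -> E) (Yt1inv Yt2inv : E -> E0) (Phi : 'rV[R]_6 -> 'rV[R]_6).
Hypotheses (oD1 : open D1) (oD2 : open D2) (oD : open D).
Hypotheses (hY1 : smooth_map (euclid R 6) M D1 Y1) (hY2 : smooth_map (euclid R 6) M D2 Y2).
Hypothesis hYt1 : bundle_iso G (euclid R 6) C P D1 Y1 Yt1 Yt1inv.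
Hypothesis hYt2 : bundle_iso G (euclid R 6) C P D2 Y2 Yt2 Yt2inv.
Hypothesis Y2_inj : forall x y, D2 x -> D2 y -> Y2 x = Y2 y -> x = y.
Hypothesis DD1 : forall x, D x -> D1 x.
Hypothesis hPhi : forall x, D x -> D2 (Phi x) /\ Y2 (Phi x) = Y1 x.
Hypothesis dPhi : forall x, D x -> differentiable Phi x.

Definition frame_shift e := Yt2inv (Yt1 e).
Local Notation tau := frame_shift.

Lemma shift_tot e : ptot C e -> D (pproj C e) ->
  [/\ ptot C (tau e), pproj C (tau e) = Phi (pproj C e) & Yt2 (tau e) = Yt1 e].
Proof.
move=> te De; have [t1 p1] := iso_cover hYt1 te (DD1 De).
have [D2x e2] := hPhi De.
have [|t2 B2 f2] := iso_FVK hYt2 t1; first by exists (Phi (pproj C e)); rewrite // p1.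
split=> //; apply: Y2_inj => //; rewrite e2 -p1 -f2.
by have [_ ->] := iso_cover hYt2 t2 B2.
Qed.

Lemma shift_act e g : ptot C e -> D (pproj C e) -> G g -> tau (pact C e g) = pact C (tau e) g.
Proof.
move=> te De Gg; have [t1 p1 f1] := shift_tot te De; have [t2 p2] := pbundle_act hC t1 Gg.
have D2x : D2 (pproj C (tau e)) by rewrite p1; have [] := hPhi De.
rewrite -[RHS](iso_FK hYt2) //; last by rewrite p2.
by rewrite (iso_act hYt2) // f1 -(iso_act hYt1) //; exact: DD1.
Qed.

Definition shift_matrix i j x := pfib C j (tau (psec C i x)).

Definition shift_dom i j := D `&` pdom C i `&` Phi @^-1` pdom C j.

Lemma shift_sec i x : D x -> pdom C i x ->
  [/\ ptot C (tau (psec C i x)), pproj C (tau (psec C i x)) = Phi x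
    & Yt2 (tau (psec C i x)) = Yt1 (psec C i x)].
Proof.
move=> Dx ix; have [ts ps _] := pbundle_sec hC ix.
by have := shift_tot ts; rewrite ps; apply.
Qed.

Lemma shift_matrixG i j x : shift_dom i j x -> G (shift_matrix i j x).
Proof.
move=> [[Dx ix] jx]; have [t p _] := shift_sec Dx ix.
by apply: (fibG hC t); rewrite p.
Qed.

Lemma shift_dom_open i j : open (shift_dom i j).
Proof.
rewrite /shift_dom openE => x [[Dx ix] jx].
have c := differentiable_cont (dPhi Dx).
have h1 := open_near (openI oD (bundle_open hC (i := i))) (conj Dx ix) (fun y Dy => Dy).
have h2 : \forall y \near x, pdom C j (Phi y).
  exact: (c _ (open_nbhs_nbhs (conj (bundle_open hC (i := j)) jx))).
by apply: filterS2 h1 h2 => y [].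
Qed.

Local Notation A1 := (iso_connection (euclid R 6) C M Y1 Yt1 A).
Local Notation A2 := (iso_connection (euclid R 6) C M Y2 Yt2 A).

(** Both framings see the same connection of P, with value [a]; its two conjugates cancel, and only
    the derivatives of the frames remain. *)
Lemma inverse_frame_derive (f1 f2 df1 df2 a h : 'M[R]_m) : G f1 -> G f2 -> h = invmx f2 *m f1 ->
  invmx f2 *m df1 - invmx f2 *m df2 *m invmx f2 *m f1 =
  h *m (invmx f1 *m a *m f1 + invmx f1 *m df1) - (invmx f2 *m a *m f2 + invmx f2 *m df2) *m h.
Proof.
move=> G1 G2 ->; have u1 := cgroupU hG G1; have u2 := cgroupU hG G2.
rewrite mulmxDl mulmxDr !mulmxA (mulmxK u2) (mulmxK u1) opprD addrACA addrA.
by rewrite subrr add0r.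
Qed.

Lemma shift_frame k i j x : shift_dom i j x -> pdom P k (Y1 x) ->
  frame (P:=P) (C:=C) Yt2 k j (Phi x) *m shift_matrix i j x = frame (P:=P) (C:=C) Yt1 k i x.
Proof.
move=> [[Dx ix] jx] kx; have [t p f] := shift_sec Dx ix.
have [D2x e2] := hPhi Dx.
have [|_ _ e] := pbundle_fib hC (i := j) t; first by rewrite p.
rewrite p in e.
have [ts ps _] := pbundle_sec hC jx.
have Gh : G (shift_matrix i j x) by apply: shift_matrixG.
rewrite /frame -f -e (iso_act hYt2) ?ps //.
have [t2 p2] := frame_tot hC hYt2 D2x jx.
have [|_ h _] := pbundle_fib hP (i := k) t2; first by rewrite p2 e2.
by rewrite h.
Qed.

(** In one trivialization of P near Y1 x = Y2 (Phi x) the matrix is h = f2^-1 f1, where f2 is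
    evaluated along Phi; differentiating the product and substituting the two pulled-back potentials
    gives the formula. *)
Lemma shift_derive i j x v : shift_dom i j x ->
  differentiable (shift_matrix i j) x /\
  'D_v (shift_matrix i j) x = shift_matrix i j x *m A1 i x v
    - A2 j (Phi x) ('D_v Phi x) *m shift_matrix i j x.
Proof.
move=> sx; have [[Dx ix] jx] := sx; have [D2x e2] := hPhi Dx.
set w := 'D_v Phi x; set k := pat P (Y1 x).
have k1 := frame_at hP hC hYt1 (DD1 Dx) ix; rewrite -/k in k1.
have k2 := frame_at hP hC hYt2 D2x jx; rewrite e2 -/k in k2.
have [_ kx] := k1.
pose f1 := frame (P:=P) (C:=C) Yt1 k i; pose f2 := frame (P:=P) (C:=C) Yt2 k j.
have d1 : differentiable f1 x by exact: (frame_diff hYt1 k1).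
have d2 : differentiable f2 (Phi x) by exact: (frame_diff hYt2 k2).
have d2P : differentiable (f2 \o Phi) x by apply: differentiable_comp => //; exact: dPhi.
have G1 : G (f1 x) by exact: (frameG hP hC hYt1 k1).
have dom2 y : shift_dom i j y -> pdom P k (Y1 y) -> frame_dom (P:=P) (C:=C) D2 Y2 k j (Phi y).
  by move=> [[Dy iy] jy] ky; have [D2y ey] := hPhi Dy; split=> //; rewrite /preimage /= ey.
have G2 y : shift_dom i j y -> pdom P k (Y1 y) -> G (f2 (Phi y)).
  by move=> sy ky; exact: (frameG hP hC hYt2 (dom2 y sy ky)).
have hE y : shift_dom i j y -> pdom P k (Y1 y) -> shift_matrix i j y = invmx (f2 (Phi y)) *m f1 y.
  by move=> sy ky; rewrite /f1 -(shift_frame sy ky) mulKmx // (cgroupU hG (G2 y sy ky)).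
have nx : \near x, shift_dom i j x /\ pdom P k (Y1 x).
  have n1 := open_near (@frame_open _ _ _ _ _ hM _ _ hP _ _ hC _ _ hY1 k i) k1 (fun y Dy => Dy).
  have n2 := open_near (@shift_dom_open i j) sx (fun y Dy => Dy).
  by apply: filterS2 n1 n2 => y [_ ky] sy; split.
have nG : \near x, G ((f2 \o Phi) x) by apply: filterS nx => y [sy ky]; exact: G2.
have [di eI] := is_derive_inv hG hQ v d2P nG.
have ne : \near x, invmx ((f2 \o Phi) x) *m f1 x = shift_matrix i j x.
  by apply: filterS nx => y [sy ky]; rewrite hE.
have dh : differentiable (shift_matrix i j) x.
  by have [] := near_eq_diff ne (differentiable_mulmx di d1).
split=> //.
have -> : 'D_v (shift_matrix i j) x = 'D_v (fun y => invmx ((f2 \o Phi) y) *m f1 y) x.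
  by apply: near_eq_derive; apply: filterS ne => y ->.
rewrite (derive_mulmx v di d1) eI (derive_comp v (dPhi Dx) d2).
rewrite (frame_potential_at A hP hC hYt1 v (DD1 Dx) ix).
rewrite (frame_potential_at A hP hC hYt2 w D2x jx) e2 -/k.
have pe : pulled M Y1 A k x v = pulled M Y2 A k (Phi x) w.
  by rewrite /pulled e2 (tmap_comp v oD hY2 Dx hPhi (dPhi Dx)).
rewrite /frame_potential pe -/f1 -/f2 -/w addrC mulNmx.
exact: (inverse_frame_derive _ _ _ G1 (G2 x sx kx) (hE x sx kx)).
Qed.

End Transition.

(** * Comparison of the two framings *)

Section Pieces.
Variables (R : realType) (n : nat).
Implicit Types (x y : 'rV[R]_n) (D Om : set 'rV[R]_n).

Lemma symbol_union k lam D D' f : symbol 1 k lam D f -> symbol 1 k lam D' f ->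
  symbol 1 k lam (D `|` D') f.
Proof.
elim: k lam f => [|k IH] lam f h h'.
all: have [c1 t1 b1 _] := symbol_symbol0 h; have [c2 t2 b2 _] := symbol_symbol0 h'.
all: have f0 : symbol0 1 lam (D `|` D') f.
1,3: split=> // [t x [Dx|Dx]|t x [Dx|Dx]|_]; [exact: c1|exact: c2|exact: t1|exact: t2|].
1,2: have [K K0 hK] := b1 isT; have [K' K0' hK'] := b2 isT.
1,2: exists (K + K') => [|t x [Dx|Dx]]; first exact: addr_ge0.
1,3: by apply: (le_trans (hK t x Dx)); apply: ler_wpM2r; rewrite ?powR_ge0 // lerDl.
1,2: by apply: (le_trans (hK' t x Dx)); apply: ler_wpM2r; rewrite ?powR_ge0 // lerDr.
  by split.
split=> //; split=> [t x [Dx|Dx]|v]; [exact: (symbol_diff h)|exact: (symbol_diff h')|].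
exact: IH (symbol_derive v h) (symbol_derive v h').
Qed.

(** An open cone around the ray through x0, truncated at radius e and without its vertex. It is
    stable under shrinking along rays, and its directions stay in a compact ball around x0. *)
Definition piece x0 (d e : R) : set 'rV[R]_n :=
  [set x | [/\ 0 < enorm x, enorm x < e & `|pr x - x0| < d]].

Definition cball x0 (d : R) : set 'rV[R]_n := [set y | `|y - x0| <= d].

Lemma open_piece x0 d e : open (piece x0 d e).
Proof.
rewrite openE => x [h0 he hd].
have x0' : (~` [set 0]) x by move=> /= xE; rewrite xE (eqP (_ : enorm 0 == 0)) ?ltxx ?enorm_eq0 in h0.
have cpr : {for x, continuous (@pr R n)} by exact/differentiable_cont/(smooth_on_diff (@smooth_pr R n)).
have cd : {for x, continuous (fun y => `|pr y - x0|)}.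
  apply: (@continuous_comp _ _ _ (fun y => pr y - x0) (fun z : 'rV[R]_n => `|z|)); last exact: norm_continuous.
  by apply: (@continuousB _ _ _ (@pr R n) (fun=> x0)); [exact: cpr|exact: cst_continuous].
have n1 : \forall y \near x, 0 < enorm y by exact: (cvgr_gt _ (@enorm_continuous R n x) _ h0).
have n2 : \forall y \near x, enorm y < e by exact: (cvgr_lt _ (@enorm_continuous R n x) _ he).
have n3 : \forall y \near x, `|pr y - x0| < d by exact: (cvgr_lt _ cd _ hd).
by apply: filterS3 n1 n2 n3 => y; split.
Qed.

Lemma piece_neq0 x0 d e x : piece x0 d e x -> x != 0.
Proof. by move=> [h _ _]; rewrite -enorm_gt0. Qed.

Lemma piece_scale x0 d e (s : R) x : 0 < s <= 1 -> piece x0 d e x -> piece x0 d e (s *: x).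
Proof.
move=> /andP[s0 s1] [h0 he hd]; split; rewrite ?pr_scale //.
  by rewrite enormZ gtr0_norm // mulr_gt0.
by apply: le_lt_trans he; rewrite enormZ gtr0_norm // ler_piMl // enorm_ge0.
Qed.

Lemma piece_sub x0 d e d' e' : d <= d' -> e <= e' -> piece x0 d e `<=` piece x0 d' e'.
Proof. by move=> dd ee x [h0 he hd]; split=> //; [exact: lt_le_trans he ee|exact: lt_le_trans hd dd]. Qed.

Lemma piece_cball x0 d e x : piece x0 d e x -> cball x0 d (pr x).
Proof. by move=> [_ _ /ltW]. Qed.

Lemma piece_away x0 d e : away0 1 (piece x0 d e).
Proof. by move=> _ x []. Qed.

Lemma compact_cball x0 d : compact (cball x0 d).
Proof.
have -> : cball x0 d = (fun y => y + x0) @` (@supball R n d).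
  apply/seteqP; split=> [y hy|_ [y hy <-]]; last by rewrite /cball /= addrK.
  by exists (y - x0); rewrite ?subrK.
apply: continuous_compact; last exact: compact_supball.
apply: continuous_subspaceT => y.
by apply: (@continuousD _ _ _ id (fun=> x0)); [exact: cvg_id|exact: cst_continuous].
Qed.

Lemma cball_in Om x0 : open Om -> Om x0 -> exists2 d, 0 < d & cball x0 d `<=` Om.
Proof.
move=> oO Ox; have /nbhs_ballP[e /= e0 he] : nbhs x0 Om by exact: open_nbhs_nbhs.
exists (e / 2) => [|y hy]; first by rewrite divr_gt0.
apply: he; rewrite -ball_normE /= -normrN opprB; apply: le_lt_trans hy _; lra.
Qed.

Lemma polar_dist x x0 : x != 0 -> `|x - enorm x *: x0| = enorm x * `|pr x - x0|.
Proof.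
move=> h; rewrite -[in RHS](ger0_norm (enorm_ge0 x)) -normrZ scalerBr.
by rewrite -(pr_polar h).
Qed.

(** The last condition is |pr x - x0| <= d multiplied by the radius, which keeps it continuous
    everywhere. The part of a piece away from the vertex lies in such a set. *)
Lemma compact_annulus x0 (d a b : R) : compact [set x | [/\ a <= enorm x, enorm x <= b
  & `|x - enorm x *: x0| <= d * enorm x]].
Proof.
apply: (subclosed_compact _ (@compact_supball R n b)); last first.
  by move=> x [_ h _]; exact: le_trans (norm_le_enorm x) h.
have -> : [set x | [/\ a <= enorm x, enorm x <= b & `|x - enorm x *: x0| <= d * enorm x]] =
   (@enorm R n) @^-1` [set s | a <= s] `&` (@enorm R n) @^-1` [set s | s <= b]
   `&` (fun x => d * enorm x - `|x - enorm x *: x0|) @^-1` [set s | 0 <= s].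
  apply/seteqP; split=> [x [h1 h2 h3]|x [[h1 h2] h3]].
    by split; [split|rewrite /preimage /= subr_ge0].
  by split=> //; rewrite /preimage /= subr_ge0 in h3.
have ec := @enorm_continuous R n.
apply: closedI; first apply: closedI.
- by apply: preimage_closed; [move=> x _; exact: ec|exact: closed_ge].
- by apply: preimage_closed; [move=> x _; exact: ec|exact: closed_le].
apply: preimage_closed; last exact: closed_ge.
move=> x _; apply: (@continuousB _ _ _ (fun x => d * enorm x) (fun x => `|x - enorm x *: x0|)).
  by apply: (@continuous_comp _ _ _ (@enorm R n) (fun y : R => d * y)); [exact: ec|exact: mulrl_continuous].
apply: (@continuous_comp _ _ _ (fun x => x - enorm x *: x0) (fun z : 'rV[R]_n => `|z|)); last exact: norm_continuous.
apply: (@continuousB _ _ _ id (fun x => enorm x *: x0)); first exact: cvg_id.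
by apply: (@continuous_comp _ _ _ (@enorm R n) (fun y : R => y *: x0)); [exact: ec|exact: scalel_continuous].
Qed.

(** The inverse of the sum of the inverses lies below every member; the extra 1 covers the empty
    family. *)
Lemma finite_pos_min (I : finType) (e : I -> R) : (forall i, 0 < e i) ->
  exists2 e0, 0 < e0 & forall i, e0 <= e i.
Proof.
move=> e0; have S0 : 0 < \sum_i (e i)^-1 + 1.
  by rewrite ltr_wpDl // sumr_ge0 // => i _; rewrite invr_ge0 ltW.
exists (\sum_i (e i)^-1 + 1)^-1 => [|i]; first by rewrite invr_gt0.
rewrite -[leRHS]invrK lef_pV2 ?posrE ?invr_gt0 // (bigD1 i) //= -addrA lerDl addr_ge0 //.
by rewrite sumr_ge0 // => j _; rewrite invr_ge0 ltW.
Qed.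

Variables (m : nat) (G : set 'M[R]_m).
Hypothesis hG : compact_group G.

Lemma linear_basis (V : lmodType R) (f : 'rV[R]_n -> V) :
  (forall a u v, f (a *: u + v) = a *: f u + f v) ->
  forall v, f v = \sum_b v 0 b *: f (delta_mx 0 b).
Proof.
move=> fl v; have f0 : f 0 = 0.
  have := fl 1 0 0; rewrite !scale1r addr0 => h.
  by apply: (@addrI _ (f 0)); rewrite addr0 -h.
rewrite {1}(row_sum_delta v); elim: (index_enum _) => [|c r IH]; first by rewrite !big_nil f0.
by rewrite !big_cons fl IH.
Qed.

Lemma ncov_smooth D A B I (s : 'rV[R]_n -> 'M[R]_m) : open D ->
  (forall v, smooth_on D (A ^~ v)) -> (forall v, smooth_on D (B ^~ v)) ->
  smooth_on D s -> smooth_on D (ncov B A I s).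
Proof.
move=> oD sA sB ss; elim: I => [|b I IH] //=; rewrite /cov.
apply: smooth_on_add => //; first apply: smooth_on_add => //.
- exact: smooth_on_derive.
- exact: smooth_on_mul.
- by apply: smooth_on_opp => //; exact: smooth_on_mul.
Qed.

Variable Q : 'M[R]_m.
Hypothesis hQ : invariant_gram G Q.
Local Notation g := (lie_algebra G).

(** The inner product is controlled only on the Lie algebra, so iterated covariant derivatives must
    be known to stay there before [nabla_form_norm] can bound them. *)
Lemma ncov_lie D A I (s : 'rV[R]_n -> 'M[R]_m) : open D ->
  (forall v, smooth_on D (A ^~ v)) -> (forall x v, D x -> g (A x v)) ->
  smooth_on D s -> (forall x, D x -> g (s x)) -> forall x, D x -> g (ncov A A I s x).
Proof.
move=> oD sA gA ss gs; elim: I => [|b I IH] //= x Dx.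
have sI := ncov_smooth I oD sA sA ss.
rewrite /cov -addrA; apply: (lieD hG).
  apply: (lie_derive hG); first exact: (smooth_on_diff sI).
  exact: (open_near oD Dx IH).
by apply: (lie_bracket hG hQ); [exact: gA|exact: IH].
Qed.

Variable ip : 'M[R]_m -> 'M[R]_m -> R.
Hypothesis hip : Ad_invariant_inner_product G ip.

(** The bound of order k holds only below a radius depending on k, while the piece is fixed
    beforehand. Near the vertex the bounds on covariant derivatives are converted to ordinary ones;
    the rest of the piece lies in a compact annulus, where smoothness and mu < 0 suffice. *)
Lemma difference_symbol Om (A : 'rV[R]_n -> 'rV[R]_n -> 'M[R]_m) (a : 'rV[R]_n -> 'rV[R]_n -> 'M[R]_m)
    (rho mu d e : R) x0 b k : mu < 0 ->
  open Om -> conic Om -> (forall x, Om x -> x != 0) ->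
  (forall v, smooth_on Om (A ^~ v)) -> (forall x v, Om x -> g (A x v)) ->
  (forall s x v, 0 < s -> Om x -> A (s *: x) v = s^-1 *: A x v) ->
  (forall v, smooth_on (eball rho `&` Om) (a ^~ v)) ->
  (forall x v, (eball rho `&` Om) x -> g (a x v)) ->
  (forall k, exists K e : R, 0 < e /\ forall x, 0 < enorm x < e -> Om x ->
     nabla_form_norm ip A a k x <= K * enorm x `^ (mu - k%:R)) ->
  cball x0 d `<=` Om -> e <= 1 -> e < rho ->
  msymbol 1 k mu (piece x0 d e) (fun _ x => a x (delta_mx 0 b)).
Proof.
move=> mu0 oO cO O0 sA gA hA sa ga ha KO e1 erho.
set D := piece x0 d e; set W := eball rho `&` Om.
have oW : open W by apply: openI => //; exact: open_eball.
have DO x : D x -> Om x.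
  move=> Dx; rewrite (pr_polar (piece_neq0 Dx)); apply: cO; first by case: Dx.
  exact/KO/(piece_cball Dx).
have DW x : D x -> W x by move=> Dx; split; [case: Dx => _ h _; exact: lt_trans h erho|exact: DO].
have hA' c k' : msymbol 1 k' (-1) D (fun _ x => A x (delta_mx 0 c)).
  move=> i j; apply: (@homogeneous_symbol _ _ _ _ (cball x0 d) Om D (fun x => A x (delta_mx 0 c) i j)) => //.
  - exact: open_piece.
  - exact: compact_cball.
  - by move=> x Dx; split; [case: Dx|exact: (piece_cball Dx)].
  - exact: smooth_on_entry.
  - by move=> s x s0 Ox; rewrite hA // mxE powRN powRr1 // ltW.
have [C C0 hC] := ip_norm_bound hG hip.
have nbound I : exists K e : R, [/\ 0 <= K, 0 < e & forall x, 0 < enorm x < e -> W x ->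
    `|ncov A A I (fun y => a y (delta_mx 0 b)) x| <= K * enorm x `^ (mu - (size I)%:R)].
  have [K [e' [e0' hK]]] := ha (size I).
  exists (C * Num.max 0 K), e'; split=> //; first by rewrite mulr_ge0 // le_max lexx.
  move=> x xe Wx; have Ox : Om x by case: Wx.
  have gX J c : g (ncov A A J (fun y => a y (delta_mx 0 c)) x).
    apply: (@ncov_lie W) => //; first by move=> v; apply: smooth_on_sub (sA v) => y [].
      by move=> y v [_ Oy]; exact: gA.
    by move=> y Wy; exact: ga.
  apply: (le_trans (hC _ (gX I b))); rewrite -mulrA; apply: ler_wpM2l => //.
  apply: (@le_trans _ _ (nabla_form_norm ip A a (size I) x)); last first.
    apply: (le_trans (hK x xe Ox)); apply: ler_wpM2r; first exact: powR_ge0.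
    by rewrite le_max lexx orbT.
  rewrite ler_wsqrtr // (bigD1 (in_tuple I)) //= (bigD1 b) //= -addrA lerDl.
  by apply: addr_ge0; do ?[apply: sumr_ge0 => ? _]; apply: (ip_ge0 hG hip); exact: gX.
have [e' e0' hs] : exists2 e', 0 < e' & forall I, (size I <= k)%N -> exists2 K, 0 <= K &
    forall x, 0 < enorm x < e' -> W x ->
    `|ncov A A I (fun y => a y (delta_mx 0 b)) x| <= K * enorm x `^ (mu - (size I)%:R).
  have /choice[eI heI] : forall I, exists e : R, 0 < e /\ exists2 K, 0 <= K & forall x, 0 < enorm x < e -> W x ->
    `|ncov A A I (fun y => a y (delta_mx 0 b)) x| <= K * enorm x `^ (mu - (size I)%:R).
    by move=> I; have [K [e' [? ? ?]]] := nbound I; exists e'; split=> //; exists K.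
  (* The index lists of length at most k form a finite type, so one radius serves all of them. *)
  have [e' e0' he] := @finite_pos_min {j : 'I_k.+1 & j.-tuple 'I_n} (fun s => eI (tagged s)) (fun s => (heI _).1).
  exists e' => // I sI; have [_ [K K0 hK]] := heI I; exists K => // x /andP[x0' xe] Wx.
  apply: hK => //; rewrite x0'; apply: lt_le_trans xe _.
  exact: (he (Tagged (fun j : 'I_k.+1 => j.-tuple 'I_n) (in_tuple I : (Ordinal (sI : (size I < k.+1)%N)).-tuple 'I_n))).
set D1 := D `&` eball e'; set D2 := D `&` [set x | e' / 2 < enorm x].
have oD : open D by exact: open_piece.
have oD1 : open D1 by apply: openI => //; exact: open_eball.
have oD2 : open D2.
  apply: openI => //; apply: (@open_comp _ _ (@enorm R n) [set s | e' / 2 < s]); last exact: open_gt.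
  by move=> x _; exact: enorm_continuous.
have sD c : smooth_on D (fun x => a x (delta_mx 0 c)) by exact: smooth_on_sub (sa _).
have h1 : msymbol 1 k mu D1 (fun _ x => a x (delta_mx 0 b)).
  apply: (@symbol_of_ncov _ _ _ D1 A mu k (fun x => a x (delta_mx 0 b))) => //.
  - by move=> _ x [Dx _]; case: Dx.
  - by move=> c k' i j; apply: symbol_sub (hA' c k' i j) => x [].
  - move=> k'; apply: (proj1 (smooth_onP 0 (fun x => a x (delta_mx 0 b)) oD1)).
    by apply: smooth_on_sub (sD b) => x [].
  - move=> I /hs[K K0 hK]; exists K => // x [Dx xe]; apply: hK; last exact: DW.
    by rewrite xe andbT; case: Dx.
have h2 : msymbol 1 k mu D2 (fun _ x => a x (delta_mx 0 b)).
  move=> i j; apply: (@smooth_symbol _ _ _ _ _ W D2 (fun x => a x (delta_mx 0 b) i j) oD2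
     (@compact_annulus x0 d (e' / 2) e)).
  - move=> x [xa xb xd]; have x0' : 0 < enorm x by apply: lt_le_trans xa; rewrite divr_gt0.
    split; first exact: le_lt_trans xb erho.
    rewrite (pr_polar (_ : x != 0)) -?enorm_gt0 //; apply: cO => //; apply: KO.
    by rewrite /cball /= -(ler_pM2l x0') -polar_dist -?enorm_gt0 // [leRHS]mulrC.
  - move=> x [[x0' xe xd] xa]; split=> //; last by exact: le_trans (ltW xe) e1.
    split; [exact: ltW|exact: ltW|].
    by rewrite polar_dist -?enorm_gt0 // mulrC ler_pM2r // ltW.
  - exact: ltW.
  - by apply: smooth_on_entry => //; exact: sa.
move=> i j; apply: symbol_sub (symbol_union (h1 i j) (h2 i j)) => x Dx.
have [xe|xe] := ltP (enorm x) e'; [left|right]; split=> //=; lra.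
Qed.

End Pieces.

(** * Linear maps preserving omega_0 and Omega_0 *)

Section SpecialUnitary.
Variable R : realType.
Local Notation C := (R[i])%type.

(** The 3 by 3 determinant as an explicit polynomial in its rows, within reach of [ring]. *)
Definition tri (a b c : 'rV[C]_3) : C :=
  let i0 := @inord 2 0 in let i1 := @inord 2 1 in let i2 := @inord 2 2 in
  a 0 i0 * b 0 i1 * c 0 i2 - a 0 i0 * b 0 i2 * c 0 i1 - a 0 i1 * b 0 i0 * c 0 i2
  + a 0 i1 * b 0 i2 * c 0 i0 + a 0 i2 * b 0 i0 * c 0 i1 - a 0 i2 * b 0 i1 * c 0 i0.

Let o3 : [/\ (ord0 : 'I_3) = inord 0, lift (ord0 : 'I_3) ord0 = inord 1
  & lift (ord0 : 'I_3) (lift (ord0 : 'I_2) ord0) = inord 2].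
Proof. by split; apply/val_inj; rewrite /= inordK. Qed.

Lemma det2 (M : 'M[C]_2) :
  \det M = M ord0 ord0 * M ord_max ord_max - M ord0 ord_max * M ord_max ord0.
Proof.
rewrite (expand_det_row _ ord0) !big_ord_recl big_ord0 /cofactor !det_mx11 !mxE /=.
have -> : lift (ord0 : 'I_2) ord0 = ord_max by apply/val_inj.
have -> : lift (ord_max : 'I_2) ord0 = ord0 by apply/val_inj.
by rewrite /bump /= expr0 addn0 expr1 mul1r addr0 mulN1r mulrN.
Qed.

Lemma det3 (M : 'M[C]_3) : \det M = tri (row (inord 0) M) (row (inord 1) M) (row (inord 2) M).
Proof.
have [e0 e1 e2] := o3; rewrite (expand_det_row _ ord0) !big_ord_recl big_ord0 /cofactor !det2.
rewrite /row' /col' !mxE.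
rewrite /tri /row !mxE -e0 -e1 -e2.
have -> : lift (ord0 : 'I_3) ord_max = lift (ord0 : 'I_3) (lift (ord0 : 'I_2) ord0) by apply/val_inj.
have -> : lift (lift (ord0 : 'I_3) ord0) (ord0 : 'I_2) = ord0 by apply/val_inj.
have -> : lift (lift (ord0 : 'I_3) ord0) (ord_max : 'I_2) = lift (ord0 : 'I_3) (lift (ord0 : 'I_2) ord0) by apply/val_inj.
have -> : lift (lift (ord0 : 'I_3) (lift (ord0 : 'I_2) ord0)) (ord0 : 'I_2) = ord0 by apply/val_inj.
have -> : lift (lift (ord0 : 'I_3) (lift (ord0 : 'I_2) ord0)) (ord_max : 'I_2) = lift (ord0 : 'I_3) ord0 by apply/val_inj.
have -> : (-1) ^+ ((ord0 : 'I_3) + (ord0 : 'I_3)) = 1 :> C by rewrite expr0.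
have -> : (-1) ^+ ((ord0 : 'I_3) + lift (ord0 : 'I_3) ord0) = -1 :> C by rewrite expr1.
have -> : (-1) ^+ ((ord0 : 'I_3) + lift (ord0 : 'I_3) (lift (ord0 : 'I_2) ord0)) = 1 :> C.
  by rewrite -signr_odd.
ring.
Qed.

Lemma Omega0E (u v w : 'rV[R]_6) : Omega0 u v w = tri (zcoord u) (zcoord v) (zcoord w).
Proof. by rewrite /Omega0 det3 /tri !mxE !inordK. Qed.

(** Cramer's rule: the three determinants are the coordinates of d in the basis f, g, h. *)
Lemma tri_solve (d f g h : 'rV[C]_3) : tri f g h = 1 -> tri d g h = 0 -> tri d h f = 0 ->
  tri d f g = 0 -> d = 0.
Proof.
move=> t1 t2 t3 t4; have [e0 e1 e2] := o3.
have key l : tri d g h * f 0 l + tri d h f * g 0 l + tri d f g * h 0 l = tri f g h * d 0 l.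
  suff [h0 [h1 h2]] : let P l := tri d g h * f 0 l + tri d h f * g 0 l + tri d f g * h 0 l = tri f g h * d 0 l in
      P (inord 0) /\ P (inord 1) /\ P (inord 2).
    case: l => [[|[|[|//]]] hl].
    - by have -> : Ordinal hl = inord 0 by apply/val_inj; rewrite /= inordK.
    - by have -> : Ordinal hl = inord 1 by apply/val_inj; rewrite /= inordK.
    - by have -> : Ordinal hl = inord 2 by apply/val_inj; rewrite /= inordK.
  by rewrite /tri /=; split; [|split]; ring.
apply/rowP => l; rewrite mxE; have := key l.
by rewrite t1 t2 t3 t4 !mul0r !add0r mul1r.
Qed.

Lemma zcoordD (u v : 'rV[R]_6) : zcoord (u + v) = zcoord u + zcoord v.
Proof. by apply/rowP => j; rewrite !mxE. Qed.

Lemma zcoordZ (a : R) (u : 'rV[R]_6) : zcoord (a *: u) = (a%:C)%C *: zcoord u.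
Proof. by apply/rowP => j; rewrite !mxE; apply/eqP; rewrite eq_complex /= !mul0r subr0 addr0 !eqxx. Qed.

Lemma zcoord_sum (I : Type) (r : seq I) (F : I -> 'rV[R]_6) :
  zcoord (\sum_(i <- r) F i) = \sum_(i <- r) zcoord (F i).
Proof.
elim: r => [|i r IH]; last by rewrite !big_cons zcoordD IH.
by rewrite !big_nil; apply/rowP => j; rewrite !mxE.
Qed.

Definition zbasis (j : 'I_3) : 'rV[R]_6 := delta_mx 0 (inord j.*2).
Definition zbasis' (j : 'I_3) : 'rV[R]_6 := delta_mx 0 (inord j.*2.+1).

Let ltz (j : 'I_3) : (j.*2 < 6)%N. Proof. by case: j => [[|[|[|]]]]. Qed.
Let ltz' (j : 'I_3) : (j.*2.+1 < 6)%N. Proof. by case: j => [[|[|[|]]]]. Qed.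

Let ezz (j k : 'I_3) : ((inord k.*2 : 'I_6) == inord j.*2) = (k == j).
Proof. by rewrite -val_eqE /= !inordK // -[RHS]val_eqE /= (inj_eq double_inj). Qed.
Let ezz' (j k : 'I_3) : ((inord k.*2 : 'I_6) == inord j.*2.+1) = false.
Proof.
rewrite -val_eqE /= !inordK //; apply/eqP => /(congr1 odd) /=.
by rewrite !odd_double.
Qed.
Let ez'z' (j k : 'I_3) : ((inord k.*2.+1 : 'I_6) == inord j.*2.+1) = (k == j).
Proof. by rewrite -val_eqE /= !inordK // eqSS -[RHS]val_eqE /= (inj_eq double_inj). Qed.
Let ez'z (j k : 'I_3) : ((inord k.*2.+1 : 'I_6) == inord j.*2) = false.
Proof. by rewrite eq_sym ezz'. Qed.

Let zE := (ezz, ezz', ez'z', ez'z).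

Lemma zcoord_basis j : zcoord (zbasis j) = delta_mx 0 j.
Proof. by apply/rowP => k; rewrite !mxE !zE /=; case: (k == j). Qed.

Lemma zcoord_basis' j : zcoord (zbasis' j) = 'i%C *: delta_mx 0 j.
Proof.
apply/rowP => k; rewrite !mxE !zE /=; case: (k == j); rewrite ?mulr1 ?mulr0 //.
Qed.

Lemma zdecomp (x : 'rV[R]_6) :
  x = \sum_j (x 0 (inord (j : 'I_3).*2) *: zbasis j + x 0 (inord j.*2.+1) *: zbasis' j).
Proof.
apply/rowP => l; rewrite summxE.
have [k [->|->]] : exists k : 'I_3, l = inord k.*2 \/ l = inord k.*2.+1.
  exists (inord l./2); have l2 : (l./2 < 3)%N by case: l => [[|[|[|[|[|[|]]]]]]].
  rewrite inordK //; case: (boolP (odd l)) => ol; [right|left]; apply/val_inj; rewrite /= inordK //.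
  - by rewrite -[LHS]odd_double_half ol.
  - by case: (l) ol => [[|[|[|[|[|[|]]]]]]].
  - by rewrite -[LHS]odd_double_half (negbTE ol).
  - by case: (l) ol => [[|[|[|[|[|[|]]]]]]].
all: rewrite (bigD1 k) //= big1 ?addr0 => [|j /negbTE jk]; rewrite !mxE !zE /= ?eqxx ?(eq_sym k j) ?jk;
  by rewrite ?mulr1 ?mulr0 ?addr0 ?add0r.
Qed.

Variable U : {linear 'rV[R]_6 -> 'rV[R]_6}.
Hypothesis Uomega : forall u v, omega0 (U u) (U v) = omega0 u v.
Hypothesis UOmega : forall u v w, Omega0 (U u) (U v) (U w) = Omega0 u v w.

Let f j := zcoord (U (zbasis j)).
Let f' j := zcoord (U (zbasis' j)).

Lemma tri_zbasis : tri (f (inord 0)) (f (inord 1)) (f (inord 2)) = 1.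
Proof.
rewrite -Omega0E UOmega Omega0E !zcoord_basis /tri !mxE /= -!val_eqE /= !inordK //=.
by rewrite ?mulr0 ?mul0r ?mulr1 ?subr0 ?addr0.
Qed.

Lemma triZ (a : C) (u v w : 'rV[C]_3) : tri (a *: u) v w = a * tri u v w.
Proof. by rewrite /tri !mxE; ring. Qed.

Lemma triB (u u' v w : 'rV[C]_3) : tri (u - u') v w = tri u v w - tri u' v w.
Proof. by rewrite /tri !mxE; ring. Qed.

(** Omega_0 is complex trilinear and U preserves it, so the vector U (i e_j) - i U e_j has
    determinant zero with any two images of basis vectors. These images form a complex basis, hence
    that vector is 0: a real linear map preserving Omega_0 is complex linear. *)
Lemma complex_linear j : f' j = 'i%C *: f j.
Proof.
apply/eqP; rewrite -subr_eq0; apply/eqP; apply: tri_solve tri_zbasis _ _ _.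
all: rewrite /f /f' triB triZ -!Omega0E !UOmega !Omega0E zcoord_basis' !zcoord_basis triZ subrr //.
Qed.

Definition umatrix : 'M[C]_3 := \matrix_j f j.

Lemma zcoord_umatrix x : zcoord (U x) = zcoord x *m umatrix.
Proof.
rewrite {1}(zdecomp x) linear_sum zcoord_sum mulmx_sum_row; apply: eq_bigr => j _.
rewrite linearD !linearZ zcoordD !zcoordZ -/(f j) -/(f' j) complex_linear rowK scalerA -scalerDl.
congr (_ *: _); rewrite mxE; apply/eqP; rewrite eq_complex /=.
by rewrite !mulr0 !mul0r !mulr1 subr0 !addr0 !add0r !eqxx.
Qed.

(** Invariance of omega_0 on (e_j, i e_k) yields the real parts of the Hermitian products of the
    rows, and on (e_j, e_k) the imaginary parts. *)
Lemma umatrix_unitary : umatrix *m (map_mx (@conjc R) umatrix)^T = 1%:M.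
Proof.
apply/matrixP => j k.
have w1 := Uomega (zbasis j) (zbasis k); have w2 := Uomega (zbasis j) (zbasis' k).
have cl l : (U (zbasis' k)) 0 (inord (l : 'I_3).*2) = - (U (zbasis k)) 0 (inord l.*2.+1) /\
    (U (zbasis' k)) 0 (inord l.*2.+1) = (U (zbasis k)) 0 (inord l.*2).
  have := complex_linear k; move/rowP/(_ l); rewrite !mxE => /eqP; rewrite eq_complex /=.
  by rewrite !mul0r !mul1r sub0r add0r => /andP[/eqP ? /eqP ?].
have e1 : omega0 (zbasis j) (zbasis k) = 0.
  by rewrite /omega0 big1 // => l _; rewrite !mxE !zE /= !mulr0 subr0.
have e2 : omega0 (zbasis j) (zbasis' k) = (j == k)%:R.
  rewrite /omega0 (bigD1 j) //= big1 ?addr0 => [|l lj]; rewrite !mxE !zE /= ?eqxx ?(negbTE lj) ?mul0r ?subr0 ?mul1r //.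
rewrite {}e1 /omega0 in w1; rewrite {}e2 /omega0 in w2.
have S : forall (F : 'I_3 -> C), \sum_l F l = ((\sum_l complex.Re (F l)) +i* (\sum_l complex.Im (F l)))%C.
  move=> F; elim: (index_enum _) => [|l r IH]; first by rewrite !big_nil.
  by rewrite !big_cons IH; case: (F l).
rewrite !mxE S; apply/eqP; rewrite eq_complex; apply/andP; split; apply/eqP => /=.
  transitivity ((j == k)%:R : R); last by case: (j == k).
  rewrite -w2; apply: eq_bigr => l _; have [-> ->] := cl l; rewrite !mxE /=; ring.
transitivity (- 0 : R); last by rewrite oppr0; case: (j == k).
rewrite -[in RHS]w1 -sumrN; apply: eq_bigr => l _; rewrite !mxE /=; ring.
Qed.

Lemma structure_preserving_SU3 : SU3 U.
Proof.
exists umatrix; last exact: zcoord_umatrix.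
split; first exact: umatrix_unitary.
by rewrite det3 !rowK tri_zbasis.
Qed.

Lemma zcoord_norm (x : 'rV[R]_6) :
  (zcoord x *m (map_mx (@conjc R) (zcoord x))^T) 0 0 = ((enorm x ^+ 2)%:C)%C.
Proof.
have xl (k l : 'I_6) : val k = val l -> x 0 k = x 0 l by move=> /val_inj ->.
have enE : enorm x ^+ 2 = \sum_(j < 3) (x 0 (inord j.*2) ^+ 2 + x 0 (inord j.*2.+1) ^+ 2).
  rewrite enorm2 !big_ord_recl !big_ord0 !addr0 -!addrA /=.
  by do 5?[congr (_ + _)]; congr (_ ^+ 2); apply: xl; rewrite /= inordK.
rewrite {}enE mxE; elim/big_ind2: _ => //.
  by move=> a b c d -> ->; apply/eqP; rewrite eq_complex /= !addr0 !eqxx.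
move=> j _; rewrite !mxE; apply/eqP; rewrite eq_complex /=; apply/andP; split; apply/eqP; ring.
Qed.

(** This makes U act on the unit sphere and commute with the radial projection. *)
Lemma structure_preserving_enorm x : enorm (U x) = enorm x.
Proof.
apply/eqP; rewrite -(eqrXn2 (n := 2)) ?enorm_ge0 //; apply/eqP.
suff : ((enorm (U x) ^+ 2)%:C)%C = ((enorm x ^+ 2)%:C)%C :> C by move=> [].
rewrite -!zcoord_norm zcoord_umatrix map_mxM trmx_mul mulmxA -(mulmxA (zcoord x)).
by rewrite umatrix_unitary mulmx1.
Qed.

End SpecialUnitary.

(** * The segments from Phi x to U x inside a cone around U x0 *)

Section SegmentPiece.
Variables (R : realType) (n : nat).
Variables (U : {linear 'rV[R]_n -> 'rV[R]_n}) (Phi : 'rV[R]_n -> 'rV[R]_n) (W : set 'rV[R]_n) (r : R).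
Hypotheses (oW : open W) (r0 : 0 < r) (rW : supball r `<=` W).
Hypotheses (sPhi : smooth_on W Phi) (Phi0 : Phi 0 = 0) (dPhi0 : forall v, 'D_v Phi 0 = U v).
Hypothesis enU : forall x, enorm (U x) = enorm x.

Lemma smooth_on_linear (D : set 'rV[R]_n) : open D -> smooth_on D U.
Proof.
move=> oD; apply: (@smooth_on_eq _ _ _ _ _ (fun x => \sum_b x 0 b *: U (delta_mx 0 b))) => //.
  by move=> x _; rewrite {2}(row_sum_delta x) linear_sum; apply: eq_bigr => b _; rewrite linearZ.
apply: smooth_on_sum => // b; apply: smooth_on_scale => //; last exact: smooth_on_cst.
by move=> k; apply: (symbol_any (lam := 1)); exact: symbol_coord.
Qed.

Let Dr x0 (d e : R) : e <= 1 -> e <= r -> forall x : 'rV[R]_n, piece x0 d e x -> [/\ `|x| <= r, 0 < enorm x & enorm x <= 1].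
Proof.
move=> e1 er x [h0 he _]; split=> //; last exact: le_trans (ltW he) e1.
by apply: (le_trans (norm_le_enorm x)); exact: le_trans (ltW he) er.
Qed.

Lemma piece_Phi x0 (d e : R) b k : e <= 1 -> e <= r -> symbol 1 k 1 (piece x0 d e) (fun _ x => Phi x 0 b).
Proof.
move=> e1 er; apply: (symbol_vanish1 k (@open_piece _ _ x0 d e) rW (Dr e1 er)).
  by move=> k'; exact: smooth_on_entry.
by rewrite Phi0 mxE.
Qed.

Lemma piece_defect x0 (d e : R) b k : e <= 1 -> e <= r ->
  symbol 1 k 2 (piece x0 d e) (fun _ x => (U x - Phi x) 0 b).
Proof.
move=> e1 er.
have sw : smooth_on W (fun x => U x - Phi x).
  by apply: smooth_on_add => //; [exact: smooth_on_linear|exact: smooth_on_opp].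
have W0 : W 0 by apply: rW; rewrite /supball /= normr0 ltW.
apply: (symbol_vanish2 k (@open_piece _ _ x0 d e) rW (Dr e1 er)).
- by move=> k'; exact: smooth_on_entry.
- by rewrite Phi0 linear0 subrr mxE.
move=> c; have dw := smooth_on_diff sw W0.
have dU : differentiable U (0 : 'rV[R]_n) by exact: (smooth_on_diff (smooth_on_linear oW) W0).
have dP := smooth_on_diff sPhi W0.
rewrite -derive_entry // -[X in 'D__ X 0]/(U \- Phi).
rewrite deriveB; [|exact: diff_derivable|exact: diff_derivable].
rewrite dPhi0 deriveE // diff_lin ?subrr ?mxE //; exact: linear_rV_continuous.
Qed.

(** A point of the segment is U x - (1 - t) (U x - Phi x). Divided by r it is close to U x0: the
    first term by continuity of U on directions, the second because the defect is O(r^2). *)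
Lemma segment_piece x0 (d1 e1 d2 e2 : R) : enorm x0 = 1 -> 0 < d1 -> 0 < e1 -> 0 < d2 -> 0 < e2 ->
  exists d e : R, [/\ 0 < d <= d1, 0 < e <= e1, e <= 1, e <= r
    & forall t x, -1 <= t <= 2 -> piece x0 d e x ->
      piece (U x0) d2 e2 (Phi x + t *: (U x - Phi x)) /\
      2^-1 * enorm x <= enorm (Phi x + t *: (U x - Phi x)) <= 2 * enorm x].
Proof.
move=> x01 d10 e10 d20 e20.
set ea := Num.min 1 r; have ea0 : 0 < ea by rewrite lt_min ltr01.
have [ea1 ear] : ea <= 1 /\ ea <= r by split; rewrite ge_min lexx ?orbT.
have [K K0 hK] : exists2 K, 0 <= K & forall x, piece x0 d1 ea x -> `|U x - Phi x| <= K * enorm x ^+ 2.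
  have hd i j : symbol 1 0 2 (piece x0 d1 ea) (fun _ x => (U x - Phi x) i j).
    by rewrite ord1; exact: piece_defect.
  have [K K0 hK] := msymbol_bound (F := fun _ x => U x - Phi x) (isT : (0 < 1)%N) hd.
  by exists K => // x /(hK 0); rewrite powR_mulrn ?enorm_ge0.
(* Rescaled points near the unit vector U x0 have norm between 1/2 and 2, which gives the comparison
   of radii, and a direction close to U x0. *)
have [d3 d30 hd3] : exists2 d3, 0 < d3 & cball (U x0) d3 `<=` piece (U x0) d2 2 `&` [set y | 2^-1 < enorm y].
  apply: cball_in.
    apply: openI; first exact: open_piece.
    by apply: (@open_comp _ _ (@enorm R n) [set s | 2^-1 < s]); [move=> x _; exact: enorm_continuous|exact: open_gt].
  by split; [split; rewrite ?enU ?x01 ?pr_id ?enU ?subrr ?normr0 //; lra|rewrite /= enU x01; lra].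
have [d4 d40 hd4] : exists2 d4, 0 < d4 & forall y, `|y - x0| < d4 -> `|U y - U x0| <= d3 / 2.
  have /(@cvgrPdist_le _ _ _ (nbhs (x0 : 'rV[R]_n)))/(_ (d3 / 2)) := @linear_rV_continuous _ _ _ U x0.
  move=> /(_ ltac:(by rewrite divr_gt0))/nbhs_ballP[d4 /= d40 h]; exists d4 => // y yd.
  by rewrite -normrN opprB; apply: h; rewrite -ball_normE /= -normrN opprB.
(* Half of the tolerance d3 is left to the defect, at most 2 K r after division by r, as |1 - t| <=
   2; this fixes [e3]. The bound e2 / 2 matches the factor 2 in the comparison of radii. *)
set d := Num.min d1 d4; set e3 := d3 / (4 * (K + 1)); set e := Num.min (Num.min e1 ea) (Num.min (e2 / 2) e3).
have K1 : 0 < K + 1 by rewrite ltr_wpDl.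
have e30 : 0 < e3 by rewrite divr_gt0 // mulr_gt0.
have e3E : 2 * (K + 1) * e3 = d3 / 2 by rewrite /e3; field; rewrite gt_eqF.
clearbody ea e3.
have [dd1 dd4] : d <= d1 /\ d <= d4 by split; rewrite ge_min lexx ?orbT.
have [ee1 eea ee2 ee3] : [/\ e <= e1, e <= ea, e <= e2 / 2 & e <= e3].
  by split; rewrite !ge_min lexx ?orbT.
exists d, e; split.
- by rewrite lt_min d10 d40.
- by rewrite ee1 !lt_min e10 ea0 e30 divr_gt0.
- exact: le_trans eea ea1.
- exact: le_trans eea ear.
move=> t x t12 Dx; have [xp xe xd] := Dx.
have Dx' : piece x0 d1 ea x by exact: (piece_sub dd1 eea).
set z := Phi x + _; set s := enorm x in xp xe *.
have zE : z = U x - (1 - t) *: (U x - Phi x).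
  by apply/rowP => c; rewrite /z !mxE; ring.
have zs : `|s^-1 *: z - U x0| <= d3.
  have -> : s^-1 *: z - U x0 = (U (pr x) - U x0) - s^-1 *: ((1 - t) *: (U x - Phi x)).
    have Upr : U (pr x) = s^-1 *: U x by rewrite /pr linearZ.
    by rewrite Upr zE; apply/rowP => c; rewrite !mxE; ring.
  apply: (le_trans (ler_normB _ _)); rewrite [leRHS](_ : _ = d3 / 2 + d3 / 2); last by lra.
  apply: lerD; first by apply: hd4; exact: lt_le_trans xd dd4.
  rewrite !normrZ gtr0_norm ?invr_gt0 //.
  have t2 : `|1 - t| <= 2 by rewrite ler_norml; lra.
  apply: (@le_trans _ _ (s^-1 * (2 * (K * s ^+ 2)))).
    have si : 0 <= s^-1 by rewrite invr_ge0; exact: ltW.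
    by apply: (ler_wpM2l si); apply: ler_pM => //; exact: hK.
  have -> : s^-1 * (2 * (K * s ^+ 2)) = 2 * K * s by field; rewrite gt_eqF.
  apply: (@le_trans _ _ (2 * (K + 1) * e3)).
    apply: ler_pM; [by rewrite mulr_ge0|exact: ltW|by rewrite ler_wpM2l // lerDl|].
    by apply: ltW; exact: lt_le_trans xe ee3.
  by rewrite e3E.
have [[p1 p2 p3] p4] := hd3 _ zs; rewrite /= in p4.
have en : enorm (s^-1 *: z) = s^-1 * enorm z by rewrite enormZ gtr0_norm ?invr_gt0.
rewrite {}en in p1 p2 p4; rewrite pr_scale ?invr_gt0 // in p3.
have q2 : enorm z < 2 * s by rewrite mulrC; rewrite ltr_pdivrMl in p2.
have q4 : 2^-1 * s < enorm z by rewrite mulrC; rewrite ltr_pdivlMl in p4.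
split; last by rewrite !ltW.
split=> //; first by rewrite pmulr_rgt0 ?invr_gt0 in p1.
by apply: (lt_le_trans q2); lra.
Qed.

End SegmentPiece.

Lemma near_between (R : realType) (a b t : R) : a < t < b -> \forall s \near t, a < s < b.
Proof.
move=> /andP[a1 a2].
have n1 : \forall s \near t, a < s by exact: (cvgr_gt _ (@cvg_id _ (nbhs t)) _ a1).
have n2 : \forall s \near t, s < b by exact: (cvgr_lt _ (@cvg_id _ (nbhs t)) _ a2).
by apply: filterS2 n1 n2 => s s1 s2; apply/andP; split.
Qed.

(** * Parallel transport from the matrix equation *)

Section ParallelTransport.
Variables (R : realType) (m n : nat) (G : set 'M[R]_m).
Hypothesis hG : compact_group G.
Variable Q : 'M[R]_m.
Hypothesis hQ : invariant_gram G Q.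
Variables (E : Type) (C : pbundle R m 'rV[R]_n E) (A : potentials n C).
Hypothesis hC : is_pbundle G (euclid R n) C.
Hypothesis gaugeA : forall i j x v, pdom C i x -> pdom C j x ->
  let g y := pfib C i (psec C j y) in
  differentiable g x /\ A j x v = invmx (g x) *m A i x v *m g x + invmx (g x) *m 'D_v g x.
Variables (j : pidx C) (z z' : 'rV[R]_n) (y : R -> 'M[R]_m).
Let c (t : R) := z + t *: (z' - z).
Let B (t : R) := - A j (c (clamp t)) (z' - z).
Hypothesis cj : forall t, -1 <= t <= 2 -> pdom C j (c t).
Hypothesis hy : ode_solution B B y.
Hypothesis Gy : forall t : R, -1 < t < 2 -> G (1%:M + y t).

Let open_dom i : open (pdom C i).
Proof. by have /mopen_euclid := pbundle_dom_open hC (i := i). Qed.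

Let c0 : c 0 = z. Proof. by rewrite /c scale0r addr0. Qed.
Let c1 : c 1 = z'. Proof. by rewrite /c scale1r addrC subrK. Qed.

Let y0 : 1%:M + y 0 = 1%:M.
Proof. by have [-> _ _ _] := hy; rewrite addr0. Qed.

Let dP (t : R) : -1 < t < 2 -> is_derive t (1 : R) (fun t => 1%:M + y t) (- A j (c t) (z' - z) *m (1%:M + y t)).
Proof.
move=> t12; have [_ _ _ dy] := hy; have dyt := dy t t12.
have t12' : -1 <= t <= 2 by case/andP: t12 => /ltW -> /ltW ->.
have e : B t *m y t + B t = - A j (c t) (z' - z) *m (1%:M + y t).
  by rewrite mulmxDr mulmx1 addrC /B (clamp_id t12').
by have := is_deriveD (is_derive_cst (1%:M : 'M[R]_m) t (1 : R)) dyt; rewrite add0r e.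
Qed.

(** The curve is written in the single frame j; in any other frame the gauge law of the connection
    turns its equation into the required one. *)
Lemma parallel_transport_exists e : ptot C e -> pproj C e = z ->
  exists e', parallel_transport A z z' e e'.
Proof.
move=> te pe; have pj : pdom C j (pproj C e) by rewrite pe -c0; apply: cj; apply/andP; split; lra.
have [Gp _ ep] := pbundle_fib hC te pj.
pose p t := (1%:M + y t) *m pfib C j e.
pose q t := pact C (psec C j (c t)) (p t).
(* The solution lives on (-1, 2), which contains (-1/2, 3/2). *)
exists (q 1), (2^-1) => //; exists q; split=> //.
  by rewrite /q /p c0 y0 mul1mx -{1}pe.
move=> t /andP[t1 t2].
have t12 : -1 < t < 2 by apply/andP; split; lra.
have jt : pdom C j (c t) by apply: cj; case/andP: t12 => /ltW -> /ltW ->.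
have Gpt s : -1 < s < 2 -> G (p s) by move=> s12; apply: (cgroupM hG); [exact: Gy|].
have [ts ps fs] := pbundle_sec hC jt.
have [tq pq] := pbundle_act hC ts (Gpt t t12).
split=> // [|i it]; first by rewrite pq ps.
pose g x := pfib C i (psec C j x).
have [dg eg] := gaugeA (z' - z) it jt; rewrite -/(g _) in eg.
have Gg : G (g (c t)) by exact: (fib_secG hC).
have dgc : is_derive t (1 : R) (fun s => g (c s)) ('D_(z' - z) g (c t)) by exact: is_derive_line.
have dp := is_derive_mulmx (dP t12) (is_derive_cst (pfib C j e) t (1 : R)).
rewrite mulmx0 addr0 in dp.
have := is_derive_mulmx dgc dp.
have -> : 'D_(z' - z) g (c t) *m p t + g (c t) *m (- A j (c t) (z' - z) *m (1%:M + y t) *m pfib C j e)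
   = - (A i (c t) (z' - z) *m (g (c t) *m p t)).
  have e1 : g (c t) *m A j (c t) (z' - z) = A i (c t) (z' - z) *m g (c t) + 'D_(z' - z) g (c t).
    rewrite eg mulmxDr !mulmxA mulmxV ?(cgroupU hG) // !mul1mx //.
  rewrite -mulmxA -/(p t) mulmxA mulmxN mulNmx e1 mulmxDl opprD addrA addrC addrA addNr add0r.
  by rewrite mulmxA.
have fE s : -1 < s < 2 -> pdom C i (c s) -> pdom C j (c s) -> pfib C i (q s) = g (c s) *m p s.
  move=> s12 is_ js; have [ts' ps' _] := pbundle_sec hC js.
  have [|_ h _] := pbundle_fib hC (i := i) ts'; first by rewrite ps'.
  by rewrite /q h //; exact: Gpt.
rewrite -(fE t t12 it jt); apply: near_eq_is_derive => //.
have cc : {for t, continuous c}.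
  apply: (@continuousD _ _ _ (fun=> z) (fun s : R => s *: (z' - z))); first exact: cst_continuous.
  exact: scalel_continuous.
have n1 : \forall s \near t, pdom C i (c s) by exact: (cc _ (open_nbhs_nbhs (conj (@open_dom i) it))).
have n2 : \forall s \near t, pdom C j (c s) by exact: (cc _ (open_nbhs_nbhs (conj (@open_dom j) jt))).
have n3 := near_between t12.
by apply: filterS3 n1 n2 n3 => s ? ? ?; rewrite fE.
Qed.

(** Uniqueness: multiplying any parallel curve by the inverse of 1 + y gives a curve with zero
    derivative, hence the same value at times 0 and 1. *)
Lemma parallel_transport_fib e e' : ptot C e -> parallel_transport A z z' e e' ->
  [/\ ptot C e', pproj C e' = z' & pfib C j e' = (1%:M + y 1) *m pfib C j e].
Proof.
move=> te [d d0 [q [q0 q1 hq]]].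
have in1 : - d < 1 < 1 + d by apply/andP; split; lra.
have in0 : - d < 0 < 1 + d by apply/andP; split; lra.
have [t1 p1 _] := hq 1 in1; rewrite q1 -/(c 1) c1 in t1 p1; split=> //.
pose r t := pfib C j (q t).
pose s t := invmx (1%:M + y t) *m r t.
have ds (t : R) : 0 <= t <= 1 -> is_derive t (1 : R) s 0.
  move=> /andP[ta tb].
  have tin : - d < t < 1 + d by apply/andP; split; lra.
  have t12 : -1 < t < 2 by apply/andP; split; lra.
  have jt : pdom C j (c t) by apply: cj; case/andP: t12 => /ltW -> /ltW ->.
  have [_ _ /(_ j jt) dr] := hq t tin.
  have dPt := dP t12.
  have dPd : differentiable (fun t => 1%:M + y t) t by apply/derivable1_diffP; case: dPt.
  have nG : \forall t \near t, G (1%:M + y t) by apply: filterS (near_between t12) => s' ; exact: Gy.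
  have [di eI] := is_derive_inv hG hQ (1 : R) dPd nG.
  have dI : is_derive t (1 : R) (fun t => invmx (1%:M + y t)) (invmx (1%:M + y t) *m A j (c t) (z' - z)).
    split; first exact: diff_derivable.
    rewrite eI (derive_val (is_derive := dPt)) mulNmx mulmxN mulNmx opprK.
    by rewrite mulmxA mulmxK // (cgroupU hG) //; exact: Gy.
  have := is_derive_mulmx dI dr.
  by rewrite mulmxN mulmxA subrr.
have se : s 1 = s 0.
  apply/matrixP => a b; apply/eqP; rewrite -subr_eq0 -normr_le0.
  have -> : s 1 a b - s 0 a b = (s 1) a b - (s 0) a b by [].
  have := @mvt_le R (fun t => s t a b) (fun=> 0) 0 1 0 ler01.
  rewrite mul0r; apply=> t t01; last by rewrite normr0.
    apply: continuous_entry; apply: differentiable_cont; apply/derivable1_diffP.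
    by have [] := ds t t01.
  have t01' : 0 <= t <= 1 by case/andP: t01 => /ltW -> /ltW ->.
  by have := is_derive_entry a b (ds t t01'); rewrite mxE.
have G1 : G (1%:M + y 1) by apply: Gy; apply/andP; split; lra.
have r1 : r 1 = (1%:M + y 1) *m s 1 by rewrite /s mulmxA mulmxV ?mul1mx // (cgroupU hG G1).
by rewrite -q1 -/(r 1) r1 se /s y0 invmx1 mul1mx /r q0.
Qed.

End ParallelTransport.

(* In the frames [i] and [j], over the truncated cone [D], [F] is the matrix of the
   framing change followed by parallel transport, and [h] is its radial limit. *)
Definition local_comparison (R : realType) (m : nat) (G : set 'M[R]_m) (Es : Type)
    (Ps : pbundle R m 'rV[R]_6 Es) (As : potentials 5 Ps) (mu : R)
    (U : {linear 'rV[R]_6 -> 'rV[R]_6}) (Phi : 'rV[R]_6 -> 'rV[R]_6)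
    (tau : 'rV[R]_6 * Es -> 'rV[R]_6 * Es) (i j : pidx (cone_bundle Ps))
    (D : set 'rV[R]_6) (F h : 'rV[R]_6 -> 'M[R]_m) :=
  let C := cone_bundle Ps in let A0 := cone_connection As in
  let B := rotated U (A0 j) in
  [/\ forall x, D x -> [/\ pdom C i x, pdom C j (U x) & G (h x)],
      forall e, ptot C e -> D (pproj C e) ->
        exists e', parallel_transport A0 (Phi (pproj C e)) (U (pproj C e)) (tau e) e',
      forall e e', ptot C e -> D (pproj C e) ->
        parallel_transport A0 (Phi (pproj C e)) (U (pproj C e)) (tau e) e' ->
        [/\ ptot C e', pproj C e' = U (pproj C e) & pfib C j e' = F (pproj C e) *m pfib C i e],
      is_radial_limit D F mu h
    & [/\ smooth_on D h,
          forall x v, D x -> cov B (A0 i) v h x = 0,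
          forall t x, 0 < t <= 1 -> D x -> h (t *: x) = h x,
          forall I x, D x -> differentiable (ncov B (A0 i) I (fun y => F y - h y)) x
        & forall k, exists2 K, 0 <= K & forall I, size I = k -> forall x, D x ->
            `|ncov B (A0 i) I (fun y => F y - h y) x| <= K * enorm x `^ (mu + 1 - k%:R)]].

(** * The comparison of the two framings on a truncated cone *)

Section Comparison.
Variables (R : realType) (m : nat) (G : set 'M[R]_m).
Hypothesis hG : compact_group G.
Variable ip : 'M[R]_m -> 'M[R]_m -> R.
Hypothesis hip : Ad_invariant_inner_product G ip.
Variable Q : 'M[R]_m.
Hypothesis hQ : invariant_gram G Q.
Variables (Z : topologicalType) (M : atlas R Z 6).
Hypothesis hM : is_manifold M.
Variables (omega : form2 R Z 6) (Omega : cform3 R Z 6).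
Variables (E : Type) (P : pbundle R m Z E) (A : potentials 6 P).
Hypotheses (hP : is_pbundle G M P) (hA : is_connection G M A).
Variables (Es : Type) (Ps : pbundle R m 'rV[R]_6 Es) (As : potentials 5 Ps).
Hypotheses (bPs : pbase Ps = usphere R 6) (hPs : is_pbundle G (sphere R 5) Ps)
  (hAs : is_connection G (sphere R 5) As).
Variables (mu : R) (s : Z) (rho : R).
Hypotheses (mu1 : -1 < mu) (mu0 : mu < 0).
Variables (Y1 Y2 : 'rV[R]_6 -> Z) (Y1inv Y2inv : Z -> 'rV[R]_6).
Hypotheses (hY1 : SU3_coordinates M omega Omega s rho Y1 Y1inv)
  (hY2 : SU3_coordinates M omega Omega s rho Y2 Y2inv).
Variables (Yt1 Yt2 : 'rV[R]_6 * Es -> E) (Yt1inv Yt2inv : E -> 'rV[R]_6 * Es).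
Local Notation C := (cone_bundle Ps).
Local Notation A0 := (cone_connection As).
Hypotheses (hYt1 : bundle_iso G (euclid R 6) C P (punctured_ball rho) Y1 Yt1 Yt1inv)
  (hYt2 : bundle_iso G (euclid R 6) C P (punctured_ball rho) Y2 Yt2 Yt2inv).
Hypotheses (hA1 : asymptotic ip M A As mu Y1 Yt1) (hA2 : asymptotic ip M A As mu Y2 Yt2).

Definition chart_change := Y2inv \o Y1.
Local Notation Phi := chart_change.

Definition tangent_change : {linear 'rV[R]_6 -> 'rV[R]_6} := 'd Phi 0.
Local Notation U := tangent_change.

Definition change_dom := eball rho `&` Y1 @^-1` (Y2 @` eball rho).
Local Notation W := change_dom.

Lemma manifold_atlas : atlas_on M setT.
Proof.
by split; [move=> x _; exact: manifold_at|exact: manifold_coordK|exact: manifold_smooth].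
Qed.
Let hM' := manifold_atlas.

Let rho0 : 0 < rho. Proof. by have [] := hY1. Qed.
Let d1 : diffeo (euclid R 6) M (eball rho) Y1 Y1inv. Proof. by have [] := hY1. Qed.
Let d2 : diffeo (euclid R 6) M (eball rho) Y2 Y2inv. Proof. by have [] := hY2. Qed.
Let YT (Y : 'rV[R]_6 -> Z) x : eball rho x -> setT (Y x). Proof. by []. Qed.
Let B0 : eball rho (0 : 'rV[R]_6).
Proof. by have /eqP e : enorm (0 : 'rV[R]_6) == 0; rewrite ?enorm_eq0 // /eball /= e. Qed.
Let e2 : Y2 0 = Y1 0. Proof. by have [_ _ -> _ _] := hY2; have [_ _ -> _ _] := hY1. Qed.

Lemma change_open : open W.
Proof.
have [sm1 _ _ _] := d1; have [_ oY2 _ _] := d2.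
exact: (preimage_open hM' sm1 (@YT Y1) oY2).
Qed.

Lemma change_smooth : smooth_on W Phi.
Proof.
have [sm1 _ _ _] := d1; have [_ oY2 sm2 _] := d2.
have [_ si] := sm2 tt.
have sg : smooth_fun M (Y2 @` eball rho) Y2inv.
  by move=> j; apply: smooth_on_sub (si j) => y [x [jx Yx] <-]; exists x.
exact: (pull_smooth hM' sm1 (@YT Y1) oY2 sg).
Qed.

Lemma change_spec x : W x -> eball rho (Phi x) /\ Y2 (Phi x) = Y1 x.
Proof.
move=> [_ [y By e]]; have [_ _ _ iK] := d2.
by rewrite /Phi /= -e iK.
Qed.

Lemma change0 : W 0 /\ Phi 0 = 0.
Proof.
have [_ _ _ iK] := d2; split; last by rewrite /Phi /= -e2 iK.
by split=> //; exists 0.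
Qed.

Lemma change_neq0 x : W x -> x != 0 -> Phi x != 0.
Proof.
move=> Wx; apply: contra_neq => p0; have [Bx _] := Wx.
have [_ e] := change_spec Wx; have [_ _ _ iK] := d1.
by rewrite -(iK x Bx) -e p0 e2 iK.
Qed.

Lemma change_diff x : W x -> differentiable Phi x.
Proof. exact: (smooth_on_diff change_smooth). Qed.

Lemma change_derive v : 'D_v Phi 0 = U v.
Proof. by rewrite deriveE //; apply: change_diff; have [] := change0. Qed.

(** Both coordinate systems pull (omega, Omega) back to the standard forms at 0, so this
    factorization makes U preserve the standard forms. *)
Lemma tangent_tmap v : tmap (euclid R 6) M Y1 0 v = tmap (euclid R 6) M Y2 0 (U v).
Proof.
have [sm2 _ _ _] := d2; have [W0 p0] := change0.
by rewrite (tmap_comp hM' v change_open sm2 W0 change_spec (change_diff W0)) p0 change_derive.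
Qed.

Lemma tangent_omega u v : omega0 (U u) (U v) = omega0 u v.
Proof.
have [_ _ _ o1 _] := hY1; have [_ _ _ o2 _] := hY2.
by rewrite -o2 -!tangent_tmap o1.
Qed.

Lemma tangent_Omega u v w : Omega0 (U u) (U v) (U w) = Omega0 u v w.
Proof.
have [_ _ _ _ o1] := hY1; have [_ _ _ _ o2] := hY2.
by rewrite -o2 -!tangent_tmap o1.
Qed.

Lemma tangent_SU3 : SU3 U.
Proof. exact: (structure_preserving_SU3 tangent_omega tangent_Omega). Qed.

Lemma tangent_enorm x : enorm (U x) = enorm x.
Proof. exact: (structure_preserving_enorm tangent_omega tangent_Omega). Qed.

Let D1 := punctured_ball rho.

Lemma punctured_open : open D1.
Proof. by rewrite /D1 /punctured_ball setDE; apply: openI; [exact: open_eball|exact: open_punctured]. Qed.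

Definition punctured_change := W `\ 0.
Local Notation Wp := punctured_change.

Let oWp : open Wp.
Proof. by rewrite /Wp setDE; apply: openI; [exact: change_open|exact: open_punctured]. Qed.

Let sm1 : smooth_map (euclid R 6) M D1 Y1.
Proof. by have [h _ _ _] := d1; apply: smooth_map_sub h; [exact: punctured_open|move=> x []]. Qed.
Let sm2 : smooth_map (euclid R 6) M D1 Y2.
Proof. by have [h _ _ _] := d2; apply: smooth_map_sub h; [exact: punctured_open|move=> x []]. Qed.

Let Y2_inj x y : D1 x -> D1 y -> Y2 x = Y2 y -> x = y.
Proof. by move=> [Bx _] [By _] e; have [_ _ _ iK] := d2; rewrite -(iK x Bx) e iK. Qed.

Let WpD1 x : Wp x -> D1 x. Proof. by move=> [[Bx _] x0]. Qed.

Let hPhi x : Wp x -> D1 (Phi x) /\ Y2 (Phi x) = Y1 x.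
Proof.
move=> [Wx /eqP x0]; have [Bp e] := change_spec Wx; split=> //; split=> //.
by apply/eqP; exact: change_neq0.
Qed.

Let dPhi x : Wp x -> differentiable Phi x.
Proof. by move=> [Wx _]; exact: change_diff. Qed.

Let hC : is_pbundle G (euclid R 6) C. Proof. exact: cone_pbundle. Qed.

Local Notation tau := (frame_shift Yt1 Yt2inv).

Lemma tau_tot e : ptot C e -> Wp (pproj C e) ->
  [/\ ptot C (tau e), pproj C (tau e) = Phi (pproj C e) & Yt2 (tau e) = Yt1 e].
Proof. exact: (shift_tot hYt1 hYt2 Y2_inj WpD1 hPhi). Qed.

Lemma tau_act e g : ptot C e -> Wp (pproj C e) -> G g -> tau (pact C e g) = pact C (tau e) g.
Proof. exact: (shift_act hC hYt1 hYt2 Y2_inj WpD1 hPhi). Qed.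

Lemma iso_difference_symbol Y Yt Ytinv i x0 (d e : R) b k :
  smooth_map (euclid R 6) M D1 Y ->
  bundle_iso G (euclid R 6) C P D1 Y Yt Ytinv -> asymptotic ip M A As mu Y Yt ->
  cball x0 d `<=` pdom C i -> e <= 1 -> e < rho ->
  msymbol 1 k mu (piece x0 d e) (fun _ x =>
    iso_connection (euclid R 6) C M Y Yt A i x (delta_mx 0 b) - A0 i x (delta_mx 0 b)).
Proof.
move=> sm hYt hAY KO e1 erho.
have oi : open (pdom C i) by apply: (cone_open bPs hPs).
have DE : eball rho `&` pdom C i `<=` D1 `&` pdom C i.
  by move=> x [Bx ix]; split=> //; split=> // x0'; have := cone_neq0 ix; rewrite x0' eqxx.
have oD : open (eball rho `&` pdom C i) by apply: openI => //; exact: open_eball.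
pose a x v := iso_connection (euclid R 6) C M Y Yt A i x v - A0 i x v.
apply: (@difference_symbol _ _ _ _ hG _ hQ _ hip (pdom C i) (A0 i) a rho mu d e x0 b k) => //.
- exact: cone_conic.
- by move=> x ix; exact: cone_neq0 ix.
- by move=> v; exact: (cone_smooth hPs hAs i v).
- by move=> x v ix; exact: (cone_lie hAs).
- by move=> s' x v s0 ix; exact: (cone_scale hAs).
- move=> v; apply: smooth_on_add => //.
    exact: smooth_on_sub DE (frame_potential_smooth hG hQ hM' hP hA hC sm hYt i v).
  apply: smooth_on_opp => //; apply: smooth_on_sub (cone_smooth hPs hAs i v) => x [] //.
- move=> x v Dx; have [D1x ix] := DE x Dx; apply: (lieB hG).
    exact: (frame_potential_lie hG hM' hP hA hC sm hYt).
  exact: (cone_lie hAs).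
- move=> k'; have [K [eps [eps0 h]]] := hAY k'; exists K, eps; split=> // x xe ix; exact: h.
Qed.

Lemma cone_symbol i x0 (d e : R) b k : cball x0 d `<=` pdom C i ->
  msymbol 1 k (-1) (piece x0 d e) (fun _ x => A0 i x (delta_mx 0 b)).
Proof.
move=> KO a c; have oi : open (pdom C i) by apply: (cone_open bPs hPs).
apply: (@homogeneous_symbol _ _ _ _ (cball x0 d) (pdom C i) _ (fun x => A0 i x (delta_mx 0 b) a c)) => //.
- exact: cone_conic.
- exact: open_piece.
- exact: compact_cball.
- by move=> x Dx; split; [case: Dx|exact: (piece_cball Dx)].
- by apply: smooth_on_entry => //; exact: (cone_smooth hPs hAs i).
- by move=> t x t0 ix; rewrite (cone_scale hAs) // mxE powRN powRr1 // ltW.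
Qed.

Lemma cone_basis i x v : pdom C i x -> A0 i x v = \sum_b v 0 b *: A0 i x (delta_mx 0 b).
Proof. by move=> ix; apply: linear_basis => a u w; exact: (cone_linear hAs). Qed.

Lemma piece_dom i x0 (d e : R) : cball x0 d `<=` pdom C i -> piece x0 d e `<=` pdom C i.
Proof.
move=> KO x Dx; have x0' := piece_neq0 Dx.
exact: (proj1 (@cone_pr _ _ _ Ps i x x0') (KO _ (piece_cball Dx))).
Qed.

Let itv0 : -1 <= (0 : R) <= 2. Proof. by apply/andP; split; lra. Qed.
Let itv1 : -1 <= (1 : R) <= 2. Proof. by apply/andP; split; lra. Qed.
Let itv1' : -1 < (1 : R) < 2. Proof. by apply/andP; split; lra. Qed.

Lemma local_comparison_exists i j x0 : enorm x0 = 1 -> pdom C i x0 -> pdom C j (U x0) ->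
  exists d e F h, [/\ 0 < d, 0 < e & local_comparison G As mu U Phi tau i j (piece x0 d e) F h].
Proof.
move=> x01 ix0 jx0.
have oi : open (pdom C i) by apply: (cone_open bPs hPs).
have oj : open (pdom C j) by apply: (cone_open bPs hPs).
have [W0 Phi0] := change0.
have [r r0 rW] := cball_in change_open W0.
have {}rW : supball r `<=` W by move=> x hx; apply: rW; rewrite /cball /= subr0.
have [d1' d10 K1] := cball_in oi ix0; have [d2' d20 K2] := cball_in oj jx0.
set eb := Num.min (rho / 2) 1.
have eb0 : 0 < eb by rewrite lt_min divr_gt0 // ltr01.
have [eb1 ebr] : eb <= 1 /\ eb < rho.
  by split; [rewrite ge_min lexx orbT|have := rho0; rewrite gt_min => ?; apply/orP; left; lra].
clearbody eb.
have [d [e0 [/andP[d0 dd1] /andP[e00 e0b] e01 e0r seg]]] :=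
  segment_piece change_open r0 rW change_smooth Phi0 change_derive tangent_enorm x01 d10 eb0 d20 eb0.
set D0 := piece x0 d e0; set D' := piece (U x0) d2' eb.
have K1' : cball x0 d `<=` pdom C i by move=> y yd; apply: K1; exact: le_trans yd dd1.
have D'j : D' `<=` pdom C j by exact: piece_dom.
have hB b k : msymbol 1 k (-1) D' (fun _ x => A0 j x (delta_mx 0 b)) by exact: cone_symbol.
have linB x v : D' x -> A0 j x v = \sum_b v 0 b *: A0 j x (delta_mx 0 b).
  by move=> /D'j; exact: cone_basis.
have hPh b k : symbol 1 k 1 D0 (fun _ x => Phi x 0 b).
  exact: (piece_Phi change_open rW change_smooth Phi0 x0 d b k e01 e0r).
have hw b k : symbol 1 k 2 D0 (fun _ x => (U x - Phi x) 0 b).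
  exact: (piece_defect change_open r0 rW change_smooth Phi0 change_derive x0 d b k e01 e0r).
(* The size of the segment potential that the ODE lemmas tolerate, with m + 1 to cover m = 0. *)
pose bb : R := (4 * (m%:R + 1))^-1.
have bb0 : 0 < bb by rewrite invr_gt0 mulr_gt0 // ltr_wpDl.
have mb : m%:R * bb * 4 <= 1.
  have -> : m%:R * bb * 4 = m%:R / (m%:R + 1).
    rewrite /bb; move: (m%:R) (ler0n R m) => x x0'.
    by field; rewrite gt_eqF // ltr_wpDl.
  by rewrite ler_pdivrMr ?ltr_wpDl // mul1r lerDl.
have h2 : (0 : R) < 2^-1 by rewrite invr_gt0.
(* The radius is shrunk a second time: [e0] keeps the segments in the domain of the target frame,
   [e'] makes the potential along them at most [bb]. *)
have [e' e'0 he'] := segment_potential_small (@open_piece _ _ x0 d e0) (@piece_away _ _ x0 d e0)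
  (fun x (Dx : D0 x) => le_trans (ltW (let: And3 _ h _ := Dx in h)) e01) h2 (ltr0n R 2) seg hPh hw hB linB bb0.
set e := Num.min e0 e'.
have e_gt0 : 0 < e by rewrite lt_min e00.
have [ee0 ee'] : e <= e0 /\ e <= e' by split; rewrite ge_min lexx ?orbT.
clearbody e.
exists d, e; set D := piece x0 d e.
have DD0 : D `<=` D0 by exact: (piece_sub (lexx d) ee0).
have oD : open D by exact: open_piece.
have D0a : away0 1 D by exact: piece_away.
have D1e x : D x -> enorm x <= 1 by move=> [_ h _]; apply: ltW; exact: (lt_le_trans h (le_trans ee0 e01)).
have segD t x : -1 <= t <= 2 -> D x -> D' (Phi x + t *: (U x - Phi x)) /\
   2^-1 * enorm x <= enorm (Phi x + t *: (U x - Phi x)) <= 2 * enorm x.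
  by move=> t12 /DD0; exact: seg.
have hPhD b k : symbol 1 k 1 D (fun _ x => Phi x 0 b) by exact: symbol_sub (hPh b k).
have hwD b k : symbol 1 k 2 D (fun _ x => (U x - Phi x) 0 b) by exact: symbol_sub (hw b k).
have Bb t x : D x -> `|segment_potential U Phi (A0 j) t x| <= bb.
  by move=> Dx; apply: he'; [exact: DD0|case: Dx => _ h _; exact: lt_le_trans h ee'].
have [y hy] := transport_exists oD D0a D1e h2 (ltr0n R 2) segD hPhD hwD hB linB Bb mb.
have DWp x : D x -> Wp x.
  move=> Dx; have x0' := piece_neq0 Dx; split; last by move=> xE; rewrite xE eqxx in x0'.
  apply: rW; rewrite /supball /=; apply: le_trans (norm_le_enorm x) _.
  by case: Dx => _ h _; apply: ltW; apply: (lt_le_trans h); exact: le_trans ee0 e0r.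
have Di x : D x -> pdom C i x by exact: piece_dom.
have segt t x : -1 <= t <= 2 -> D x -> pdom C j (Phi x + t *: (U x - Phi x)).
  by move=> t12 Dx; apply: D'j; have [] := segD t x t12 Dx.
have D'Phi x : D x -> D' (Phi x).
  by move=> Dx; have [|h _] := segD 0 x _ Dx; [exact: itv0|rewrite scale0r addr0 in h].
have DU x : D x -> pdom C j (U x).
  by move=> Dx; have := segt 1 x; rewrite scale1r addrC subrK; apply=> //; exact: itv1.
have DPhi x : D x -> pdom C j (Phi x) by move=> /D'Phi /D'j.
have segG t x : D x -> -1 < t < 2 -> G (1%:M + y t x).
  move=> Dx; apply: (group_ode hG (hy x Dx) _ (fun t => Bb t x Dx) mb) => t'.
  rewrite /segment_potential; apply: lieN => //; apply: (cone_lie hAs).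
  by apply: segt => //; exact: clamp_itv.
pose sh := shift_matrix (C := C) Yt1 Yt2inv i j.
(* By equivariance the framing change on a fibre is determined by its value on the local section. *)
have hpt x e1 : ptot C e1 -> D (pproj C e1) -> x = pproj C e1 ->
    [/\ ptot C (tau e1), pproj C (tau e1) = Phi x & pfib C j (tau e1) = sh x *m pfib C i e1].
  move=> te Dx xE; rewrite -xE in Dx; have Wx : Wp (pproj C e1) by rewrite -xE; exact: DWp.
  have [t1 p1 _] := tau_tot te Wx; rewrite -xE in p1; split=> //.
  have ie : pdom C i (pproj C e1) by rewrite -xE; exact: Di.
  have [Gf _ eE] := pbundle_fib hC te ie.
  have [ts ps _] := pbundle_sec hC ie; rewrite -xE in ts ps.
  have Ws : Wp (pproj C (psec C i x)) by rewrite ps xE.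
  have [t2 p2 _] := tau_tot ts Ws; rewrite ps in p2.
  rewrite -{1}eE -xE tau_act //.
  have [|_ hh _] := pbundle_fib hC (i := j) t2; first by rewrite p2; exact: DPhi.
  by rewrite hh.
have shd x : D x -> shift_dom (C := C) Wp Phi i j x.
  by move=> Dx; split; [split; [exact: DWp|exact: Di]|exact: DPhi].
have shG x : D x -> G (sh x).
  by move=> /shd; exact: (shift_matrixG hC hYt1 hYt2 Y2_inj WpD1 hPhi).
pose A1 := iso_connection (euclid R 6) C M Y1 Yt1 A.
pose A2 := iso_connection (euclid R 6) C M Y2 Yt2 A.
pose a1 b x := A1 i x (delta_mx 0 b) - A0 i x (delta_mx 0 b).
pose a2 b x := A2 j x (delta_mx 0 b) - A0 j x (delta_mx 0 b).
have e1' : e <= 1 by exact: le_trans ee0 e01.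
have erho : e < rho by apply: le_lt_trans ebr; exact: le_trans ee0 e0b.
have ha1 b k : msymbol 1 k mu D (fun=> a1 b) by exact: (iso_difference_symbol b k sm1 hYt1 hA1 K1').
have ha2 b k : msymbol 1 k mu D' (fun=> a2 b) by exact: (iso_difference_symbol b k sm2 hYt2 hA2 K2).
have hAi b k : msymbol 1 k (-1) D (fun _ x => A0 i x (delta_mx 0 b)) by exact: cone_symbol.
have dsh x : D x -> differentiable sh x.
  by move=> /shd sx; have [] := shift_derive hG hQ hM' A hP hC oWp sm1 sm2 hYt1 hYt2 Y2_inj WpD1 hPhi dPhi (delta_mx 0 0) sx.
have [Ch Ch0 hCh] := cgroup_bounded hG.
have shb x : D x -> `|sh x| <= Ch by move=> Dx; apply: hCh; exact: shG.
have shder b x : D x ->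
   'D_(delta_mx 0 b) sh x = sh x *m (A0 i x (delta_mx 0 b) + a1 b x)
    - (\sum_l ('D_(delta_mx 0 b) Phi x) 0 l *: (A0 j (Phi x) (delta_mx 0 l) + a2 l (Phi x))) *m sh x.
  move=> Dx; have [_ ->] := shift_derive hG hQ hM' A hP hC oWp sm1 sm2 hYt1 hYt2 Y2_inj WpD1 hPhi dPhi (delta_mx 0 b) (shd x Dx).
  have -> : A0 i x (delta_mx 0 b) + a1 b x = A1 i x (delta_mx 0 b) by rewrite /a1 addrC subrK.
  have [D1P _] := hPhi (DWp x Dx).
  have lA2 a u v : A2 j (Phi x) (a *: u + v) = a *: A2 j (Phi x) u + A2 j (Phi x) v.
    exact: (frame_potential_linear hP hA hC hYt2 _ _ _ D1P (DPhi x Dx)).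
  suff -> : \sum_l ('D_(delta_mx 0 b) Phi x) 0 l *: (A0 j (Phi x) (delta_mx 0 l) + a2 l (Phi x)) =
    A2 j (Phi x) ('D_(delta_mx 0 b) Phi x) by [].
  rewrite [RHS](linear_basis lA2); apply: eq_bigr => l _.
  by rewrite /a2 addrC subrK.
pose F := transported sh y; pose B := rotated U (A0 j).
have starD t x : 0 < t <= 1 -> D x -> D (t *: x) by exact: piece_scale.
have hBr b k : msymbol 1 k (-1) D (fun _ x => B x (delta_mx 0 b)).
  by apply: (@rotated_symbol _ _ _ D D' U Phi (A0 j) 2^-1 2).
have hF k : msymbol 1 k 0 D (fun=> F).
  by apply: (@transported_symbol _ _ _ D D' U Phi (A0 j) 2^-1 2 oD D0a D1e h2 (ltr0n R 2) segD hPhD hwD hB linB bb Bb mb mu (A0 i) a1 a2 sh y) => //; exact: shb.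
have hcov b k : msymbol 1 k mu D (fun=> cov B (A0 i) (delta_mx 0 b) F).
  by apply: (@transported_cov _ _ _ D D' U Phi (A0 j) 2^-1 2 oD D0a D1e h2 (ltr0n R 2) segD hPhD hwD hB linB bb Bb mb mu (A0 i) a1 a2 sh y) => //; exact: shb.
have linA x v : D x -> A0 i x v = \sum_b v 0 b *: A0 i x (delta_mx 0 b) by move=> /Di; exact: cone_basis.
have linBr x v : D x -> B x v = \sum_b v 0 b *: B x (delta_mx 0 b).
  move=> /DU jU; apply: linear_basis => a u w.
  by rewrite /B /rotated linearP (cone_linear hAs).
have homA t x v : 0 < t <= 1 -> D x -> A0 i (t *: x) v = t^-1 *: A0 i x v.
  by move=> /andP[t0 _] /Di ix; exact: (cone_scale hAs).
have homB t x v : 0 < t <= 1 -> D x -> B (t *: x) v = t^-1 *: B x v.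
  by move=> /andP[t0 _] /DU jU; rewrite /B /rotated linearZ (cone_scale hAs).
have radA x : D x -> A0 i x x = 0 by move=> /Di; exact: (cone_radial hAs).
have radB x : D x -> B x x = 0 by move=> /DU; exact: (cone_radial hAs).
have FG x : D x -> G (F x).
  move=> Dx; apply: (cgroupM hG); last exact: shG.
  by apply: segG => //; exact: itv1'.
have [h hlim] : exists h, is_radial_limit D F mu h.
  by apply: (@radial_limit_exists _ _ _ D (A0 i) B F mu).
(* The values F (2^-N x) lie in G, and G is closed. *)
have hG_ x : D x -> G (h x).
  move=> Dx; apply: (@closed_cvg _ _ \oo _ (fun N => F (2^-1 ^+ N *: x)) G (cgroup_closed hG)).
    apply: nearW => N; apply: FG; apply: starD => //.
    by rewrite exprn_gt0 ?invr_gt0 //= exprn_ile1 ?invr_ge0 // invf_le1 // ler1n.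
  have [K K0 hK] := hlim; apply/cvgrPdist_le => eps eps0.
  apply: filterS (geometric_small (K * enorm x `^ (mu + 1)) (halving01 mu1) eps0) => N hN.
  by rewrite -normrN opprB; apply: le_trans (hK x Dx N) hN.
have gauge k l x v : pdom C k x -> pdom C l x -> let g y := pfib C k (psec C l y) in
    differentiable g x /\ A0 l x v = invmx (g x) *m A0 k x v *m g x + invmx (g x) *m 'D_v g x.
  by move=> kx lx; exact: (cone_gauge hPs hAs v kx lx).
have rcov x : D x -> differentiable h x /\ forall v, cov B (A0 i) v h x = 0.
  by apply: (@radial_limit_cov _ _ _ D (A0 i) B F mu).
(* Bootstrapping again: h is bounded, being G-valued, and nabla h = 0 expresses its derivatives by h
   and the potentials. *)
have hsym k : msymbol 1 k 0 D (fun=> h).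
  elim: k => [|k IH].
    apply: (@msymbol0P _ _ _ _ _ _ _ Ch) => // x Dx.
      by apply: differentiable_cont; have [] := rcov x Dx.
    by rewrite powRr0 mulr1; apply: hCh; exact: hG_.
  apply: msymbolS => //.
  - exact: msymbol_leq IH.
  - by move=> _ x Dx; have [] := rcov x Dx.
  move=> b; apply: (@msymbol_eq _ _ _ _ _ _ _ _ (fun _ x => h x *m A0 i x (delta_mx 0 b) - B x (delta_mx 0 b) *m h x)) => //.
    move=> _ x Dx; have [_ /(_ (delta_mx 0 b))] := rcov x Dx.
    by rewrite /cov => /eqP; rewrite subr_eq0 => /eqP <-; rewrite addrK.
  apply: msymbol_sub => //; first exact: msymbol_mul.
  by rewrite addrC; exact: msymbol_mul.
have hsub k : msymbol 1 k 0 D (fun _ y => F y - h y) by exact: msymbol_sub.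
exists F, h; split=> //; split=> //.
- by move=> x Dx; split; [exact: Di|exact: DU|exact: hG_].
- move=> e1 te De; have [t1 p1 _] := hpt _ e1 te De erefl.
  apply: (parallel_transport_exists hG hC gauge (j := j) (y := y^~ (pproj C e1))) t1 p1.
  - by move=> t t12; exact: segt.
  - exact: hy.
  - by move=> t; exact: segG.
- move=> e1 e1t te De pt; have [t1 p1 f1] := hpt _ e1 te De erefl.
  have [|||? ? ->] := parallel_transport_fib hG hQ (j := j) (y := y^~ (pproj C e1)) _ _ _ t1 pt.
  - by move=> t t12; exact: segt.
  - exact: hy.
  - by move=> t; exact: segG.
  by split=> //; rewrite f1 mulmxA.
split=> //.
- apply/(smooth_onP 0 h oD) => k a b; exact: symbol_mode (hsym k a b).
- by move=> x v Dx; have [_] := rcov x Dx.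
- move=> t x t01 Dx; exact: (@radial_limit_scale _ _ _ D (A0 i) B F mu oD D0a D1e starD).
- move=> I x Dx; exact: (msymbol_diff (ncov_symbol 1 I oD D0a hAi hBr hsub) 0 Dx).
- move=> k; exact: (@radial_limit_ncov _ _ _ D (A0 i) B F mu).
Qed.

End Comparison.

(** * The limit isomorphism *)

Section SphereCharts.
Variables (R : realType) (n : nat).
Local Notation S := (sphere R n).

Lemma sphere_pt_norm j y : eball 1 y -> enorm (apt S j y) = 1.
Proof.
move=> y1; apply/eqP; rewrite -(eqrXn2 (n := 2)) ?enorm_ge0 // expr1n; apply/eqP.
rewrite enorm2 (bigD1_ord j.1) //= mxE unlift_none exprMn sqrr_sign mul1r.
have h : 0 <= 1 - enorm y ^+ 2 by rewrite subr_ge0 expr_le1 ?enorm_ge0 //; exact: ltW.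
rewrite sqr_sqrtr // enorm2 -[RHS](subrK (\sum_i y 0 i ^+ 2)); congr (_ + _).
by apply: eq_bigr => k _; rewrite mxE liftK.
Qed.

Lemma sphere_pt_dom j y : eball 1 y -> adom S j (apt S j y).
Proof.
move=> y1; split; first exact: sphere_pt_norm.
rewrite /= mxE unlift_none mulrA -expr2 sqrr_sign mul1r sqrtr_gt0 subr_gt0.
by rewrite expr_lt1 ?enorm_ge0.
Qed.

Lemma sphere_ptK j y : acoord S j (apt S j y) = y.
Proof. by apply/rowP => k; rewrite !mxE liftK. Qed.

Lemma sphere_in_chart j D : in_chart S j D = eball 1 `&` apt S j @^-1` D.
Proof.
have [_ cK _] := sphere_atlas R n; apply/seteqP; split=> [_ [x [jx Dx] <-]|y [y1 Dy]].
  split; first exact: sphere_coord_ball.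
  by have e := cK j x jx; rewrite -[(_ @^-1` _) _]/(D (apt S j (acoord S j x))) e.
by exists (apt S j y); [split=> //; exact: sphere_pt_dom|exact: sphere_ptK].
Qed.

End SphereCharts.

(** * Gauge covariance of iterated covariant derivatives *)

Section GaugeCovariance.
Variables (R : realType) (n m : nat) (D : set 'rV[R]_n).
Hypothesis oD : open D.
Variables (A A' B B' : 'rV[R]_n -> 'rV[R]_n -> 'M[R]_m) (a b : 'rV[R]_n -> 'M[R]_m).
Hypothesis da : forall x, D x -> differentiable a x.
Hypothesis db : forall x, D x -> differentiable b x.
Hypothesis Ea : forall x v, D x -> 'D_v a x = a x *m A' x v - A x v *m a x.
Hypothesis Eb : forall x v, D x -> 'D_v b x = b x *m B x v - B' x v *m b x.

Lemma cov_gauge (s : 'rV[R]_n -> 'M[R]_m) v x : D x -> differentiable s x ->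
  cov B' A' v (fun y => b y *m s y *m a y) x = b x *m cov B A v s x *m a x.
Proof.
move=> Dx ds; rewrite /cov derive_mulmx; [|exact: differentiable_mulmx (db Dx) ds|exact: da].
rewrite derive_mulmx //; last exact: db.
rewrite Ea // Eb // !(mulmxDl, mulmxDr, mulmxN, mulNmx, mulmxA).
have aE (M N : 'M[R]_m) i j : (M + N) i j = M i j + N i j by rewrite mxE.
have nE (M : 'M[R]_m) i j : (- M) i j = - M i j by rewrite mxE.
by apply/matrixP => i j; rewrite !(aE, nE); ring.
Qed.

Lemma ncov_gauge I (s s' : 'rV[R]_n -> 'M[R]_m) : 
  (forall J x, D x -> differentiable (ncov B A J s) x) ->
  (forall x, D x -> s' x = b x *m s x *m a x) ->
  forall x, D x -> ncov B' A' I s' x = b x *m ncov B A I s x *m a x.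
Proof.
move=> ds ss; elim: I => [|c I IH] //= x Dx.
by rewrite (cov_eq _ _ _ oD IH Dx) cov_gauge //; exact: ds.
Qed.

End GaugeCovariance.

Section HilbertSchmidt.
Variables (R : realType) (m : nat).

Lemma HSnorm2_bound (Q : 'M[R]_m) : exists2 C, 0 <= C & forall X, HSnorm2 Q X <= C * `|X| ^+ 2.
Proof.
exists (m%:R * (m%:R * (m%:R * (m%:R * `|invmx Q| * `|Q|)))); first by rewrite !mulr_ge0.
move=> X; rewrite /HSnorm2.
have tr (Y : 'M[R]_m) : \tr Y <= m%:R * `|Y|.
  rewrite /mxtrace; apply: (@le_trans _ _ (\sum_(i < m) `|Y|)).
    by apply: ler_sum => i _; apply: le_trans (mx_entry_le Y i i); exact: ler_norm.
  by rewrite sumr_const card_ord mulr_natl.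
have nt : `|X^T| <= `|X| by apply: mx_norm_le => // i j; rewrite mxE; exact: mx_entry_le.
apply: (le_trans (tr _)); rewrite -!mulrA; apply: ler_wpM2l => //.
apply: (le_trans (mulmx_norm_le _ _)).
apply: (@le_trans _ _ (m%:R * (m%:R * (m%:R * `|invmx Q| * `|X^T|) * `|Q|) * `|X|)).
  apply: ler_wpM2r => //; apply: ler_wpM2l => //.
  apply: (le_trans (mulmx_norm_le _ _)); apply: ler_wpM2r => //; apply: ler_wpM2l => //.
  exact: mulmx_norm_le.
apply: (@le_trans _ _ (m%:R * (m%:R * (m%:R * `|invmx Q| * `|X|) * `|Q|) * `|X|)).
  apply: ler_wpM2r => //; apply: ler_wpM2l => //; apply: ler_wpM2r => //.
  by apply: ler_wpM2l => //; apply: ler_wpM2l; rewrite ?mulr_ge0.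
by rewrite le_eqVlt; apply/orP; left; apply/eqP; ring.
Qed.

End HilbertSchmidt.

(** * Compactness of the set of directions *)

Section RayCover.
Variables (R : realType) (n : nat).

Lemma compact_usphere : compact (usphere R n).
Proof.
apply: (subclosed_compact _ (@compact_supball R n 1)); last first.
  by move=> x x1; rewrite /supball /= -x1; exact: norm_le_enorm.
have -> : usphere R n = (@enorm R n) @^-1` [set 1] by [].
apply: preimage_closed; first by move=> x _; exact: enorm_continuous.
exact: closed_eq.
Qed.

(** A single integer N serves as the bound and, through 1/(N + 1), as the radius, so that one
    compactness argument on the sphere makes both uniform. *)
Lemma ray_cover (P : nat -> 'rV[R]_n -> Prop) :
  (forall x0, enorm x0 = 1 -> exists d e N0, [/\ 0 < d, 0 < e &
     forall x N, piece x0 d e x -> (N0 <= N)%N -> P N x]) ->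
  exists (N : nat) (e : R), 0 < e /\ forall x, 0 < enorm x < e -> P N x.
Proof.
move=> loc.
have /compact_near_coveringP cov := compact_usphere.
pose Pp N s := forall x : 'rV[R]_n, pr x = s -> 0 < enorm x < N.+1%:R^-1 -> P N x.
have [|N hN] := @filter_ex _ \oo _ _ (cov nat \oo Pp _ _).
  move=> x0 x01; have [d [e [N0 [d0 e0 h]]]] := loc x0 x01.
  exists (ball x0 d, [set N | (N0 <= N)%N /\ N.+1%:R^-1 <= e]).
    split; first exact: nbhsx_ballx.
    apply: filterS2 (nbhs_infty_ge N0) (near_infty_natSinv_lt (PosNum e0)) => N ? /ltW ?; split=> //.
  move=> [s N] [/= bs [N0N Ne]] x xs /andP[x0' xe]; apply: (h x N) => //.
  split=> //; first exact: lt_le_trans xe Ne.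
  by rewrite xs -normrN opprB; move: bs; rewrite -ball_normE.
exists N, N.+1%:R^-1; split; first by rewrite invr_gt0.
move=> x /andP[x0' xe]; apply: (hN (pr x)) => //; last by rewrite x0'.
by apply: enorm_pr; rewrite -enorm_gt0.
Qed.

End RayCover.

(** * Gluing the local limits into an isomorphism of P_s *)

Section Assembly.
Variables (R : realType) (m : nat) (G : set 'M[R]_m).
Hypothesis hG : compact_group G.
Variable Q : 'M[R]_m.
Hypothesis hQ : invariant_gram G Q.
Variables (Es : Type) (Ps : pbundle R m 'rV[R]_6 Es) (As : potentials 5 Ps).
Hypotheses (bPs : pbase Ps = usphere R 6) (hPs : is_pbundle G (sphere R 5) Ps)
  (hAs : is_connection G (sphere R 5) As).
Variables (mu : R) (U : {linear 'rV[R]_6 -> 'rV[R]_6}) (Phi : 'rV[R]_6 -> 'rV[R]_6).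
Variable tau : 'rV[R]_6 * Es -> 'rV[R]_6 * Es.
Hypothesis mu1 : -1 < mu.
Hypothesis enU : forall x, enorm (U x) = enorm x.
Local Notation C := (cone_bundle Ps).
Local Notation A0 := (cone_connection As).
Hypothesis hloc : forall i j x0, enorm x0 = 1 -> pdom C i x0 -> pdom C j (U x0) ->
  exists d e F h, [/\ 0 < d, 0 < e & local_comparison G As mu U Phi tau i j (piece x0 d e) F h].

Let hC : is_pbundle G (euclid R 6) C. Proof. exact: cone_pbundle. Qed.

Lemma cone_at x : x != 0 -> pdom C (pat C x) x.
Proof. by move=> /eqP x0; apply: (pbundle_at hC). Qed.

Lemma isometry_neq0 x : x != 0 -> U x != 0.
Proof. by rewrite -!enorm_gt0 enU. Qed.

Lemma isometry_pr x : U (pr x) = pr (U x).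
Proof. by rewrite /pr linearZ enU. Qed.

Let unit_neq0 (x : 'rV[R]_6) : enorm x = 1 -> x != 0.
Proof. by move=> x1; rewrite -enorm_gt0 x1. Qed.

Lemma local_piece x0 : enorm x0 = 1 -> exists d e F h, [/\ 0 < d, 0 < e &
  local_comparison G As mu U Phi tau (pat C x0) (pat C (U x0)) (piece x0 d e) F h].
Proof.
move=> x01; have x0n := unit_neq0 x01.
by apply: hloc => //; apply: cone_at => //; exact: isometry_neq0.
Qed.

Lemma transport_map_exists : exists (e0 : R) (H : 'rV[R]_6 * Es -> 'rV[R]_6 * Es), 0 < e0 /\
  forall e, ptot C e -> enorm (pproj C e) < e0 ->
    parallel_transport A0 (Phi (pproj C e)) (U (pproj C e)) (tau e) (H e).
Proof.
have [|_ [e0 [e00 he0]]] := @ray_cover R 6 (fun _ x => forall e, ptot C e -> pproj C e = x ->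
   exists e', parallel_transport A0 (Phi x) (U x) (tau e) e').
  move=> x0 /local_piece[d [e [F [h [d0 e0' [_ ex _ _ _]]]]]].
  exists d, e, 0%N; split=> // x _ Dx _ p tp px; rewrite -px; apply: ex => //; by rewrite px.
have /choice[H hH] : forall e, exists e', ptot C e -> enorm (pproj C e) < e0 ->
    parallel_transport A0 (Phi (pproj C e)) (U (pproj C e)) (tau e) e'.
  move=> e; have [te|nte] := pselect (ptot C e); last by exists e.
  have [xe|nxe] := pselect (enorm (pproj C e) < e0); last by exists e.
  have p0 : 0 < enorm (pproj C e) by case: te => /eqP h _ _; rewrite enorm_gt0.
  have [|e' he'] := he0 (pproj C e) _ e te erefl; first by rewrite p0.
  by exists e'.
by exists e0, H.
Qed.

Variables (e0 : R) (H : 'rV[R]_6 * Es -> 'rV[R]_6 * Es).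
Hypothesis e00 : 0 < e0.
Hypothesis hH : forall e, ptot C e -> enorm (pproj C e) < e0 ->
  parallel_transport A0 (Phi (pproj C e)) (U (pproj C e)) (tau e) (H e).

Definition transport_matrix i j x := pfib C j (H (psec C i x)).
Local Notation Fm := transport_matrix.

Lemma local_matrix i j D F h x : local_comparison G As mu U Phi tau i j D F h -> D x -> enorm x < e0 ->
  Fm i j x = F x /\ forall e, ptot C e -> pproj C e = x ->
  [/\ ptot C (H e), pproj C (H e) = U x & pfib C j (H e) = F x *m pfib C i e].
Proof.
move=> [dom _ hF _ _] Dx xe.
have key e : ptot C e -> pproj C e = x ->
    [/\ ptot C (H e), pproj C (H e) = U x & pfib C j (H e) = F x *m pfib C i e].
  move=> te pe; have De : D (pproj C e) by rewrite pe.
  have := hF e (H e) te De; rewrite pe; apply.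
  by rewrite -pe; apply: hH => //; rewrite pe.
split=> //; have [ix _ _] := dom x Dx; have [ts ps fs] := pbundle_sec hC ix.
by have [_ _] := key _ ts ps; rewrite /Fm fs mulmx1.
Qed.

(** Only [H] is mentioned, no piece and no local F, so that values obtained on different pieces can
    be compared. *)
Definition radial_value i j s (T : 'M[R]_m) := exists K e : R, [/\ 0 <= K, 0 < e &
  forall x, pr x = s -> 0 < enorm x < e -> `|Fm i j x - T| <= K * enorm x `^ (mu + 1)].

(** Below x, the points of its ray are scaled copies of x inside the same piece, and h takes the
    value h x at all of them. *)
Lemma local_radial_value i j x0 d e F h x :
  local_comparison G As mu U Phi tau i j (piece x0 d e) F h -> piece x0 d e x ->
  radial_value i j (pr x) (h x).
Proof.
move=> L Dx; have [_ _ _ [K K0 hK] [_ _ hs _ _]] := L.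
have x0' : 0 < enorm x by case: Dx.
exists K, (Num.min (enorm x) e0); split=> // [|y yx /andP[y0]].
  by rewrite lt_min x0'.
rewrite lt_min => /andP[yx' ye].
have yE : y = (enorm y / enorm x) *: x.
  rewrite -scalerA -/(pr x) -yx -pr_polar // -enorm_gt0 //.
have t01 : 0 < enorm y / enorm x <= 1 by rewrite divr_gt0 //= ler_pdivrMr // mul1r ltW.
have Dy : piece x0 d e y by rewrite yE; exact: piece_scale.
have [-> _] := local_matrix L Dy ye.
have -> : h x = h y by rewrite [in RHS]yE hs.
by have := hK y Dy 0; rewrite !expr0 scale1r mulr1.
Qed.

Lemma radial_value_unique i j s T T' : enorm s = 1 -> radial_value i j s T -> radial_value i j s T' -> T = T'.
Proof.
move=> s1 [K [e [K0 e_0 hK]]] [K' [e' [K0' e0' hK']]].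
apply/eqP; rewrite -subr_eq0 -normr_le0; apply/ler_addgt0Pr => eps eps0; rewrite add0r.
set e2 := Num.min e e' / 2; have m0 : 0 < Num.min e e' by rewrite lt_min e_0.
have e20 : 0 < e2 by rewrite divr_gt0.
(* Points of the ray at radii 2^-N e2, where both estimates hold; as mu + 1 > 0, these force T - T'
   to be arbitrarily small. *)
pose y N := 2^-1 ^+ N *: (e2 *: s).
have [N hN] := filter_ex (geometric_small ((K + K') * e2 `^ (mu + 1)) (halving01 mu1) eps0).
have h0 : 0 < (2^-1 : R) ^+ N by rewrite exprn_gt0 // invr_gt0.
have h1 : (2^-1 : R) ^+ N <= 1 by rewrite exprn_ile1 ?invr_ge0 // invf_le1 // ler1n.
have ys : pr (y N) = s by rewrite /y !pr_scale // pr_id.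
have es : enorm (e2 *: s) = e2 by rewrite enormZ s1 mulr1 gtr0_norm.
have ye : enorm (y N) = 2^-1 ^+ N * e2 by rewrite /y enormZ es gtr0_norm.
have [ye1 ye2] : 0 < enorm (y N) < e /\ 0 < enorm (y N) < e'.
  have lt2 : enorm (y N) < Num.min e e'.
    rewrite ye; apply: (@le_lt_trans _ _ e2); first by rewrite ler_piMl // ltW.
    by rewrite /e2 ltr_pdivrMr // mulr_natr mulr2n ltrDl.
  have p : 0 < enorm (y N) by rewrite ye mulr_gt0.
  by move: lt2; rewrite lt_min p => /andP[-> ->].
have -> : T - T' = (Fm i j (y N) - T') - (Fm i j (y N) - T) by apply/matrixP => a b; rewrite !mxE; ring.
apply: (le_trans (ler_normB _ _)); apply: le_trans hN.
apply: (le_trans (lerD (hK' _ ys ye2) (hK _ ys ye1))).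
rewrite -mulrDl [K' + K]addrC /y enorm_half es -/(halving mu).
by rewrite le_eqVlt; apply/orP; left; apply/eqP; ring.
Qed.

Lemma radial_value_exists i j s : enorm s = 1 -> pdom C i s -> pdom C j (U s) ->
  exists T, G T /\ radial_value i j s T.
Proof.
move=> s1 is_ js; have [d [e [F [h [d0 e_0 L]]]]] := hloc s1 is_ js.
have e2 : 0 < e / 2 by rewrite divr_gt0.
pose x := (e / 2) *: s.
have prx : pr x = s by rewrite /x pr_scale // pr_id.
have Dx : piece s d e x.
  split; rewrite ?prx ?subrr ?normr0 // /x enormZ s1 mulr1 gtr0_norm //; lra.
exists (h x); split; first by have [/(_ x Dx)[]] := L.
by rewrite -{1}prx; exact: local_radial_value L Dx.
Qed.

Definition transition_fun j' j (y : 'rV[R]_6) : 'M[R]_m := pfib C j' (psec C j y).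

Lemma transition_fun_pr j' j y : transition_fun j' j (pr y) = transition_fun j' j y.
Proof.
rewrite /transition_fun /=; have -> // : pr (pr y) = pr y.
by have [->|y0] := eqVneq y 0; [rewrite /pr !scaler0|rewrite pr_id // enorm_pr].
Qed.

Lemma transport_matrix_change i j i' j' x0 d e F h x :
  local_comparison G As mu U Phi tau i j (piece x0 d e) F h -> piece x0 d e x -> enorm x < e0 ->
  pdom C i' x -> pdom C j' (U x) ->
  Fm i' j' x = transition_fun j' j (U x) *m Fm i j x *m transition_fun i i' x.
Proof.
move=> L Dx xe ix' jx'; have [FE hF] := local_matrix L Dx xe.
have [/(_ x Dx)[ix jx _] _ _ _ _] := L.
have [ts ps _] := pbundle_sec hC ix'; have [th ph fh] := hF _ ts ps.
rewrite {1}/Fm (fib_trans hC th (i := j') (j := j)) ?ph // fh FE.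
by rewrite mulmxA.
Qed.

(** The transition functions of the cone bundle are constant along rays, so they act on the limit by
    their values at s and U s. *)
Lemma radial_value_change i j i' j' s T : enorm s = 1 -> pdom C i s -> pdom C j (U s) ->
  pdom C i' s -> pdom C j' (U s) -> radial_value i j s T ->
  radial_value i' j' s (transition_fun j' j (U s) *m T *m transition_fun i i' s).
Proof.
move=> s1 is_ js is' js' [K [e' [K0 e0' hK]]].
have [d [e [F [h [d0 e_0 L]]]]] := hloc s1 is_ js.
set b := transition_fun j' j (U s); set a := transition_fun i i' s.
exists (m%:R * (m%:R * `|b|) * `|a| * K), (Num.min (Num.min e e0) e'); split.
- by rewrite !mulr_ge0.
- by rewrite !lt_min e_0 e00.
move=> x xs /andP[x0 ]; rewrite !lt_min => /andP[/andP[xe xe0] xe'].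
have xn : x != 0 by rewrite -enorm_gt0.
have Dx : piece s d e x by split; rewrite ?xs ?subrr ?normr0.
have cp k y : pr y = pr y -> y != 0 -> pdom C k (pr y) -> pdom C k y.
  by move=> _ y0; exact: (proj1 (@cone_pr _ _ _ Ps k y y0)).
have ix' : pdom C i' x by apply: cp; rewrite ?xs.
have jx' : pdom C j' (U x) by apply: cp; rewrite ?isometry_neq0 // -isometry_pr xs.
rewrite (transport_matrix_change L Dx xe0 ix' jx').
have -> : transition_fun j' j (U x) = b by rewrite -transition_fun_pr -isometry_pr xs.
have -> : transition_fun i i' x = a by rewrite -transition_fun_pr xs.
rewrite -mulmxBl -mulmxBr; apply: (le_trans (mulmx_norm_le _ _)).
have hKx : `|Fm i j x - T| <= K * enorm x `^ (mu + 1) by apply: hK; rewrite ?x0.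
have -> : m%:R * (m%:R * `|b|) * `|a| * K * enorm x `^ (mu + 1) =
   m%:R * (m%:R * `|b| * (K * enorm x `^ (mu + 1))) * `|a| by ring.
apply: ler_wpM2r => //; apply: ler_wpM2l => //; apply: (le_trans (mulmx_norm_le _ _)).
by apply: ler_wpM2l; rewrite ?mulr_ge0.
Qed.

Lemma radial_limits_exist : exists T : pidx C -> pidx C -> 'rV[R]_6 -> 'M[R]_m,
  forall i j s, enorm s = 1 -> pdom C i s -> pdom C j (U s) -> G (T i j s) /\ radial_value i j s (T i j s).
Proof.
have /choice[T hT] : forall q : pidx C * pidx C * 'rV[R]_6, exists T, enorm q.2 = 1 ->
    pdom C q.1.1 q.2 -> pdom C q.1.2 (U q.2) -> G T /\ radial_value q.1.1 q.1.2 q.2 T.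
  move=> [[i j] s] /=; have [s1|n1] := pselect (enorm s = 1); last by exists 0.
  have [is_|ni] := pselect (pdom C i s); last by exists 0.
  have [js|nj] := pselect (pdom C j (U s)); last by exists 0.
  by have [T] := radial_value_exists s1 is_ js; exists T.
by exists (fun i j s => T (i, j, s)) => i j s; exact: (hT (i, j, s)).
Qed.

Variable T : pidx C -> pidx C -> 'rV[R]_6 -> 'M[R]_m.
Hypothesis hT : forall i j s, enorm s = 1 -> pdom C i s -> pdom C j (U s) ->
  G (T i j s) /\ radial_value i j s (T i j s).

Lemma limit_change i j i' j' s : enorm s = 1 -> pdom C i s -> pdom C j (U s) ->
  pdom C i' s -> pdom C j' (U s) ->
  T i' j' s = transition_fun j' j (U s) *m T i j s *m transition_fun i i' s.
Proof.
move=> s1 is_ js is' js'; have [_ h] := hT s1 is_ js; have [_ h'] := hT s1 is' js'.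
exact: radial_value_unique s1 h' (radial_value_change s1 is_ js is' js' h).
Qed.

Lemma limit_local i j x0 d e F h x : local_comparison G As mu U Phi tau i j (piece x0 d e) F h ->
  piece x0 d e x -> T i j (pr x) = h x.
Proof.
move=> L Dx; have [/(_ x Dx)[ix jx _] _ _ _ _] := L; have x0' := piece_neq0 Dx.
have p1 : enorm (pr x) = 1 by exact: enorm_pr.
have ip : pdom C i (pr x) by exact: (proj2 (@cone_pr _ _ _ Ps i x x0')).
have jp : pdom C j (U (pr x)).
  by rewrite isometry_pr; exact: (proj2 (@cone_pr _ _ _ Ps j _ (isometry_neq0 x0'))).
have [_ h1] := hT p1 ip jp.
exact: radial_value_unique p1 h1 (local_radial_value L Dx).
Qed.

Lemma sphere_dom i s : enorm s = 1 -> pdom C i s <-> pdom Ps i s.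
Proof.
move=> s1; split=> [[_]|is_]; first by rewrite /preimage /= pr_id.
by split; [exact/eqP/unit_neq0|rewrite /preimage /= pr_id].
Qed.

Lemma transition_sphere j' j s : enorm s = 1 -> transition_fun j' j s = pfib Ps j' (psec Ps j s).
Proof. by move=> s1; rewrite /transition_fun /= pr_id. Qed.

Lemma isometry_unit s : enorm s = 1 -> enorm (U s) = 1.
Proof. by rewrite enU. Qed.

Lemma isometry_inj x y : U x = U y -> x = y.
Proof.
move=> e; apply/eqP; rewrite -subr_eq0 -enorm_eq0 -enU linearB /= e subrr enorm_eq0 //.
Qed.

Lemma bundle_unit e : ptot Ps e -> enorm (pproj Ps e) = 1.
Proof. by move=> te; have := pbundle_proj hPs te; rewrite bPs. Qed.

Lemma trivial_at s : enorm s = 1 -> pdom Ps (pat Ps s) s.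
Proof. by move=> s1; apply: (pbundle_at hPs); rewrite bPs. Qed.

(** Written in the preferred trivializations at s and U s; by [limit_change] any others give the
    same point, as [limit_map_fib] states. *)
Definition limit_map e :=
  let s := pproj Ps e in
  pact Ps (psec Ps (pat Ps (U s)) (U s)) (T (pat Ps s) (pat Ps (U s)) s *m pfib Ps (pat Ps s) e).
Local Notation Ut := limit_map.

Lemma limit_group i j s : enorm s = 1 -> pdom Ps i s -> pdom Ps j (U s) -> G (T i j s).
Proof.
move=> s1 is_ js; have [//|||h _] := @hT i j s; first exact/sphere_dom.
  by apply/sphere_dom => //; exact: isometry_unit.
exact: h.
Qed.

Lemma limit_map_tot e : ptot Ps e -> ptot Ps (Ut e) /\ pproj Ps (Ut e) = U (pproj Ps e).
Proof.
move=> te; have s1 := bundle_unit te; have is_ := trivial_at s1.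
have js := trivial_at (isometry_unit s1).
have [ts ps _] := pbundle_sec hPs js.
have Gk : G (T (pat Ps (pproj Ps e)) (pat Ps (U (pproj Ps e))) (pproj Ps e)
    *m pfib Ps (pat Ps (pproj Ps e)) e).
  by apply: (cgroupM hG); [exact: limit_group|exact: (fibG hPs te)].
by have [? pE] := pbundle_act hPs ts Gk; split=> //; rewrite /Ut pE.
Qed.

Lemma limit_map_fib e i j : ptot Ps e -> pdom Ps i (pproj Ps e) -> pdom Ps j (U (pproj Ps e)) ->
  pfib Ps j (Ut e) = T i j (pproj Ps e) *m pfib Ps i e.
Proof.
move=> te ie je; have s1 := bundle_unit te; have is_ := trivial_at s1.
have js := trivial_at (isometry_unit s1).
have [ts ps _] := pbundle_sec hPs js.
have Gk : G (T (pat Ps (pproj Ps e)) (pat Ps (U (pproj Ps e))) (pproj Ps e)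
    *m pfib Ps (pat Ps (pproj Ps e)) e).
  by apply: (cgroupM hG); [exact: limit_group|exact: (fibG hPs te)].
have [|_ h _] := pbundle_fib hPs (i := j) ts; first by rewrite ps.
rewrite /Ut h // (@limit_change (pat Ps (pproj Ps e)) (pat Ps (U (pproj Ps e))) i j) //.
- rewrite !transition_sphere ?isometry_unit // -!mulmxA; congr (_ *m (_ *m _)).
  exact: (fib_trans hPs).
- exact/sphere_dom.
- by apply/sphere_dom => //; exact: isometry_unit.
- exact/sphere_dom.
- by apply/sphere_dom => //; exact: isometry_unit.
Qed.

Lemma limit_map_act e g : ptot Ps e -> G g -> Ut (pact Ps e g) = pact Ps (Ut e) g.
Proof.
move=> te Gg; have s1 := bundle_unit te; have is_ := trivial_at s1.
have js := trivial_at (isometry_unit s1).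
have [ts ps _] := pbundle_sec hPs js; have [_ pE] := pbundle_act hPs te Gg.
have Gt := limit_group s1 is_ js; have [Gf fE _] := pbundle_fib hPs te is_.
rewrite /Ut pE (fE _ Gg) mulmxA [RHS](pbundle_actM hPs) //.
exact: (cgroupM hG).
Qed.

Lemma limit_map_inj e e' : ptot Ps e -> ptot Ps e' -> Ut e = Ut e' -> e = e'.
Proof.
move=> te te' ee; have [_ p] := limit_map_tot te; have [_ p'] := limit_map_tot te'.
have pe : pproj Ps e = pproj Ps e' by apply: isometry_inj; rewrite -p -p' ee.
have s1 := bundle_unit te; have is_ := trivial_at s1; have js := trivial_at (isometry_unit s1).
apply: (fib_inj hPs te te' pe is_).
have h := limit_map_fib te is_ js; have h' := limit_map_fib te'; rewrite -pe in h'.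
have {}h' := h' _ _ is_ js; rewrite -ee h in h'.
have u := cgroupU hG (limit_group s1 is_ js).
by rewrite -(mulKmx u (pfib _ _ e)) h' mulKmx.
Qed.

Lemma limit_map_surj e' : ptot Ps e' -> (U @` usphere R 6) (pproj Ps e') ->
  exists e, [/\ ptot Ps e, usphere R 6 (pproj Ps e) & Ut e = e'].
Proof.
move=> te' [s s1 es]; have is_ := trivial_at s1; have js := trivial_at (isometry_unit s1).
have [ts ps fs] := pbundle_sec hPs is_; set i := pat Ps s in is_ ts ps fs; set j := pat Ps (U s) in js.
have Gt := limit_group s1 is_ js.
have je' : pdom Ps j (pproj Ps e') by rewrite -es.
have Gg : G (invmx (T i j s) *m pfib Ps j e').
  by apply: (cgroupM hG); [exact: (cgroupV hG)|exact: (fibG hPs te')].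
have [te pe] := pbundle_act hPs ts Gg; rewrite ps in pe.
exists (pact Ps (psec Ps i s) (invmx (T i j s) *m pfib Ps j e')); split=> //; first by rewrite pe.
have [tu pu] := limit_map_tot te; rewrite pe in pu.
apply: (fib_inj hPs tu te'); first by rewrite pu.
  by rewrite pu; exact: js.
rewrite (@limit_map_fib _ i j) ?pe //.
have [|_ h _] := pbundle_fib hPs (i := i) ts; first by rewrite ps.
by rewrite h // fs mul1mx mulKVmx // (cgroupU hG Gt).
Qed.

Let half (e : R) : 0 < e -> 0 < e / 2. Proof. by move=> ?; rewrite divr_gt0. Qed.

Lemma half_piece (x0 : 'rV[R]_6) (d e : R) : enorm x0 = 1 -> 0 < d -> 0 < e -> piece x0 d e ((e / 2) *: x0).
Proof.
move=> x01 d0 e_0; have e2 := half e_0; split.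
- by rewrite enormZ x01 mulr1 gtr0_norm.
- by rewrite enormZ x01 mulr1 gtr0_norm //; lra.
- by rewrite pr_scale // pr_id // subrr normr0.
Qed.

(** A sphere chart lifted to radius e / 2, well inside a piece of radius e. It carries statements
    about h, a function on an open subset of R^6, to the sphere; the choice of radius is harmless
    because h is constant along rays. *)
Definition half_chart (e : R) jx (y : 'rV[R]_5) : 'rV[R]_6 := (e / 2) *: apt (sphere R 5) jx y.

Lemma half_chart_smooth e jx : smooth_on (eball 1) (half_chart e jx).
Proof.
apply: smooth_on_scale (@sphere_pt_smooth R 5 jx); first exact: open_eball.
by move=> k; exact: symbol_cst.
Qed.

Lemma half_chart_pr e jx y : 0 < e -> eball 1 y -> pr (half_chart e jx y) = apt (sphere R 5) jx y.
Proof. by move=> e_0 y1; rewrite /half_chart pr_scale ?half // pr_id //; exact: sphere_pt_norm. Qed.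

Lemma limit_local_chart i k x0 d e F h jx y : 0 < e -> eball 1 y ->
  local_comparison G As mu U Phi tau i k (piece x0 d e) F h -> piece x0 d e (half_chart e jx y) ->
  pfib Ps k (Ut (psec Ps i (apt (sphere R 5) jx y))) = h (half_chart e jx y).
Proof.
move=> e_0 y1 L Dy; have [/(_ _ Dy)[iy ky _] _ _ _ _] := L; have z0 := piece_neq0 Dy.
rewrite -(limit_local L Dy) half_chart_pr //.
set x := apt (sphere R 5) jx y; have x1 : enorm x = 1 by exact: sphere_pt_norm.
have ix : pdom Ps i x.
  by rewrite /x -(half_chart_pr jx e_0 y1); case: iy.
have kx : pdom Ps k (U x).
  by rewrite /x -(half_chart_pr jx e_0 y1) isometry_pr; case: ky.
have [ts ps fs] := pbundle_sec hPs ix.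
have := @limit_map_fib _ i k ts; rewrite ps => ->//; by rewrite fs mulmx1.
Qed.

Lemma limit_smooth i k : smooth_fun (sphere R 5)
  (usphere R 6 `&` pdom Ps i `&` U @^-1` pdom Ps k) (fun x => pfib Ps k (Ut (psec Ps i x))).
Proof.
move=> jx; apply: smooth_on_local => y0; rewrite sphere_in_chart => -[y01 [[x1 ix] kx]].
set x := apt (sphere R 5) jx y0 in x1 ix kx.
have [d [e [F [h [d0 e_0 L]]]]] := hloc x1 (proj2 (sphere_dom i x1) ix)
  (proj2 (sphere_dom k (isometry_unit x1)) kx).
have oP := @open_piece R 6 x d e; have oB := @open_eball R 5 1.
have hs := half_chart_smooth e jx.
have oD : open (eball 1 `&` half_chart e jx @^-1` piece x d e).
  rewrite openE => y [y1 Dy].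
  have c := differentiable_cont (smooth_on_diff hs y1).
  have h1 := open_near oB y1 (fun z Dz => Dz).
  have h2 : \forall z \near y, piece x d e (half_chart e jx z) := c _ (open_nbhs_nbhs (conj oP Dy)).
  by apply: filterS2 h1 h2 => z z1 Dz.
exists (eball 1 `&` half_chart e jx @^-1` piece x d e); first by split=> //; exact: half_piece.
have [_ _ _ _ [sh _ _ _ _]] := L.
apply: (@smooth_on_eq _ _ _ _ _ (h \o half_chart e jx)) => //.
  by move=> y [y1 Dy] /=; rewrite (limit_local_chart e_0 y1 L Dy).
apply: smooth_on_comp oP _ _ sh => //; first by move=> y [].
by apply: smooth_on_sub hs => y [].
Qed.

Lemma limit_bundle_iso : exists Utinv : Es -> Es,
  bundle_iso G (sphere R 5) Ps Ps (usphere R 6) U Ut Utinv.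
Proof.
have /choice[V hV] : forall e', exists e, ptot Ps e' -> (U @` usphere R 6) (pproj Ps e') ->
    [/\ ptot Ps e, usphere R 6 (pproj Ps e) & Ut e = e'].
  move=> e'; have [te'|n1] := pselect (ptot Ps e'); last by exists e'.
  have [ue'|n2] := pselect ((U @` usphere R 6) (pproj Ps e')); last by exists e'.
  by have [e he] := limit_map_surj te' ue'; exists e.
exists V; split=> //.
- by move=> e te _; exact: limit_map_tot.
- by move=> e g te _ Gg; exact: limit_map_act.
- move=> e te s1; have [tu pu] := limit_map_tot te.
  have [|t2 _ e2] := hV _ tu; first by rewrite pu; exists (pproj Ps e).
  exact: limit_map_inj.
- exact: limit_smooth.
Qed.

Lemma tmap_pr_curve p (c : 'rV[R]_p -> 'rV[R]_6) y v : differentiable c y -> c y != 0 ->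
  tmap (euclid R 6) (sphere R 5) (@pr R 6) (c y) ('d c y v) =
  'd (acoord (sphere R 5) (aat (sphere R 5) (pr (c y))) \o @pr R 6 \o c) y v.
Proof.
move=> dc c0; rewrite /tmap; set j := aat (sphere R 5) (pr (c y)).
have jx : adom (sphere R 5) j (pr (c y)).
  by have [at_ _ _] := sphere_atlas R 5; apply: at_; exact: enorm_pr.
have [/mopen_euclid _ /smooth_fun_euclid s1] := @pr_smooth_map R 5 j.
have d1 : differentiable (acoord (sphere R 5) j \o @pr R 6) (c y).
  by apply: (smooth_on_diff s1); split=> //; exact/eqP.
have -> : acoord (sphere R 5) j \o @pr R 6 \o apt (euclid R 6) (aat (euclid R 6) (c y)) =
  acoord (sphere R 5) j \o @pr R 6 by [].
by rewrite [in RHS]diff_comp.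
Qed.

(** The equation nabla h = 0 is restricted to the sphere of radius e / 2. The cone potentials are
    pullbacks by [pr], and [pr] after [half_chart] is the sphere chart, so they become the
    potentials of A_s at x and at U x. *)
Lemma limit_connection i x v : pdom Ps i x ->
  iso_connection (sphere R 5) Ps (sphere R 5) U Ut As i x v = As i x v.
Proof.
move=> ix; have x1 : enorm x = 1 by have := pbundle_dom hPs ix; rewrite bPs.
have kx := trivial_at (isometry_unit x1).
rewrite /iso_connection /fdiff; set k := pat Ps (U x) in kx *; set jx := aat (sphere R 5) x.
set y0 := acoord (sphere R 5) jx x.
have [at_ cK _] := sphere_atlas R 5; have jxx : adom (sphere R 5) jx x by exact: at_.
have xE : apt (sphere R 5) jx y0 = x by exact: cK.
have y01 : eball 1 y0 by exact: sphere_coord_ball.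
have [d [e [F [h [d0 e_0 L]]]]] := hloc x1 (proj2 (sphere_dom i x1) ix)
  (proj2 (sphere_dom k (isometry_unit x1)) kx).
have oP := @open_piece R 6 x d e; have oB := @open_eball R 5 1.
have hs := half_chart_smooth e jx; have dc := smooth_on_diff hs y01.
set c := half_chart e jx in hs dc.
have Dz : piece x d e (c y0) by rewrite /c /half_chart xE; exact: half_piece.
have z0 := piece_neq0 Dz.
have prz : pr (c y0) = x by rewrite half_chart_pr.
have h1 := open_near oB y01 (fun z Dz => Dz).
have cc := differentiable_cont dc.
have h2 : \forall z \near y0, piece x d e (c z) := cc _ (open_nbhs_nbhs (conj oP Dz)).
have [_ _ _ _ [sh hcov _ _ _]] := L; have dh := smooth_on_diff sh Dz.
set w := 'd c y0 v; have := hcov _ w Dz; rewrite /cov deriveE // => hE.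
have Aw : A0 i (c y0) w = As i x v.
  rewrite /cone_connection /pullback_connection prz tmap_pr_curve // prz -/jx.
  have nE0 : \forall y \near y0, @idfun 'rV[R]_5 y = (acoord (sphere R 5) jx \o @pr R 6 \o c) y.
    by apply: filterS h1 => y y1; rewrite [RHS](congr1 _ (half_chart_pr jx e_0 y1)) sphere_ptK.
  have di : differentiable (@idfun 'rV[R]_5) y0.
    by apply: linear_differentiable => z; exact: cvg_id.
  have [_ ->] := near_eq_diff nE0 di.
  by rewrite diff_lin // => z; exact: cvg_id.
have dU z : differentiable U z by apply: linear_differentiable; exact: linear_rV_continuous.
have dUw z u : 'd U z u = U u by rewrite diff_lin //; exact: linear_rV_continuous.
(* Since U commutes with [pr], the target potential is that of A_s at U x on the image of v under
   the differential of U on the sphere. *)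
have Bw : rotated U (A0 k) (c y0) w = As k (U x) (tmap (sphere R 5) (sphere R 5) U x v).
  rewrite /rotated /cone_connection /pullback_connection -isometry_pr prz; congr (As k _ _).
  have wE : U w = 'd (U \o c) y0 v by rewrite diff_comp // /= dUw.
  have pe : pr ((U \o c) y0) = U x by rewrite [LHS](esym (isometry_pr (c y0))) prz.
  rewrite wE (@tmap_pr_curve 5 (U \o c)); last exact: isometry_neq0.
    rewrite pe /tmap -/jx -/y0; set j' := aat (sphere R 5) (U x).
    have nE : \forall y \near y0, (acoord (sphere R 5) j' \o @pr R 6 \o (U \o c)) y =
       (acoord (sphere R 5) j' \o U \o apt (sphere R 5) jx) y.
      by apply: filterS h1 => y y1 /=; rewrite -isometry_pr half_chart_pr.
    have dl : differentiable (acoord (sphere R 5) j' \o @pr R 6 \o (U \o c)) y0.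
      apply: differentiable_comp; first exact: differentiable_comp.
      have [/mopen_euclid _ /smooth_fun_euclid s1] := @pr_smooth_map R 5 j'.
      apply: (smooth_on_diff s1); split; first exact/eqP/isometry_neq0.
      by rewrite /= -isometry_pr prz; apply: at_; exact: isometry_unit.
    by have [_ e'] := near_eq_diff nE dl; exact: (congr1 (fun f : _ -> _ => f v) (esym e')).
  exact: differentiable_comp.
have nE : \forall y \near y0, (h \o c) y =
    ((fun y => pfib Ps k (Ut (psec Ps i y))) \o apt (sphere R 5) jx) y.
  by apply: filterS2 h1 h2 => y y1 Dy /=; rewrite (limit_local_chart e_0 y1 L Dy).
have dhc : differentiable (h \o c) y0 by exact: differentiable_comp.
have [_ ->] := near_eq_diff nE dhc; rewrite diff_comp //= -/w.
have hx : pfib Ps k (Ut (psec Ps i x)) = h (c y0) by rewrite -(limit_local_chart e_0 y01 L Dz) xE.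
rewrite hx -Bw.
have Gh : G (h (c y0)) by have [/(_ _ Dz)[]] := L.
have u := cgroupU hG Gh.
rewrite -mulmxA -mulmxDr -(mulKmx u (As i x v)); congr (_ *m _).
by move: hE; rewrite Aw => /eqP; rewrite subr_eq0 addrC => /eqP.
Qed.

(** The gauge law of the cone connection, solved for the derivative: this is the hypothesis of
    [ncov_gauge]. *)
Lemma transition_derive j' j x v : pdom C j' x -> pdom C j x ->
  let g := transition_fun j' j in
  [/\ G (g x), differentiable g x & 'D_v g x = g x *m A0 j x v - A0 j' x v *m g x].
Proof.
move=> jx' jx g; have Gg : G (g x) by exact: (fib_secG hC).
have [dg ->] := cone_gauge hPs hAs v jx' jx; split=> //.
have u := cgroupU hG Gg; rewrite -/g mulmxDr !mulmxA (mulmxV u) !mul1mx addrAC subrr add0r.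
by [].
Qed.

Lemma transition_isometry_derive j' j x v : pdom C j' (U x) -> pdom C j (U x) ->
  let b := transition_fun j' j \o U in
  [/\ G (b x), differentiable b x & 'D_v b x = b x *m rotated U (A0 j) x v - rotated U (A0 j') x v *m b x].
Proof.
move=> jx' jx b; have [Gg dg e] := transition_derive (U v) jx' jx.
have dU : differentiable U x by apply: linear_differentiable; exact: linear_rV_continuous.
have db : differentiable b x by exact: differentiable_comp.
split=> //; rewrite deriveE // diff_comp //= diff_lin; last exact: linear_rV_continuous.
by rewrite -deriveE.
Qed.

(** Near each direction the local estimate is taken in the preferred frames [i0], [j0]. In other
    frames the section is multiplied by G-valued transition functions and its covariant derivatives
    likewise, so bounds on G give a constant that does not depend on i and j. *)
Lemma limit_estimate k : exists K eps : R, 0 < eps /\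
  forall (i j : pidx C) x, 0 < enorm x < eps -> pdom C i x -> pdom C j (U x) ->
    nabla_hom_norm Q (fun y v => A0 j (U y) (U v)) (A0 i)
      (fun y => pfib C j (H (psec C i y)) - pfib C j (U (psec C i y).1, Ut (psec C i y).2)) k x
    <= K * enorm x `^ (mu + 1 - k%:R).
Proof.
have [Cg Cg0 hCg] := cgroup_bounded hG; have [Cq Cq0 hCq] := HSnorm2_bound Q.
have [|N [eps [eps0 hN]]] := @ray_cover R 6 (fun N x => forall i j : pidx C, pdom C i x -> pdom C j (U x) ->
    nabla_hom_norm Q (fun y v => A0 j (U y) (U v)) (A0 i)
      (fun y => pfib C j (H (psec C i y)) - pfib C j (U (psec C i y).1, Ut (psec C i y).2)) k x
    <= N%:R * enorm x `^ (mu + 1 - k%:R)); last first.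
  by exists N%:R, eps; split=> // i j x xe ix jx; exact: hN.
move=> x0 x01; have [d [e [F [h [d0 e_0 L]]]]] := local_piece x01.
have [dom _ _ _ [_ _ _ dn /(_ k)[K K0 hK]]] := L.
set i0 := pat C x0 in L dom dn hK; set j0 := pat C (U x0) in L dom dn hK.
pose nI : R := #|{: k.-tuple 'I_6}|%:R.
pose K1 := m%:R * (m%:R * Cg * K) * Cg; pose K2 := Num.sqrt (nI * Cq) * K1.
have K1_ge0 : 0 <= K1 by rewrite !mulr_ge0.
(* [ray_cover] takes integer bounds, so the real constant is rounded up. *)
exists d, (Num.min e e0), (Num.bound K2); split=> //; first by rewrite lt_min e_0.
move=> x N [x0' xe xd] KN i j ix jx.
have [xe1 xe2] : enorm x < e /\ enorm x < e0 by move: xe; rewrite lt_min => /andP[].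
(* This domain depends on the frames i and j, but it only serves to differentiate the change of
   frames; the constants are already fixed. *)
pose D := piece x0 d e `&` eball e0 `&` pdom C i `&` U @^-1` pdom C j.
have Dx : D x by [].
have oC i' : open (pdom C i') by exact: (cone_open bPs hPs).
have oU : open (U @^-1` pdom C j).
  by apply: open_comp (oC j) => y _; exact: linear_rV_continuous.
have oD : open D.
  apply: openI oU; apply: openI (oC i); apply: openI; [exact: open_piece|exact: open_eball].
pose a := transition_fun i0 i; pose b := transition_fun j j0 \o U.
have hs y : D y -> pfib C j (H (psec C i y)) - pfib C j (U (psec C i y).1, Ut (psec C i y).2)
    = b y *m (F y - h y) *m a y.
  move=> [[[Dy ye] iy] jy]; have y0 := piece_neq0 Dy; have p1 := enorm_pr y0.
  have [i0y j0y _] := dom _ Dy; have [FE _] := local_matrix L Dy ye.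
  rewrite -[pfib C j (H _)]/(Fm i j y) (transport_matrix_change L Dy ye iy jy) FE.
  have cp l z : z != 0 -> pdom C l z -> pdom C l (pr z).
    by move=> z0; exact: (proj2 (@cone_pr _ _ _ Ps l z z0)).
  have Uy0 := isometry_neq0 y0.
  have [ip jp i0p j0p] : [/\ pdom C i (pr y), pdom C j (U (pr y)), pdom C i0 (pr y) & pdom C j0 (U (pr y))].
    by rewrite isometry_pr; split; exact: cp.
  have ip' := proj1 (sphere_dom i p1) ip.
  have jp' := proj1 (sphere_dom j (isometry_unit p1)) jp.
  have [ts ps fs] := pbundle_sec hPs ip'.
  have -> : pfib C j (U (psec C i y).1, Ut (psec C i y).2) = T i j (pr y).
    by rewrite /= (@limit_map_fib _ i j) ?ps // fs mulmx1.
  rewrite (limit_change p1 i0p j0p ip jp) (limit_local L Dy) isometry_pr !transition_fun_pr.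
  by rewrite mulmxBr mulmxBl.
have hb I : size I = k -> `|ncov (rotated U (A0 j)) (A0 i) I
    (fun y => pfib C j (H (psec C i y)) - pfib C j (U (psec C i y).1, Ut (psec C i y).2)) x|
    <= K1 * enorm x `^ (mu + 1 - k%:R).
  move=> Ik; have [[[Dpx _] _] _] := Dx; have [i0x j0x _] := dom _ Dpx.
  rewrite (@ncov_gauge _ _ _ D oD (A0 i0) (A0 i) (rotated U (A0 j0)) (rotated U (A0 j)) a b _ _ _ _ I
     (fun y => F y - h y)) //.
  - have [Ga _ _] := transition_derive 0 i0x ix; have [Gb _ _] := transition_isometry_derive 0 jx j0x.
    apply: (le_trans (mulmx_norm_le _ _)).
    have -> : K1 * enorm x `^ (mu + 1 - k%:R) = m%:R * (m%:R * (Cg * (K * enorm x `^ (mu + 1 - k%:R)))) * Cg.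
      by rewrite /K1; ring.
    apply: (ler_pM _ (normr_ge0 _)); [exact: mulr_ge0| |exact: hCg].
    apply: ler_wpM2l => //; apply: (le_trans (mulmx_norm_le _ _)).
    rewrite -mulrA; apply: ler_wpM2l => //.
    by apply: (ler_pM (normr_ge0 _) (normr_ge0 _)); [exact: hCg|exact: hK].
  - move=> y [[[Dy _] iy] _]; have [i0y _ _] := dom _ Dy.
    by have [_ ? _] := transition_derive 0 i0y iy.
  - move=> y [[[Dy _] _] jy]; have [_ j0y _] := dom _ Dy.
    by have [_ ? _] := transition_isometry_derive 0 jy j0y.
  - move=> y v [[[Dy _] iy] _]; have [i0y _ _] := dom _ Dy.
    by have [_ _ ->] := transition_derive v i0y iy.
  - move=> y v [[[Dy _] _] jy]; have [_ j0y _] := dom _ Dy.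
    by have [_ _ ->] := transition_isometry_derive v jy j0y.
  - by move=> J y [[[Dy _] _] _]; exact: dn.
set q := enorm x `^ (mu + 1 - k%:R) in hb *; have q0 : 0 <= q by exact: powR_ge0.
apply: (@le_trans _ _ (K2 * q)); last first.
  apply: ler_wpM2r => //; apply: (@le_trans _ _ (Num.bound K2)%:R); last by rewrite ler_nat.
  by apply/ltW/archi_boundP/mulr_ge0 => //; exact: sqrtr_ge0.
have K1q : 0 <= K1 * q by exact: mulr_ge0.
have -> : K2 * q = Num.sqrt (nI * Cq * (K1 * q) ^+ 2).
  have nC : 0 <= nI * Cq by apply: mulr_ge0 => //; exact: ler0n.
  by rewrite (sqrtrM _ nC) sqrtr_sqr (ger0_norm K1q) [RHS]mulrA.
rewrite /nabla_hom_norm; apply: ler_wsqrtr.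
apply: (@le_trans _ _ (\sum_(I : k.-tuple 'I_6) Cq * (K1 * q) ^+ 2)); last first.
  by rewrite sumr_const -[X in X <= _]mulr_natl -mulrA.
apply: ler_sum => I _.
apply: (le_trans (hCq _)); apply: ler_wpM2l => //.
rewrite ler_pXn2r ?nnegrE //; apply: hb; exact: size_tuple.
Qed.

End Assembly.

Theorem proposition2p19 (R : realType)
  (* the structure group, in GL(W) with W = R^m *)
  (m : nat) (G : set 'M[R]_m) (hG : compact_group G)
  (ip : 'M[R]_m -> 'M[R]_m -> R) (hip : Ad_invariant_inner_product G ip)
  (Q : 'M[R]_m) (hQ : invariant_gram G Q)
  (* the compact 6-manifold Z with its SU(3)-structure *)
  (Z : topologicalType) (M : atlas R Z 6) (hM : is_manifold M)
  (hZ : hausdorff_space Z) (hZc : compact [set: Z])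
  (omega : form2 R Z 6) (Omega : cform3 R Z 6)
  (homega : SU3_structure M omega Omega)
  (* the bundle P over Z \ S *)
  (S : set Z) (hS : finite_set S)
  (E : Type) (P : pbundle R m Z E) (hPS : pbase P = ~` S)
  (hP : is_pbundle G M P)
  (* the forms on the 5-sphere *)
  (theta : 'rV[R]_6 -> 'rV[R]_5 -> R)
  (omega1 omega2 omega3 : form2 R 'rV[R]_6 5)
  (hcone : cone_forms theta omega1 omega2 omega3)
  (* the rates and the tangent connections *)
  (mu : Z -> R) (hmu : forall s, S s -> -1 < mu s < 0)
  (Es : Z -> Type) (Ps : forall s, pbundle R m 'rV[R]_6 (Es s))
  (hPsS : forall s, S s -> pbase (Ps s) = usphere R 6)
  (hPs : forall s, S s -> is_pbundle G (sphere R 5) (Ps s))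
  (As : forall s, potentials 5 (Ps s))
  (hAs : forall s, S s -> is_connection G (sphere R 5) (As s))
  (hF : forall s, S s -> forall i x, pdom (Ps s) i x -> forall a b c d,
    let F := curvature (sphere R 5) (As s) i x in
    [/\ wedge22 F (omega1 x) a b c d = 0,
        wedge22 F (omega2 x) a b c d = 0
      & wedge22 F (omega3 x) a b c d = 0])
  (* the conically singular connection *)
  (A : potentials 6 P)
  (hA : conically_singular G ip M omega Omega S mu As A)
  (* the two framings at s *)
  (s : Z) (hs : S s) (rho : R)
  (Y1 Y2 : 'rV[R]_6 -> Z) (Y1inv Y2inv : Z -> 'rV[R]_6)
  (hY1 : SU3_coordinates M omega Omega s rho Y1 Y1inv)
  (hY2 : SU3_coordinates M omega Omega s rho Y2 Y2inv)
  (Yt1 Yt2 : 'rV[R]_6 * Es s -> E) (Yt1inv Yt2inv : E -> 'rV[R]_6 * Es s)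
  (hYt1 : bundle_iso G (euclid R 6) (cone_bundle (Ps s)) P
    (punctured_ball rho) Y1 Yt1 Yt1inv)
  (hYt2 : bundle_iso G (euclid R 6) (cone_bundle (Ps s)) P
    (punctured_ball rho) Y2 Yt2 Yt2inv)
  (hA1 : asymptotic ip M A (As s) (mu s) Y1 Yt1)
  (hA2 : asymptotic ip M A (As s) (mu s) Y2 Yt2) :
  let C := cone_bundle (Ps s) in
  let A0 := cone_connection (As s) in
  let U : 'rV[R]_6 -> 'rV[R]_6 := 'd (Y2inv \o Y1) 0 in
  SU3 U /\
  exists Ut Utinv : Es s -> Es s,
  [/\ bundle_iso G (sphere R 5) (Ps s) (Ps s) (usphere R 6) U Ut Utinv,
      (forall i x v, pdom (Ps s) i x ->
        iso_connection (sphere R 5) (Ps s) (sphere R 5) U Ut (As s) i x v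
        = As s i x v)
    & (* H is Yt2^-1 o Yt1 followed by the parallel transport *)
      exists H : 'rV[R]_6 * Es s -> 'rV[R]_6 * Es s,
      (exists2 eps : R, 0 < eps & forall e, ptot C e -> enorm e.1 < eps ->
         parallel_transport A0 (Y2inv (Y1 e.1)) (U e.1)
           (Yt2inv (Yt1 e)) (H e)) /\
      forall k : nat, exists K eps : R, 0 < eps /\
      forall (i j : pidx C) x, 0 < enorm x < eps ->
        pdom C i x -> pdom C j (U x) ->
        nabla_hom_norm Q (fun y v => A0 j (U y) (U v)) (A0 i)
          (fun y => pfib C j (H (psec C i y))
                    - pfib C j (U (psec C i y).1, Ut (psec C i y).2)) k x
        <= K * enorm x `^ (mu s + 1 - k%:R)].
Proof.
move=> C A0 U; have [hAP _] := hA; have /andP[mu1 mu0] := hmu s hs.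
have hloc := local_comparison_exists hG hip hQ hM hP hAP (hPsS s hs) (hPs s hs) (hAs s hs)
  mu1 mu0 hY1 hY2 hYt1 hYt2 hA1 hA2.
have enU := tangent_enorm hM hY1 hY2.
split; first exact: (tangent_SU3 hM hY1 hY2).
have [e0 [H [e00 hH]]] := transport_map_exists (hPsS s hs) (hPs s hs) enU hloc.
have [T hT] := radial_limits_exist (hPsS s hs) (hPs s hs) hloc e00 hH.
exists (limit_map U T).
have [V hV] := limit_bundle_iso hG (hPsS s hs) (hPs s hs) mu1 enU hloc e00 hH hT.
exists V; split; first exact: hV.
  exact: (limit_connection hG (hPsS s hs) (hPs s hs) mu1 enU hloc e00 hH hT).
exists H; split; first by exists e0.
exact: (limit_estimate hG Q (hPsS s hs) (hPs s hs) (hAs s hs) mu1 enU hloc e00 hH hT).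
Qed.
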